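(* Let $\Omega$ be a bounded domain of class $C^{1,1}$ in $\mathbb{R}^N$, $N\ge2$. Then there exists $s_*=s_*(\Omega)>\frac12$ such that $$\mu_{N,s}(\Omega)=\mathfrak{h}_{N,s}\quad\text{for all }\tfrac12<s\le s_*.$$ In particular, $\mu_{N,s}(\Omega)$ is never achieved (in $H^s_0(\Omega)$) for $s$ sufficiently close to $\frac12$ (with $s>\frac12$).
   Context: The parameter $s$ ranges in $(\frac12,1)$. $\delta(x)=\mathrm{dist}(x,\partial\Omega)$; $c_{N,s}=2^{2s}\pi^{-N/2}s\,\Gamma(\frac{N+2s}{2})/\Gamma(1-s)$. Let $H^s(\Omega)$ be the space of $u\in L^2(\Omega)$ with $(u(x)-u(y))|x-y|^{-(N+2s)/2}\in L^2(\Omega\times\Omega)$, with norm given by $\|u\|_{H^s(\Omega)}^2=\|u\|_{L^2(\Omega)}^2+[u]_s$, where $[u]_s=\frac{c_{N,s}}{2}\iint_{\Omega\times\Omega}\frac{(u(x)-u(y))^2}{|x-y|^{N+2s}}\,dx\,dy$; $H^s_0(\Omega)$ is the completion of $C_c^\infty(\Omega)$ in $H^s(\Omega)$. The best fractional Hardy constant is $$\mu_{N,s}(\Omega)=\inf_{u\in C_c^\infty(\Omega)\setminus\{0\}}\frac{[u]_s}{\int_\Omega u^2\delta^{-2s}\,dx},$$ equivalently the infimum over $H^s_0(\Omega)\setminus\{0\}$; it is achieved if some nonzero $u\in H^s_0(\Omega)$ attains the infimum. The constant (the sharp fractional Hardy constant of the half-space) is $\mathfrak{h}_{N,s}=c_{N,s}\kappa_{N,2s}$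 with $$\kappa_{N,2s}=\pi^{\frac{N-1}{2}}\frac{\Gamma(\frac{1+2s}{2})}{\Gamma(\frac{N+2s}{2})}\frac{1}{2s}\left[\frac{2^{1-2s}}{\sqrt{\pi}}\Gamma(1-s)\Gamma\Big(\frac{1+2s}{2}\Big)-1\right].$$ *)

(* Defs.v *)
From HB Require Import structures.
From mathcomp Require Import all_boot all_order all_algebra.
From mathcomp Require Import all_classical all_reals all_analysis.

Set Implicit Arguments.
Unset Strict Implicit.
Unset Printing Implicit Defensive.

Import Order.TTheory GRing.Theory Num.Theory.
Import numFieldNormedType.Exports.

Local Open Scope classical_set_scope.
Local Open Scope ring_scope.

(* 'rV[R]_n carries the product sigma-algebra of its coordinates, as the
   library does for n.-tuple T; it is the Borel sigma-algebra of R^n. *)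
Definition rV_display : measure_display -> measure_display.
Proof. exact. Qed.

Section rV_measurable.
Variables (R : realType) (n : nat).

Let coors : 'I_n -> 'rV[R]_n -> R := fun i x => x ord0 i.

Let rV_set0 : g_sigma_preimage coors set0.
Proof. exact: sigma_algebra0. Qed.

Let rV_setC A : g_sigma_preimage coors A -> g_sigma_preimage coors (~` A).
Proof. exact: sigma_algebraC. Qed.

Let rV_bigcup (F : _^nat) : (forall i, g_sigma_preimage coors (F i)) ->
  g_sigma_preimage coors (\bigcup_i (F i)).
Proof. exact: sigma_algebra_bigcup. Qed.

HB.instance Definition _ :=
  @isMeasurable.Build (rV_display default_measure_display)
    'rV[R]_n (g_sigma_preimage coors) rV_set0 rV_setC rV_bigcup.

End rV_measurable.

Section rV_measurable_theory.
Variable R : realType.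

Lemma measurable_coor n (i : 'I_n) :
  measurable_fun [set: 'rV[R]_n] (fun x : 'rV[R]_n => x ord0 i).
Proof.
move=> _ Y mY; rewrite setTI; apply: sub_sigma_algebra => /=.
rewrite -bigcup_seq/=; exists i => /=; first by rewrite mem_index_enum.
by exists Y => //; rewrite setTI.
Qed.

Lemma measurable_fun_rVP d (T : measurableType d) n (f : T -> 'rV[R]_n) :
  (forall i, measurable_fun [set: T] (fun t => f t ord0 i)) ->
  measurable_fun [set: T] f.
Proof.
move=> mf _ A mA; rewrite setTI.
have : <<s \big[setU/set0]_(i < n)
    preimage_set_system setT (fun x : 'rV[R]_n => x ord0 i) measurable >>
    `<=` [set B | measurable (f @^-1` B)]; last exact.
apply: smallest_sub.
  split => /=.
  - by rewrite preimage_set0.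
  - by move=> B mB; rewrite setTD preimage_setC; exact: measurableC.
  - by move=> F mF; rewrite preimage_bigcup; exact: bigcup_measurable.
rewrite -bigcup_seq => B [i _] [C mC <-] /=.
have := mf i measurableT C mC.
by rewrite !setTI.
Qed.

Definition rV_cons n (z : measurableTypeR R * 'rV[R]_n) : 'rV[R]_n.+1 :=
  row_mx (z.1%:M : 'M[R]_1) z.2.

Lemma measurable_rV_cons n : measurable_fun setT (@rV_cons n).
Proof.
apply: measurable_fun_rVP => i; rewrite /rV_cons.
have [j ->|j ->] := @split_ordP 1 n i.
- have -> : (fun z : measurableTypeR R * 'rV[R]_n =>
      row_mx (z.1%:M : 'M[R]_1) z.2 ord0 (lshift n j)) = fst.
    by apply/funext => z; rewrite row_mxEl mxE (ord1 j) eqxx mulr1n.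
  exact: measurable_fst.
- have -> : (fun z : measurableTypeR R * 'rV[R]_n =>
      row_mx (z.1%:M : 'M[R]_1) z.2 ord0 (rshift 1 j)) =
      (fun x : 'rV[R]_n => x ord0 j) \o snd.
    by apply/funext => z; rewrite row_mxEr.
  exact: (measurableT_comp (measurable_coor j) measurable_snd).
Qed.

HB.instance Definition _ n :=
  isMeasurableFun.Build _ _ _ _ (@rV_cons n) (@measurable_rV_cons n).

Definition rV_uncons n (x : 'rV[R]_n.+1) : measurableTypeR R * 'rV[R]_n :=
  (x ord0 ord0, rsubmx (x : 'M[R]_(1, 1 + n))).

Lemma rV_consK n : cancel (@rV_cons n) (@rV_uncons n).
Proof.
case=> a v; rewrite /rV_cons /rV_uncons row_mxKr; congr (_, _).
have -> : row_mx (a%:M : 'M[R]_1) v ord0 ord0 =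
    row_mx (a%:M : 'M[R]_1) v ord0 (lshift n ord0).
  by congr (row_mx _ _ _ _); exact: val_inj.
by rewrite row_mxEl mxE eqxx mulr1n.
Qed.

Lemma measurable_rV_uncons n : measurable_fun setT (@rV_uncons n).
Proof.
apply/measurable_fun_pairP; split; first exact: measurable_coor.
apply: measurable_fun_rVP => i /=.
under eq_fun do rewrite mxE.
exact: measurable_coor.
Qed.

End rV_measurable_theory.

Section lebesgue_measure_rV.
Variable R : realType.

Section cons.
Variables (n : nat) (m : {sigma_finite_measure set 'rV[R]_n -> \bar R}).

Definition lebesgue_cons : set 'rV[R]_n.+1 -> \bar R :=
  pushforward (@lebesgue_measure R \x m)%E (@rV_cons R n).

Let lebesgue_cons0 : lebesgue_cons set0 = 0%E.
Proof. exact: measure0. Qed.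

Let lebesgue_cons_ge0 A : (0 <= lebesgue_cons A)%E.
Proof. exact: measure_ge0. Qed.

Let lebesgue_cons_sigma_additive : semi_sigma_additive lebesgue_cons.
Proof. exact: measure_semi_sigma_additive. Qed.

HB.instance Definition _ := isMeasure.Build _ _ _ lebesgue_cons
  lebesgue_cons0 lebesgue_cons_ge0 lebesgue_cons_sigma_additive.

(* Proved by hand: the sigma-finite instance of \x is not inferred, being
   shadowed by the library's instance for products of subprobabilities. *)
Let lebesgue_cons_sigma_finite : sigma_finite setT lebesgue_cons.
Proof.
have /sigma_finiteP[F [TF ndF Foo]] := sigma_finiteT (@lebesgue_measure R).
have /sigma_finiteP[G [TG ndG Goo]] := sigma_finiteT m.
exists (fun k => @rV_uncons R n @^-1` (F k `*` G k)).
  rewrite -preimage_bigcup; apply/seteqP; split=> // x _ /=.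
  have [i _ Fi] : (\bigcup_i F i) (x ord0 ord0) by rewrite -TF.
  have [j _ Gj] : (\bigcup_i G i) (rV_uncons x).2 by rewrite -TG.
  exists (maxn i j) => //; split => /=.
  - by have /subsetPset := ndF _ _ (leq_maxl i j); exact.
  - by have /subsetPset := ndG _ _ (leq_maxr i j); exact.
move=> k; have [mF Fk] := Foo k; have [mG Gk] := Goo k; split.
  rewrite -[X in measurable X]setTI; apply: measurable_rV_uncons => //.
  exact: measurableX.
rewrite /lebesgue_cons /pushforward -comp_preimage (_ : _ \o _ = id); last first.
  by apply/funext => z; exact: rV_consK.
by rewrite preimage_id product_measure1E// lte_mul_pinfty// ge0_fin_numE.
Qed.

HB.instance Definition _ := Measure_isSigmaFinite.Build _ _ _ lebesgue_cons
  lebesgue_cons_sigma_finite.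

End cons.

Fixpoint lebesgue_rV n : {sigma_finite_measure set 'rV[R]_n -> \bar R} :=
  if n is n'.+1 then lebesgue_cons (lebesgue_rV n')
  else \d_(0 : 'rV[R]_0).

End lebesgue_measure_rV.

Section domains.
Variable R : realType.

(* The library's norm on 'rV[R]_n is the sup norm. *)
Definition enorm n (x : 'rV[R]_n) : R := Num.sqrt (\sum_i x ord0 i ^+ 2).

Definition eball n (x : 'rV[R]_n) (r : R) : set 'rV[R]_n :=
  [set y | enorm (y - x) < r].

Definition boundary n (A : set 'rV[R]_n) : set 'rV[R]_n :=
  closure A `\` interior A.

Definition dist_boundary n (Omega : set 'rV[R]_n) (x : 'rV[R]_n) : R :=
  inf [set enorm (x - y) | y in boundary Omega].

Fixpoint class_C k n (f : 'rV[R]_n -> R) : Prop :=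
  continuous f /\
  if k is k'.+1 then
    forall i : 'I_n, (forall x, derivable f x 'e_i) /\ class_C k' ('D_('e_i) f)
  else True.

Definition class_C11 n (f : 'rV[R]_n -> R) : Prop :=
  class_C 1 f /\ forall i : 'I_n, lipschitz ('D_('e_i) f).

Definition domain n (A : set 'rV[R]_n) : Prop :=
  [/\ A !=set0, open A & connected A].

(* Near each boundary point, in suitable orthonormal coordinates x *m Q, the
   set lies strictly above the graph of a C^{1,1} function of the n - 1
   coordinates other than the i-th. *)
Definition C11_boundary n (A : set 'rV[R]_n) : Prop :=
  forall x0, boundary A x0 ->
  exists (r : R) (Q : 'M[R]_n) (i : 'I_n) (g : 'rV[R]_n.-1 -> R),
  [/\ 0 < r, Q *m Q^T = 1%:M, class_C11 g &
    forall x, eball x0 r x ->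
      (A x <-> g (col' i (x *m Q)) < (x *m Q) ord0 i)].

(* C_c^oo(Omega), its elements being extended by 0 outside Omega. *)
Definition test_function n (Omega : set 'rV[R]_n) (f : 'rV[R]_n -> R) : Prop :=
  [/\ forall k, class_C k f,
      compact (closure [set x | f x != 0]) &
      closure [set x | f x != 0] `<=` Omega].

End domains.

Section constants.
Variables (R : realType) (N : nat) (s : R).

Definition Gamma (x : R) : R :=
  \int[@lebesgue_measure R]_(t in `]0, +oo[) (t `^ (x - 1) * expR (- t)).

Definition c_Ns : R :=
  2 `^ (2 * s) * pi `^ (- (N%:R / 2)) * s *
  Gamma ((N%:R + 2 * s) / 2) / Gamma (1 - s).

(* kappa_{N,2s} *)
Definition kappa : R :=
  pi `^ ((N%:R - 1) / 2) * (Gamma ((1 + 2 * s) / 2) / Gamma ((N%:R + 2 * s) / 2))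
  * (2 * s)^-1
  * (2 `^ (1 - 2 * s) / Num.sqrt pi * Gamma (1 - s) * Gamma ((1 + 2 * s) / 2)
     - 1).

Definition h_Ns : R := c_Ns * kappa.

End constants.

Section fractional_hardy.
Variables (R : realType) (N : nat) (s : R) (Omega : set 'rV[R]_N).

Local Notation leb := (@lebesgue_rV R N).
Implicit Types u : 'rV[R]_N -> R.

Definition in_L2 d (T : measurableType d) (m : {measure set T -> \bar R})
    (D : set T) (f : T -> R) : Prop :=
  measurable_fun D f /\ (\int[m]_(x in D) (f x ^+ 2)%:E < +oo)%E.

(* An element of H^s(Omega) is represented by a function on the whole space,
   of which only the values on Omega matter. *)
Definition in_Hs u : Prop :=
  in_L2 leb Omega u /\
  in_L2 (leb \x leb)%E (Omega `*` Omega)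
    (fun z => (u z.1 - u z.2) *
              enorm (z.1 - z.2) `^ (- ((N%:R + 2 * s) / 2))).

Definition gagliardo u : \bar R :=
  ((c_Ns N s / 2)%:E *
   \int[leb \x leb]_(z in Omega `*` Omega)
     ((u z.1 - u z.2) ^+ 2 / enorm (z.1 - z.2) `^ (N%:R + 2 * s))%:E)%E.

Definition Hs_norm u : \bar R :=
  ((\int[leb]_(x in Omega) (u x ^+ 2)%:E + gagliardo u) `^ 2^-1)%E.

(* H^s_0(Omega), as the closure of C_c^oo(Omega) in H^s(Omega). *)
Definition in_Hs0 u : Prop :=
  in_Hs u /\
  forall e : R, 0 < e -> exists phi, test_function Omega phi /\
    (Hs_norm (u \- phi)%R < e%:E)%E.

Definition hardy_quotient u : \bar R :=
  (gagliardo u /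
   \int[leb]_(x in Omega) (u x ^+ 2 * dist_boundary Omega x `^ (- (2 * s)))%:E)%E.

Definition mu_Ns : \bar R :=
  ereal_inf [set hardy_quotient u | u in
    [set u | test_function Omega u /\ exists x, u x != 0]].

Definition mu_achieved : Prop :=
  exists u, [/\ in_Hs0 u, ~ {ae leb, forall x, Omega x -> u x = 0} &
    hardy_quotient u = mu_Ns].

End fractional_hardy.

(* Main.v *)
(** The half-space problem splits along lines: integrating over directions
    [(1, z)] turns [h_Ns] into [c_Ns * dirJ * kap], where [kap] is the constant
    of a one-dimensional Hardy problem whose ground state is [t `^ (s - 2^-1)].

    Lower bound.  On every chord of the domain the Moebius image of this ground
    state, a power of [(p + t) (q - t)] with [p], [q] the two exit times, gives a
    Hardy weight [chord_gain] which strictly exceeds the half-line weight of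
    each endpoint.  Since [kap] is of order [(s - 2^-1) ^ 2] while the excess is
    of order [s - 2^-1], the excess absorbs the curvature error coming from the
    exterior balls of a C^{1,1} boundary as soon as [s] is close to [2^-1].  This
    yields [gagliardo >= h_Ns * \int u^2 delta^(-2s) + c * \int u^2] with
    [c > 0], so the bound holds on [Hs0] and cannot be attained.

    Upper bound.  At a closure point minimising the first coordinate the domain
    lies in a half-space, hence [delta <= x_1] and almost optimal functions of
    the half-space, rescaled into the domain, are competitors.  They are taken
    as [x_1 `^ (s - 2^-1)] times a wide cut-off in [ln x_1] times a wide
    product bump in the other variables. *)
Require Import Defs.
From HB Require Import structures.
From mathcomp Require Import all_boot all_order all_algebra.
From mathcomp Require Import all_classical all_reals all_analysis.
From mathcomp Require Import measurable_realfun.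
From mathcomp Require Import ring lra.

Set Implicit Arguments.
Unset Strict Implicit.
Unset Printing Implicit Defensive.

Import Order.TTheory GRing.Theory Num.Theory.
Import numFieldNormedType.Exports.

Local Open Scope classical_set_scope.
Local Open Scope ring_scope.

(** * Integration on row vectors *)

(** On a chord only the pointwise bound (a - b)^2 >= a^2 (1 - w) + b^2 (1 - 1/w) is used, w being
    the ratio of the ground state at the two points. The kernel is singular on the diagonal, so
    pairs are cut off at a fixed cross-ratio, which is symmetric in the two points; the cut-off is
    removed only once the weighted terms have been cancelled. The obstacle is the grazing
    directions. If c is the cosine with the normal, curvature changes the exit time by a relative
    error of order delta / c^2, so the loss is an average of c^(2s-2), which blows up like 1/(s -
    1/2). After multiplication by [kap] the loss has order (s - 1/2) delta^(1-2s): the same order as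
    the excess. What decides is that the excess also carries a factor ln(1/delta). In a thin enough
    boundary layer it beats any constant; outside the layer [kap] delta^(-2s) is O((s - 1/2)^2) and
    the excess wins by its order. The layer is fixed before s, which is why the range of s depends
    on the domain. *)

Definition affine (R : realType) (a b : R) (x : measurableTypeR R) : measurableTypeR R :=
  a * x + b.

Lemma measurable_affine (R : realType) (a b : R) :
  measurable_fun setT (@affine R a b).
Proof. by apply: measurable_funD => //; exact: measurable_funM. Qed.

HB.instance Definition _ (R : realType) (a b : R) :=
  isMeasurableFun.Build _ _ _ _ (@affine R a b) (@measurable_affine R a b).

(** The pushforward scaled by |a| gives every interval []x, y]] its length, and Lebesgue measure is
    determined by that. For [a < 0] the preimage is closed at the other end, which does not change
    its length. *)
Lemma lebesgue_measure_affine (R : realType) (a b : R) (A : set R) :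
  a != 0 -> measurable A ->
  (lebesgue_measure (affine a b @^-1` A) =
   (`|a|^-1)%:E * lebesgue_measure A)%E.
Proof.
move=> a0 mA.
have na0 : 0 < `|a| by rewrite normr_gt0.
suff -> : lebesgue_measure A =
    mscale (NngNum (ltW na0)) (pushforward (@lebesgue_measure R) (affine a b)) A.
  rewrite /mscale/= /pushforward muleA -EFinM mulVf ?gt_eqF// mul1e.
  by [].
move=> m; apply: lebesgue_measure_unique => //= _ [[x y] _ <-] /=.
rewrite /mscale/= /pushforward/=.
have [a_gt0|a_lt0|] := ltgtP 0 a; last by move=> a00; rewrite a00 eqxx in a0.
- have -> : affine a b @^-1` `]x, y] = `](x - b) / a, (y - b) / a]%classic.
    apply/seteqP; split=> z; rewrite /affine /= !in_itv /=.
    + by rewrite ltr_pdivrMr// ler_pdivlMr// ltrBlDr lerBrDr mulrC.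
    + by rewrite ltr_pdivrMr// ler_pdivlMr// ltrBlDr lerBrDr mulrC.
  rewrite !lebesgue_measure_itv/= !lte_fin ltr_pM2r ?invr_gt0// ltrD2r.
  case: ifPn => _; last by rewrite mule0.
  rewrite -!EFinD -EFinM gtr0_norm//; congr (_%:E); field.
  exact: lt0r_neq0.
- have -> : affine a b @^-1` `]x, y] = `[(y - b) / a, (x - b) / a[%classic.
    apply/seteqP; split=> z; rewrite /affine /= !in_itv /=.
    + by rewrite ltr_ndivlMr// ler_ndivrMr// ltrBlDr lerBrDr mulrC andbC.
    + by rewrite ltr_ndivlMr// ler_ndivrMr// ltrBlDr lerBrDr mulrC andbC.
  rewrite !lebesgue_measure_itv/= !lte_fin ltr_nM2r ?invr_lt0// ltrD2r.
  case: ifPn => _; last by rewrite mule0.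
  rewrite -!EFinD -EFinM ltr0_norm//; congr (_%:E); field.
  exact: ltr0_neq0.
Qed.

Lemma ge0_integralZT d (T : measurableType d) (R : realType)
    (mu : {measure set T -> \bar R}) (f : T -> \bar R) (k : R) :
  measurable_fun setT f -> (forall x, 0 <= f x)%E -> 0 <= k ->
  (\int[mu]_x (k%:E * f x) = k%:E * \int[mu]_x f x)%E.
Proof. by move=> mf f0 k0; rewrite ge0_integralZl_EFin. Qed.

Lemma ge0_integral_affine (R : realType) (a b : R) (f : R -> \bar R) :
  a != 0 -> measurable_fun setT f -> (forall x, 0 <= f x)%E ->
  (\int[@lebesgue_measure R]_x f (affine a b x) =
   (`|a|^-1)%:E * \int[@lebesgue_measure R]_x f x)%E.
Proof.
move=> a0 mf f0.
have na0 : 0 < `|a| by rewrite normr_gt0.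
have := @ge0_integral_pushforward _ _ _ _ R (affine a b) (@measurable_affine R a b)
  (@lebesgue_measure R) setT f measurableT mf (fun y _ => f0 y).
rewrite preimage_setT => <-.
have i0 : 0 <= `|a|^-1 by rewrite invr_ge0 ltW.
rewrite (_ : `|a|^-1 = (NngNum i0)%:num)//.
rewrite -ge0_integral_mscale//.
apply: eq_measure_integral => A mA _.
exact: lebesgue_measure_affine.
Qed.

(** The sigma-algebra is generated by the coordinates, so an open set has to be exhibited as a
    countable union of boxes: the cubes [B p] with rational centre and half-side 1/(k+1) that it
    contains. *)
Lemma open_measurable_rV (R : realType) n (A : set 'rV[R]_n) :
  open A -> measurable A.
Proof.
move=> oA.
pose B (p : 'rV[rat]_n * nat) : set 'rV[R]_n :=
  [set y | forall i, `|y ord0 i - ratr (p.1 ord0 i)| < p.2.+1%:R^-1 ].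
have mB p : measurable (B p).
  have -> : B p = \bigcap_(i in [set: 'I_n])
      ((fun y : 'rV[R]_n => y ord0 i) @^-1` (ball (ratr (p.1 ord0 i) : R) p.2.+1%:R^-1)).
    apply/seteqP; split=> y; rewrite /B /=.
    + by move=> Hy i _ /=; rewrite -ball_normE /= distrC; exact: Hy.
    + by move=> Hy i; have := Hy i I; rewrite -ball_normE /= distrC.
  apply: fin_bigcap_measurable => //= i _.
  rewrite -[X in measurable X]setTI; apply: measurable_coor => //.
  exact: measurable_ball.
have -> : A = \bigcup_p (if `[< B p `<=` A >] then B p else set0).
  apply/seteqP; split=> [x Ax|x [p _]]; last by case: asboolP => // BA /BA.
  have /nbhs_ballP[e /= e0 xeA] := open_nbhs_nbhs (conj oA Ax).
  (* Half of [e], because a point of the cube is compared with [x] through the centre of the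
     cube. *)
  have [k [w [kw w0 ke]]] : exists (k : nat) (w : R),
      [/\ k.+1%:R^-1 = w, 0 < w & w < e / 2].
    have [k _ /(_ _ (leqnn _))/=] := near_infty_natSinv_lt (PosNum (divr_gt0 e0 (ltr0n _ 2))).
    by exists k, k.+1%:R^-1; split; rewrite ?invr_gt0.
  have [q qx] : exists q : 'I_n -> rat, forall i, ratr (q i) \in `]x ord0 i - w, x ord0 i + w[.
    suff H : forall i, exists r : rat, ratr r \in `]x ord0 i - w, x ord0 i + w[.
      by exists (fun i => sval (cid (H i))) => i; case: cid.
    by move=> i; apply: rat_in_itvoo; lra.
  exists (\row_i q i, k) => //=.
  have Bx : B (\row_i q i, k) x.
    move=> i /=; rewrite mxE kw; have := qx i; rewrite in_itv/= => /andP[h1 h2].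
    by rewrite ltr_norml; apply/andP; split; lra.
  case: asboolP => // -[] y By; apply: xeA; split => // i j /=.
  rewrite (ord1 i) -ball_normE /=; have := By j; have := Bx j; rewrite /= !mxE kw.
  rewrite !ltr_norml => /andP[h1 h2] /andP[h3 h4].
  by apply/andP; split; lra.
apply: countable_bigcupT_measurable; first exact: countableP.
by move=> p; case: asboolP.
Qed.

Lemma continuous_measurable_rV (R : realType) n (f : 'rV[R]_n -> R) :
  continuous f -> measurable_fun setT f.
Proof.
move=> cf; apply: (measurability _ (RGenOInfty.measurableE R)).
move=> /= _ [_ [a ->]] <-; rewrite setTI; apply: open_measurable_rV.
by apply: open_comp => // x _; exact: cf.
Qed.

Section integral_rV.
Variable R : realType.
Local Notation leb n := (@lebesgue_rV R n).
Local Notation leb1 := (@lebesgue_measure R).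
Local Open Scope ereal_scope.

Lemma ge0_integral_rVS n (f : 'rV[R]_n.+1 -> \bar R) :
  measurable_fun setT f -> (forall x, 0 <= f x) ->
  \int[leb n.+1]_x f x = \int[leb1]_a \int[leb n]_v f (rV_cons (a, v)).
Proof.
move=> mf f0.
have := @ge0_integral_pushforward _ _ _ _ R (@rV_cons R n) (@measurable_rV_cons R n)
  (leb1 \x leb n) setT f measurableT mf (fun y _ => f0 y).
rewrite preimage_setT => E.
rewrite [LHS]E fubini_tonelli1//; last by move=> x /=.
by apply: measurableT_comp => //; exact: measurable_rV_cons.
Qed.

Lemma measurable_rVS n (f : 'rV[R]_n.+1 -> \bar R) :
  measurable_fun setT f -> (forall x, 0 <= f x) ->
  measurable_fun setT (fun a : measurableTypeR R => \int[leb n]_v f (rV_cons (a, v))).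
Proof.
move=> mf f0; apply: (@measurable_fun_fubini_tonelli_F _ _ _ _ _ (leb n) (f \o @rV_cons R n)) => //=.
by apply: measurableT_comp => //; exact: measurable_rV_cons.
Qed.

Lemma ge0_integral_rV0 (f : 'rV[R]_0 -> \bar R) :
  measurable_fun setT f -> (forall x, 0 <= f x) ->
  \int[leb 0]_x f x = f 0%R.
Proof. by move=> mf f0 /=; rewrite integral_dirac// diracT mul1e. Qed.

Opaque lebesgue_rV.

Lemma measurable_affine_rV n (c : R) (w : 'rV[R]_n) :
  measurable_fun setT (fun x : 'rV[R]_n => (c *: x + w)%R).
Proof.
apply: measurable_fun_rVP => i; under eq_fun do rewrite !mxE.
apply: measurable_funD => //; apply: measurable_funM => //.
exact: measurable_coor.
Qed.

Lemma rV_cons0 n (z : R * 'rV[R]_n) : rV_cons z ord0 ord0 = z.1.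
Proof.
have -> : rV_cons z ord0 ord0 =
    row_mx (z.1%:M : 'M[R]_1) z.2 ord0 (lshift n (ord0 : 'I_1)).
  by rewrite /rV_cons; congr (row_mx _ _ _ _); exact: val_inj.
by rewrite row_mxEl mxE eqxx mulr1n.
Qed.

Lemma rV_consS n (z : R * 'rV[R]_n) (j : 'I_n) :
  rV_cons z ord0 (lift ord0 j) = z.2 ord0 j.
Proof.
have -> : rV_cons z ord0 (lift ord0 j) =
    row_mx (z.1%:M : 'M[R]_1) z.2 ord0 (rshift 1 j).
  by rewrite /rV_cons; congr (row_mx _ _ _ _); exact: val_inj.
by rewrite row_mxEr.
Qed.

Lemma rV_consP n (x y : 'rV[R]_n.+1) : x ord0 ord0 = y ord0 ord0 ->
  (forall j : 'I_n, x ord0 (lift ord0 j) = y ord0 (lift ord0 j)) -> x = y.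
Proof.
by move=> h0 hS; apply/rowP => i; case: (unliftP ord0 i) => [j|] ->.
Qed.

Lemma rV_consD n (a b : R) (v w : 'rV[R]_n) :
  (rV_cons (a, v) + rV_cons (b, w) = rV_cons ((a + b)%R, (v + w)%R))%R.
Proof.
by apply: rV_consP => [|j]; rewrite [LHS]mxE ?rV_cons0 ?rV_consS//= [RHS]mxE.
Qed.

Lemma rV_consZ n (c a : R) (v : 'rV[R]_n) :
  (c *: rV_cons (a, v) = rV_cons ((c * a)%R, (c *: v)%R))%R.
Proof.
by apply: rV_consP => [|j]; rewrite [LHS]mxE ?rV_cons0 ?rV_consS//= [RHS]mxE.
Qed.

Lemma rV_unconsK n (x : 'rV[R]_n.+1) : rV_cons (rV_uncons x) = x.
Proof.
apply: rV_consP => [|j]; rewrite ?rV_cons0 ?rV_consS//= mxE.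
by congr (x _ _); exact: val_inj.
Qed.

Lemma ge0_integral_affine_rV n (c : R) (w : 'rV[R]_n) (f : 'rV[R]_n -> \bar R) :
  c != 0%R -> measurable_fun setT f -> (forall x, 0 <= f x) ->
  \int[leb n]_x f (c *: x + w)%R = (`|c|^-1 ^+ n)%:E * \int[leb n]_x f x.
Proof.
move=> c0; elim: n w f => [|n IH] w f mf f0.
  rewrite !ge0_integral_rV0//; last first.
    by apply: measurableT_comp => //; exact: measurable_affine_rV.
  by rewrite expr0 mul1e scaler0 add0r (thinmx0 w).
have mfc : measurable_fun setT (fun x : 'rV[R]_n.+1 => f (c *: x + w)%R).
  by apply: measurableT_comp => //; exact: measurable_affine_rV.
rewrite !ge0_integral_rVS//.
rewrite -[w in LHS]rV_unconsK /rV_uncons.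
set b := w _ _; set w' := rsubmx _.
under eq_integral do under eq_integral do rewrite rV_consZ rV_consD.
have mfa a : measurable_fun setT (fun v => f (rV_cons (a, v))).
  apply: measurableT_comp => //; apply: measurableT_comp; first exact: measurable_rV_cons.
  exact: pair1_measurable.
under eq_integral => a _ do rewrite (IH w' (fun v => f (rV_cons (_, v))))//.
rewrite ge0_integralZl; first last.
- by rewrite lee_fin exprn_ge0.
- by move=> a _; exact: integral_ge0.
- have := @measurable_rVS n _ mf f0.
  move=> m; exact: (measurableT_comp m (@measurable_affine R c b)).
- exact: measurableT.
rewrite (@ge0_integral_affine R c b (fun a => \int[leb n]_v f (rV_cons (a, v))))//.
- by rewrite muleA -EFinM exprSr.
- exact: measurable_rVS.
- by move=> a; exact: integral_ge0.
Qed.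

(** In the slice with first coordinate [t] the other [n] coordinates are written [t *: z], which
    costs the Jacobian |t|^n; the slice t = 0 is null. Lines are thus indexed by (1, z) and
    traversed by all real [t], without any measure on the sphere. *)
Lemma ge0_integral_polar n (f : 'rV[R]_n.+1 -> \bar R) :
  measurable_fun setT f -> (forall x, 0 <= f x) ->
  \int[leb n.+1]_h f h =
  \int[leb n]_z \int[leb1]_t ((`|t| ^+ n)%:E * f (t *: rV_cons (1%R, z))%R).
Proof.
move=> mf f0; rewrite ge0_integral_rVS//.
have mg : measurable_fun setT (fun p : measurableTypeR R * 'rV[R]_n =>
    (`|p.1| ^+ n)%:E * f (p.1 *: rV_cons (1%R, p.2))%R).
  apply: emeasurable_funM.
    by apply/measurable_EFinP; apply: measurable_funX; apply: measurableT_comp.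
  apply: measurableT_comp => //; apply: measurable_fun_rVP => i.
  under eq_fun do rewrite mxE.
  apply: measurable_funM => //.
  exact: (measurableT_comp (measurable_coor i) (measurableT_comp
    (@measurable_rV_cons R n)
    (measurable_fun_pair (measurable_cst (1%R : measurableTypeR R)) measurable_snd))).
have g0 p : 0 <= (`|p.1| ^+ n)%:E * f (p.1 *: rV_cons (1%R, p.2))%R.
  by rewrite mule_ge0// lee_fin exprn_ge0.
rewrite -(fubini_tonelli (m1 := leb1) (m2 := leb n) _ mg g0)/=.
apply: ge0_ae_eq_integral => //.
- exact: measurable_rVS.
- exact: (@measurable_fun_fubini_tonelli_F _ _ _ _ _ (leb n) _ mg g0).
- by move=> a _; exact: integral_ge0.
- by move=> a _; apply: integral_ge0 => z _; exact: (g0 (a, z)).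
exists [set 0%R]; split; [exact: measurable_set1|exact: lebesgue_measure_set1|].
move=> t /=; apply: contra_notP => /eqP t0 _.
have mft : measurable_fun setT (fun v => f (rV_cons (t, v))).
  apply: measurableT_comp => //; apply: measurableT_comp; first exact: measurable_rV_cons.
  exact: pair1_measurable.
have mft' : measurable_fun setT (fun v : 'rV[R]_n => f (rV_cons (t, t *: v + 0)%R)).
  apply: (measurableT_comp mft); exact: measurable_affine_rV.
under [RHS]eq_integral do rewrite rV_consZ mulr1 -[(t *: _)%R]addr0.
rewrite [RHS]ge0_integralZl//.
rewrite (ge0_integral_affine_rV 0 t0 mft)// muleA -EFinM -exprMn divff ?normr_eq0//.
by rewrite expr1n mul1e.
Qed.

End integral_rV.

(** * Improper integrals and the Gamma function *)

Section exhaustion.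
Context {R : realType}.
Local Notation leb1 := (@lebesgue_measure R).
Implicit Types (f g F G : R -> R) (a b : nat -> R).

Lemma measurable_fun_continuous_itv f (i : interval R) :
  {in [set` i], continuous f} -> measurable_fun [set` i] f.
Proof.
move=> cf; apply: subspace_continuous_measurable_fun => //.
exact: continuous_in_subspaceT.
Qed.

Lemma integral_itvcc_is_derive f F (a b : R) : a <= b ->
  {in `[a, b], continuous f} ->
  (forall x, x \in `[a, b] -> is_derive x 1 F (f x)) ->
  (\int[leb1]_(x in `[a, b]) (f x)%:E = (F b - F a)%:E)%E.
Proof.
rewrite le_eqVlt => /predU1P[<- _ _|ab cf dF].
  by rewrite set_itv1 integral_set1 subrr.
have cF x : x \in `[a, b] -> {for x, continuous F}.
  by move=> xab; apply/differentiable_continuous/derivable1_diffP; case: (dF x xab).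
rewrite (@continuous_FTC2 _ f F)//.
- apply: continuous_in_subspaceT => x; rewrite inE => xab; exact: cf.
- split.
  + by move=> x xab; case: (dF x (subset_itv_oo_cc xab)).
  + by apply: cvg_at_right_filter; apply: cF; rewrite in_itv/= lexx ltW.
  + by apply: cvg_at_left_filter; apply: cF; rewrite in_itv/= lexx ltW.
- move=> x xab; rewrite derive1E.
  by case: (dF x (subset_itv_oo_cc xab)).
Qed.

Section sequence.
Variables a b : nat -> R.
Hypothesis da : {homo a : n m / (n <= m)%N >-> m <= n}.
Hypothesis ib : {homo b : n m / (n <= m)%N >-> n <= m}.
Hypothesis ab : forall n, a n <= b n.
Local Notation D := (\bigcup_n `[a n, b n]%classic).

Lemma exhaustion_nd : {homo (fun n => `[a n, b n]%classic : set R) : n m / (n <= m)%N >-> (n <= m)%O}.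
Proof.
move=> n m nm; apply/subsetPset => x /=; rewrite !in_itv/= => /andP[h1 h2].
by rewrite (le_trans (da nm) h1) (le_trans h2 (ib nm)).
Qed.

Lemma exhaustion_cvg f : (forall x, D x -> 0 <= f x) ->
  (forall x, D x -> {for x, continuous f}) ->
  (\int[leb1]_(x in `[a n, b n]) (f x)%:E @[n --> \oo] -->
   \int[leb1]_(x in D) (f x)%:E)%E.
Proof.
move=> f0 cf; apply: ge0_nondecreasing_set_cvg_integral.
- exact: exhaustion_nd.
- by move=> n; exact: measurable_itv.
- move=> n; apply/measurable_EFinP; apply: measurable_fun_continuous_itv => x.
  by rewrite inE => xn; apply: cf; exists n.
- by move=> n x xn; rewrite lee_fin f0//; exists n.
Qed.

(** Both integrals may be infinite, hence an identity between nonnegative integrands rather than the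
    integral of [f - g]. On each segment they are finite and can be subtracted; monotone convergence
    then passes to the union. *)
Lemma exhaustion_FTC F f g (L : R) :
  (forall x, D x -> 0 <= f x) -> (forall x, D x -> 0 <= g x) ->
  (forall x, D x -> {for x, continuous f}) ->
  (forall x, D x -> {for x, continuous g}) ->
  (forall x, D x -> is_derive x 1 F (f x - g x)) ->
  F (b n) - F (a n) @[n --> \oo] --> L ->
  (\int[leb1]_(x in D) (f x)%:E = \int[leb1]_(x in D) (g x)%:E + L%:E)%E.
Proof.
move=> f0 g0 cf cg dF FL.
have Fab n : (\int[leb1]_(x in `[a n, b n]) (f x)%:E =
    \int[leb1]_(x in `[a n, b n]) (g x)%:E + (F (b n) - F (a n))%:E)%E.
  have Dn x : x \in `[a n, b n] -> D x by move=> xn; exists n.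
  have intf h : (forall x, D x -> {for x, continuous h}) ->
      leb1.-integrable `[a n, b n] (EFin \o h).
    move=> ch; apply: continuous_compact_integrable; first exact: segment_compact.
    by apply: continuous_in_subspaceT => x; rewrite inE => xn; apply: ch; exact: Dn.
  have E1 : {in `[a n, b n], continuous (f \- g)}.
    by move=> x xn; apply: cvgB; [apply: cf|apply: cg]; exact: Dn.
  have E2 (x : R) : x \in `[a n, b n] -> is_derive x 1 F ((f \- g) x).
    by move=> xn; apply: dF; exact: Dn.
  rewrite -(@integral_itvcc_is_derive (f \- g) F (a n) (b n) (ab n) E1 E2).
  under [in X in (_ = _ + X)%E]eq_integral do rewrite /= EFinB.
  rewrite integralB//; [|exact: intf..].
  by rewrite addeC subeK//; apply: integrable_fin_num => //; exact: intf.
have h1 := exhaustion_cvg f0 cf.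
have h2 := exhaustion_cvg g0 cg.
have h3 : ((\int[leb1]_(x in `[a n, b n]) (g x)%:E + (F (b n) - F (a n))%:E)%E @[n --> \oo] -->
   (\int[leb1]_(x in D) (g x)%:E + L%:E))%E.
  apply: cvgeD => //; first by rewrite fin_num_adde_defl.
  by apply: cvg_EFin; [exact: nearW|exact: FL].
rewrite -(cvg_lim _ h1)// -(cvg_lim _ h3)//.
by congr (limn _); apply/funext => n; rewrite -Fab.
Qed.

Lemma exhaustion_le F f (L : R) :
  (forall x, D x -> 0 <= f x) ->
  (forall x, D x -> {for x, continuous f}) ->
  (forall x, D x -> is_derive x 1 F (f x)) ->
  (forall n, F (b n) - F (a n) <= L) ->
  (\int[leb1]_(x in D) (f x)%:E <= L%:E)%E.
Proof.
move=> f0 cf dF FL.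
have h := exhaustion_cvg f0 cf.
rewrite -(cvg_lim _ h)//; apply: lime_le; first exact: (cvgP _ h).
near=> n; have Dn x : x \in `[a n, b n] -> D x by move=> xn; exists n.
have E1 : {in `[a n, b n], continuous f} by move=> x xn; apply: cf; exact: Dn.
have E2 (x : R) : x \in `[a n, b n] -> is_derive x 1 F (f x).
  by move=> xn; apply: dF; exact: Dn.
by rewrite (@integral_itvcc_is_derive f F _ _ (ab n) E1 E2) lee_fin.
Unshelve. all: by end_near. Qed.

End sequence.

(** The index starts at 2 so that the left end 1/(n+2) never exceeds the right end 1 - 1/(n+2). *)
Lemma bigcup_itv01 : (\bigcup_n `[n.+2%:R^-1, 1 - n.+2%:R^-1]%classic)%R = `]0, 1[%classic :> set R.
Proof.
apply/seteqP; split=> [x [n _]|x] /=; rewrite !in_itv/=.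
  move=> /andP[h1 h2]; have h : 0 < n.+2%:R^-1 :> R by rewrite invr_gt0.
  by rewrite (lt_le_trans h h1)/= (le_lt_trans h2)// gtrBl.
move=> /andP[x0 x1]; have m0 : 0 < Num.min x (1 - x) by rewrite lt_min x0 subr_gt0.
have [k _ /(_ _ (leqnn _))/=] := near_infty_natSinv_lt (PosNum m0).
rewrite lt_min => /andP[h1 h2]; exists k => //=; rewrite in_itv/=.
have h : k.+2%:R^-1 <= k.+1%:R^-1 :> R by rewrite lef_pV2 ?posrE ?ler_nat.
by rewrite (le_trans h (ltW h1))/= lerBrDr addrC -lerBrDr (le_trans h (ltW h2)).
Qed.

Lemma bigcup_itv0y : (\bigcup_n `[n.+2%:R^-1, n.+2%:R]%classic)%R = `]0, +oo[%classic :> set R.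
Proof.
apply/seteqP; split=> [x [n _]|x] /=; rewrite !in_itv/= ?andbT.
  by move=> /andP[h1 h2]; rewrite (lt_le_trans _ h1)// invr_gt0.
move=> x0.
have [k _ /(_ _ (leqnn _))/= h1] := near_infty_natSinv_lt (PosNum x0).
have [m hm] : exists m : nat, x < m%:R by exists (Num.trunc x).+1; exact: truncnS_gt.
exists (maxn k m) => //=; rewrite in_itv/=; apply/andP; split.
  apply: le_trans (ltW h1); rewrite lef_pV2 ?posrE// ler_nat.
  by rewrite ltnW// !ltnS leq_maxl.
apply: le_trans (ltW hm) _; rewrite ler_nat.
by rewrite (leq_trans (leq_maxr k m))// ltnW.
Qed.

Lemma invn2_noninc : {homo (fun n => n.+2%:R^-1 : R) : n m / (n <= m)%N >-> m <= n}.
Proof. by move=> n m nm; rewrite lef_pV2 ?posrE// ler_nat. Qed.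

Lemma cvg_invn2 : (n.+2%:R^-1 : R) @[n --> \oo] --> 0.
Proof.
have := @cvg_harmonic R; rewrite -(cvg_shiftS (@harmonic R)).
exact.
Qed.

Section itv01.
Variables (F f g : R -> R) (l0 l1 : R).
Local Notation D := (`]0, 1[%classic : set R).
Hypothesis f0 : forall x : R, 0 < x < 1 -> 0 <= f x.
Hypothesis g0 : forall x : R, 0 < x < 1 -> 0 <= g x.
Hypothesis cf : forall x : R, 0 < x < 1 -> {for x, continuous f}.
Hypothesis cg : forall x : R, 0 < x < 1 -> {for x, continuous g}.
Hypothesis dF : forall x : R, 0 < x < 1 -> is_derive x 1 F (f x - g x).
Hypothesis F0 : F x @[x --> 0^'+] --> l0.
Hypothesis F1 : F x @[x --> 1^'-] --> l1.

Lemma FTC_itv01 :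
  (\int[leb1]_(x in D) (f x)%:E = \int[leb1]_(x in D) (g x)%:E + (l1 - l0)%:E)%E.
Proof.
have DP (P : R -> Prop) : (forall x : R, 0 < x < 1 -> P x) ->
    forall x, (\bigcup_n `[n.+2%:R^-1, 1 - n.+2%:R^-1]%classic)%R x -> P x.
  by move=> HP x; rewrite bigcup_itv01 /= in_itv/= => /HP.
rewrite -bigcup_itv01; apply: (@exhaustion_FTC _ _ _ _ _ F).
- exact: invn2_noninc.
- by move=> n m nm; rewrite lerD2l lerN2 invn2_noninc.
- move=> n; rewrite lerBrDr -mulr2n -[X in X <= _]mulr_natr ler_pdivrMl// mulr1.
  by rewrite ler_nat.
- exact: (DP (fun x => 0 <= f x)).
- exact: (DP (fun x => 0 <= g x)).
- exact: (DP (fun x => {for x, continuous f})).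
- exact: (DP (fun x => {for x, continuous g})).
- exact: (DP (fun x => is_derive x 1 F (f x - g x))).
apply: cvgB.
- move/cvg_at_leftP : F1; apply; split.
    by move=> n; rewrite gtrBl invr_gt0.
  by rewrite -[X in _ --> X]subr0; apply: cvgB; [exact: cvg_cst|exact: cvg_invn2].
- move/cvg_at_rightP : F0; apply; split; last exact: cvg_invn2.
  by move=> n; rewrite invr_gt0.
Qed.
End itv01.

Section itv0y.
Variables (F f g : R -> R) (l0 l1 : R).
Local Notation D := (`]0, +oo[%classic : set R).
Hypothesis f0 : forall x : R, 0 < x -> 0 <= f x.
Hypothesis g0 : forall x : R, 0 < x -> 0 <= g x.
Hypothesis cf : forall x : R, 0 < x -> {for x, continuous f}.
Hypothesis cg : forall x : R, 0 < x -> {for x, continuous g}.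

Let DP (P : R -> Prop) : (forall x : R, 0 < x -> P x) ->
  forall x, (\bigcup_n `[n.+2%:R^-1, n.+2%:R]%classic)%R x -> P x.
Proof. by move=> HP x; rewrite bigcup_itv0y /= in_itv/= andbT => /HP. Qed.

Let n2 n : n.+2%:R^-1 <= n.+2%:R :> R.
Proof. by rewrite (@le_trans _ _ 1)// ?invf_le1// ler1n. Qed.

Lemma FTC_itv0y :
  (forall x : R, 0 < x -> is_derive x 1 F (f x - g x)) ->
  F x @[x --> 0^'+] --> l0 -> F x @[x --> +oo] --> l1 ->
  (\int[leb1]_(x in D) (f x)%:E = \int[leb1]_(x in D) (g x)%:E + (l1 - l0)%:E)%E.
Proof.
move=> dF F0 F1.
rewrite -bigcup_itv0y; apply: (@exhaustion_FTC _ _ _ _ _ F).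
- exact: invn2_noninc.
- by move=> n m nm; rewrite ler_nat.
- exact: n2.
- exact: (DP (P := fun x => 0 <= f x)).
- exact: (DP (P := fun x => 0 <= g x)).
- exact: (DP (P := fun x => {for x, continuous f})).
- exact: (DP (P := fun x => {for x, continuous g})).
- exact: (DP (P := fun x => is_derive x 1 F (f x - g x))).
apply: cvgB.
- move/cvg_pinftyP : F1; apply.
  have := @cvgr_idn R; rewrite -(cvg_shiftn 2 (fun n => n%:R : R)) => h.
  by under eq_fun do rewrite -addn2.
- move/cvg_at_rightP : F0; apply; split; last exact: cvg_invn2.
  by move=> n; rewrite invr_gt0.
Qed.

Lemma FTC_itv0y_le (L : R) :
  (forall x : R, 0 < x -> is_derive x 1 F (f x)) ->
  (forall x y : R, 0 < x -> 0 < y -> F y - F x <= L) ->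
  (\int[leb1]_(x in D) (f x)%:E <= L%:E)%E.
Proof.
move=> dF FL.
rewrite -bigcup_itv0y; apply: (@exhaustion_le _ _ _ _ _ F).
- exact: invn2_noninc.
- by move=> n m nm; rewrite ler_nat.
- exact: n2.
- exact: (DP (P := fun x => 0 <= f x)).
- exact: (DP (P := fun x => {for x, continuous f})).
- exact: (DP (P := fun x => is_derive x 1 F (f x))).
by move=> n; apply: FL; rewrite ?invr_gt0.
Qed.

End itv0y.

Lemma is_derive_continuous F (x d : R) : is_derive x 1 F d -> {for x, continuous F}.
Proof. by move=> [dF _]; apply/differentiable_continuous/derivable1_diffP. Qed.

Lemma continuous_powRl (p x : R) : 0 < x -> {for x, continuous (@powR R ^~ p)}.
Proof. by move=> x0; apply: is_derive_continuous; exact: is_derive1_powR. Qed.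

Lemma continuous_expRN (x : R) : {for x, continuous (fun t : R => expR (- t))}.
Proof. apply: continuous_comp; [exact: opp_continuous|exact: continuous_expR]. Qed.

Local Notation gam x := (fun t : R => t `^ (x - 1) * expR (- t)).

Lemma continuous_Gamma_integrand (x t : R) : 0 < t -> {for t, continuous (gam x)}.
Proof.
by move=> t0; apply: continuousM; [exact: continuous_powRl|exact: continuous_expRN].
Qed.

Lemma measurable_Gamma_integrand (x : R) (D : set R) : measurable_fun D (gam x).
Proof.
apply: measurable_funTS; apply: measurable_funM; first exact: measurable_powR.
by apply: measurableT_comp.
Qed.

(** The integrand is dominated by the derivative of the bounded function C/x (1 - 1/(1 + t^x)),
    because (1 + t^x)^2 <= C e^t. *)
Lemma Gamma_lty (x : R) : 0 < x ->
  (\int[leb1]_(t in `]0%R, +oo[) (gam x t)%:E < +oo)%E.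
Proof.
move=> x0; have [n xn] : exists n : nat, x < n%:R.
  by exists (Num.trunc x).+1; exact: truncnS_gt.
have n0 : (0 < n)%N by rewrite -(ltr0n R); exact: lt_trans xn.
(* From t^x <= 1 + t^n, then (2 + y)^2 <= 8 + 2 y^2 with y = t^n, then t^(2n) <= (2n)! e^t. *)
pose C : R := 8 + 2 * (n.*2)`!%:R.
have C0 : 0 < C by rewrite ltr_wpDr// mulr_ge0.
have bound (t : R) : 0 < t -> (1 + t `^ x) ^+ 2 <= C * expR t.
  move=> t0; have h1 : t `^ x <= 1 + t ^+ n.
    have [t1|t1] := leP t 1.
    - rewrite (@le_trans _ _ 1)//; last by rewrite lerDl exprn_ge0// ltW.
      by rewrite -[leRHS](powRr0 t) ger_powR ?t0 ?t1 ?ltW.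
    - rewrite (@le_trans _ _ (t ^+ n))//; last by rewrite lerDr.
      by rewrite -powR_mulrn ?(ltW t0)// ler_powR ?(ltW t1) ?(ltW xn).
  have tn : 0 <= t ^+ n by rewrite exprn_ge0// ltW.
  have h2 : (1 + t `^ x) ^+ 2 <= 8 + 2 * t ^+ n.*2.
    apply: (@le_trans _ _ ((2 + t ^+ n) ^+ 2)).
      rewrite lerXn2r ?nnegrE ?addr_ge0 ?powR_ge0//; lra.
    rewrite -addnn exprD; have := sqr_ge0 (t ^+ n - 2); nra.
  apply: (le_trans h2); rewrite /C [leRHS]mulrDl; apply: lerD.
    rewrite ler_peMr//; have := expR_ge1Dx t; lra.
  rewrite -mulrA ler_pM2l//.
  have := @expR_ge1Dxn R t n.*2.-1 (ltW t0); rewrite prednK ?double_gt0//.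
  have f0 : 0 < (n.*2)`!%:R :> R by rewrite ltr0n fact_gt0.
  move=> h; rewrite mulrC -ler_pdivrMr//; lra.
pose dF (t : R) : R := C / x * (x * t `^ (x - 1) * (1 + t `^ x) ^- 2).
have cdF (t : R) : 0 < t -> {for t, continuous dF}.
    move=> t0; rewrite /dF.
    apply: continuousM; first exact: cvg_cst.
    apply: continuousM.
      by apply: continuousM; [exact: cvg_cst|exact: continuous_powRl].
    have ne : (1 + t `^ x) ^+ 2 != 0 by rewrite sqrf_eq0 gt_eqF// ltr_pwDl// powR_ge0.
    apply: (@continuousV _ _ (fun t => (1 + t `^ x) ^+ 2) t ne).
    apply: (@continuous_comp _ _ _ (fun t => 1 + t `^ x) (fun y => y ^+ 2)).
      by apply: continuousD; [exact: cvg_cst|exact: continuous_powRl].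
    exact: exprn_continuous.
apply: (@le_lt_trans _ _ (\int[leb1]_(t in `]0%R, +oo[) (dF t)%:E)%E).
  apply: ge0_le_integral => //.
  - by move=> t _; rewrite lee_fin mulr_ge0 ?powR_ge0 ?expR_ge0.
  - by apply/measurable_EFinP; exact: measurable_Gamma_integrand.
  - apply/measurable_EFinP; apply: measurable_fun_continuous_itv => t.
    rewrite inE/= in_itv/= andbT => t0; exact: cdF.
  - move=> t /=; rewrite in_itv/= andbT => t0; rewrite lee_fin /dF.
    have h := bound t t0.
    have p1 : 0 < (1 + t `^ x) ^+ 2 by rewrite exprn_gt0// ltr_pwDl// powR_ge0.
    have -> : C / x * (x * t `^ (x - 1) * (1 + t `^ x) ^- 2) =
        t `^ (x - 1) * (C / (1 + t `^ x) ^+ 2).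
      by field; rewrite !gt_eqF// ltr_pwDl// powR_ge0.
    rewrite ler_wpM2l ?powR_ge0// expRN ler_pdivlMr// mulrC ler_pdivrMr ?expR_gt0//.
apply: (@le_lt_trans _ _ (C / x)%:E); last by rewrite ltry.
apply: (@FTC_itv0y_le (fun t => C / x * (1 - (1 + t `^ x)^-1)) dF).
- by move=> t t0; rewrite /dF !mulr_ge0 ?invr_ge0 ?exprn_ge0 ?powR_ge0 ?addr_ge0 ?powR_ge0// ltW.
- move=> t t0; exact: cdF.
- move=> t t0.
  have ne : 1 + t `^ x != 0 by rewrite gt_eqF// ltr_pwDl// powR_ge0.
  have d1 := is_derive1_powR x t0.
  have d2 : is_derive t 1 (fun t : R => 1 + t `^ x) (x * t `^ (x - 1)).
    by have := is_deriveD (is_derive_cst (1 : R) t 1) d1; rewrite add0r.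
  have d3 := @is_deriveV R (fun t : R => 1 + t `^ x) t _ _ ne d2.
  have d4 := is_deriveZ (C / x) (is_deriveB (is_derive_cst (1 : R) t 1) d3).
  apply: (is_derive_eq d4); rewrite /GRing.scale/= /dF; field.
  by rewrite ne gt_eqF.
- move=> s t s0 t0; rewrite -mulrBr -[leRHS]mulr1 ler_wpM2l ?divr_ge0 ?ltW//.
  have p (r : R) : 0 < (1 + r `^ x)^-1 <= 1.
    by rewrite invr_gt0 ltr_pwDl ?powR_ge0//= invf_le1 ?lerDl ?ltr_pwDl ?powR_ge0.
  have /andP[a1 a2] := p s; have /andP[a3 a4] := p t; lra.
Qed.

Lemma GammaE (x : R) : 0 < x ->
  (\int[leb1]_(t in `]0%R, +oo[) (gam x t)%:E)%E = (Gamma x)%:E.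
Proof.
move=> x0; rewrite /Gamma /Rintegral fineK// ge0_fin_numE ?Gamma_lty//.
by apply: integral_ge0 => t _; rewrite lee_fin mulr_ge0 ?powR_ge0 ?expR_ge0.
Qed.

Opaque Gamma.

Lemma Gamma_gt0 (x : R) : 0 < x -> 0 < Gamma x.
Proof.
move=> x0; rewrite -lte_fin -GammaE//.
pose c : R := Num.min 1 (2 `^ (x - 1)) * expR (- 2).
have c0 : 0 < c by rewrite mulr_gt0 ?expR_gt0// lt_min ltr01 powR_gt0.
apply: (@lt_le_trans _ _ (\int[leb1]_(t in `[1%R, 2%R]) c%:E)%E).
  rewrite integral_cst//= lebesgue_measure_itv/= lte_fin ltr1n.
  by rewrite -EFinB -EFinM lte_fin mulr_gt0// subr_gt0 ltr1n.
have sub : `[1%R, 2%R]%classic `<=` (`]0%R, +oo[%classic : set R).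
  by move=> t /=; rewrite !in_itv/= andbT => /andP[+ _]; exact: lt_le_trans.
apply: (@le_trans _ _ (\int[leb1]_(t in `[1%R, 2%R]) (gam x t)%:E)%E).
  apply: ge0_le_integral => //.
  - by move=> t _; rewrite lee_fin ltW.
  - by apply/measurable_EFinP; exact: measurable_Gamma_integrand.
  - move=> t /=; rewrite in_itv/= => /andP[t1 t2]; rewrite lee_fin.
    apply: ler_pM; rewrite ?expR_ge0 ?le_min ?powR_ge0 ?ler01//; last by rewrite ler_expR lerN2.
    rewrite ge_min; have [x1|x1] := leP 1 x.
      by rewrite -[leLHS](powRr0 t) ler_powR ?subr_ge0.
    apply/orP; right; have t0 : 0 < t by exact: lt_le_trans t1.
    have e (r : R) : r `^ (x - 1) = (r `^ (1 - x))^-1 by rewrite -powRN opprB.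
    rewrite !e lef_pV2 ?posrE ?powR_gt0//.
    by rewrite ge0_ler_powR ?nnegrE ?subr_ge0 ?(ltW x1) ?(ltW t0).
apply: ge0_subset_integral => //.
- by apply/measurable_EFinP; exact: measurable_Gamma_integrand.
- by move=> t _; rewrite lee_fin mulr_ge0 ?powR_ge0 ?expR_ge0.
Qed.

Lemma GammaS (x : R) : 0 < x -> Gamma (x + 1) = x * Gamma x.
Proof.
move=> x0; apply: EFin_inj; have y0 : 0 < x + 1 by rewrite addr_gt0.
rewrite EFinM -(GammaE y0) -(GammaE x0).
rewrite -ge0_integralZl//; last 3 first.
- by apply/measurable_EFinP; exact: measurable_Gamma_integrand.
- by move=> t _; rewrite lee_fin mulr_ge0 ?powR_ge0 ?expR_ge0.
- by rewrite lee_fin ltW.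
have := @FTC_itv0y (fun t => - (t `^ x * expR (- t))) (gam (x + 1)) (fun t => x * gam x t) 0 0.
rewrite subr0 adde0; apply.
- by move=> t t0; rewrite mulr_ge0 ?powR_ge0 ?expR_ge0.
- by move=> t t0; rewrite !mulr_ge0 ?powR_ge0 ?expR_ge0// ltW.
- by move=> t t0; exact: continuous_Gamma_integrand.
- by move=> t t0; apply: continuousM; [exact: cvg_cst|exact: continuous_Gamma_integrand].
- move=> t t0.
  have d1 := is_derive1_powR x t0.
  have d2 : is_derive t 1 (fun t : R => expR (- t)) (- expR (- t)).
    have := @is_derive1_comp R expR -%R t _ _ (is_derive_expR _) (is_deriveN (is_derive_id t 1)).
    by rewrite mulrN1.
  have d4 := is_deriveN (is_deriveM d1 d2).
  by apply: (is_derive_eq d4); rewrite /GRing.scale/= addrK; ring.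
- have h : t `^ x * expR (- t) @[t --> (0 : R)^'+] --> 0 * expR (- 0).
    apply: cvgM; first exact: powR_cvg0.
    by apply: cvg_at_right_filter; exact: continuous_expRN.
  by rewrite mul0r in h; rewrite -[X in _ --> X]oppr0; exact: cvgN.
- have [n xn] : exists n : nat, x < n%:R.
    by exists (Num.trunc x).+1; exact: truncnS_gt.
  apply: (@squeeze_cvgr _ _ _ _ (fun t => - ((n.+1)`!%:R * t^-1)) (fun=> 0)).
  + near=> t.
    have t1 : 1 < t by near: t; exact: nbhs_pinfty_gt.
    have t0 : 0 < t by rewrite (lt_trans _ t1).
    rewrite oppr_le0 mulr_ge0 ?powR_ge0 ?expR_ge0// andbT lerN2 expRN.
    rewrite ler_pdivrMr ?expR_gt0// (@le_trans _ _ (t ^+ n))//.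
      by rewrite -powR_mulrn ?(ltW t0)// ler_powR ?(ltW t1) ?(ltW xn).
    rewrite mulrAC ler_pdivlMr// -exprSr.
    have := @expR_ge1Dxn R t n (ltW t0).
    have f0 : 0 < (n.+1)`!%:R :> R by rewrite ltr0n fact_gt0.
    move=> h; rewrite mulrC -ler_pdivrMr//; lra.
  + rewrite -oppr0; apply: cvgN; rewrite -[X in _ --> X](mulr0 (n.+1)`!%:R).
    by apply: cvgM; [exact: cvg_cst|apply/(@gtr0_cvgV0 _ _ _ _ id); [exact: nbhs_pinfty_gt|exact: cvg_id]].
  + exact: cvg_cst.
Unshelve. all: by end_near. Qed.

(** Gamma(x) = Gamma(x + 1)/x, and t^x <= 1 + t bounds Gamma(x + 1). Used at x = s - 1/2, where it
    measures how fast the average over grazing directions diverges. *)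
Lemma Gamma_le (x : R) : 0 < x <= 1 -> Gamma x <= (Gamma 1 + Gamma 2) / x.
Proof.
move=> /andP[x0 x1]; rewrite ler_pdivlMr// mulrC -GammaS//.
have y0 : 0 < x + 1 by rewrite addr_gt0.
have tr (a b c : \bar R) (u v w : R) : a = u%:E -> b = v%:E -> c = w%:E ->
  (a <= b + c)%E -> u <= v + w by move=> -> -> ->; rewrite -EFinD lee_fin.
apply: (tr _ _ _ _ _ _ (GammaE y0) (GammaE (ltr01 : 0 < 1 :> R))
  (GammaE (ltr0n R 2 : 0 < 2 :> R))).
have m (y : R) : measurable_fun (`]0%R, +oo[%classic : set R) (EFin \o gam y).
  by apply/measurable_EFinP; exact: measurable_Gamma_integrand.
have p (y t : R) : 0 <= gam y t by rewrite mulr_ge0 ?powR_ge0 ?expR_ge0.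
rewrite -ge0_integralD//; [|by (exact: m) || (move=> ? _; rewrite lee_fin)..].
apply: ge0_le_integral => //.
- by move=> t _; rewrite lee_fin.
- exact: m.
- by apply: emeasurable_funD; exact: m.
move=> t /=; rewrite in_itv/= andbT => t0; rewrite -EFinD lee_fin -mulrDl.
rewrite ler_wpM2r ?expR_ge0// subrr powRr0 addrK.
rewrite (_ : 2 - 1 = 1) ?powRr1 ?(ltW t0)//; last by lra.
have [t1|t1] := leP t 1.
- by rewrite (@le_trans _ _ 1)// ?lerDl ?(ltW t0)// -[leRHS](powRr0 t) ger_powR ?t0 ?t1 ?(ltW x0).
- rewrite (@le_trans _ _ t)// ?lerDr//.
  by rewrite -[leRHS]powRr1 ?(ltW t0)// ler_powR ?(ltW t1).
Qed.

End exhaustion.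

(** * Gaussian moments and directions *)

Section gaussian.
Context {R : realType}.
Local Notation leb n := (@lebesgue_rV R n).
Local Notation leb1 := (@lebesgue_measure R).
Implicit Types (F : R -> \bar R).

Definition dot n (x y : 'rV[R]_n) : R := \sum_i x ord0 i * y ord0 i.

Lemma enorm_ge0 n (x : 'rV[R]_n) : 0 <= enorm x.
Proof. exact: sqrtr_ge0. Qed.

Lemma enorm_sqr n (x : 'rV[R]_n) : enorm x ^+ 2 = \sum_i x ord0 i ^+ 2.
Proof. by rewrite sqr_sqrtr// sumr_ge0// => i _; exact: sqr_ge0. Qed.

Lemma dotxx n (x : 'rV[R]_n) : dot x x = enorm x ^+ 2.
Proof. by rewrite enorm_sqr; apply: eq_bigr => i _; rewrite expr2. Qed.

Lemma enormZ n (c : R) (x : 'rV[R]_n) : enorm (c *: x) = `|c| * enorm x.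
Proof.
rewrite /enorm; under eq_bigr do rewrite mxE exprMn.
by rewrite -mulr_sumr sqrtrM ?sqr_ge0// sqrtr_sqr.
Qed.

Lemma enormN n (x : 'rV[R]_n) : enorm (- x) = enorm x.
Proof. by rewrite -scaleN1r enormZ normrN1 mul1r. Qed.

Lemma enorm0 n : enorm (0 : 'rV[R]_n) = 0.
Proof. by rewrite /enorm big1 ?sqrtr0// => i _; rewrite mxE expr0n. Qed.

Lemma enorm_cons n (a : R) (v : 'rV[R]_n) :
  enorm (rV_cons (a, v)) ^+ 2 = a ^+ 2 + enorm v ^+ 2.
Proof.
rewrite !enorm_sqr big_ord_recl rV_cons0; congr (_ + _).
by apply: eq_bigr => i _; rewrite rV_consS.
Qed.

Lemma dot_cons n (a b : R) (v w : 'rV[R]_n) :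
  dot (rV_cons (a, v)) (rV_cons (b, w)) = a * b + dot v w.
Proof.
rewrite /dot big_ord_recl !rV_cons0; congr (_ + _).
by apply: eq_bigr => i _; rewrite !rV_consS.
Qed.

Lemma dotZl n (c : R) (x y : 'rV[R]_n) : dot (c *: x) y = c * dot x y.
Proof. by rewrite /dot mulr_sumr; apply: eq_bigr => i _; rewrite mxE mulrA. Qed.

Lemma dotDl n (x y z : 'rV[R]_n) : dot (x + y) z = dot x z + dot y z.
Proof. by rewrite /dot -big_split; apply: eq_bigr => i _; rewrite mxE mulrDl. Qed.

Lemma dotC n (x y : 'rV[R]_n) : dot x y = dot y x.
Proof. by apply: eq_bigr => i _; rewrite mulrC. Qed.

Lemma measurable_enorm n : measurable_fun setT (@enorm R n).
Proof.
apply: measurableT_comp.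
  by apply: continuous_measurable_fun; exact: sqrt_continuous.
apply: measurable_sum => i; apply: measurable_funX; exact: measurable_coor.
Qed.

Lemma measurable_dot n (y : 'rV[R]_n) : measurable_fun setT (fun x => dot x y).
Proof.
apply: measurable_sum => i; apply: measurable_funM => //; exact: measurable_coor.
Qed.

Lemma integral_gauss_affine (c b : R) : c != 0 ->
  (\int[leb1]_x (expR (- (c * x + b) ^+ 2))%:E = (`|c|^-1 * Num.sqrt pi)%:E)%E.
Proof.
move=> c0.
rewrite (@ge0_integral_affine R c b (fun t => (gauss_fun t)%:E))//.
- by rewrite integralT_gauss EFinM.
- by apply/measurable_EFinP; apply: continuous_measurable_fun; exact: continuous_gauss_fun.
- by move=> x; rewrite lee_fin expR_ge0.
Qed.

Lemma measurable_expRNsqr (D : set R) : measurable_fun D (fun t : R => expR (- t ^+ 2)).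
Proof.
apply: measurable_funTS; apply: measurableT_comp => //.
by apply: measurableT_comp => //; exact: measurable_funX.
Qed.

(* Completing the square after the shear [t = (x - p a) / q]. *)
Lemma gauss_rotation2 (p q : R) F : measurable_fun setT F -> (forall x, 0 <= F x)%E ->
  (\int[leb1]_a \int[leb1]_t (F (p * a + q * t)%R * (expR (- (a ^+ 2 + t ^+ 2)))%:E) =
   (Num.sqrt pi)%:E *
   \int[leb1]_t (F (Num.sqrt (p ^+ 2 + q ^+ 2) * t)%R * (expR (- t ^+ 2))%:E))%E.
Proof.
move=> mF F0.
have [->|q0] := eqVneq q 0.
  rewrite expr0n addr0 sqrtr_sqr.
  have E0 (a : R) : (\int[leb1]_t (F (p * a + 0 * t)%R * (expR (- (a ^+ 2 + t ^+ 2)))%:E) =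
      (Num.sqrt pi)%:E * (F (p * a)%R * (expR (- a ^+ 2))%:E))%E.
    under eq_integral do rewrite mul0r addr0 opprD expRD EFinM muleA.
    rewrite ge0_integralZl//; last 2 first.
    - by apply/measurable_EFinP; exact: measurable_expRNsqr.
    - by rewrite mule_ge0// lee_fin expR_ge0.
    rewrite (_ : (\int[leb1]_x (expR (- x ^+ 2))%:E)%E = (Num.sqrt pi)%:E); last first.
      exact: integralT_gauss.
    by rewrite muleC.
  under eq_integral do rewrite E0.
  have mG (r : R) : measurable_fun setT (fun t : R => F (r * t)%R * (expR (- t ^+ 2))%:E)%E.
    apply: emeasurable_funM; first by apply: measurableT_comp.
    by apply/measurable_EFinP; exact: measurable_expRNsqr.
  rewrite ge0_integralZl//; last 2 first.
  - exact: mG.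
  - by move=> t _; rewrite mule_ge0// lee_fin expR_ge0.
  congr (_ * _)%E; have [p0|p0] := leP 0 p; first by rewrite ger0_norm.
  rewrite ltr0_norm//.
  have G0 (r t : R) : (0 <= F (r * t)%R * (expR (- t ^+ 2))%:E)%E.
    by rewrite mule_ge0// lee_fin expR_ge0.
  have n1 : -1 != 0 :> R by rewrite oppr_eq0 oner_eq0.
  have E := ge0_integral_affine 0 n1 (mG (- p)) (G0 (- p)).
  rewrite normrN1 invr1 mul1e in E; rewrite -E.
  by apply: eq_integral => t _; rewrite /affine addr0 mulN1r mulrNN sqrrN.
set r := Num.sqrt (p ^+ 2 + q ^+ 2).
have q20 : 0 < q ^+ 2 by rewrite exprn_even_gt0.
have r20 : 0 < p ^+ 2 + q ^+ 2 by rewrite ltr_wpDl// sqr_ge0.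
have r0 : 0 < r by rewrite sqrtr_gt0.
have r2 : r ^+ 2 = p ^+ 2 + q ^+ 2 by rewrite sqr_sqrtr// ltW.
pose H (a x : R) : R := expR (- (a ^+ 2 + ((x - p * a) / q) ^+ 2)).
have H0 a x : 0 <= H a x by exact: expR_ge0.
have mH : measurable_fun setT (fun z : measurableTypeR R * measurableTypeR R => H z.1 z.2).
  apply: measurableT_comp => //; apply: measurableT_comp => //.
  apply: measurable_funD; first exact: measurable_funX.
  apply: measurable_funX; apply: measurable_funM => //.
  apply: measurable_funB => //; exact: measurable_funM.
have E1 (a : R) : (\int[leb1]_t (F (p * a + q * t)%R * (expR (- (a ^+ 2 + t ^+ 2)))%:E) =
    (`|q|^-1)%:E * \int[leb1]_x (F x * (H a x)%:E))%E.
  have mFa : measurable_fun setT (fun x : R => F x * (H a x)%:E)%E.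
    apply: emeasurable_funM => //; apply/measurable_EFinP.
    exact: (measurableT_comp mH (pair1_measurable a)).
  have Fa0 (x : R) : (0 <= F x * (H a x)%:E)%E by rewrite mule_ge0// lee_fin.
  rewrite -[RHS](ge0_integral_affine (p * a) q0 mFa Fa0).
  apply: eq_integral => t _; rewrite /affine [(q * t + _)%R]addrC; congr (_ * _%:E)%E.
  by rewrite /H; congr (expR (- (_ + _ ^+ 2))); field.
under eq_integral do rewrite E1.
have mFH : measurable_fun setT
    (fun z : measurableTypeR R * measurableTypeR R => F z.2 * (H z.1 z.2)%:E)%E.
  apply: emeasurable_funM; last exact/measurable_EFinP.
  by apply: measurableT_comp.
have FH0 (z : measurableTypeR R * measurableTypeR R) : (0 <= F z.2 * (H z.1 z.2)%:E)%E.
  by rewrite mule_ge0// lee_fin.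
rewrite ge0_integralZT; last 3 first.
- exact: (@measurable_fun_fubini_tonelli_F _ _ _ _ _ leb1 _ mFH FH0).
- by move=> a; apply: integral_ge0 => x _; exact: (FH0 (a, x)).
- by rewrite invr_ge0.
rewrite (fubini_tonelli (m1 := leb1) (m2 := leb1) _ mFH FH0)/=.
have E2 (x : R) : (\int[leb1]_a (F x * (H a x)%:E) =
    (`|q| / r * Num.sqrt pi)%:E * (F x * (expR (- (r^-1 * x) ^+ 2))%:E))%E.
  rewrite ge0_integralZl//; last 2 first.
  - apply/measurable_EFinP; exact: (measurableT_comp mH (pair2_measurable x)).
  - by move=> a _; rewrite lee_fin.
  rewrite muleCA; congr (_ * _)%E.
  have HE a : H a x = expR (- (r^-1 * x) ^+ 2) * expR (- (r / q * a + (- p * x / (q * r))) ^+ 2).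
    rewrite -expRD /H; congr expR; rewrite -opprD; congr (- _).
    have -> : (r^-1 * x) ^+ 2 + (r / q * a + (- p * x / (q * r))) ^+ 2 =
        (x ^+ 2 * q ^+ 2 + (r ^+ 2 * a - p * x) ^+ 2) / (q ^+ 2 * r ^+ 2).
      by field; rewrite q0 gt_eqF.
    rewrite r2; field; rewrite q0/= -r2 expf_neq0// gt_eqF//.
  under eq_integral do rewrite HE EFinM.
  rewrite ge0_integralZT; last 3 first.
  - apply/measurable_EFinP; apply: (measurableT_comp (@measurable_expRNsqr setT)).
    by apply: measurable_funD => //; exact: measurable_funM.
  - by move=> a; rewrite lee_fin expR_ge0.
  - exact: expR_ge0.
  rewrite integral_gauss_affine; last by rewrite mulf_neq0// ?invr_eq0// gt_eqF.
  rewrite muleC -!EFinM; congr (_ * _)%:E.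
  by rewrite normf_div invf_div (gtr0_norm r0).
under eq_integral do rewrite E2.
have mFe (c : R) : measurable_fun setT (fun x : R => F x * (expR (- (c * x) ^+ 2))%:E)%E.
  apply: emeasurable_funM => //; apply/measurable_EFinP.
  apply: (measurableT_comp (@measurable_expRNsqr setT)); exact: measurable_funM.
have Fe0 (c x : R) : (0 <= F x * (expR (- (c * x) ^+ 2))%:E)%E.
  by rewrite mule_ge0// lee_fin expR_ge0.
rewrite ge0_integralZl//; last 2 first.
- exact: mFe.
- by rewrite lee_fin !mulr_ge0 ?invr_ge0 ?sqrtr_ge0.
have E3 := ge0_integral_affine 0 (lt0r_neq0 r0) (mFe r^-1) (Fe0 r^-1).
rewrite (gtr0_norm r0) in E3.
have -> : (\int[leb1]_t (F (r * t)%R * (expR (- t ^+ 2))%:E) =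
    (r^-1)%:E * \int[leb1]_x (F x * (expR (- (r^-1 * x) ^+ 2))%:E))%E.
  rewrite -[RHS]E3; apply: eq_integral => t _.
  by rewrite /affine addr0 mulrA mulVf ?mul1r// gt_eqF.
rewrite !muleA -!EFinM; congr (_%:E * _)%E; field.
by rewrite normr_eq0 q0 gt_eqF.
Qed.

(** Rotation invariance of the Gaussian, by induction on the dimension: one coordinate [a] is peeled
    off, the others contribute [enorm w * t] by induction, and the planar rotation merges
    [b * a + enorm w * t] into a single Gaussian variable of size [enorm nu]. *)
Lemma integral_gauss_dot n (nu : 'rV[R]_n) F :
  measurable_fun setT F -> (forall x, 0 <= F x)%E ->
  (\int[leb n]_h (F (dot h nu) * (expR (- enorm h ^+ 2))%:E) =
   (Num.sqrt pi ^+ n)%:E * ((Num.sqrt pi)^-1%:E *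
   \int[leb1]_t (F (enorm nu * t)%R * (expR (- t ^+ 2))%:E)))%E.
Proof.
have pi0 : 0 < Num.sqrt pi :> R by rewrite sqrtr_gt0 pi_gt0.
have mE m (G : R -> \bar R) (mu : 'rV[R]_m) : measurable_fun setT G ->
   measurable_fun setT (fun h : 'rV[R]_m => G (dot h mu) * (expR (- enorm h ^+ 2))%:E)%E.
  move=> mG; apply: emeasurable_funM.
    by apply: measurableT_comp => //; exact: measurable_dot.
  apply/measurable_EFinP; apply: (measurableT_comp (@measurable_expRNsqr setT)).
  exact: measurable_enorm.
elim: n nu F => [|n IH] nu F mF F0.
  rewrite ge0_integral_rV0//; last 2 first.
  - exact: mE.
  - by move=> h; rewrite mule_ge0// lee_fin expR_ge0.
  rewrite /dot big_ord0 [nu]thinmx0 !enorm0 expr0 mul1e.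
  under eq_integral do rewrite mul0r.
  rewrite ge0_integralZl//; last first.
    by apply/measurable_EFinP; exact: measurable_expRNsqr.
  rewrite (_ : (\int[leb1]_x (expR (- x ^+ 2))%:E)%E = (Num.sqrt pi)%:E); last first.
    exact: integralT_gauss.
  rewrite muleCA -EFinM mulVf ?gt_eqF// expr0n oppr0 expR0 muleC.
  by [].
rewrite ge0_integral_rVS//; last 2 first.
- exact: mE.
- by move=> h; rewrite mule_ge0// lee_fin expR_ge0.
rewrite -[nu]rV_unconsK /rV_uncons; set b := nu _ _; set w := rsubmx _.
have E0 (a : R) : (\int[leb n]_v (F (dot (rV_cons (a, v)) (rV_cons (b, w))) *
      (expR (- enorm (rV_cons (a, v)) ^+ 2))%:E) =
    (Num.sqrt pi ^+ n)%:E * ((Num.sqrt pi)^-1%:E *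
     \int[leb1]_t (F (b * a + enorm w * t)%R * (expR (- (a ^+ 2 + t ^+ 2)))%:E)))%E.
  under eq_integral do rewrite dot_cons enorm_cons opprD expRD EFinM muleA.
  rewrite (IH w (fun s : R => F (a * b + s)%R * (expR (- a ^+ 2))%:E)%E); last 2 first.
  - apply: emeasurable_funM => //; apply: measurableT_comp => //.
    exact: measurable_funD.
  - by move=> s; rewrite mule_ge0// lee_fin expR_ge0.
  by under eq_integral => t _ do rewrite -muleA -EFinM -expRD -opprD (mulrC a b).
under eq_integral do rewrite E0.
have mG : measurable_fun setT (fun z : measurableTypeR R * measurableTypeR R =>
    F (b * z.1 + enorm w * z.2)%R * (expR (- (z.1 ^+ 2 + z.2 ^+ 2)))%:E)%E.
  apply: emeasurable_funM.
    apply: measurableT_comp => //; apply: measurable_funD; exact: measurable_funM.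
  apply/measurable_EFinP; apply: measurableT_comp => //; apply: measurableT_comp => //.
  by apply: measurable_funD; exact: measurable_funX.
have G0 (z : measurableTypeR R * measurableTypeR R) : (0 <=
    F (b * z.1 + enorm w * z.2)%R * (expR (- (z.1 ^+ 2 + z.2 ^+ 2)))%:E)%E.
  by rewrite mule_ge0// lee_fin expR_ge0.
have mGF := @measurable_fun_fubini_tonelli_F _ _ _ _ _ leb1 _ mG G0.
have I0 (a : R) : (0 <= \int[leb1]_t (F (b * a + enorm w * t)%R *
    (expR (- (a ^+ 2 + t ^+ 2)))%:E))%E.
  by apply: integral_ge0 => t _; exact: (G0 (a, t)).
rewrite ge0_integralZT; last 3 first.
- exact: (emeasurable_funM (measurable_cst (Num.sqrt pi)^-1%:E) mGF).
- by move=> a; rewrite mule_ge0// lee_fin invr_ge0 ltW.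
- by rewrite exprn_ge0// ltW.
rewrite ge0_integralZT; last 3 first.
- exact: mGF.
- exact: I0.
- by rewrite invr_ge0 ltW.
rewrite gauss_rotation2// !muleA -!EFinM; congr (_%:E * _)%E.
  by rewrite mulfVK ?gt_eqF// exprSr mulfK ?gt_eqF.
apply: eq_integral => t _; congr (F (_ * _)%R * _)%E.
by rewrite -enorm_cons sqrtr_sqr ger0_norm// enorm_ge0.
Qed.

End gaussian.

Section moments.
Context {R : realType}.
Local Notation leb n := (@lebesgue_rV R n).
Local Notation leb1 := (@lebesgue_measure R).

Lemma ge0_integral_even (f : R -> R) : measurable_fun setT f ->
  (forall x, 0 <= f x) -> (forall x, f (- x) = f x) ->
  (\int[leb1]_x (f x)%:E = 2%:E * \int[leb1]_(x in `]0%R, +oo[) (f x)%:E)%E.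
Proof.
move=> mf f0 fN.
have mfE (D : set R) : measurable_fun D (EFin \o f).
  by apply/measurable_EFinP; exact: measurable_funTS.
have -> : [set: R] = `]-oo, 0]%classic `|` `]0, +oo[%classic.
  apply/seteqP; split=> x //= _; rewrite !in_itv/= andbT; by have [h|h] := leP x 0; [left|right].
rewrite ge0_integral_setU//=; last 3 first.
- exact: mfE.
- by move=> x _; rewrite lee_fin.
- apply/disj_setPS => x /= []; rewrite !in_itv/= andbT => h1 h2.
  by have := lt_le_trans h2 h1; rewrite ltxx.
have E2 : (2%:E = 1 + 1 :> \bar R)%E by rewrite -EFinD.
rewrite E2 ge0_muleDl ?lee_fin// mul1e; congr (_ + _)%E.
rewrite [LHS](_ : _ = \int[leb1]_(x in `]-oo, 0%R[) (f x)%:E)%E; last first.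
  by rewrite integral_itv_bndo_bndc.
rewrite [LHS]integral_mkcond [RHS]integral_mkcond.
have n1 : -1 != 0 :> R by rewrite oppr_eq0 oner_eq0.
have mg : measurable_fun setT ((fun x => (f x)%:E) \_ `]0%R, +oo[)%E.
  by apply/(measurable_restrictT _ _).1 => //; exact: mfE.
have g0 x : (0 <= ((fun x => (f x)%:E) \_ `]0%R, +oo[) x)%E.
  by rewrite patchE; case: ifPn => // _; rewrite lee_fin.
have E := ge0_integral_affine 0 n1 mg g0.
rewrite normrN1 invr1 mul1e in E; rewrite -[RHS]E.
apply: eq_integral => x _; rewrite /affine addr0 mulN1r !patchE !mem_setE !in_itv/= andbT oppr_gt0.
by case: ifPn => // _; rewrite fN.
Qed.

(** A substitution between open intervals need only be done on two increasing families of segments,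
    monotone convergence giving both limits. Nothing is asked of the substituting map at the
    endpoints. *)
Lemma exhaustion_subst (a b c d : nat -> R) (f g : R -> R) (D E : set R) :
  (forall x, D x -> 0 <= f x) -> (forall x, E x -> 0 <= g x) ->
  (forall x, D x -> {for x, continuous f}) ->
  (forall x, E x -> {for x, continuous g}) ->
  {homo a : n m / (n <= m)%N >-> m <= n} -> {homo b : n m / (n <= m)%N >-> n <= m} ->
  {homo c : n m / (n <= m)%N >-> m <= n} -> {homo d : n m / (n <= m)%N >-> n <= m} ->
  D = \bigcup_n `[a n, b n]%classic -> E = \bigcup_n `[c n, d n]%classic ->
  (forall n, \int[leb1]_(x in `[a n, b n]) (f x)%:E =
     \int[leb1]_(x in `[c n, d n]) (g x)%:E)%E ->
  (\int[leb1]_(x in D) (f x)%:E = \int[leb1]_(x in E) (g x)%:E)%E.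
Proof.
move=> f0 g0 cf cg da ib dc id DE EE H; subst D E.
have h1 := exhaustion_cvg da ib f0 cf.
have h2 := exhaustion_cvg dc id g0 cg.
rewrite -(cvg_lim _ h1)// -(cvg_lim _ h2)//.
by congr (limn _); apply/funext => n; rewrite H.
Qed.

Lemma integral_subst_is_derive (F dF G : R -> R) (a b : R) : a <= b ->
  (forall x, x \in `[a, b] -> is_derive x 1 F (dF x)) ->
  (forall x, x \in `[a, b] -> {for x, continuous dF}) ->
  (forall y, y \in `[F a, F b] -> {for y, continuous G}) ->
  {in `[a, b] &, {homo F : x y / x < y}} ->
  (\int[leb1]_(x in `[F a, F b]) (G x)%:E =
   \int[leb1]_(x in `[a, b]) (G (F x) * dF x)%:E)%E.
Proof.
move=> ab HF cdF cG incF.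
have aab : a \in `[a, b] by rewrite in_itv/= lexx.
have bab : b \in `[a, b] by rewrite in_itv/= lexx ab.
have F'E x : x \in `[a, b] -> (F^`())%classic x = dF x.
  by move=> xab; rewrite derive1E; case: (HF x xab).
have cF x : x \in `[a, b] -> {for x, continuous F}.
  by move=> xab; apply: is_derive_continuous; exact: HF.
have [/eqP abE|ab'] := boolP (a == b).
  by rewrite abE !set_itv1 !integral_set1.
have {}ab : a < b by rewrite lt_neqAle ab' ab.
rewrite integration_by_substitution_increasing ?(ltW ab)//.
- apply: eq_integral => x; by rewrite inE/= => xab; rewrite -F'E.
- move=> x xab; have xab' := subset_itv_oo_cc xab.
  rewrite /continuous_at F'E//.
  have h := cdF _ xab'; apply: (cvg_trans _ h); apply: near_eq_cvg.
  near=> y; rewrite F'E//; apply: subset_itv_oo_cc; near: y.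
  exact: near_in_itvoo.
- apply/cvg_ex; exists (dF a).
  have h : dF x @[x --> a^'+] --> dF a by apply: cvg_at_right_filter; exact: cdF.
  apply: (cvg_trans _ h); apply: near_eq_cvg; near=> y; rewrite F'E//.
  rewrite in_itv/=; apply/andP; split; first by near: y; exact: nbhs_right_ge.
  by near: y; exact: nbhs_right_le.
- apply/cvg_ex; exists (dF b).
  have h : dF x @[x --> b^'-] --> dF b by apply: cvg_at_left_filter; exact: cdF.
  apply: (cvg_trans _ h); apply: near_eq_cvg; near=> y; rewrite F'E//.
  rewrite in_itv/=; apply/andP; split; first by near: y; exact: nbhs_left_ge.
  by near: y; exact: nbhs_left_le.
- split.
  + by move=> x xab; case: (HF x (subset_itv_oo_cc xab)).
  + by apply: cvg_at_right_filter; apply: cF.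
  + by apply: cvg_at_left_filter; apply: cF.
- by apply: continuous_in_subspaceT => y; rewrite inE; exact: cG.
Unshelve. all: by end_near. Qed.

Local Notation mom g := (fun t : R => `|t| `^ g * expR (- t ^+ 2)).

Lemma measurable_mom (g : R) : measurable_fun setT (mom g).
Proof.
apply: measurable_funM; last exact: measurable_expRNsqr.
exact: (measurableT_comp (@measurable_powR R g) (@normr_measurable R setT)).
Qed.

(** The substitution t -> t^2 in the Gamma integral; the factor 2 of its Jacobian is also the one
    given by evenness. *)
Lemma gauss_moment (g : R) : -1 < g ->
  (\int[leb1]_t (mom g t)%:E = (Gamma ((g + 1) / 2))%:E)%E.
Proof.
move=> g1; have x0 : 0 < (g + 1) / 2 by lra.
rewrite ge0_integral_even; last 3 first.
- exact: measurable_mom.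
- by move=> t; rewrite mulr_ge0 ?powR_ge0 ?expR_ge0.
- by move=> t; rewrite normrN sqrrN.
rewrite -GammaE//; set x := (g + 1) / 2.
have -> : (\int[leb1]_(t in `]0%R, +oo[) (t `^ (x - 1) * expR (- t))%:E =
    \int[leb1]_(t in `]0%R, +oo[) (2 * mom g t)%:E)%E.
  have inv (n : nat) : 0 < n.+2%:R^-1 :> R by rewrite invr_gt0.
  have cm (t : R) : 0 < t -> {for t, continuous (fun t : R => (t ^+ 2) `^ (x - 1) * expR (- t ^+ 2) * (2 * t))}.
    move=> t0; apply: continuousM; last first.
      by apply: continuousM; [exact: cvg_cst|exact: cvg_id].
    apply: continuousM.
      apply: (@continuous_comp _ _ _ (fun t : R => t ^+ 2) (fun y : R => y `^ (x - 1))).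
        exact: exprn_continuous.
      by apply: continuous_powRl; rewrite exprn_gt0.
    apply: (@continuous_comp _ _ _ (fun t : R => t ^+ 2) (fun y : R => expR (- y))).
      exact: exprn_continuous.
    exact: continuous_expRN.
  transitivity (\int[leb1]_(t in `]0%R, +oo[) ((t ^+ 2) `^ (x - 1) * expR (- t ^+ 2) * (2 * t))%:E)%E.
    apply: (@exhaustion_subst (fun n => n.+2%:R^-1 ^+ 2) (fun n => n.+2%:R ^+ 2)
        (fun n => n.+2%:R^-1) (fun n => n.+2%:R)).
    - by move=> t _; rewrite mulr_ge0 ?powR_ge0 ?expR_ge0.
    - by move=> t; rewrite /= in_itv/= andbT => t0; rewrite !mulr_ge0 ?powR_ge0 ?expR_ge0// ltW.
    - by move=> t; rewrite /= in_itv/= andbT => t0; exact: continuous_Gamma_integrand.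
    - by move=> t; rewrite /= in_itv/= andbT => t0; exact: cm.
    - move=> n m nm; rewrite lerXn2r ?nnegrE ?(ltW (inv _))//; exact: invn2_noninc.
    - by move=> n m nm; rewrite lerXn2r ?nnegrE// ler_nat.
    - exact: invn2_noninc.
    - by move=> n m nm; rewrite ler_nat.
    - rewrite -bigcup_itv0y; apply/seteqP; split=> t [n _] /=; rewrite in_itv/= => /andP[h1 h2].
      + exists n => //=; rewrite in_itv/=; apply/andP; split.
          apply: le_trans h1; rewrite expr2 ler_piMr ?(ltW (inv _))// invf_le1// ler1n//.
        by apply: (le_trans h2); rewrite expr2 ler_peMr// ler1n.
      + exists (n.+2 ^ 2)%N => //=; rewrite in_itv/=; apply/andP; split.
          apply: le_trans h1; rewrite exprVn -natrX lef_pV2 ?posrE ?ltr0n ?expn_gt0// ler_nat.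
          by rewrite ltnW// ltnS leqnSn.
        by apply: (le_trans h2); rewrite -natrX ler_nat ltnW// ltnS leqnSn.
    - by rewrite bigcup_itv0y.
    - move=> n; have n2 : n.+2%:R^-1 <= n.+2%:R :> R.
        by rewrite (@le_trans _ _ 1)// ?invf_le1// ler1n.
      apply: (@integral_subst_is_derive (fun t => t ^+ 2) (fun t => 2 * t) _ _ _ n2).
      + move=> t _; have d := is_deriveX 2 (is_derive_id t (1 : R)).
        by apply: (is_derive_eq d); rewrite /GRing.scale/= mulr1 expr1.
      + by move=> t _; apply: continuousM; [exact: cvg_cst|exact: cvg_id].
      + move=> y; rewrite in_itv/= => /andP[h1 _]; apply: continuous_Gamma_integrand.
        by apply: lt_le_trans h1; rewrite exprn_gt0.
      + move=> s t; rewrite !in_itv/= => /andP[h1 _] /andP[h2 _] st.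
        have s0 : 0 < s := lt_le_trans (inv n) h1; clear h1 h2; nra.
  apply: eq_integral => t; rewrite inE/= in_itv/= andbT => t0; congr _%:E.
  have tg : t `^ g = t `^ (2 * (x - 1)) * t.
    rewrite -[X in _ * X](powRr1 (ltW t0)) -powRD; last by rewrite (gt_eqF t0) implybT.
    by congr (_ `^ _); rewrite /x; field.
  rewrite (gtr0_norm t0) tg -[in (t ^+ 2) `^ _](powR_mulrn _ (ltW t0)) -powRrM.
  by ring.
under [RHS]eq_integral do rewrite EFinM.
rewrite ge0_integralZl_EFin//.
by apply/measurable_EFinP; apply: measurable_funTS; exact: measurable_mom.
Qed.

Lemma Gamma_half : Gamma (2^-1 : R) = Num.sqrt pi.
Proof.
apply: EFin_inj; have h : -1 < 0 :> R by lra.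
have := gauss_moment h; rewrite add0r mul1r => <-.
rewrite (_ : (Num.sqrt pi)%:E = \int[leb1]_x (gauss_fun x)%:E)%E; last by rewrite integralT_gauss.
by apply: eq_integral => t _; rewrite powRr0 mul1r.
Qed.

(** An affine chart of the projective space of directions. The lines it misses, those in the
    hyperplane of zero first coordinate, are negligible in the polar formula. *)
Definition dir n (z : 'rV[R]_n) : 'rV[R]_n.+1 := rV_cons (1, z).

Lemma measurable_dir n : measurable_fun setT (@dir n).
Proof.
apply: (measurableT_comp (@measurable_rV_cons R n)).
exact: measurable_fun_pair.
Qed.

Lemma enorm_dir_ge1 n (z : 'rV[R]_n) : 1 <= enorm (dir z).
Proof.
rewrite -(@ler_pXn2r _ 2) ?nnegrE ?enorm_ge0// expr1n enorm_cons expr1n.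
by rewrite lerDl sqr_ge0.
Qed.

Lemma enorm_dir_gt0 n (z : 'rV[R]_n) : 0 < enorm (dir z).
Proof. exact: lt_le_trans (enorm_dir_ge1 z). Qed.

(** For a unit vector [nu] this is |dir z|^(-(n+1)) times the [g]-th power of the cosine between
    [dir z] and [nu]. The first factor is the surface density of the half-sphere in the gnomonic
    chart [z]. *)
Definition dirw n (g : R) (nu : 'rV[R]_n.+1) (z : 'rV[R]_n) : R :=
  enorm (dir z) `^ (- (n.+1%:R + g)) * `|dot (dir z) nu| `^ g.

Lemma dirw_ge0 n g nu (z : 'rV[R]_n) : 0 <= dirw g nu z.
Proof. by rewrite mulr_ge0 ?powR_ge0. Qed.

Lemma measurable_dirw n g nu : measurable_fun setT (@dirw n g nu).
Proof.
apply: measurable_funM.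
  apply: (measurableT_comp (@measurable_powR R _)).
  exact: (measurableT_comp (@measurable_enorm R _) (@measurable_dir n)).
apply: (measurableT_comp (@measurable_powR R _)).
apply: (measurableT_comp (@normr_measurable R _)).
exact: (measurableT_comp (@measurable_dot R _ nu) (@measurable_dir n)).
Qed.

(** The integral of the [g]-th power of the cosine over the half-sphere, for [g > -1]. *)
Definition dirJ n (g : R) : R :=
  Num.sqrt pi ^+ n * (Gamma ((1 + g) / 2) / Gamma ((n.+1%:R + g) / 2)).

Lemma dirJ_gt0 n (g : R) : -1 < g -> 0 < dirJ n g.
Proof.
move=> g1; have n1 : 1 <= n.+1%:R :> R by rewrite ler1n.
by rewrite mulr_gt0 ?exprn_gt0 ?sqrtr_gt0 ?pi_gt0// divr_gt0 ?Gamma_gt0//; lra.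
Qed.

(** The integral of |h.nu|^g e^(-|h|^2) is computed twice: by rotation invariance as a
    one-dimensional moment, and in polar form as the wanted integral times a radial moment. The
    quotient of the two moments is independent of [nu]. *)
Lemma integral_dirw n (g : R) (nu : 'rV[R]_n.+1) : -1 < g -> enorm nu = 1 ->
  (\int[leb n]_z (dirw g nu z)%:E = (dirJ n g)%:E)%E.
Proof.
move=> g1 nu1.
pose F (s : R) : \bar R := (`|s| `^ g)%:E.
have mF : measurable_fun setT F.
  apply/measurable_EFinP; apply: (measurableT_comp (@measurable_powR R _)).
  exact: normr_measurable.
have F0 s : (0 <= F s)%E by rewrite lee_fin powR_ge0.
have := integral_gauss_dot nu mF F0; rewrite nu1.
under [X in _ = (_ * (_ * X))%E -> _]eq_integral do rewrite mul1r -EFinM.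
rewrite (gauss_moment g1).
have mh : measurable_fun setT (fun h : 'rV[R]_n.+1 => F (dot h nu) * (expR (- enorm h ^+ 2))%:E)%E.
  apply: emeasurable_funM.
    by apply: measurableT_comp => //; exact: measurable_dot.
  apply/measurable_EFinP; apply: (measurableT_comp (@measurable_expRNsqr R setT)).
  exact: measurable_enorm.
rewrite ge0_integral_polar//; last by move=> h; rewrite mule_ge0// lee_fin expR_ge0.
have n1 : 1 <= n.+1%:R :> R by rewrite ler1n.
have ng : -1 < n%:R + g by have : 0 <= n%:R :> R by []; lra.
have E (z : 'rV[R]_n) : (\int[leb1]_t ((`|t| ^+ n)%:E * (F (dot (t *: dir z) nu) *
     (expR (- enorm (t *: dir z) ^+ 2))%:E)) =
   (Gamma ((n.+1%:R + g) / 2))%:E * (dirw g nu z)%:E)%E.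
  set c := enorm (dir z); have c0 : 0 < c := enorm_dir_gt0 z.
  pose k := `|dot (dir z) nu| `^ g * c `^ (- (n%:R + g)).
  have k0 : 0 <= k by rewrite mulr_ge0 ?powR_ge0.
  transitivity (\int[leb1]_t (k%:E * (mom (n%:R + g) (c * t))%:E))%E.
    apply: eq_integral => t _; rewrite -!EFinM; congr _%:E.
    rewrite dotZl normrM powRM// enormZ -/c (normrM c) powRM//.
    have e1 : (`|t| * c) ^+ 2 = (c * t) ^+ 2.
      by rewrite !exprMn real_normK ?num_real// mulrC.
    rewrite e1 (gtr0_norm c0) /k.
    (* Exponents cannot be added at [t = 0]: for [n = 0] there is nothing to add, and for [n > 0]
       both sides vanish since [n%:R + g != 0]. *)
    have [->|t0] := eqVneq t 0.
      rewrite normr0 expr0n; have [n0|n0] := eqVneq n 0%N.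
        have -> : n%:R = 0 :> R by rewrite n0.
        by rewrite add0r powRN /=; field; rewrite gt_eqF ?powR_gt0.
      have ng0 : n%:R + g != 0.
        have : 1 <= n%:R :> R by rewrite ler1n lt0n.
        by move=> h; rewrite gt_eqF//; lra.
      by rewrite (powR0 ng0) /=; ring.
    have t0' : 0 < `|t| by rewrite normr_gt0.
    rewrite [`|t| `^ (_ + _)]powRD ?(gt_eqF t0') ?implybT// powR_mulrn// powRN.
    by field; rewrite gt_eqF ?powR_gt0.
  have mm : measurable_fun setT (fun t => (mom (n%:R + g) t)%:E).
    by apply/measurable_EFinP; exact: measurable_mom.
  have m0 t : (0 <= (mom (n%:R + g) t)%:E)%E.
    by rewrite lee_fin mulr_ge0 ?powR_ge0 ?expR_ge0.
  have := ge0_integral_affine 0 (lt0r_neq0 c0) mm m0.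
  rewrite (gauss_moment ng) gtr0_norm// => E1.
  rewrite ge0_integralZT; last 3 first.
  - apply: (measurableT_comp mm); exact: measurable_funM.
  - by move=> t; exact: m0.
  - exact: k0.
  under eq_integral do rewrite -[(c * _)%R]addr0.
  rewrite [X in (_ * X)%E]E1 -!EFinM; congr _%:E.
  rewrite (_ : n%:R + g + 1 = n.+1%:R + g); last by rewrite -natr1; ring.
  rewrite /k /dirw -/c.
  have -> : c `^ (- (n.+1%:R + g)) = c `^ (- (n%:R + g)) * c^-1.
    rewrite -[in RHS](powR_inv1 (ltW c0)) -powRD ?(gt_eqF c0) ?implybT//.
    by rewrite -natr1; congr (_ `^ _); ring.
  by field; rewrite gt_eqF.
under eq_integral do rewrite E.
rewrite ge0_integralZT; last 3 first.
- by apply/measurable_EFinP; exact: measurable_dirw.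
- by move=> z; rewrite lee_fin dirw_ge0.
- by rewrite ltW// Gamma_gt0//; lra.
have G0 : 0 < Gamma ((n.+1%:R + g) / 2) by rewrite Gamma_gt0//; lra.
move=> /(congr1 (fun y => (Gamma ((n.+1%:R + g) / 2))^-1%:E * y)%E).
rewrite !muleA -!EFinM mulVf ?gt_eqF// mul1e => ->; congr _%:E.
have pi0 : 0 < Num.sqrt pi :> R by rewrite sqrtr_gt0 pi_gt0.
rewrite /dirJ exprS (addrC 1 g).
move: (Num.sqrt pi) pi0 (Gamma ((n.+1%:R + g) / 2)) G0 => r r0 a a0; move: (Gamma _) => c; field.
by rewrite !gt_eqF.
Qed.

End moments.

(** * The half-line Hardy constant *)

Section kappa_integral.
Context {R : realType}.
Local Notation leb1 := (@lebesgue_measure R).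

Lemma FTC_itv01_le (F f : R -> R) (L : R) :
  (forall x : R, 0 < x < 1 -> 0 <= f x) ->
  (forall x : R, 0 < x < 1 -> {for x, continuous f}) ->
  (forall x : R, 0 < x < 1 -> is_derive x 1 F (f x)) ->
  (forall x y : R, 0 < x < 1 -> 0 < y < 1 -> F y - F x <= L) ->
  (\int[leb1]_(x in `]0%R, 1%R[) (f x)%:E <= L%:E)%E.
Proof.
move=> f0 cf dF FL.
have DP (P : R -> Prop) : (forall x : R, 0 < x < 1 -> P x) ->
    forall x, (\bigcup_n `[n.+2%:R^-1, 1 - n.+2%:R^-1]%classic)%R x -> P x.
  by move=> HP x; rewrite bigcup_itv01 /= in_itv/= => /HP.
have n2 n : n.+2%:R^-1 < 1 :> R by rewrite invf_lt1// ltr1n.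
rewrite -bigcup_itv01; apply: (@exhaustion_le _ _ _ _ _ _ F).
- exact: invn2_noninc.
- by move=> n m nm; rewrite lerD2l lerN2 invn2_noninc.
- move=> n; rewrite lerBrDr -mulr2n -[X in X <= _]mulr_natr ler_pdivrMl// mulr1.
  by rewrite ler_nat.
- exact: (DP (fun x => 0 <= f x)).
- exact: (DP (fun x => {for x, continuous f})).
- exact: (DP (fun x => is_derive x 1 F (f x))).
by move=> n; apply: FL; rewrite ?gtrBl ?subr_gt0 ?invr_gt0 ?n2 ?ltr0n.
Qed.

Lemma ge0_integral_itv01_onem (f : R -> R) : (forall x : R, 0 < x < 1 -> 0 <= f x) ->
  measurable_fun (`]0%R, 1%R[%classic : set R) f ->
  (\int[leb1]_(x in `]0%R, 1%R[) (f x)%:E = \int[leb1]_(x in `]0%R, 1%R[) (f (1 - x))%:E)%E.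
Proof.
move=> f0 mf; rewrite [LHS]integral_mkcond [RHS]integral_mkcond.
have n1 : -1 != 0 :> R by rewrite oppr_eq0 oner_eq0.
have mg : measurable_fun setT ((fun x => (f x)%:E) \_ `]0%R, 1%R[)%E.
  apply/(measurable_restrictT _ _).1 => //; exact/measurable_EFinP.
have g0 x : (0 <= ((fun x => (f x)%:E) \_ `]0%R, 1%R[) x)%E.
  by rewrite patchE mem_setE in_itv/=; case: ifPn => // /f0; rewrite lee_fin.
have E := ge0_integral_affine 1 n1 mg g0.
rewrite normrN1 invr1 mul1e in E; rewrite -[LHS]E.
apply: eq_integral => x _; rewrite /affine mulN1r (addrC (- x)) !patchE !mem_setE !in_itv/=.
by rewrite subr_gt0 gtrBl andbC.
Qed.

Lemma continuousV_R (f : R -> R) (x : R) : f x != 0 -> {for x, continuous f} ->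
  {for x, continuous (fun y : R => (f y)^-1)}.
Proof. by move=> fx cf; exact: continuousV. Qed.

Lemma powR1E (p : R) : 1 `^ p = 1 :> R.
Proof. by rewrite powR1. Qed.

Lemma powRB1 (x p : R) : 0 < x -> x `^ (p - 1) = x `^ p / x.
Proof. by move=> x0; rewrite powRB ?(gt_eqF x0) ?implybT// powRr1// ltW. Qed.

Lemma powRD1 (x p : R) : 0 < x -> x `^ (p + 1) = x `^ p * x.
Proof. by move=> x0; rewrite powRD ?(gt_eqF x0) ?implybT// powRr1// ltW. Qed.

Lemma is_derive_onem_powR (p t : R) : t < 1 ->
  is_derive t 1 (fun t : R => (1 - t) `^ p) (- (p * (1 - t) `^ (p - 1))).
Proof.
move=> t1; have t0 : 0 < 1 - t by rewrite subr_gt0.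
have d1 : is_derive t 1 (fun t : R => 1 - t) (-1).
  by have := is_deriveB (is_derive_cst (1 : R) t 1) (is_derive_id t (1 : R)); rewrite sub0r.
have := @is_derive1_comp R (@powR R ^~ p) (fun t => 1 - t) t _ _ (is_derive1_powR p t0) d1.
by rewrite mulrN1.
Qed.

(* Tonelli on [t^(q-1) e^(-t (1+x))] in two orders. *)
Lemma Beta_integral (p q : R) : 0 < p -> p < q ->
  (\int[leb1]_(x in `]0%R, +oo[) (x `^ (p - 1) * (1 + x) `^ (- q))%:E =
   (Gamma p * Gamma (q - p) / Gamma q)%:E)%E.
Proof.
move=> p0 pq; have q0 : 0 < q by exact: lt_trans pq.
have qp0 : 0 < q - p by rewrite subr_gt0.
pose I : set R := `]0, +oo[%classic.
have mI : measurable I by exact: measurable_itv.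
pose G (z : measurableTypeR R * measurableTypeR R) : \bar R :=
  (\1_I z.1 * \1_I z.2 * (z.1 `^ (p - 1) * (z.2 `^ (q - 1) * expR (- (z.2 * (1 + z.1))))))%:E.
have mI1 : measurable_fun setT (\1_I : measurableTypeR R -> R) by exact: measurable_indic.
have mp1 r : measurable_fun setT (fun x : measurableTypeR R => x `^ r) by exact: measurable_powR.
have mG : measurable_fun setT G.
  apply/measurable_EFinP; apply: measurable_funM.
    by apply: measurable_funM; apply: measurableT_comp => //.
  apply: measurable_funM; first exact: (measurableT_comp (mp1 _) measurable_fst).
  apply: measurable_funM; first exact: (measurableT_comp (mp1 _) measurable_snd).
  apply: measurableT_comp => //; apply: measurableT_comp => //.
  apply: measurable_funM => //; exact: measurable_funD.
have I01 (x : R) : 0 <= (\1_I x : R) by rewrite indicE.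
have G0 z : (0 <= G z)%E.
  by rewrite lee_fin !mulr_ge0 ?I01 ?powR_ge0 ?expR_ge0.
have gm0 (r t : R) : 0 <= t `^ (r - 1) * expR (- t).
  by rewrite mulr_ge0 ?powR_ge0 ?expR_ge0.
have scal (r c : R) : 0 < r -> 0 < c ->
    (\int[leb1]_t (\1_I t * (t `^ (r - 1) * expR (- (t * c))))%:E = (c `^ (- r) * Gamma r)%:E)%E.
  move=> r0 c0; pose g (t : R) : \bar R := (\1_I t * (t `^ (r - 1) * expR (- t)))%:E.
  have mg : measurable_fun setT g.
    apply/measurable_EFinP; apply: measurable_funM => //.
    exact: measurable_Gamma_integrand.
  have g0 t : (0 <= g t)%E by rewrite lee_fin mulr_ge0.
  have Eg : (\int[leb1]_t g t = (Gamma r)%:E)%E.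
    rewrite -(GammaE r0) [RHS]integral_mkcond; apply: eq_integral => t _.
    by rewrite /g patchE indicE; case: ifPn => _; rewrite ?mul1r ?mul0r.
  have E := ge0_integral_affine 0 (lt0r_neq0 c0) mg g0; rewrite Eg (gtr0_norm c0) in E.
  transitivity ((c `^ (1 - r))%:E * ((c^-1)%:E * (Gamma r)%:E))%E; last first.
    rewrite -!EFinM; congr _%:E; rewrite (addrC 1) powRD1//; field.
    by rewrite gt_eqF.
  rewrite -E -ge0_integralZT; last 3 first.
  - apply: (measurableT_comp mg); exact: measurable_affine.
  - by move=> t; exact: g0.
  - exact: powR_ge0.
  apply: eq_integral => t _; rewrite /g /affine addr0 -EFinM; congr _%:E.
  rewrite !indicE !mem_setE !in_itv/= !andbT pmulr_rgt0//.
  have [t0|t0] := boolP (0 < t); last by rewrite !mul0r mulr0.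
  rewrite /= !mul1r powRM ?(ltW c0) ?(ltW t0)// -(opprB r 1) powRN [t * c]mulrC.
  by field; rewrite gt_eqF ?powR_gt0.
have F1 (x : R) : (\int[leb1]_t G (x, t) =
    (Gamma q)%:E * (\1_I x * (x `^ (p - 1) * (1 + x) `^ (- q)))%:E)%E.
  rewrite /G/=; have [x0|x0] := boolP (x \in I); last first.
    rewrite [\1_I x]indicE (negbTE x0) !mul0r mule0.
    by under eq_integral do rewrite mul0r mul0r; rewrite integral0.
  have x1 : 0 < 1 + x by move: x0; rewrite mem_setE in_itv/= andbT => x0; rewrite ltr_pwDl// ltW.
  rewrite [\1_I x]indicE x0 mul1r -EFinM.
  transitivity ((x `^ (p - 1))%:E * ((1 + x) `^ (- q) * Gamma q)%:E)%E; last first.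
    by rewrite -EFinM; congr _%:E; ring.
  rewrite -scal// -ge0_integralZT; last 3 first.
  - apply/measurable_EFinP; apply: measurable_funM => //; apply: measurable_funM => //.
    by apply: measurableT_comp => //; apply: measurableT_comp => //; exact: measurable_funM.
  - by move=> t; rewrite lee_fin !mulr_ge0 ?powR_ge0 ?expR_ge0.
  - exact: powR_ge0.
  by apply: eq_integral => t _; rewrite -EFinM mul1r; congr _%:E; ring.
have F2 (t : R) : (\int[leb1]_x G (x, t) =
    (Gamma p)%:E * (\1_I t * (t `^ (q - p - 1) * expR (- t)))%:E)%E.
  rewrite /G/=; have [t0|t0] := boolP (t \in I); last first.
    rewrite [\1_I t]indicE (negbTE t0) !mul0r mule0.
    by under eq_integral do rewrite mulr0 mul0r; rewrite integral0.
  have t0' : 0 < t by move: t0; rewrite mem_setE in_itv/= andbT.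
  rewrite [\1_I t]indicE t0 mul1r -EFinM.
  transitivity ((t `^ (q - 1) * expR (- t))%:E * (t `^ (- p) * Gamma p)%:E)%E; last first.
    rewrite -EFinM; congr _%:E.
    rewrite (_ : q - p - 1 = (q - 1) + (- p)); last by ring.
    by rewrite [in RHS]powRD ?(gt_eqF t0') ?implybT//; ring.
  rewrite -scal// -ge0_integralZT; last 3 first.
  - apply/measurable_EFinP; apply: measurable_funM => //; apply: measurable_funM => //.
    by apply: measurableT_comp => //; apply: measurableT_comp => //; exact: measurable_funM.
  - by move=> x; rewrite lee_fin !mulr_ge0 ?powR_ge0 ?expR_ge0.
  - by rewrite mulr_ge0 ?powR_ge0 ?expR_ge0.
  apply: eq_integral => x _; rewrite -EFinM mulr1; congr _%:E.
  by rewrite (_ : - (t * (1 + x)) = - t + - (x * t)) ?expRD; ring.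
have E := fubini_tonelli (m1 := leb1) (m2 := leb1) G mG G0.
have mB : measurable_fun setT (fun x : R => (\1_I x * (x `^ (p - 1) * (1 + x) `^ (- q)))%:E).
  apply/measurable_EFinP; apply: (measurable_funM mI1); apply: (measurable_funM (mp1 _)).
  apply: (measurableT_comp (mp1 _)).
  by apply: measurable_funD.
have A1 : (\int[leb1]_x \int[leb1]_t G (x, t) =
    \int[leb1]_x ((Gamma q)%:E * (\1_I x * (x `^ (p - 1) * (1 + x) `^ (- q)))%:E))%E.
  by apply: eq_integral => x _; exact: F1.
have A2 : (\int[leb1]_t \int[leb1]_x G (x, t) =
    \int[leb1]_t ((Gamma p)%:E * (\1_I t * (t `^ (q - p - 1) * expR (- t)))%:E))%E.
  by apply: eq_integral => t _; exact: F2.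
have {}E := etrans (esym A1) (etrans E A2).
rewrite ge0_integralZT in E; last 3 first.
- exact: mB.
- by move=> x; rewrite lee_fin !mulr_ge0 ?I01 ?powR_ge0.
- by rewrite ltW// Gamma_gt0.
rewrite ge0_integralZT in E; last 3 first.
- apply/measurable_EFinP; apply: (measurable_funM mI1); exact: measurable_Gamma_integrand.
- by move=> x; rewrite lee_fin !mulr_ge0 ?I01 ?powR_ge0 ?expR_ge0.
- by rewrite ltW// Gamma_gt0.
have {}F2 := scal (q - p) 1 qp0 ltr01; rewrite powR1 mul1r in F2.
have A3 : (\int[leb1]_t (\1_I t * (t `^ (q - p - 1) * expR (- t)))%:E = (Gamma (q - p))%:E)%E.
  by rewrite -F2; apply: eq_integral => t _; rewrite mulr1.
rewrite A3 in E.
have Gq : 0 < Gamma q by exact: Gamma_gt0.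
have cancel (a b c : R) (y : \bar R) : 0 < a -> (a%:E * y = b%:E * c%:E)%E -> y = (b * c / a)%:E.
  move=> a0 /(congr1 (fun y => a^-1%:E * y)%E); rewrite muleA -!EFinM mulVf ?gt_eqF// mul1e => ->.
  by rewrite mulrC.
rewrite [LHS]integral_mkcond; transitivity (\int[leb1]_x (\1_I x * (x `^ (p - 1) * (1 + x) `^ (- q)))%:E)%E.
  by apply: eq_integral => x _; rewrite patchE indicE; case: ifPn => _; rewrite ?mul1r ?mul0r.
exact: cancel Gq E.
Qed.

Section kappa.
Variable s : R.
Hypothesis s01 : 2^-1 < s < 1.
Local Notation b := (s - 2^-1).
Local Notation al := (2 * s).

(** With b = s - 1/2, apply the half-line operator to t^b at the point 1 and fold the part beyond 1
    onto ]0, 1[ by t -> 1/t: the numerator (1 - t^b) + t^(2s-1) (1 - t^(-b)) is the square (1 -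
    t^b)^2 because 2s - 1 = 2b. *)
Definition kint (t : R) : R := (1 - t `^ (s - 2^-1)) ^+ 2 * (1 - t) `^ (- 1 - 2 * s).

Lemma kint_ge0 (t : R) : 0 <= kint t.
Proof. by rewrite mulr_ge0 ?sqr_ge0 ?powR_ge0. Qed.

Lemma continuous_kint (t : R) : 0 < t < 1 -> {for t, continuous kint}.
Proof.
move=> /andP[t0 t1]; apply: continuousM.
  apply: (@continuous_comp _ _ _ (fun t : R => 1 - t `^ b) (fun y => y ^+ 2)).
    by apply: continuousB; [exact: cvg_cst|exact: continuous_powRl].
  exact: exprn_continuous.
by apply: is_derive_continuous; exact: is_derive_onem_powR.
Qed.

(** Two integrations by parts, carried by one explicit primitive: they lower the singularity at 1 to
    the integrable order 2s - 1. The primitive tends to 0 at 1 and to 1/(2s) at 0, which produces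
    the [- 1] in the bracket of the constant. *)
Lemma kint_reduction :
  (\int[leb1]_(t in `]0%R, 1%R[) (kint t)%:E =
   \int[leb1]_(t in `]0%R, 1%R[) (b / al * (t `^ (b - 1) * (1 - t) `^ (1 - al)))%:E +
   (0 - al^-1)%:E)%E.
Proof.
have /andP[s0 s1] := s01.
have b0 : 0 < b by lra.
have a0 : al != 0 by lra.
apply: (@FTC_itv01 _ (fun t : R => al^-1 * ((1 - t `^ b) ^+ 2 * (1 - t) `^ (- al) +
    t `^ b * (1 - t `^ b) * (1 - t) `^ (1 - al)))).
- by move=> t _; exact: kint_ge0.
- by move=> t _; rewrite !mulr_ge0 ?powR_ge0 ?invr_ge0//; lra.
- by move=> t; exact: continuous_kint.
- move=> t /andP[t0 t1]; apply: continuousM; first exact: cvg_cst.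
  apply: continuousM; first exact: continuous_powRl.
  by apply: is_derive_continuous; exact: is_derive_onem_powR.
- move=> t /andP[t0 t1].
  have u0 : 0 < 1 - t by rewrite subr_gt0.
  have d1 := is_derive1_powR b t0.
  have d2 : is_derive t 1 (fun t : R => 1 - t `^ b) (- (b * t `^ (b - 1))).
    by have := is_deriveB (is_derive_cst (1 : R) t 1) d1; rewrite sub0r.
  have d3 := is_derive_onem_powR (- al) t1.
  have d4 := is_derive_onem_powR (1 - al) t1.
  have d5 := is_deriveZ al^-1 (is_deriveD (is_deriveM (is_deriveX 2 d2) d3)
     (is_deriveM (is_deriveM d1 d2) d4)).
  apply: (is_derive_eq d5).
  rewrite /GRing.scale/= /kint !fctE /=.
  rewrite (_ : -1 - al = - al - 1); last by ring.
  rewrite (_ : 1 - al = - al + 1); last by ring.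
  rewrite (_ : - al + 1 - 1 = - al); last by ring.
  rewrite !(powRB1 _ t0) !(powRB1 _ u0) !(powRD1 _ u0).
  move: (t `^ b) ((1 - t) `^ (- al)) => A B; field.
  by rewrite (gt_eqF t0) (gt_eqF u0) gt_eqF//; lra.
- have tb : t `^ b @[t --> (0 : R)^'+] --> (0 : R) by exact: powR_cvg0.
  have cq q : (1 - t) `^ q @[t --> (0 : R)^'+] --> (1 : R).
    rewrite -[X in _ --> X](powR1E q) -[X in _ --> X `^ _](subr0 1).
    apply: cvg_at_right_filter.
    exact: (is_derive_continuous (is_derive_onem_powR q (ltr01 : 0 < 1 :> R))).
  have h : al^-1 * ((1 - t `^ b) ^+ 2 * (1 - t) `^ (- al) +
    t `^ b * (1 - t `^ b) * (1 - t) `^ (1 - al)) @[t --> (0 : R)^'+] -->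
    al^-1 * ((1 - 0) * (1 - 0) * 1 + 0 * (1 - 0) * 1).
    apply: cvgM; first exact: cvg_cst.
    have c1 : 1 - t `^ b @[t --> (0 : R)^'+] --> (1 - 0 : R).
      by apply: cvgB => //; exact: cvg_cst.
    apply: cvgD; apply: cvgM => //; first by exact: cvgM.
    exact: cvgM.
  by rewrite subr0 !mul1r mul0r mul0r addr0 mulr1 in h.
- have cq : (1 - t) `^ (2 - al) @[t --> (1 : R)^'-] --> (0 : R).
    have p0 : 0 < 2 - al by lra.
    apply/cvg_at_leftP => u [u1 u01]; have /cvg_at_rightP H := powR_cvg0 p0.
    apply: (H (fun n => 1 - u n)); split; first by move=> n; rewrite subr_gt0.
    by rewrite -(subrr 1); apply: cvgB => //; exact: cvg_cst.
  apply: (@squeeze_cvgr _ _ _ _ (fun=> 0) (fun t : R => al^-1 * 2 * (1 - t) `^ (2 - al))).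
  + near=> t.
    have t0 : 0 < t by near: t; exact: nbhs_left_gt.
    have t1 : t < 1 by near: t; exact: nbhs_left_lt.
    have u0 : 0 < 1 - t by rewrite subr_gt0.
    have A0 : t <= t `^ b by rewrite ger1_powR ?t0 ?(ltW t1)//; lra.
    have A1 : t `^ b <= 1.
      by rewrite -[leRHS](powRr0 t) ger_powR ?t0 ?(ltW t1)// ltW.
    rewrite (_ : 1 - al = - al + 1); last by ring.
    rewrite (_ : 2 - al = - al + 1 + 1); last by ring.
    rewrite !(powRD1 _ u0).
    have B0 : 0 < (1 - t) `^ (- al) by exact: powR_gt0.
    have ai : 0 < al^-1 by rewrite invr_gt0; lra.
    move: (t `^ b) ((1 - t) `^ (- al)) A0 A1 B0 => A B A0 A1 B0.
    rewrite (_ : (1 - A) ^+ 2 * B + A * (1 - A) * (B * (1 - t)) =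
      B * ((1 - A) ^+ 2 + A * (1 - A) * (1 - t))); last by ring.
    have A2 : 0 <= A * (1 - A) by rewrite mulr_ge0//; lra.
    apply/andP; split.
      rewrite mulr_ge0 ?(ltW ai)// mulr_ge0 ?(ltW B0)// addr_ge0 ?sqr_ge0//.
      by rewrite mulr_ge0 ?(ltW u0).
    rewrite (_ : al^-1 * 2 * _ = al^-1 * (B * (2 * ((1 - t) * (1 - t))))); last by ring.
    apply: ler_wpM2l; first exact: ltW.
    apply: ler_wpM2l; first exact: ltW.
    have h1 : (1 - A) ^+ 2 <= (1 - t) * (1 - t) by rewrite expr2; nra.
    have h2 : A * (1 - A) * (1 - t) <= (1 - t) * (1 - t).
      by apply: ler_wpM2r; [exact: ltW|nra].
    by rewrite mulr_natl mulr2n; exact: lerD.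
  + exact: cvg_cst.
  + by rewrite -[X in _ --> X](mulr0 (al^-1 * 2)); apply: cvgM => //; exact: cvg_cst.
Unshelve. all: by end_near. Qed.

Lemma powR_expR (x p : R) : 0 < x -> x `^ p = expR (p * ln x).
Proof. by move=> x0; rewrite /powR gt_eqF. Qed.

(** The value B(b, 2 - 2s) is wanted in terms of Gamma(1 - s) instead of Gamma(2 - 2s). The
    duplication formula is built into the substitution x = u^2 / (4 (1 - u)), where u = 1 - t: it
    carries a Beta integral over ]0, +oo[ with exponents -s and -1/2 directly onto this one. *)
Lemma kint_beta :
  (\int[leb1]_(t in `]0%R, 1%R[) (t `^ (b - 1) * (1 - t) `^ (1 - al))%:E =
   (4 `^ (- b) * (Gamma (1 - s) * Gamma b / Gamma 2^-1))%:E)%E.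
Proof.
have /andP[s0 s1] := s01.
have c1 (t : R) (p q : R) : 0 < t < 1 -> {for t, continuous (fun t : R => t `^ p * (1 - t) `^ q)}.
  move=> /andP[t0 t1]; apply: continuousM; first exact: continuous_powRl.
  by apply: is_derive_continuous; exact: is_derive_onem_powR.
rewrite ge0_integral_itv01_onem; last 2 first.
- by move=> t _; rewrite mulr_ge0 ?powR_ge0.
- by apply: measurable_fun_continuous_itv => t; rewrite inE/= in_itv/=; exact: c1.
pose F (u : R) : R := u ^+ 2 * (4 * (1 - u))^-1.
pose dF (u : R) : R := u * (2 - u) / (4 * (1 - u) ^+ 2).
have p0 : 0 < 1 - s by rewrite subr_gt0.
have pq : 1 - s < 2^-1 by lra.
have B := Beta_integral p0 pq; rewrite (_ : 2^-1 - (1 - s) = b) in B; last by lra.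
rewrite (_ : 1 - s - 1 = - s) in B; last by ring.
rewrite EFinM -B -ge0_integralZl_EFin; last 4 first.
- exact: measurable_itv.
- by move=> x _; rewrite lee_fin mulr_ge0 ?powR_ge0.
- apply/measurable_EFinP; apply: measurable_funTS; apply: measurable_funM.
    exact: measurable_powR.
  apply: (measurableT_comp (@measurable_powR R _)); exact: measurable_funD.
- exact: powR_ge0.
have eqF (u : R) : 0 < u < 1 ->
    4 `^ (- b) * (F u `^ (- s) * (1 + F u) `^ (- 2^-1)) * dF u =
    (1 - u) `^ (b - 1) * (1 - (1 - u)) `^ (1 - al).
  move=> /andP[u0 u1]; have v0 : 0 < 1 - u by rewrite subr_gt0.
  have w0 : 0 < 2 - u by lra.
  have l4 : 0 < 4 :> R by [].
  have FE : 1 + F u = (2 - u) ^+ 2 * (4 * (1 - u))^-1.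
    by rewrite /F; field; rewrite gt_eqF.
  have F0 : 0 < F u by rewrite mulr_gt0 ?exprn_gt0 ?invr_gt0 ?mulr_gt0.
  have F1 : 0 < 1 + F u by rewrite addr_gt0.
  have lF : ln (F u) = 2 * ln u - (ln 4 + ln (1 - u)).
    rewrite /F lnM ?posrE ?exprn_gt0 ?invr_gt0 ?mulr_gt0// lnV ?posrE ?mulr_gt0//.
    by rewrite lnXn// [ln (4 * _)]lnM ?posrE// mulr_natl.
  have lF1 : ln (1 + F u) = 2 * ln (2 - u) - (ln 4 + ln (1 - u)).
    rewrite FE lnM ?posrE ?exprn_gt0 ?invr_gt0 ?mulr_gt0// lnV ?posrE ?mulr_gt0//.
    by rewrite lnXn// [ln (4 * _)]lnM ?posrE// mulr_natl.
  have dFE : dF u = expR (ln u + ln (2 - u) - ln 4 - 2 * ln (1 - u)).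
    rewrite /dF !expRD !expRN expRM_natl ?lnK ?posrE//.
    by field; rewrite gt_eqF.
  by rewrite subKr !powR_expR// lF lF1 dFE -!expRD; congr expR; field.
have inv n : 0 < (n.+2%:R^-1 : R) < 1 by rewrite invr_gt0 ltr0n invf_lt1// ltr1n.
have ninv n : 0 < 1 - (n.+2%:R^-1 : R) < 1.
  by have /andP[h1 h2] := inv n; rewrite subr_gt0 h2 gtrBl.
have nn n : n.+2%:R^-1 <= 1 - n.+2%:R^-1 :> R.
  rewrite lerBrDr -mulr2n -[X in X <= _]mulr_natr ler_pdivrMl// mulr1.
  by rewrite ler_nat.
have incF (u v : R) : 0 < u < 1 -> 0 < v < 1 -> u < v -> F u < F v.
  move=> /andP[u0 u1] /andP[v0 v1] uv; rewrite /F.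
  rewrite ltr_pdivrMr ?mulr_gt0 ?subr_gt0// mulrAC ltr_pdivlMr ?mulr_gt0 ?subr_gt0//.
  apply: ltr_pM; [exact: sqr_ge0|lra|rewrite !expr2; nra|lra].
have incF' (u v : R) : 0 < u < 1 -> 0 < v < 1 -> u <= v -> F u <= F v.
  by move=> u01 v01; rewrite le_eqVlt => /predU1P[->//|uv]; exact/ltW/incF.
have F0 (u : R) : 0 < u < 1 -> 0 < F u.
  by move=> /andP[u0 u1]; rewrite mulr_gt0 ?exprn_gt0 ?invr_gt0 ?mulr_gt0 ?subr_gt0.
apply/esym; apply: (@exhaustion_subst _ (fun n => F n.+2%:R^-1) (fun n => F (1 - n.+2%:R^-1))
  (fun n => n.+2%:R^-1) (fun n => 1 - n.+2%:R^-1)).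
- by move=> x _; rewrite !mulr_ge0 ?powR_ge0.
- by move=> x _; rewrite mulr_ge0 ?powR_ge0.
- move=> x; rewrite /= in_itv/= andbT => x0; apply: continuousM; first exact: cvg_cst.
  apply: continuousM; first exact: continuous_powRl.
  apply: (@continuous_comp _ _ _ (fun x : R => 1 + x) (fun y => y `^ (- 2^-1))).
    by apply: continuousD; [exact: cvg_cst|exact: cvg_id].
  by apply: continuous_powRl; rewrite ltr_wpDl.
- move=> t; rewrite /= in_itv/= => /andP[t0 t1].
  apply: (@continuous_comp _ _ _ (fun x : R => 1 - x) (fun t => t `^ (b - 1) * (1 - t) `^ (1 - al))).
    by apply: continuousB; [exact: cvg_cst|exact: cvg_id].
  by apply: c1; rewrite subr_gt0 t1 gtrBl.
- by move=> n m nm; apply: incF' => //; exact: invn2_noninc.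
- by move=> n m nm; apply: incF' => //; rewrite lerD2l lerN2 invn2_noninc.
- exact: invn2_noninc.
- by move=> n m nm; rewrite lerD2l lerN2 invn2_noninc.
- rewrite -bigcup_itv0y; apply/seteqP; split=> x [n _] /=; rewrite in_itv/= => /andP[h1 h2]; last first.
    have : (`]0, +oo[%classic : set R) x.
      by rewrite /= in_itv/= andbT (lt_le_trans _ h1)// F0.
    by rewrite -bigcup_itv0y.
  (* With m = n + 2 the parameter is u = 1/(8m + 3), small enough for F(u) <= 1/m and m <= F(1 -
     u). *)
  exists (8 * n.+2).+1%N => //=; rewrite in_itv/=.
  set m : R := n.+2%:R; have m2 : 2 <= m :> R by rewrite ler_nat.
  have M : (8 * n.+2).+1.+2%:R = 8 * m + 3 :> R.
    by rewrite -(natr1 (8 * n.+2).+2) -(natr1 (8 * n.+2).+1) -(natr1 (8 * n.+2)) natrM /m; ring.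
  rewrite M; apply/andP; split.
  + apply: le_trans h1; rewrite -/m /F.
    have -> : (8 * m + 3)^-1 ^+ 2 / (4 * (1 - (8 * m + 3)^-1)) =
       (4 * (8 * m + 3) * (8 * m + 2))^-1 by field; lra.
    rewrite lef_pV2 ?posrE; nra.
  + apply: (le_trans h2); rewrite -/m /F.
    have -> : (1 - (8 * m + 3)^-1) ^+ 2 / (4 * (1 - (1 - (8 * m + 3)^-1))) =
       (8 * m + 2) ^+ 2 / (4 * (8 * m + 3)) by field; lra.
    rewrite ler_pdivlMr; nra.
- by rewrite bigcup_itv01.
- move=> n.
  have sub (u : R) : u \in `[n.+2%:R^-1, 1 - n.+2%:R^-1] -> 0 < u < 1.
    rewrite in_itv/= => /andP[h1 h2].
    by rewrite (lt_le_trans _ h1)/= ?(le_lt_trans h2).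
  have D1 (u : R) : u \in `[n.+2%:R^-1, 1 - n.+2%:R^-1] -> is_derive u 1 F (dF u).
    move=> /sub /andP[u0 u1].
    have d1 := is_deriveX 2 (is_derive_id u (1 : R)).
    have d2 : is_derive u 1 (fun u : R => 4 * (1 - u)) (-4).
      have := is_deriveZ (4 : R) (is_deriveB (is_derive_cst (1 : R) u 1) (is_derive_id u (1 : R))).
      by rewrite sub0r /GRing.scale/= mulrN1.
    have ne : 4 * (1 - u) != 0 by rewrite gt_eqF// mulr_gt0// subr_gt0.
    have d3 := @is_deriveV R (fun u : R => 4 * (1 - u)) u _ _ ne d2.
    apply: (is_derive_eq (is_deriveM d1 d3)); rewrite /GRing.scale/= /dF !fctE.
    by field; rewrite gt_eqF// subr_gt0.
  have D2 (u : R) : u \in `[n.+2%:R^-1, 1 - n.+2%:R^-1] -> {for u, continuous dF}.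
    move=> /sub /andP[u0 u1]; rewrite /dF; apply: continuousM.
      apply: continuousM; first exact: cvg_id.
      by apply: continuousB; [exact: cvg_cst|exact: cvg_id].
    have ne : 4 * (1 - u) ^+ 2 != 0 by rewrite gt_eqF// mulr_gt0// exprn_gt0// subr_gt0.
    apply: (@continuousV_R (fun u : R => 4 * (1 - u) ^+ 2) u ne).
    apply: continuousM; first exact: cvg_cst.
    apply: (@continuous_comp _ _ _ (fun x : R => 1 - x) (fun y : R => y ^+ 2)).
      by apply: continuousB; [exact: cvg_cst|exact: cvg_id].
    exact: exprn_continuous.
  pose G (x : R) := 4 `^ (- b) * (x `^ (- s) * (1 + x) `^ (- 2^-1)).
  have D3 (x : R) : x \in `[F n.+2%:R^-1, F (1 - n.+2%:R^-1)] -> {for x, continuous G}.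
    rewrite in_itv/= => /andP[h1 _].
    have x0 : 0 < x by apply: lt_le_trans h1; exact: F0.
    apply: continuousM; first exact: cvg_cst.
    apply: continuousM; first exact: continuous_powRl.
    apply: (@continuous_comp _ _ _ (fun x : R => 1 + x) (fun y => y `^ (- 2^-1))).
      by apply: continuousD; [exact: cvg_cst|exact: cvg_id].
    by apply: continuous_powRl; rewrite ltr_wpDl.
  have D4 : {in `[(n.+2%:R^-1 : R), 1 - n.+2%:R^-1] &, {homo F : x y / x < y}}.
    by move=> u v /sub u01 /sub v01; exact: incF.
  apply: (etrans (integral_subst_is_derive (nn n) D1 D2 D3 D4)).
  by apply: eq_integral => u; rewrite inE => /sub u01; rewrite /G eqF.
Qed.

(** What remains of [kappa] once the factor [dirJ n (2 * s)] of the directions is taken out. *)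
Definition kap : R := (2 * s)^-1 *
  (2 `^ (1 - 2 * s) / Num.sqrt pi * Gamma (1 - s) * Gamma ((1 + 2 * s) / 2) - 1).

Lemma integral_kint : (\int[leb1]_(t in `]0%R, 1%R[) (kint t)%:E = kap%:E)%E.
Proof.
have /andP[s0 s1] := s01.
have b0 : 0 < b by lra.
rewrite kint_reduction; under eq_integral do rewrite EFinM.
rewrite ge0_integralZl_EFin; last 4 first.
- exact: measurable_itv.
- by move=> x _; rewrite lee_fin mulr_ge0 ?powR_ge0.
- have cc (t : R) : 0 < t < 1 -> {for t, continuous (fun x : R => x `^ (b - 1) * (1 - x) `^ (1 - al))}.
    move=> /andP[t0 t1]; apply: continuousM; first exact: continuous_powRl.
    by apply: is_derive_continuous; exact: is_derive_onem_powR.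
  apply/measurable_EFinP; apply: measurable_fun_continuous_itv => t.
  by rewrite inE/= in_itv/=; exact: cc.
- by rewrite divr_ge0//; lra.
rewrite kint_beta -EFinM -EFinD /kap; congr _%:E.
rewrite (_ : (1 + 2 * s) / 2 = b + 1); last by field.
rewrite GammaS// Gamma_half.
have -> : 4 `^ (- b) = 2 `^ (1 - al) :> R.
  rewrite (_ : 4 = 2 `^ 2 :> R); last by rewrite powR_mulrn//; ring.
  by rewrite -powRrM; congr (_ `^ _); field.
have : 0 < Num.sqrt pi :> R by rewrite sqrtr_gt0 pi_gt0.
move: (Num.sqrt pi) (Gamma (1 - s)) (Gamma b) (2 `^ (1 - al)) => r G1 G2 w r0; field.
by rewrite gt_eqF//=; lra.
Qed.

End kappa.

Lemma kap_gt0 (s : R) : 2^-1 < s < 1 -> 0 < kap s.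
Proof.
move=> s01; have /andP[s0 s1] := s01.
rewrite -lte_fin -integral_kint//.
have b0 : 0 < s - 2^-1 by lra.
pose c : R := (1 - 2^-1 `^ (s - 2^-1)) ^+ 2.
have c0 : 0 < c.
  rewrite exprn_gt0// subr_gt0 -[ltRHS](powR1E (s - 2^-1)).
  by rewrite gt0_ltr_powR ?nnegrE//; lra.
apply: (@lt_le_trans _ _ (\int[leb1]_(t in `[4^-1%R, 2^-1%R]) c%:E)%E).
  rewrite integral_cst//= lebesgue_measure_itv/= lte_fin.
  rewrite ifT; last by lra.
  by rewrite -EFinB -EFinM lte_fin mulr_gt0//; lra.
have sub : `[4^-1%R, 2^-1%R]%classic `<=` (`]0%R, 1%R[%classic : set R).
  move=> t /=; rewrite !in_itv/= => /andP[h1 h2]; apply/andP; split; lra.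
have mk (D : set R) : measurable D -> D `<=` `]0%R, 1%R[%classic -> measurable_fun D (EFin \o kint s).
  move=> mD DI; apply/measurable_EFinP; apply: (measurable_funS _ DI) => //.
  by apply: measurable_fun_continuous_itv => t; rewrite inE/= in_itv/=; exact: continuous_kint.
apply: (@le_trans _ _ (\int[leb1]_(t in `[4^-1%R, 2^-1%R]) (kint s t)%:E)%E).
  apply: ge0_le_integral => //.
  - by move=> t _; rewrite lee_fin ltW.
  - exact: mk.
  - move=> t /=; rewrite in_itv/= => /andP[t1 t2]; rewrite lee_fin /kint.
    rewrite -[c]mulr1; apply: ler_pM => //; first exact: sqr_ge0.
      have h : t `^ (s - 2^-1) <= 2^-1 `^ (s - 2^-1) by rewrite ge0_ler_powR ?nnegrE//; lra.
      have h' : 2^-1 `^ (s - 2^-1) <= 1 :> R.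
        by rewrite -[leRHS](powR1E (s - 2^-1)) ge0_ler_powR ?nnegrE//; lra.
      by rewrite /c lerXn2r ?nnegrE; lra.
    rewrite (_ : -1 - 2 * s = - (1 + 2 * s)); last by ring.
    rewrite powRN -[leLHS]invr1 lef_pV2 ?posrE ?powR_gt0//; last by lra.
    rewrite -[leRHS](powR1E (1 + 2 * s)) ge0_ler_powR ?nnegrE//; lra.
apply: ge0_subset_integral => //.
- exact: mk.
- by move=> t _; rewrite lee_fin kint_ge0.
Qed.

(** From 1 - t^e <= - e ln t and a bound of the logarithm by t^(-1/4). The exponent 1/4 is chosen so
    that the square t^(-1/2) stays integrable at 0. *)
Lemma onem_powR_le (e t : R) : 0 < e -> 0 < t < 1 ->
  1 - t `^ e <= 4 * e * (1 - t) * t `^ (- 4^-1).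
Proof.
move=> e0 /andP[t0 t1].
have h1 : 1 - t `^ e <= - (e * ln t).
  by rewrite powR_expR//; have := expR_ge1Dx (e * ln t); lra.
apply: (le_trans h1).
have u0 : 0 < t `^ (- 4^-1) by exact: powR_gt0.
have h2 : - ln t <= 4 * (t `^ (- 4^-1) - 1).
  have := le_ln1Dx; move=> /(_ R (t `^ (- 4^-1) - 1)).
  rewrite (_ : 1 + (_ - 1) = t `^ (- 4^-1)); last by ring.
  rewrite ln_powR; lra.
have h3 : t `^ (- 4^-1) - 1 <= (1 - t) * t `^ (- 4^-1).
  have h5 : t `^ (- 4^-1) * t `^ (4^-1) = 1.
    by rewrite -powRD ?addNr ?powRr0// (gt_eqF t0) implybT.
  have h4 : t <= t `^ 4^-1 by rewrite ger1_powR ?t0 ?(ltW t1)//; lra.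
  have : t `^ (- 4^-1) * t <= t `^ (- 4^-1) * t `^ 4^-1 by rewrite ler_wpM2l// ltW.
  lra.
rewrite -mulrN (_ : 4 * e * (1 - t) * _ = e * (4 * ((1 - t) * t `^ (- 4^-1)))); last by ring.
rewrite ler_pM2l//; lra.
Qed.

(** [kint] contains the square of 1 - t^(s - 1/2), which is O(s - 1/2): hence the quadratic
    smallness on which the lower bound rests. The restriction s <= 3/4 makes the remaining power of
    1 - t no worse than -1/2. *)
Lemma kap_le (s : R) : 2^-1 < s <= 3 / 4 ->
  kap s <= 128 * (s - 2^-1) ^+ 2.
Proof.
move=> /andP[s0 s1]; have s01 : 2^-1 < s < 1 by lra.
have e0 : 0 < s - 2^-1 by lra.
rewrite -lee_fin -integral_kint//.
set e := s - 2^-1.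
pose g (t : R) : R := 32 * e ^+ 2 * (t `^ (- 2^-1) + (1 - t) `^ (- 2^-1)).
have cg (t : R) : 0 < t < 1 -> {for t, continuous g}.
  move=> /andP[t0 t1]; apply: continuousM; first exact: cvg_cst.
  apply: continuousD; first exact: continuous_powRl.
  by apply: is_derive_continuous; exact: is_derive_onem_powR.
have g0 (t : R) : 0 <= g t.
  by rewrite mulr_ge0 ?addr_ge0 ?powR_ge0// mulr_ge0// sqr_ge0.
apply: (@le_trans _ _ (\int[leb1]_(t in `]0%R, 1%R[) (g t)%:E)%E).
  apply: ge0_le_integral => //.
  - by move=> t _; rewrite lee_fin kint_ge0.
  - apply/measurable_EFinP; apply: measurable_fun_continuous_itv => t.
    by rewrite inE/= in_itv/=; exact: continuous_kint.
  - apply/measurable_EFinP; apply: measurable_fun_continuous_itv => t.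
    by rewrite inE/= in_itv/=; exact: cg.
  move=> t /=; rewrite in_itv/= => t01; have /andP[t0 t1] := t01; rewrite lee_fin.
  have u0 : 0 < 1 - t by rewrite subr_gt0.
  have h := onem_powR_le e0 t01.
  have A1 : t `^ e <= 1.
    by rewrite -[leRHS](powRr0 t) ger_powR ?t0 ?(ltW t1)// ltW.
  have h2 : (1 - t `^ e) ^+ 2 <= 16 * e ^+ 2 * (1 - t) ^+ 2 * t `^ (- 2^-1).
    have -> : t `^ (- 2^-1) = (t `^ (- 4^-1)) ^+ 2.
      by rewrite -powR_mulrn ?powR_ge0// -powRrM; congr (_ `^ _); field.
    rewrite (_ : 16 * _ * _ * _ = (4 * e * (1 - t) * t `^ (- 4^-1)) ^+ 2); last by ring.
    by rewrite lerXn2r ?nnegrE ?subr_ge0// !mulr_ge0 ?powR_ge0 ?(ltW e0) ?(ltW u0).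
  have h3 : (1 - t) ^+ 2 * (1 - t) `^ (-1 - 2 * s) <= (1 - t) `^ (- 2^-1).
    rewrite -powR_mulrn ?(ltW u0)// -powRD ?(gt_eqF u0) ?implybT//.
    by rewrite ger_powR ?u0 ?gerBl ?(ltW t0)//; lra.
  have h4 : t `^ (- 2^-1) * (1 - t) `^ (- 2^-1) <= 2 * (t `^ (- 2^-1) + (1 - t) `^ (- 2^-1)).
    have p1 : 0 < t `^ (- 2^-1) by exact: powR_gt0.
    have p2 : 0 < (1 - t) `^ (- 2^-1) by exact: powR_gt0.
    have half (x : R) : 2^-1 <= x -> x `^ (- 2^-1) <= 2.
      move=> x2; have x0 : 0 < x by lra.
      rewrite powRN invf_ple ?posrE ?powR_gt0//.
      apply: (@le_trans _ _ (2^-1 `^ (2^-1))).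
        by rewrite ger1_powR//; lra.
      by rewrite ge0_ler_powR ?nnegrE//; lra.
    have [t2|t2] := leP 2^-1 t; first by have := half _ t2; nra.
    by have := half (1 - t); nra.
  rewrite /kint /g -/e.
  apply: (@le_trans _ _ (16 * e ^+ 2 * (1 - t) ^+ 2 * t `^ (- 2^-1) * (1 - t) `^ (-1 - 2 * s))).
    by rewrite ler_wpM2r ?powR_ge0.
  rewrite (_ : 16 * e ^+ 2 * (1 - t) ^+ 2 * t `^ (- 2^-1) * (1 - t) `^ (-1 - 2 * s) =
    16 * e ^+ 2 * (t `^ (- 2^-1) * ((1 - t) ^+ 2 * (1 - t) `^ (-1 - 2 * s)))); last by ring.
  rewrite (_ : 32 * e ^+ 2 * _ = 16 * e ^+ 2 * (2 * (t `^ (- 2^-1) + (1 - t) `^ (- 2^-1)))); last by ring.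
  apply: ler_wpM2l; first by rewrite mulr_ge0// sqr_ge0.
  apply: (le_trans _ h4).
  by rewrite ler_wpM2l ?powR_ge0.
apply: (@FTC_itv01_le (fun t : R => 64 * e ^+ 2 * (t `^ 2^-1 - (1 - t) `^ 2^-1)) g).
- by move=> t _; exact: g0.
- exact: cg.
- move=> t /andP[t0 t1].
  have d1 := is_derive1_powR 2^-1 t0.
  have d2 := is_derive_onem_powR 2^-1 t1.
  apply: (is_derive_eq (is_deriveZ (64 * e ^+ 2) (is_deriveB d1 d2))).
  rewrite /GRing.scale/= /g (_ : 2^-1 - 1 = - 2^-1); last by field.
  by field.
- move=> x y /andP[x0 x1] /andP[y0 y1].
  have p (z : R) : 0 < z < 1 -> 0 <= z `^ 2^-1 <= 1.
    move=> /andP[z0 z1]; rewrite powR_ge0/= -[leRHS](powR1E 2^-1).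
    by rewrite ge0_ler_powR ?nnegrE//; lra.
  have u01 (z : R) : 0 < z -> z < 1 -> 0 < 1 - z < 1 by move=> *; lra.
  have /andP[a1 a2] := p x (introT andP (conj x0 x1)).
  have /andP[a3 a4] := p y (introT andP (conj y0 y1)).
  have /andP[a5 a6] := p _ (u01 x x0 x1).
  have /andP[a7 a8] := p _ (u01 y y0 y1).
  have e20 : 0 <= e ^+ 2 by exact: sqr_ge0.
  rewrite -mulrBr (_ : 128 * e ^+ 2 = 64 * e ^+ 2 * 2); last by ring.
  apply: ler_wpM2l; first by rewrite mulr_ge0.
  lra.
Qed.

Lemma h_NsE n (s : R) : h_Ns n.+1 s = c_Ns n.+1 s * (dirJ n (2 * s) * kap s).
Proof.
rewrite /h_Ns /kappa; congr (_ * _).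
have -> : pi `^ ((n.+1%:R - 1) / 2) = Num.sqrt pi ^+ n :> R.
  rewrite -natr1 addrK mulrC powRrM powR12_sqrt ?pi_ge0//.
  by rewrite powR_mulrn ?sqrtr_ge0.
by rewrite -!mulrA.
Qed.

End kappa_integral.

(** * Hardy weights on a chord *)

Section line.
Context {R : realType}.
Local Notation leb1 := (@lebesgue_measure R).

Section itvco.
Variables (eta e : R).
Hypothesis ee : eta < e.

Definition itvco_seq (n : nat) : R := e - (e - eta) * n.+2%:R^-1.

Lemma itvco_seq_nd : {homo itvco_seq : n m / (n <= m)%N >-> n <= m}.
Proof.
move=> n m nm; rewrite lerD2l lerN2 ler_wpM2l ?subr_ge0 ?(ltW ee)//.
exact: invn2_noninc.
Qed.

Lemma itvco_seq_bnd n : eta <= itvco_seq n < e.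
Proof.
have h0 : 0 < n.+2%:R^-1 :> R by rewrite invr_gt0.
have h1 : n.+2%:R^-1 <= (1 : R) by rewrite invf_le1// ler1n.
have d0 : 0 < e - eta by rewrite subr_gt0.
rewrite /itvco_seq; apply/andP; split; last by rewrite gtrBl mulr_gt0.
rewrite lerBrDr -lerBrDl; exact: ler_piMr (ltW d0) h1.
Qed.

Lemma cvg_itvco_seq : itvco_seq n @[n --> \oo] --> e.
Proof.
rewrite -[X in _ --> X](subr0 e) -(mulr0 (e - eta)); apply: cvgB; first exact: cvg_cst.
by apply: cvgM; [exact: cvg_cst|exact: cvg_invn2].
Qed.

Lemma bigcup_itvco : (\bigcup_n `[eta, itvco_seq n]%classic)%R = `[eta, e[%classic :> set R.
Proof.
apply/seteqP; split=> [x [n _]|x] /=; rewrite !in_itv/=.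
  by move=> /andP[-> h2]; have /andP[_ h3] := itvco_seq_bnd n; exact: le_lt_trans h3.
move=> /andP[h1 h2]; have d0 : 0 < e - x by rewrite subr_gt0.
have : \forall n \near \oo, x < itvco_seq n.
  by apply: (cvgr_gt e cvg_itvco_seq).
by move=> [n _ /(_ n (leqnn n))/= hn]; exists n => //=; rewrite in_itv/= h1 ltW.
Qed.

Lemma FTC_itvco (F f g : R -> R) (L : R) :
  (forall x : R, eta <= x < e -> 0 <= f x) ->
  (forall x : R, eta <= x < e -> 0 <= g x) ->
  (forall x : R, eta <= x < e -> {for x, continuous f}) ->
  (forall x : R, eta <= x < e -> {for x, continuous g}) ->
  (forall x : R, eta <= x < e -> is_derive x 1 F (f x - g x)) ->
  F x @[x --> e^'-] --> L ->
  (\int[leb1]_(x in `[eta, e[) (f x)%:E = \int[leb1]_(x in `[eta, e[) (g x)%:E + (L - F eta)%:E)%E.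
Proof.
move=> f0 g0 cf cg dF FL.
have DP (P : R -> Prop) : (forall x : R, eta <= x < e -> P x) ->
    forall x, (\bigcup_n `[eta, itvco_seq n]%classic)%R x -> P x.
  by move=> HP x; rewrite bigcup_itvco /= in_itv/= => /HP.
rewrite -bigcup_itvco; apply: (@exhaustion_FTC _ _ _ _ _ _ F).
- by [].
- exact: itvco_seq_nd.
- by move=> n; case/andP: (itvco_seq_bnd n).
- exact: (DP (fun x => 0 <= f x)).
- exact: (DP (fun x => 0 <= g x)).
- exact: (DP (fun x => {for x, continuous f})).
- exact: (DP (fun x => {for x, continuous g})).
- exact: (DP (fun x => is_derive x 1 F (f x - g x))).
apply: cvgB; last exact: cvg_cst.
move/cvg_at_leftP : FL; apply; split; last exact: cvg_itvco_seq.
by move=> n; case/andP: (itvco_seq_bnd n).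
Qed.

End itvco.

(** * Moebius coordinates on a chord *)

Section sides.
Variables (p q : R).
Hypotheses (p0 : 0 < p) (q0 : 0 < q).
Local Notation l := (p + q).

(* Moebius parametrisation of the exit side: [u] is 1 minus the cross-ratio of
   the two endpoints of the chord, the base point and the point at [tau u]. *)
Definition mtau (u : R) : R := p * q * u / (l - q * u).
Definition mdtau (u : R) : R := p * q * l / (l - q * u) ^+ 2.

Let l0 : 0 < l. Proof. exact: addr_gt0. Qed.

Let den (u : R) : u <= 1 -> 0 < l - q * u.
Proof.
move=> u1; rewrite subr_gt0; apply: (@le_lt_trans _ _ q); last by rewrite ltrDr.
by rewrite ger_pMr.
Qed.

Lemma mtau_gt0 (u : R) : 0 < u <= 1 -> 0 < mtau u.
Proof. by move=> /andP[u0 u1]; rewrite divr_gt0 ?mulr_gt0 ?den. Qed.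

Lemma mtau_lt (u v : R) : u <= 1 -> v <= 1 -> (mtau u < mtau v) = (u < v).
Proof.
move=> u1 v1; rewrite /mtau ltr_pdivrMr ?den// [ltRHS]mulrAC ltr_pdivlMr ?den//.
have -> : (p * q * u * (l - q * v) < p * q * v * (l - q * u)) =
   (p * q * l * u < p * q * l * v).
  by rewrite -subr_gt0 -[in RHS]subr_gt0; congr (0 < _); ring.
by rewrite ltr_pM2l// !mulr_gt0.
Qed.

Lemma mtau_le (u v : R) : u <= 1 -> v <= 1 -> (mtau u <= mtau v) = (u <= v).
Proof. by move=> u1 v1; rewrite leNgt mtau_lt// -leNgt. Qed.

Lemma mtau1 : mtau 1 = q.
Proof. by rewrite /mtau; field; rewrite gt_eqF// addrK. Qed.

Lemma is_derive_mtau (u : R) : u <= 1 -> is_derive u 1 mtau (mdtau u).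
Proof.
move=> u1.
have d2 : is_derive u 1 (fun u : R => l - q * u) (- q).
  have := is_deriveB (is_derive_cst l u 1) (is_deriveZ q (is_derive_id u (1 : R))).
  by rewrite sub0r /GRing.scale/= mulr1.
have ne : l - q * u != 0 by rewrite gt_eqF// den.
have d3 := @is_deriveV R (fun u : R => l - q * u) u _ _ ne d2.
have d1 : is_derive u 1 (fun u : R => p * q * u) (p * q).
  have := is_deriveZ (p * q) (is_derive_id u (1 : R)).
  by rewrite /GRing.scale/= mulr1.
apply: (is_derive_eq (is_deriveM d1 d3)); rewrite /GRing.scale/= /mdtau.
by field.
Qed.

Lemma continuous_mdtau (u : R) : u <= 1 -> {for u, continuous mdtau}.
Proof.
move=> u1; apply: continuousM; first exact: cvg_cst.
have ne : (l - q * u) ^+ 2 != 0 by rewrite gt_eqF// exprn_gt0// den.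
apply: (@continuousV_R _ (fun u : R => (l - q * u) ^+ 2) u ne).
apply: (@continuous_comp _ _ _ (fun x : R => l - q * x) (fun y : R => y ^+ 2)).
  apply: continuousB; first exact: cvg_cst.
  by apply: continuousM; [exact: cvg_cst|exact: cvg_id].
exact: exprn_continuous.
Qed.

Lemma mtau_inv (x : R) : 0 < x -> x < q -> exists2 u, 0 < u < 1 & mtau u = x.
Proof.
move=> x0 xq; have d : 0 < q * (p + x) by rewrite mulr_gt0 ?addr_gt0.
exists (x * l / (q * (p + x))).
  apply/andP; split; first by rewrite divr_gt0// mulr_gt0.
  rewrite ltr_pdivrMr// mul1r.
  by rewrite -subr_gt0 (_ : _ - _ = p * (q - x)) ?mulr_gt0 ?subr_gt0//; ring.
have px : p + x != 0 by rewrite gt_eqF ?addr_gt0.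
have E : l - q * (x * l / (q * (p + x))) = l * p / (p + x).
  by field; rewrite px gt_eqF.
by rewrite /mtau E; field; rewrite px !gt_eqF.
Qed.

Lemma side_subst (g : R -> R) (eta : R) : 0 < eta < 1 ->
  (forall x, mtau eta <= x < q -> 0 <= g x) ->
  (forall x, mtau eta <= x < q -> {for x, continuous g}) ->
  (\int[leb1]_(x in `[mtau eta, q[) (g x)%:E =
   \int[leb1]_(u in `[eta, 1%R[) (g (mtau u) * mdtau u)%:E)%E.
Proof.
move=> /andP[e0 e1] g0 cg.
have bn n := itvco_seq_bnd e1 n.
have b1 n : itvco_seq eta 1 n <= 1 by case/andP: (bn n) => _ /ltW.
have Dg (u : R) : eta <= u < 1 -> mtau eta <= mtau u < q.
  move=> /andP[h1 h2]; rewrite mtau_le ?(ltW e1) ?(ltW h2)// h1/=.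
  by rewrite -[X in _ < X]mtau1 mtau_lt ?(ltW h2).
apply: (@exhaustion_subst _ (fun=> mtau eta) (fun n => mtau (itvco_seq eta 1 n))
  (fun=> eta) (itvco_seq eta 1)).
- by move=> x; rewrite /= in_itv/=; exact: g0.
- move=> u; rewrite /= in_itv/= => u01; rewrite mulr_ge0 ?g0 ?Dg//.
  by rewrite divr_ge0 ?sqr_ge0// !mulr_ge0 ?ltW.
- by move=> x; rewrite /= in_itv/=; exact: cg.
- move=> u; rewrite /= in_itv/= => u01; have /andP[h1 h2] := u01.
  apply: continuousM; last by apply: continuous_mdtau; exact: ltW.
  apply: (@continuous_comp _ _ _ mtau g).
    by apply: is_derive_continuous; apply: is_derive_mtau; exact: ltW.
  by apply: cg; exact: Dg.
- by [].
- by move=> n m nm; rewrite mtau_le// itvco_seq_nd.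
- by [].
- exact: itvco_seq_nd.
- apply/seteqP; split=> [x /=|x [n _] /=]; rewrite !in_itv/=; last first.
    move=> /andP[-> h2]; apply: (le_lt_trans h2); rewrite -[X in _ < X]mtau1 mtau_lt//.
    by case/andP: (bn n).
  move=> /andP[h1 h2].
  have x0 : 0 < x by apply: lt_le_trans h1; rewrite mtau_gt0 ?e0 ?ltW.
  have [u /andP[u0 u1] xE] := mtau_inv x0 h2; subst x.
  rewrite mtau_le ?(ltW e1) ?(ltW u1)// in h1.
  have : (`[eta, 1[%classic : set R) u by rewrite /= in_itv/= h1 u1.
  rewrite -(bigcup_itvco e1) => -[n _ /=]; rewrite in_itv/= => /andP[_ un].
  by exists n => //=; rewrite in_itv/= !mtau_le ?(ltW e1) ?(ltW u1)// h1.
- by rewrite bigcup_itvco.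
- move=> n; have /andP[h1 h2] := bn n.
  have sub (u : R) : u \in `[eta, itvco_seq eta 1 n] -> eta <= u < 1.
    by rewrite in_itv/= => /andP[->]/= h; exact: le_lt_trans h2.
  apply: (@integral_subst_is_derive _ mtau mdtau g _ _ h1).
  + by move=> u /sub /andP[_ /ltW]; exact: is_derive_mtau.
  + by move=> u /sub /andP[_ /ltW]; exact: continuous_mdtau.
  + move=> y; rewrite in_itv/= => /andP[k1 k2]; apply: cg; rewrite k1/=.
    by apply: (le_lt_trans k2); case/andP: (Dg _ (introT andP (conj h1 h2))).
  + by move=> u v /sub/andP[_ /ltW u1] /sub/andP[_ /ltW v1]; rewrite mtau_lt.
Qed.

End sides.

Section chord.
Variables (s p q eta : R).
Hypotheses (s01 : 2^-1 < s < 1) (p0 : 0 < p) (q0 : 0 < q) (e01 : 0 < eta < 1).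
Local Notation l := (p + q).
Local Notation al := (2 * s).
Local Notation b := (s - 2^-1).

(** Ratio of the ground state ((p + t)(q - t))^(s - 1/2) at [x] to its value at the base point 0, on
    the chord ]-p, q[. *)
Definition chord_weight (p q x : R) : R := ((p + x) * (q - x) / (p * q)) `^ (s - 2^-1).

Let c : R := (p^-1 + q^-1) `^ al.

(** In the Moebius coordinate every exit side becomes ]0, 1[; the kernel keeps a trace of [p] and
    [q] only in the constant [c] and in the factor with q/l. *)
Lemma side_kernel (u : R) : 0 < u < 1 ->
  mtau p q u `^ (- 1 - al) * mdtau p q u =
  c * ((1 - q / l * u) `^ (al - 1) * u `^ (- 1 - al)).
Proof.
move=> /andP[u0 u1]; have l0 : 0 < l by rewrite addr_gt0.
have d0 : 0 < l - q * u.
  by rewrite subr_gt0 (@lt_trans _ _ q) ?ltrDr// gtr_pMr.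
have d1 : 0 < 1 - q / l * u.
  by rewrite (_ : 1 - _ = (l - q * u) / l) ?divr_gt0//; field; rewrite gt_eqF.
have m0 : 0 < mtau p q u by rewrite mtau_gt0// u0 ltW.
have md : mdtau p q u = expR (ln p + ln q + ln l - 2 * ln (l - q * u)).
  rewrite !expRD expRN expRM_natl !lnK ?posrE//.
have c0 : 0 < p^-1 + q^-1 by rewrite addr_gt0 ?invr_gt0.
have cE : ln (p^-1 + q^-1) = ln l - ln p - ln q.
  rewrite (_ : p^-1 + q^-1 = l / (p * q)); last by field; rewrite !gt_eqF.
  rewrite lnM ?posrE ?invr_gt0 ?mulr_gt0// lnV ?posrE ?mulr_gt0//.
  by rewrite lnM ?posrE//; ring.
have mE : ln (mtau p q u) = ln p + ln q + ln u - ln (l - q * u).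
  rewrite /mtau lnM ?posrE ?invr_gt0 ?mulr_gt0// lnV ?posrE ?mulr_gt0//.
  by rewrite !lnM ?posrE ?mulr_gt0.
have dE : ln (1 - q / l * u) = ln (l - q * u) - ln l.
  rewrite (_ : 1 - _ = (l - q * u) / l); last by field; rewrite gt_eqF.
  by rewrite lnM ?posrE ?invr_gt0// lnV ?posrE.
by rewrite /c !powR_expR// md cE mE dE -!expRD; congr expR; ring.
Qed.

(** The Moebius factor of the kernel cancels against that of the ground state: (p + x)(q - x)
    carries the inverse square of 1 - (q/l) u, and 2b = 2s - 1. The weighted kernel is therefore the
    same function of [u] on the two sides of the base point. *)
Lemma side_weight (u : R) : 0 < u < 1 ->
  chord_weight p q (mtau p q u) * (mtau p q u `^ (- 1 - al) * mdtau p q u) =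
  c * ((1 - u) `^ b * u `^ (- 1 - al)).
Proof.
move=> u01; rewrite side_kernel//; have /andP[u0 u1] := u01.
have l0 : 0 < l by rewrite addr_gt0.
have v0 : 0 < 1 - u by rewrite subr_gt0.
have d0 : 0 < l - q * u.
  by rewrite subr_gt0 (@lt_trans _ _ q) ?ltrDr// gtr_pMr.
have d1 : 0 < 1 - q / l * u.
  by rewrite (_ : 1 - _ = (l - q * u) / l) ?divr_gt0//; field; rewrite gt_eqF.
have -> : chord_weight p q (mtau p q u) = ((1 - u) / (1 - q / l * u) ^+ 2) `^ b.
  congr (_ `^ _); rewrite /mtau; field.
  by rewrite !gt_eqF// (_ : _ - _ = l - q * u) //; ring.
rewrite mulrCA; congr (_ * _); rewrite mulrA; congr (_ * _).
rewrite powRM ?(ltW v0) ?invr_ge0 ?sqr_ge0//.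
have -> : ((1 - q / l * u) ^+ 2)^-1 `^ b = (1 - q / l * u) `^ (- (al - 1)).
  rewrite -powR_mulrn ?(ltW d1)// -powRN -powRrM; congr (_ `^ _).
  by field.
have n0 : (1 - q / l * u) `^ (al - 1) != 0 by rewrite gt_eqF// powR_gt0.
by rewrite powRN; move: n0; move: (_ `^ (al - 1)) => z z0; rewrite -mulrA mulVf ?mulr1.
Qed.

Let b0 : 0 < b. Proof. by case/andP: s01 => h _; rewrite subr_gt0. Qed.
Let al1 : 1 < al. Proof. by case/andP: s01 => h _; lra. Qed.
Let al2 : al < 2. Proof. by case/andP: s01 => _ h; lra. Qed.
Let e0 : 0 < eta. Proof. by case/andP: e01. Qed.
Let e1 : eta < 1. Proof. by case/andP: e01. Qed.

(** A primitive of (1 - Y u)^(2s-1) u^(-1-2s). The parameter [Y] is q/l or p/l on the two sides of a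
    chord, and 0 or 1 on the two sides of a half-line. *)
Definition psi (Y u : R) : R := - al^-1 * (u `^ (- al) * (1 - Y * u) `^ al).

Lemma is_derive_psi (Y u : R) : 0 <= Y <= 1 -> 0 < u < 1 ->
  is_derive u 1 (psi Y) ((1 - Y * u) `^ (al - 1) * u `^ (- 1 - al)).
Proof.
move=> /andP[Y0 Y1] /andP[u0 u1].
have v0 : 0 < 1 - Y * u by rewrite subr_gt0 (le_lt_trans _ u1)// ler_piMl// ltW.
have d2 : is_derive u 1 (fun u : R => 1 - Y * u) (- Y).
  have := is_deriveB (is_derive_cst (1 : R) u 1) (is_deriveZ Y (is_derive_id u (1 : R))).
  by rewrite sub0r /GRing.scale/= mulr1.
have d3 := @is_derive1_comp R (@powR R ^~ al) (fun u => 1 - Y * u) u _ _ (is_derive1_powR al v0) d2.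
have d1 : is_derive u 1 (fun u : R => u `^ (- al)) (- al * u `^ (- al - 1)).
  exact: is_derive1_powR.
have d4 := is_deriveZ (- al^-1) (is_deriveM d1 d3).
apply: (is_derive_eq d4); rewrite /GRing.scale/=.
have -> : u `^ (- al) = u `^ (- 1 - al) * u.
  by rewrite -(powRD1 (- 1 - al) u0); congr (_ `^ _); ring.
have -> : (1 - Y * u) `^ al = (1 - Y * u) `^ (al - 1) * (1 - Y * u).
  by rewrite -(powRD1 (al - 1) v0); congr (_ `^ _); ring.
have -> : - al - 1 = - 1 - al by ring.
have s0 : 0 < s by move: al1; lra.
by field; rewrite gt_eqF.
Qed.

(** Unweighted kernels of the two sides of the chord, added up. [chord_g] is the same sum for a
    half-line, and exceeds twice the weighted kernel by the integrand of [kap]. *)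
Definition chord_f (u : R) : R :=
  ((1 - q / l * u) `^ (al - 1) + (1 - p / l * u) `^ (al - 1)) * u `^ (- 1 - al).
Definition chord_g (u : R) : R := (1 + (1 - u) `^ (al - 1)) * u `^ (- 1 - al).

Let l0 : 0 < l. Proof. exact: addr_gt0. Qed.
Let X01 : 0 <= p / l <= 1.
Proof. by rewrite divr_ge0 ?(ltW p0) ?(ltW l0)//= ler_pdivrMr// mul1r lerDl ltW. Qed.
Let Y01 : 0 <= q / l <= 1.
Proof. by rewrite divr_ge0 ?(ltW q0) ?(ltW l0)//= ler_pdivrMr// mul1r lerDr ltW. Qed.

Let cont_lin (Y u : R) : 0 <= Y <= 1 -> 0 < u < 1 ->
  {for u, continuous (fun u : R => (1 - Y * u) `^ (al - 1))}.
Proof.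
move=> /andP[Y0 Y1] /andP[u0 u1].
have v0 : 0 < 1 - Y * u by rewrite subr_gt0 (le_lt_trans _ u1)// ler_piMl// ltW.
apply: (@continuous_comp _ _ _ (fun u : R => 1 - Y * u) (fun y : R => y `^ (al - 1))).
  apply: continuousB; first exact: cvg_cst.
  by apply: continuousM; [exact: cvg_cst|exact: cvg_id].
exact: continuous_powRl.
Qed.

(** Unweighted kernels have explicit primitives, so the excess of the chord over the half-line is
    found exactly; the lower limit [eta] leaves the bracket of [psi]. *)
Lemma chord_FTC :
  (\int[leb1]_(u in `[eta, 1%R[) (chord_f u)%:E =
   \int[leb1]_(u in `[eta, 1%R[) (chord_g u)%:E +
   (al^-1 * (1 - (p / l) `^ al - (q / l) `^ al) -
    (psi (q / l) eta + psi (p / l) eta - psi 0 eta - psi 1 eta))%:E)%E.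
Proof.
have u01 u : eta <= u < 1 -> 0 < u < 1.
  by move=> /andP[h1 ->]; rewrite (lt_le_trans e0 h1).
apply: (@FTC_itvco eta 1 e1 (fun u => psi (q / l) u + psi (p / l) u - psi 0 u - psi 1 u)
  chord_f chord_g).
- by move=> u /u01 _; rewrite mulr_ge0 ?addr_ge0 ?powR_ge0.
- by move=> u /u01 _; rewrite mulr_ge0 ?addr_ge0 ?powR_ge0.
- move=> u /u01 h; apply: continuousM.
    by apply: continuousD; exact: cont_lin.
  by apply: continuous_powRl; case/andP: h.
- move=> u /u01 h; apply: continuousM.
    apply: continuousD; first exact: cvg_cst.
    have -> : (fun u : R => (1 - u) `^ (al - 1)) = (fun u => (1 - 1 * u) `^ (al - 1)).
      by apply/funext => v; rewrite mul1r.
    by apply: cont_lin => //; rewrite ler01 lexx.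
  by apply: continuous_powRl; case/andP: h.
- move=> u /u01 h.
  have z01 : 0 <= (0 : R) <= 1 by rewrite lexx ler01.
  have o01 : 0 <= (1 : R) <= 1 by rewrite lexx ler01.
  have d := is_deriveB (is_deriveB (is_deriveD (is_derive_psi Y01 h) (is_derive_psi X01 h))
    (is_derive_psi z01 h)) (is_derive_psi o01 h).
  rewrite mul0r subr0 powR1E !mul1r in d; apply: (is_derive_eq d).
  by rewrite /chord_f /chord_g; ring.
have al0 : 0 < al by exact: lt_trans al1.
have -> : al^-1 * (1 - (p / l) `^ al - (q / l) `^ al) =
    psi (q / l) 1 + psi (p / l) 1 - psi 0 1 - psi 1 1.
  rewrite /psi !powR1E mul0r !mulr1 subr0 subrr powR1E powR0 ?mulr0 ?subr0 ?(gt_eqF al0)//.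
  have -> : 1 - q / l = p / l by field; rewrite gt_eqF.
  have -> : 1 - p / l = q / l by field; rewrite gt_eqF.
  by rewrite !mul1r; ring.
have cpsi (Y : R) : Y < 1 -> psi Y x @[x --> (1 : R)^'-] --> psi Y 1.
  move=> Y1; apply: cvg_at_left_filter.
  apply: cvgMl_tmp; apply: (@continuousM _ _ (fun u => u `^ (- al)) (fun u => (1 - Y * u) `^ al) 1).
    exact: continuous_powRl.
  apply: (@continuous_comp _ _ _ (fun u : R => 1 - Y * u) (fun y : R => y `^ al)).
    apply: continuousB; first exact: cvg_cst.
    by apply: continuousM; [exact: cvg_cst|exact: cvg_id].
  by apply: continuous_powRl; rewrite mulr1 subr_gt0.
have cpsi1 : psi 1 x @[x --> (1 : R)^'-] --> psi 1 1.
  apply: cvgMl_tmp; apply: cvgM; first by apply: cvg_at_left_filter; exact: continuous_powRl.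
  rewrite mulr1 subrr powR0 ?(gt_eqF al0)//.
  apply: (@squeeze_cvgr _ _ _ _ (fun=> 0) (fun x : R => 1 - x)).
  - near=> x; rewrite powR_ge0/= mul1r.
    have x1 : x < 1 by [].
    have x0 : 0 < x by near: x; exact: nbhs_left_gt.
    have v0 : 0 < 1 - x by rewrite subr_gt0.
    by rewrite -[leRHS]powRr1 ?(ltW v0)// ger_powR ?v0 ?gerBl ?ltW.
  - exact: cvg_cst.
  - apply: cvg_at_left_filter; rewrite -[X in _ --> X](subrr 1).
    by apply: cvgB; [exact: cvg_cst|exact: cvg_id].
by apply: cvgB => //; apply: cvgB; [apply: cvgD|]; apply: cpsi => //;
  rewrite ltr_pdivrMr// mul1r ?ltrDl ?ltrDr.
Unshelve. all: by end_near. Qed.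

(** Young's inequality for the product of t^m and 1, with exponents 1/m and 1/(1 - m). *)
Lemma powR_le_bernoulli (m t : R) : 0 < m <= 1 -> 0 <= t -> t `^ m <= 1 - m * (1 - t).
Proof.
move=> /andP[m0]; rewrite le_eqVlt => /orP[/eqP ->|m1] t0; first by rewrite powRr1// mul1r; lra.
have n0 : 0 < 1 - m by rewrite subr_gt0.
have i0 : 0 < m^-1 by rewrite invr_gt0.
have j0 : 0 < (1 - m)^-1 by rewrite invr_gt0.
have := @conjugate_powR R (t `^ m) 1 m^-1 (1 - m)^-1 (powR_ge0 _ _) ler01 i0 j0.
rewrite !invrK powR1E mulr1 -powRrM divff ?gt_eqF// powRr1// mul1r => h.
by apply: (le_trans (h _)); [ring|rewrite le_eqVlt; apply/orP; left; apply/eqP; ring].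
Qed.

Lemma powR_ge_bernoulli (a t : R) : 1 <= a -> 0 <= t -> 1 - a * (1 - t) <= t `^ a.
Proof.
move=> a1 t0; have a0 : 0 < a by exact: lt_le_trans a1.
have := @powR_le_bernoulli a^-1 (t `^ a) _ (powR_ge0 _ _).
rewrite -powRrM divff ?gt_eqF// powRr1// invr_gt0 a0 invf_le1// => /(_ a1).
rewrite -(ler_pM2l a0) mulrBr mulrA divff ?gt_eqF// mulr1 mul1r; lra.
Qed.

(** The terms of order eta^(-2s) and eta^(1-2s) cancel, as the parameters have the same sum on both
    sides, q/l + p/l = 0 + 1. Bernoulli's inequalities leave a term that tends to 0 with [eta]. *)
Lemma psi_bracket_le :
  psi (q / l) eta + psi (p / l) eta - psi 0 eta - psi 1 eta <= eta `^ (2 - al).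
Proof.
have al0 : 0 < al by exact: lt_trans al1.
have v0 : 0 < 1 - eta by rewrite subr_gt0.
have bern (Y : R) : 0 <= Y <= 1 -> 1 - al * (Y * eta) <= (1 - Y * eta) `^ al.
  move=> /andP[Y0 Y1].
  have := @powR_ge_bernoulli al (1 - Y * eta) (ltW al1) _.
  rewrite subKr; apply; rewrite subr_ge0 (@le_trans _ _ eta)// ?(ltW e1)//.
  by rewrite ler_piMl// ltW.
have h1 := bern _ X01; have h2 := bern _ Y01.
have h3 : (1 - eta) `^ al <= (1 - eta) * (1 - (al - 1) * eta).
  have -> : (1 - eta) `^ al = (1 - eta) * (1 - eta) `^ (al - 1).
    by rewrite [RHS]mulrC -(powRD1 (al - 1) v0); congr (_ `^ _); ring.
  rewrite ler_pM2l//; have := @powR_le_bernoulli (al - 1) (1 - eta) _ (ltW v0).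
  rewrite subKr; apply; rewrite subr_gt0 al1/=; move: al2; lra.
rewrite /psi !mul0r subr0 powR1E mulr1 mul1r.
have -> : eta `^ (2 - al) = eta `^ (- al) * eta ^+ 2.
  by rewrite -powR_mulrn ?ltW// -powRD ?(gt_eqF e0) ?implybT//; congr (_ `^ _); ring.
have h4 : (q / l) + (p / l) = 1 by field; rewrite gt_eqF.
set E := eta `^ (- al); have E0 : 0 <= E by exact: powR_ge0.
set A := (1 - q / l * eta) `^ al in h2 *; set B := (1 - p / l * eta) `^ al in h1 *.
set C := (1 - eta) `^ al in h3 *.
have -> : - al^-1 * (E * A) + - al^-1 * (E * B) - - al^-1 * E - - al^-1 * (E * C) =
   E * (al^-1 * (1 + C - A - B)) by ring.
apply: ler_wpM2l => //; rewrite ler_pdivrMl//.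
have h5 : al * (q / l * eta) + al * (p / l * eta) = al * eta.
  by rewrite -mulrDr -mulrDl h4 mul1r.
have h6 : (1 - eta) * (1 - (al - 1) * eta) = 1 - al * eta + (al - 1) * eta ^+ 2 by ring.
have h7 : 0 <= eta ^+ 2 by exact: sqr_ge0.
lra.
Qed.

Definition rkint (u : R) : R := kint s (1 - u).

Let rkintE (u : R) : rkint u = (1 - (1 - u) `^ b) ^+ 2 * u `^ (- 1 - al).
Proof. by rewrite /rkint /kint subKr. Qed.

Lemma continuous_rkint (u : R) : 0 < u < 1 -> {for u, continuous rkint}.
Proof.
move=> /andP[u0 u1]; apply: (@continuous_comp _ _ _ (fun u : R => 1 - u) (kint s)).
  by apply: continuousB; [exact: cvg_cst|exact: cvg_id].
by apply: continuous_kint => //; rewrite subr_gt0 u1 gtrBl.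
Qed.

Lemma measurable_rkint : measurable_fun setT rkint.
Proof.
apply: (@measurableT_comp _ _ _ _ _ _ (kint s) _ (fun u : R => 1 - u)).
  apply: measurable_funM.
    by apply: measurable_funX; apply: measurable_funB => //; exact: measurable_powR.
  apply: (@measurableT_comp _ _ _ _ _ _ (@powR R ^~ (-1 - 2 * s)) _ (fun u : R => 1 - u)).
    exact: measurable_powR.
  exact: measurable_funB.
exact: measurable_funB.
Qed.

Lemma integral_rkint : (\int[leb1]_(u in `]0%R, 1%R[) (rkint u)%:E = (kap s)%:E)%E.
Proof.
rewrite -(integral_kint s01); apply/esym; apply: ge0_integral_itv01_onem.
  by move=> x _; exact: kint_ge0.
apply: measurable_fun_continuous_itv => x; rewrite inE/= in_itv/=.
exact: continuous_kint.
Qed.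

Lemma integral_rkint_small :
  (\int[leb1]_(u in `]0%R, eta[) (rkint u)%:E <= (eta `^ (2 - al) / (2 - al))%:E)%E.
Proof.
have c0 : 0 < 2 - al by rewrite subr_gt0.
have rk u : 0 < u < 1 -> rkint u <= u `^ (1 - al).
  move=> /andP[u0 u1]; rewrite rkintE.
  have -> : u `^ (1 - al) = u ^+ 2 * u `^ (- 1 - al).
    by rewrite -powR_mulrn ?ltW// -powRD ?(gt_eqF u0) ?implybT//; congr (_ `^ _); ring.
  rewrite ler_wpM2r ?powR_ge0//.
  have v0 : 0 < 1 - u by rewrite subr_gt0.
  have v1 : 1 - u <= 1 by rewrite gerBl ltW.
  have h1 : (1 - u) `^ b <= 1.
    by rewrite -[leRHS](powRr0 (1 - u)) ger_powR ?v0 ?v1 ?(ltW b0).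
  have h2 : 1 - u <= (1 - u) `^ b.
    rewrite -[leLHS](powRr1 (ltW v0)) ger_powR ?v0 ?v1//.
    by case/andP: s01 => _ h; lra.
  rewrite ler_sqr ?nnegrE; lra.
have sub : (`]0%R, eta[%classic `<=` (`]0, 1[%classic : set R))%classic.
  by move=> u /=; rewrite !in_itv/= => /andP[->]/= h; exact: lt_trans e1.
apply: (@le_trans _ _ (\int[leb1]_(u in `]0%R, eta[) (u `^ (1 - al))%:E)%E).
  apply: ge0_le_integral => //.
  - by move=> u _; rewrite lee_fin kint_ge0.
  - apply/measurable_EFinP; apply: measurable_fun_continuous_itv => x.
    by rewrite inE => /sub /=; rewrite in_itv/=; exact: continuous_rkint.
  - by apply/measurable_EFinP; apply: measurable_funTS; exact: measurable_powR.
  - by move=> u /sub /=; rewrite in_itv/= lee_fin; exact: rk.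
have sub2 : ((`]0%R, eta[%classic : set R) `<=` \bigcup_n `[eta * n.+2%:R^-1, eta])%classic.
  move=> u /=; rewrite in_itv/= => /andP[u0 u1].
  have : \forall n \near \oo, eta * n.+2%:R^-1 < u.
    have h : eta * n.+2%:R^-1 @[n --> \oo] --> (0 : R).
      by rewrite -[X in _ --> X](mulr0 eta); apply: cvgMl_tmp; exact: cvg_invn2.
    by apply: (cvgr_lt 0 h).
  by move=> [n _ /(_ n (leqnn n))/= hn]; exists n => //=; rewrite in_itv/= !ltW.
pose D : set R := (\bigcup_n `[eta * n.+2%:R^-1, eta])%classic.
apply: (@le_trans _ _ (\int[leb1]_(u in D) (u `^ (1 - al))%:E)%E).
  apply: ge0_subset_integral => //.
  - by apply: bigcup_measurable => n _; exact: measurable_itv.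
  - by apply/measurable_EFinP; apply: measurable_funTS; exact: measurable_powR.
  - by move=> u _; rewrite lee_fin powR_ge0.
have pos (u : R) : D u -> 0 < u.
  move=> [n _ /=]; rewrite in_itv/= => /andP[h _]; apply: lt_le_trans h.
  by rewrite mulr_gt0// invr_gt0.
apply: (@exhaustion_le _ _ _ _ _ _ (fun u => (2 - al)^-1 * u `^ (2 - al))).
- by move=> n m nm; rewrite ler_wpM2l ?(ltW e0)// invn2_noninc.
- by [].
- by move=> n; rewrite ger_pMr// invf_le1 ?ler1n.
- by move=> u _; rewrite powR_ge0.
- by move=> u /pos u0; exact: continuous_powRl.
- move=> u /pos u0; have d := is_deriveZ (2 - al)^-1 (is_derive1_powR (2 - al) u0).
  apply: (is_derive_eq d); rewrite /GRing.scale/= mulrA mulVf ?gt_eqF// mul1r.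
  by congr (_ `^ _); ring.
- move=> n; rewrite [leRHS]mulrC gerBl mulr_ge0 ?powR_ge0//.
  by rewrite invr_ge0 ltW.
Qed.

Lemma kap_le_tail :
  ((kap s)%:E <= \int[leb1]_(u in `[eta, 1%R[) (rkint u)%:E + (eta `^ (2 - al) / (2 - al))%:E)%E.
Proof.
rewrite -integral_rkint.
have -> : (`]0%R, 1%R[%classic = `]0%R, eta[ `|` `[eta, 1%R[ :> set R)%classic.
  apply/seteqP; split=> [u|u [|]] /=; rewrite !in_itv/=.
  - by move=> /andP[-> ->]; rewrite andbT; case: (ltP u eta); [left|right].
  - by move=> /andP[->]/= h; exact: lt_trans e1.
  - by move=> /andP[h ->]; rewrite (lt_le_trans e0 h).
rewrite ge0_integral_setU//=.
- by rewrite addeC leeD2l// integral_rkint_small.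
- by apply/measurable_EFinP; apply: measurable_funTS; exact: measurable_rkint.
- by move=> u _; rewrite lee_fin kint_ge0.
- apply/disj_setPS => u [] /=; rewrite !in_itv/= => /andP[_ h1] /andP[h2 _].
  by move: (lt_le_trans h1 h2); rewrite ltxx.
Qed.

Let u01 (u : R) : `[eta, 1%R[%classic u -> 0 < u < 1.
Proof. by rewrite /= in_itv/= => /andP[h1 ->]; rewrite (lt_le_trans e0 h1). Qed.

Let c_ge0 : 0 <= c. Proof. exact: powR_ge0. Qed.

Let mpow (D : set R) (r : R) : measurable_fun D (@powR R ^~ r).
Proof. by apply: measurable_funTS; exact: measurable_powR. Qed.

Let mpow_lin (D : set R) (Y r : R) : measurable_fun D (fun u => (1 - Y * u) `^ r).
Proof.
apply: measurable_funTS.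
apply: (@measurableT_comp _ _ _ _ _ _ (@powR R ^~ r) _ (fun u : R => 1 - Y * u)).
  exact: measurable_powR.
by apply: measurable_funB => //; exact: measurable_funM.
Qed.

Let mt0 : 0 < mtau p q eta. Proof. by apply: mtau_gt0 => //; rewrite e0 ltW. Qed.

Lemma side_kernel_int :
  (\int[leb1]_(x in `[mtau p q eta, q[) (x `^ (- 1 - al))%:E =
   c%:E * \int[leb1]_(u in `[eta, 1%R[)
     ((1 - q / l * u) `^ (al - 1) * u `^ (- 1 - al))%:E)%E.
Proof.
rewrite (side_subst p0 q0 e01); first last.
- move=> x /andP[h1 _]; apply: continuous_powRl; exact: lt_le_trans h1.
- by move=> x _; exact: powR_ge0.
rewrite -ge0_integralZl//; last by move=> u _; rewrite lee_fin mulr_ge0 ?powR_ge0.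
  apply: eq_integral => u; rewrite inE => /u01 h.
  by rewrite -EFinM side_kernel.
apply/measurable_EFinP; apply: measurable_funM; [exact: mpow_lin|exact: mpow].
Qed.

Lemma side_weight_int :
  (\int[leb1]_(x in `[mtau p q eta, q[) (chord_weight p q x * x `^ (- 1 - al))%:E =
   c%:E * \int[leb1]_(u in `[eta, 1%R[) ((1 - u) `^ b * u `^ (- 1 - al))%:E)%E.
Proof.
rewrite (side_subst p0 q0 e01); first last.
- move=> x /andP[h1 h2]; have x0 : 0 < x by exact: lt_le_trans h1.
  apply: continuousM; last exact: continuous_powRl.
  apply: (@continuous_comp _ _ _ (fun x : R => (p + x) * (q - x) / (p * q)) (fun y : R => y `^ b)).
    apply: continuousM; last exact: cvg_cst.
    apply: continuousM; first by apply: continuousD; [exact: cvg_cst|exact: cvg_id].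
    by apply: continuousB; [exact: cvg_cst|exact: cvg_id].
  apply: continuous_powRl; rewrite divr_gt0 ?mulr_gt0 ?subr_gt0//.
  exact: addr_gt0.
- by move=> x _; rewrite mulr_ge0 ?powR_ge0.
rewrite -ge0_integralZl//; last by move=> u _; rewrite lee_fin mulr_ge0 ?powR_ge0.
  apply: eq_integral => u; rewrite inE => /u01 h.
  by rewrite -EFinM -mulrA side_weight.
apply/measurable_EFinP; apply: measurable_funM; last exact: mpow.
have -> : (fun u : R => (1 - u) `^ b) = (fun u => (1 - 1 * u) `^ b).
  by apply/funext => u; rewrite mul1r.
exact: mpow_lin.
Qed.

Lemma integral_chord_g :
  (\int[leb1]_(u in `[eta, 1%R[) (chord_g u)%:E =
   \int[leb1]_(u in `[eta, 1%R[) ((1 - u) `^ b * u `^ (- 1 - al))%:E +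
   \int[leb1]_(u in `[eta, 1%R[) ((1 - u) `^ b * u `^ (- 1 - al))%:E +
   \int[leb1]_(u in `[eta, 1%R[) (rkint u)%:E)%E.
Proof.
have mw : measurable_fun (`[eta, 1%R[%classic : set R)
    (fun u : R => ((1 - u) `^ b * u `^ (- 1 - al))%:E).
  apply/measurable_EFinP; apply: measurable_funM; last exact: mpow.
  have -> : (fun u : R => (1 - u) `^ b) = (fun u => (1 - 1 * u) `^ b).
    by apply/funext => u; rewrite mul1r.
  exact: mpow_lin.
have w0 (u : R) : (0 <= ((1 - u) `^ b * u `^ (- 1 - al))%:E)%E.
  by rewrite lee_fin mulr_ge0 ?powR_ge0.
rewrite -ge0_integralD//.
rewrite -ge0_integralD//.
- apply: eq_integral => u; rewrite inE => /u01/andP[u0 u1].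
  rewrite -!EFinD rkintE; congr (_%:E); rewrite /chord_g.
  have v0 : 0 < 1 - u by rewrite subr_gt0.
  have -> : (1 - u) `^ (al - 1) = ((1 - u) `^ b) ^+ 2.
    by rewrite -powR_mulrn ?powR_ge0// -powRrM; congr (_ `^ _); field.
  by ring.
- by move=> u _; rewrite adde_ge0.
- exact: emeasurable_funD.
- by move=> u _; rewrite lee_fin kint_ge0.
- by apply/measurable_EFinP; apply: measurable_funTS; exact: measurable_rkint.
Qed.

End chord.

(** The first term is the half-line gain with 1/p replaced by 1/p + 1/q. The second has no factor
    [kap]: it is the superadditivity gap of x^(2s), which vanishes at s = 1/2 only to first
    order. *)
Definition chord_gain (s p q : R) : R :=
  kap s * (p^-1 + q^-1) `^ (2 * s) +
  (2 * s)^-1 * ((p^-1 + q^-1) `^ (2 * s) - p^-1 `^ (2 * s) - q^-1 `^ (2 * s)).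

(** Truncation error: the bracket of [psi], plus the part of the integral of [rkint] that is lost on
    ]0, eta[. *)
Definition chord_err (s eta : R) : R := eta `^ (2 - 2 * s) * (1 + (2 - 2 * s)^-1).

Lemma measurable_chord_factor (D : set R) (Y r t : R) :
  measurable_fun D (fun u => (1 - Y * u) `^ r * u `^ t).
Proof.
apply: measurable_funTS; apply: measurable_funM; last exact: measurable_powR.
apply: (@measurableT_comp _ _ _ _ _ _ (@powR R ^~ r) _ (fun u : R => 1 - Y * u)).
  exact: measurable_powR.
by apply: measurable_funB => //; exact: measurable_funM.
Qed.

(** Both kernels are singular at the base point, so the comparison makes sense only after cutting
    the two sides at the same value [eta] of the Moebius coordinate. It is kept as a sum on each
    side, to be integrated before anything is subtracted. *)
Lemma chord_ineq (s p q eta : R) : 2^-1 < s < 1 -> 0 < p -> 0 < q -> 0 < eta < 1 ->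
  (\int[leb1]_(x in `[mtau p q eta, q[) (chord_weight s p q x * x `^ (- 1 - 2 * s))%:E +
   \int[leb1]_(x in `[mtau q p eta, p[) (chord_weight s q p x * x `^ (- 1 - 2 * s))%:E +
   (chord_gain s p q)%:E <=
   \int[leb1]_(x in `[mtau p q eta, q[) (x `^ (- 1 - 2 * s))%:E +
   \int[leb1]_(x in `[mtau q p eta, p[) (x `^ (- 1 - 2 * s))%:E +
   ((p^-1 + q^-1) `^ (2 * s) * chord_err s eta)%:E)%E.
Proof.
move=> s01 p0 q0 e01; have l0 : 0 < p + q by exact: addr_gt0.
have i0 : 0 <= p^-1 + q^-1 by rewrite addr_ge0 ?invr_ge0 ?ltW.
have c0 : 0 <= (p^-1 + q^-1) `^ (2 * s) by exact: powR_ge0.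
rewrite !side_weight_int// !side_kernel_int// (addrC q^-1) (addrC q p).
set c := (p^-1 + q^-1) `^ (2 * s) in c0 *.
have cE (x y : R) : 0 < x -> 0 < y -> x^-1 `^ (2 * s) = (x^-1 + y^-1) `^ (2 * s) * (y / (x + y)) `^ (2 * s).
  move=> x0 y0; rewrite -powRM; first by congr (_ `^ _); field; rewrite !gt_eqF ?addr_gt0.
    by rewrite addr_ge0 ?invr_ge0 ?ltW.
  by rewrite divr_ge0 ?addr_ge0 ?ltW.
have -> : chord_gain s p q = c * (kap s + (2 * s)^-1 * (1 - (p / (p + q)) `^ (2 * s) - (q / (p + q)) `^ (2 * s))).
  rewrite /chord_gain (cE p q)// (cE q p)// (addrC q^-1) (addrC q p) -/c; ring.
have cD (x y : \bar R) (k : R) : (0 <= x)%E -> (0 <= y)%E ->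
    (c%:E * x + c%:E * y + (c * k)%:E = c%:E * (x + y + k%:E))%E.
  by move=> x0 y0; rewrite [RHS]muleDr ?fin_num_adde_defl// ge0_muleDr// EFinM.
have pos (f : R -> R) : (forall u, 0 <= f u) -> (0 <= \int[leb1]_(u in `[eta, 1%R[) (f u)%:E)%E.
  by move=> f0; apply: integral_ge0 => u _; rewrite lee_fin.
have P0 : (0 <= \int[leb1]_(u in `[eta, 1%R[) ((1 - u) `^ (s - 2^-1) * u `^ (- 1 - 2 * s))%:E)%E.
  by apply: pos => u; rewrite mulr_ge0 ?powR_ge0.
have P1 : (0 <= \int[leb1]_(u in `[eta, 1%R[)
    ((1 - q / (p + q) * u) `^ (2 * s - 1) * u `^ (-1 - 2 * s))%:E)%E.
  by apply: pos => u; rewrite mulr_ge0 ?powR_ge0.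
have P2 : (0 <= \int[leb1]_(u in `[eta, 1%R[)
    ((1 - p / (p + q) * u) `^ (2 * s - 1) * u `^ (-1 - 2 * s))%:E)%E.
  by apply: pos => u; rewrite mulr_ge0 ?powR_ge0.
have aux (I0 J If Ig : \bar R) (k L ps e1 e2 : R) : (If = Ig + (L - ps)%:E)%E ->
    (Ig = I0 + I0 + J)%E -> (k%:E <= J + e2%:E)%E -> ps <= e1 ->
    (I0 + I0 + (k + L)%:E <= If + (e1 + e2)%:E)%E.
  move=> -> -> hk hps; rewrite EFinD addeA.
  apply: (@le_trans _ _ (I0 + I0 + (J + e2%:E) + L%:E)%E).
    by rewrite leeD2r// leeD2l.
  rewrite (addeA (I0 + I0)%E) -[leLHS]addeA -[leRHS]addeA leeD2l//.
  by rewrite -!EFinD lee_fin; lra.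
have := @integral_chord_g s eta e01.
have := @chord_FTC s p q eta s01 p0 q0 e01.

have := @kap_le_tail s eta s01 e01.
have := @psi_bracket_le s p q eta s01 p0 q0 e01.
have -> : (\int[leb1]_(u in `[eta, 1%R[) (chord_f s p q u)%:E =
  \int[leb1]_(u in `[eta, 1%R[)
       ((1 - q / (p + q) * u) `^ (2 * s - 1) * u `^ (-1 - 2 * s))%:E +
    \int[leb1]_(u in `[eta, 1%R[)
       ((1 - p / (p + q) * u) `^ (2 * s - 1) * u `^ (-1 - 2 * s))%:E)%E.
  rewrite -ge0_integralD//.
  - by apply: eq_integral => u _; rewrite -EFinD -mulrDl.
  - by move=> u _; rewrite lee_fin mulr_ge0 ?powR_ge0.
  - by apply/measurable_EFinP; apply: measurable_chord_factor.
  - by move=> u _; rewrite lee_fin mulr_ge0 ?powR_ge0.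
  - by apply/measurable_EFinP; apply: measurable_chord_factor.
move=> hps hk hf hg; rewrite [leLHS](cD _ _ _ P0 P0) [leRHS](cD _ _ _ P1 P2).
apply: lee_wpmul2l; first by rewrite lee_fin.
have -> : chord_err s eta = eta `^ (2 - 2 * s) + eta `^ (2 - 2 * s) / (2 - 2 * s).
  by rewrite /chord_err mulrDr mulr1.
exact: (aux _ _ _ _ _ _ _ _ _ hf hg hk hps).
Qed.

End line.

(** * Exit times *)

Section exit_time.
Context {R : realType} {n : nat}.
Local Notation rV := 'rV[R]_n.
Variable Om : set rV.
Hypotheses (oOm : open Om) (bOm : bounded_set Om).

(** The domain need not be convex: the chord through [x] is the part of the line that is reached
    without leaving [Om]. *)
Definition visible (x v : rV) (t : R) : Prop :=
  forall tau, 0 <= tau <= t -> Om (x + tau *: v).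

(** For [x] outside [Om] the set is empty and its supremum is 0 by convention. *)
Definition exit_time (x v : rV) : R := sup [set t | 0 <= t /\ visible x v t].

Lemma continuous_ray (x v : rV) : continuous (fun t : R => x + t *: v).
Proof.
move=> t; apply: cvgD; first exact: cvg_cst.
by apply: cvgZr_tmp; exact: cvg_id.
Qed.

Lemma visible_extend (x v : rV) (t : R) : 0 <= t -> visible x v t ->
  exists2 e : R, 0 < e & visible x v (t + e).
Proof.
move=> t0 vt; have Ot : Om (x + t *: v) by apply: vt; rewrite t0 lexx.
have /nbhs_ballP[e /= e0 He] := continuous_ray (open_nbhs_nbhs (conj oOm Ot)).
exists (e / 2); first by rewrite divr_gt0.
move=> r /andP[r0 rt]; have [rt'|tr] := leP r t; first by apply: vt; rewrite r0.
by apply: He; rewrite -ball_normE /= ltr_norml; apply/andP; split; lra.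
Qed.

Lemma visible_bounded (v : rV) : v != 0 -> exists M : R,
  forall x t, 0 <= t -> visible x v t -> t <= M.
Proof.
move=> v0; have [M [_ HM]] := bOm; pose M1 := `|M| + 1.
have HM1 x : Om x -> `|x| <= M1.
  by apply: HM; rewrite (le_lt_trans (ler_norm M)) ?ltrDl.
exists ((M1 + M1) / `|v|) => x t t0 vt.
have h0 : Om x by have := vt 0; rewrite scale0r addr0; apply; rewrite lexx.
have ht : Om (x + t *: v) by apply: vt; rewrite t0 lexx.
have : `|t *: v| <= M1 + M1.
  rewrite (_ : t *: v = (x + t *: v) - x); last by rewrite addrC addKr.
  by rewrite (le_trans (ler_normB _ _))// lerD// HM1.
by rewrite normrZ ger0_norm// ler_pdivlMr ?normr_gt0.
Qed.

(** Openness prevents the supremum from being attained, so visibility up to [t] is exactly the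
    strict inequality. The shift rules and the measurability of exit times are read off from this
    equivalence. *)
Lemma exit_time_gtP (x v : rV) (t : R) : v != 0 -> 0 <= t ->
  reflect (visible x v t) (t < exit_time x v).
Proof.
move=> v0 t0; apply: (iffP idP) => [h|vt].
  have [S0|/set0P S0] := eqVneq [set t | 0 <= t /\ visible x v t] set0; last first.
    have [y [y0 vy] ty] := sup_gt S0 h.
    by move=> r /andP[r0 rt]; apply: vy; rewrite r0 (le_trans rt (ltW ty)).
  move: h; rewrite /exit_time S0 sup0.
  by move=> /(le_lt_trans t0); rewrite ltxx.
have [M HM] := visible_bounded v0.
have ub : has_ubound [set t | 0 <= t /\ visible x v t].
  by exists M => r [r0 vr]; exact: HM vr.
apply: (sup_ub_strict ub); last by [].
move=> [s0 vs]; have [e e0 ve] := visible_extend s0 vs.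
have : sup [set t | 0 <= t /\ visible x v t] + e <= sup [set t | 0 <= t /\ visible x v t].
  by apply: ub_le_sup => //; split => //; rewrite addr_ge0// ltW.
by rewrite gerDl leNgt e0.
Qed.

Lemma exit_time_ge0 (x v : rV) : v != 0 -> 0 <= exit_time x v.
Proof.
move=> v0; have [S0|/set0P[t [t0 vt]]] := eqVneq [set t | 0 <= t /\ visible x v t] set0.
  by rewrite /exit_time S0 sup0.
by apply: (le_trans t0); apply: ltW; apply/exit_time_gtP.
Qed.

Lemma exit_time_gt0 (x v : rV) : v != 0 -> reflect (Om x) (0 < exit_time x v).
Proof.
move=> v0; apply: (iffP (exit_time_gtP x v0 (lexx 0))) => [h|Ox].
  by have := h 0; rewrite scale0r addr0; apply; rewrite lexx.
by move=> r /le_anti <-; rewrite scale0r addr0.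
Qed.

Lemma exit_time_lt_inj (a b : R) : 0 <= a -> 0 <= b ->
  (forall t, 0 <= t -> (t < a) = (t < b)) -> a = b.
Proof.
move=> a0 b0 H; apply/eqP; rewrite eq_le !leNgt.
by rewrite H// ltxx -H// ltxx.
Qed.

(** Together with the next lemma: moving by [t] along the chord turns the pair of exit times (p, q)
    into (p + t, q - t), which governs how chord weights transform when two points are exchanged. *)
Lemma exit_time_fwd (x v : rV) (t : R) : v != 0 -> 0 <= t -> t < exit_time x v ->
  exit_time (x + t *: v) v = exit_time x v - t.
Proof.
move=> v0 t0 tq; have /(exit_time_gtP x v0 t0) vt := tq.
apply: exit_time_lt_inj; [exact: exit_time_ge0|by rewrite subr_ge0 ltW|].
move=> r r0; rewrite ltrBrDr; have rt0 : 0 <= r + t by exact: addr_ge0.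
apply/(exit_time_gtP _ v0 r0)/(exit_time_gtP _ v0 rt0) => H k /andP[k0 k1].
  have [kt|tk] := leP k t; first by apply: vt; rewrite k0.
  have := H (k - t); rewrite -addrA -scalerDl (addrC t) subrK.
  by apply; rewrite subr_ge0 ltW//= lerBlDr.
have := H (k + t); rewrite scalerDl addrA addrAC; apply.
by rewrite addr_ge0//= lerD2r.
Qed.

Lemma exit_time_bwd (x v : rV) (t : R) : v != 0 -> 0 <= t -> t < exit_time x v ->
  exit_time (x + t *: v) (- v) = exit_time x (- v) + t.
Proof.
move=> v0 t0 tq; have /(exit_time_gtP x v0 t0) vt := tq.
have nv0 : - v != 0 by rewrite oppr_eq0.
apply: exit_time_lt_inj; [exact: exit_time_ge0|by rewrite addr_ge0// exit_time_ge0|].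
have sh k : x + t *: v + k *: - v = x + (t - k) *: v.
  by rewrite scalerN scalerBl addrA.
have sh' k : x + k *: - v = x + (- k) *: v by rewrite scalerN scaleNr.
have x0 : Om x by have := vt 0; rewrite scale0r addr0; apply; rewrite lexx.
move=> r r0; have [rt|tr] := ltP r t.
  have -> : r < exit_time x (- v) + t by rewrite ltr_wpDl// exit_time_ge0.
  apply/(exit_time_gtP _ nv0 r0) => k /andP[k0 k1]; rewrite sh; apply: vt.
  by apply/andP; split; lra.
have rt0 : 0 <= r - t by rewrite subr_ge0.
rewrite -ltrBlDr.
apply/(exit_time_gtP _ nv0 r0)/(exit_time_gtP _ nv0 rt0) => H k /andP[k0 k1].
  have := H (k + t); rewrite sh sh' opprD addrCA subrr addr0; apply.
  by apply/andP; split; lra.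
rewrite sh; have [kt|tk] := leP k t; first by apply: vt; apply/andP; split; lra.
have := H (k - t); rewrite sh' opprB; apply.
by apply/andP; split; lra.
Qed.

(** [Om] is the increasing union of the closed sets [K k] of points at distance at least 1/(k+1)
    from its complement. A visible segment is compact, hence contained in one of them, and lying in
    a closed set need only be tested at rational times. *)
Lemma measurable_visible d (T : measurableType d) (f g : T -> rV) (t : R) :
  measurable_fun setT f -> measurable_fun setT g ->
  measurable [set x | visible (f x) (g x) t].
Proof.
move=> mf mg.
pose K (k : nat) : set rV := ~` (\bigcup_(y in ~` Om) ball y k.+1%:R^-1).
have oK k : open (~` K k).
  by rewrite setCK; apply: bigcup_open => y _; exact: ball_open.
have mK k : measurable (K k).
  by rewrite -[K k]setCK; apply: measurableC; exact: open_measurable_rV.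
have KOm k : K k `<=` Om.
  move=> y Ky; apply: contrapT => nO; apply: Ky; exists y => //.
  by apply: ballxx; rewrite invr_gt0.
pose I : set rat := [set r | 0 <= (ratr r : R) <= t].
have -> : [set x | visible (f x) (g x) t] =
    \bigcup_k \bigcap_(r in I) [set x | K k (f x + (ratr r : R) *: g x)].
  apply/seteqP; split=> x /=.
    move=> vx; have /compact_near_coveringP cI := @segment_compact R 0 t.
    have : \forall k \near \oo, `[0%R, t]%classic `<=` (fun tau : R => K k (f x + tau *: g x)).
      apply: cI => tau /=; rewrite in_itv/= => /vx Ot.
      have /nbhs_ballP[e /= e0 He] := open_nbhs_nbhs (conj oOm Ot).
      have e2 : 0 < e / 2 by rewrite divr_gt0.
      near=> tau' k => /=.
      have h1 : ball (f x + tau *: g x) (e / 2) (f x + tau' *: g x).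
        by near: tau'; apply: (@continuous_ray (f x) (g x) tau); exact: nbhsx_ballx.
      have h2 : k.+1%:R^-1 < e / 2.
        by near: k; exact: (near_infty_natSinv_lt (PosNum e2)).
      rewrite /K => -[y nOy yb]; apply: nOy; apply: He.
      apply: (ball_split h1); apply: ball_sym; exact: le_ball (ltW h2) _ yb.
    move=> [k _ /(_ k (leqnn k)) Hk]; exists k => // r rI /=.
    by apply: Hk; rewrite /= in_itv.
  move=> [k _ Hk] tau t01; apply: (KOm k); apply: contrapT => nK.
  (* For [t = 0] there is no open interval of times to pick a rational from, but 0 itself is
     rational. *)
  have [t0|tn0] := eqVneq t 0.
    have [z0 z1] : tau = 0 /\ I 0.
      move: t01; rewrite t0 => /le_anti ->; split => //.
      by rewrite /I /= rmorph0 lexx t0 lexx.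
    by apply: nK; rewrite z0; have := Hk _ z1; rewrite /= rmorph0.
  have t_gt0 : 0 < t by rewrite lt_def tn0; case/andP: t01; exact: le_trans.
  have /nbhs_ballP[e /= e0 He] := continuous_ray (open_nbhs_nbhs (conj (oK k) nK)).
  have lt1 : Num.max 0 (tau - e) < Num.min t (tau + e).
    rewrite gt_max !lt_min; apply/andP; split; apply/andP; split; lra.
  have [r] := rat_in_itvoo lt1; rewrite in_itv/= gt_max lt_min.
  move=> /andP[/andP[r1 r2] /andP[r3 r4]].
  have rI : I r by rewrite /I /= !ltW.
  apply: (He (ratr r)); last exact: Hk rI.
  by rewrite -ball_normE /= ltr_norml; apply/andP; split; lra.
apply: bigcupT_measurable => k.
rewrite -[X in measurable X]setCK setC_bigcap; apply: measurableC.
rewrite bigcup_mkcond; apply: countable_bigcupT_measurable; first exact: countableP.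
move=> r; case: ifPn => // _; apply: measurableC; rewrite -[X in measurable X]setTI.
apply: (_ : measurable_fun setT (fun x => f x + (ratr r : R) *: g x)) => //.
apply: measurable_fun_rVP => i; under eq_fun do rewrite !mxE.
apply: measurable_funD; first exact: (measurableT_comp (measurable_coor i) mf).
apply: measurable_funM => //; exact: (measurableT_comp (measurable_coor i) mg).
Unshelve. all: by end_near. Qed.

Lemma measurable_exit_time d (T : measurableType d) (f g : T -> rV) :
  measurable_fun setT f -> measurable_fun setT g -> (forall x, g x != 0) ->
  measurable_fun setT (fun x => exit_time (f x) (g x)).
Proof.
move=> mf mg g0; apply: (measurability _ (RGenOInfty.measurableE R)).
move=> /= _ [_ [a ->]] <-; rewrite setTI.
have [a0|a0] := ltP a 0.
  rewrite (_ : _ @^-1` _ = setT) //; apply/seteqP; split => // x _ /=.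
  by rewrite in_itv/= andbT (lt_le_trans a0)// exit_time_ge0.
rewrite (_ : _ @^-1` _ = [set x | visible (f x) (g x) a]); first exact: measurable_visible.
by apply/seteqP; split=> x /=; rewrite in_itv/= andbT => /(exit_time_gtP _ (g0 x) a0).
Qed.

End exit_time.

(** * Measurability and symmetry of the chord quantities *)

Section powers.
Context {R : realType}.

Lemma superadditive_powR (r x y : R) : 1 <= r -> 0 <= x -> 0 <= y ->
  x `^ r + y `^ r <= (x + y) `^ r.
Proof.
move=> r1 x0 y0; have r0 : 0 < r by exact: lt_le_trans r1.
have [+|xy0] := eqVneq (x + y) 0.
  by move/eqP; rewrite paddr_eq0// => /andP[/eqP-> /eqP->]; rewrite addr0 powR0 ?gt_eqF// addr0.
have xy : 0 < x + y by rewrite lt_def xy0 addr_ge0.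
have H (z : R) : 0 <= z -> z <= x + y -> z `^ r <= z / (x + y) * (x + y) `^ r.
  move=> z0 zxy; have w0 : 0 <= z / (x + y) by rewrite divr_ge0// ltW.
  have w1 : z / (x + y) <= 1 by rewrite ler_pdivrMr// mul1r.
  rewrite -[in leLHS](divfK xy0 z) powRM// ?(ltW xy)// ler_wpM2r ?powR_ge0//.
  have [->|zn0] := eqVneq (z / (x + y)) 0; first by rewrite powR0 ?gt_eqF.
  have wp : 0 < z / (x + y) by rewrite lt_def zn0.
  by rewrite -[leRHS](powRr1 w0) ger_powR// wp.
have h1 := H x x0; have h2 := H y y0.
rewrite lerDl in h1; rewrite lerDr in h2.
apply: (le_trans (lerD (h1 y0) (h2 x0))).
by rewrite -mulrDl -mulrDl divff// mul1r.
Qed.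

Lemma chord_gain_ge0 (s p q : R) : 2^-1 < s < 1 -> 0 <= p -> 0 <= q -> 0 <= chord_gain s p q.
Proof.
move=> s01 p0 q0; rewrite addr_ge0//.
  by rewrite mulr_ge0 ?powR_ge0// ltW// kap_gt0.
have /andP[h1 h2] := s01.
rewrite mulr_ge0 ?invr_ge0; first by []; first by lra.
by rewrite -addrA -opprD subr_ge0 superadditive_powR ?invr_ge0//; lra.
Qed.

Lemma measurable_inv d (T : measurableType d) (f : T -> R) :
  measurable_fun setT f -> (forall x, 0 <= f x) -> measurable_fun setT (fun x => (f x)^-1).
Proof.
move=> mf f0; have -> : (fun x => (f x)^-1) = (fun x => f x `^ (- 1)).
  by apply/funext => x; rewrite powR_inv1.
exact: (measurableT_comp (measurable_powR _) mf).
Qed.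

Lemma measurable_chord_gain d (T : measurableType d) (s : R) (p q : T -> R) :
  measurable_fun setT p -> measurable_fun setT q -> (forall x, 0 <= p x) -> (forall x, 0 <= q x) ->
  measurable_fun setT (fun x => chord_gain s (p x) (q x)).
Proof.
move=> mp mq p0 q0; have mip := measurable_inv mp p0; have miq := measurable_inv mq q0.
have mpw (f : T -> R) : measurable_fun setT f -> measurable_fun setT (fun x => f x `^ (2 * s)).
  by move=> mf; exact: (measurableT_comp (measurable_powR _) mf).
have m1 : measurable_fun setT (fun x => ((p x)^-1 + (q x)^-1) `^ (2 * s)).
  by apply: mpw; exact: measurable_funD.
apply: measurable_funD; first by apply: measurable_funM.
apply: measurable_funM => //; apply: measurable_funB; last exact: mpw.
by apply: measurable_funB => //; exact: mpw.
Qed.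

Lemma measurable_chord_weight d (T : measurableType d) (s : R) (p q t : T -> R) :
  measurable_fun setT p -> measurable_fun setT q -> measurable_fun setT t ->
  (forall x, 0 <= p x) -> (forall x, 0 <= q x) ->
  measurable_fun setT (fun x => chord_weight s (p x) (q x) (t x)).
Proof.
move=> mp mq mt p0 q0; apply: (measurableT_comp (measurable_powR _)).
apply: measurable_funM.
  by apply: measurable_funM; [apply: measurable_funD|apply: measurable_funB].
apply: measurable_inv; first by apply: measurable_funM.
by move=> x; rewrite mulr_ge0.
Qed.

Lemma chord_weight_gt0 (s p q t : R) : 0 < p -> 0 <= t -> t < q ->
  0 < chord_weight s p q t.
Proof.
move=> p0 t0 tq; have q0 : 0 < q by exact: le_lt_trans tq.
by rewrite powR_gt0// divr_gt0 ?mulr_gt0 ?subr_gt0 ?ltr_pwDl.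
Qed.

(** The weight is a ratio of two values of one function, so exchanging the two points inverts it.
    This provides the pair (w, 1/w) of the pointwise inequality. *)
Lemma chord_weight_flip (s p q t : R) : 0 < p -> 0 <= t -> t < q ->
  chord_weight s (q - t) (p + t) t = (chord_weight s p q t)^-1.
Proof.
move=> p0 t0 tq; have q0 : 0 < q by exact: le_lt_trans tq.
have qt0 : 0 < q - t by rewrite subr_gt0.
have pt0 : 0 < p + t by rewrite ltr_pwDl.
rewrite /chord_weight subrK addrK.
have -> : q * p / ((q - t) * (p + t)) = ((p + t) * (q - t) / (p * q))^-1.
  by rewrite invf_div; congr (_ / _); rewrite mulrC.
have x0 : 0 <= (p + t) * (q - t) / (p * q) by rewrite divr_ge0 ?mulr_ge0 ?ltW.
by rewrite -[in LHS](powR_inv1 x0) -powRrM mulN1r powRN.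
Qed.

(** The truncation u >= eta of the exit side, with u = t (p + q) / (q (p + t)) and denominators
    cleared. As 1 - u is a cross-ratio, the condition is unchanged when the two points of a pair are
    exchanged. *)
Definition chord_dom (eta p q t : R) : bool :=
  [&& 0 < t, 0 < p, t < q & q * eta * (p + t) <= t * (p + q)].

Lemma chord_domE (eta p q t : R) : 0 < eta < 1 -> 0 < p -> 0 < q ->
  chord_dom eta p q t = (mtau p q eta <= t < q).
Proof.
move=> /andP[e0 e1] p0 q0; rewrite /chord_dom p0/=.
have m0 : 0 < mtau p q eta by rewrite mtau_gt0// e0 ltW.
have d0 : 0 < p + q - q * eta.
  by rewrite subr_gt0 (@lt_trans _ _ q) ?ltrDr// gtr_pMr.
have -> : (mtau p q eta <= t) = (q * eta * (p + t) <= t * (p + q)).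
  rewrite /mtau ler_pdivrMr// -subr_ge0 -[in RHS]subr_ge0; congr (0 <= _); ring.
have [t0|t0] := ltP 0 t; first by rewrite /= andbC.
apply/esym/negbTE; rewrite negb_and -ltNge; apply/orP; left.
rewrite -subr_gt0 (_ : _ - _ = q * eta * p + (- t) * (p + q * (1 - eta))); last by ring.
rewrite ltr_pwDl ?mulr_gt0// mulr_ge0 ?oppr_ge0// addr_ge0 ?mulr_ge0 ?ltW// subr_gt0//.
Qed.

Lemma chord_dom_flip (eta p q t : R) : t < q ->
  chord_dom eta p q t -> chord_dom eta (q - t) (p + t) t.
Proof.
move=> tq /and4P[t0 p0 _ h]; rewrite /chord_dom t0 subr_gt0 tq ltrDr p0/= subrK.
have -> : t * (q - t + (p + t)) = t * (p + q) by ring.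
by have -> : (p + t) * eta * q = q * eta * (p + t) by ring.
Qed.

Lemma measurable_chord_dom d (T : measurableType d) (eta : R) (p q t : T -> R) :
  measurable_fun setT p -> measurable_fun setT q -> measurable_fun setT t ->
  measurable_fun setT (fun x => chord_dom eta (p x) (q x) (t x)).
Proof.
move=> mp mq mt.
apply: measurable_and; first exact: measurable_fun_ltr.
apply: measurable_and; first exact: measurable_fun_ltr.
apply: measurable_and; first exact: measurable_fun_ltr.
apply: measurable_fun_ler.
  apply: measurable_funM; [exact: measurable_funM|exact: measurable_funD].
by apply: measurable_funM; last exact: measurable_funD.
Qed.

(** Finiteness of the weighted kernel, needed to cancel its integral later. The bound degenerates as
    [eta] tends to 0, which is harmless because the cancellation takes place at fixed [eta]. *)
Lemma side_weight_le (s p q eta : R) : 2^-1 < s < 1 -> 0 < p -> 0 < q -> 0 < eta < 1 ->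
  (\int[@lebesgue_measure R]_(x in `[mtau p q eta, q[)
    (chord_weight s p q x * x `^ (- 1 - 2 * s))%:E <=
   ((p^-1 + q^-1) `^ (2 * s) * eta `^ (- 1 - 2 * s))%:E)%E.
Proof.
move=> s01 p0 q0 e01; rewrite side_weight_int// EFinM lee_wpmul2l ?lee_fin ?powR_ge0//.
have /andP[e0 e1] := e01; have /andP[h1 h2] := s01.
apply: (@le_trans _ _ (\int[@lebesgue_measure R]_(x in `[eta, 1%R[) (eta `^ (- 1 - 2 * s))%:E)%E).
  apply: ge0_le_integral => //.
  - by move=> u _; rewrite lee_fin mulr_ge0 ?powR_ge0.
  - apply/measurable_EFinP; have := @measurable_chord_factor R `[eta, 1%R[ 1 (s - 2^-1) (- 1 - 2 * s).
    by apply: eq_measurable_fun => u _; rewrite mul1r.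
  - move=> u /=; rewrite in_itv/= => /andP[eu u1]; rewrite lee_fin.
    have v0 : 0 < 1 - u by rewrite subr_gt0.
    have u0 : 0 < u by exact: lt_le_trans eu.
    rewrite -[leRHS]mul1r ler_pM ?powR_ge0//.
      rewrite -[leRHS](powRr0 (1 - u)) ger_powR ?v0 ?gerBl ?(ltW u0)//; lra.
    rewrite (_ : - 1 - 2 * s = - (1 + 2 * s)); last by ring.
    rewrite !powRN lef_pV2 ?posrE ?powR_gt0//.
    by apply: ge0_ler_powR => //; rewrite ?nnegrE ?(ltW e0) ?(ltW u0)//; lra.
rewrite integral_cst//= lebesgue_measure_itv/= lte_fin e1 -EFinD -EFinM lee_fin.
by rewrite ler_piMr ?powR_ge0// gerBl ltW.
Qed.

End powers.

(** * Hardy inequality along a direction *)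

Section direction.
Context {R : realType} {n : nat}.
Local Notation rV := 'rV[R]_n.
Local Notation leb1 := (@lebesgue_measure R).
Local Notation leb := (@lebesgue_rV R n).
Local Notation m2 := (leb \x leb1)%E.

Lemma measurable_ray (v : rV) (c : R) :
  measurable_fun setT (fun z : rV * measurableTypeR R => z.1 + (c * z.2) *: v).
Proof.
apply: measurable_fun_rVP => i; under eq_fun do rewrite !mxE.
apply: measurable_funD; first exact: (measurableT_comp (measurable_coor i) measurable_fst).
by apply: measurable_funM => //; apply: measurable_funM.
Qed.

Lemma ge0_integral_shear (v : rV) (c : R) (F : rV * measurableTypeR R -> \bar R) :
  measurable_fun setT F -> (forall z, 0 <= F z)%E ->
  (\int[m2]_z F z = \int[m2]_z F (z.1 + (c * z.2) *: v, z.2)%R)%E.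
Proof.
move=> mF F0.
have mG : measurable_fun setT (fun z : rV * measurableTypeR R => F (z.1 + (c * z.2) *: v, z.2)).
  apply: (measurableT_comp mF); apply: measurable_fun_pair; last exact: measurable_snd.
  exact: measurable_ray.
rewrite (fubini_tonelli2 _ mF F0) (fubini_tonelli2 _ mG (fun z => F0 _)); apply: eq_integral => t _.
rewrite /fubini_G /=.
have mFt : measurable_fun setT (fun x : rV => F (x, t)).
  by apply: measurableT_comp => //; exact: pair2_measurable.
have E := @ge0_integral_affine_rV R n 1 ((c * t) *: v) (fun x => F (x, t)) (oner_neq0 _) mFt (fun x => F0 _).
rewrite normr1 invr1 expr1n mul1e in E; rewrite -[LHS]E.
by apply: eq_integral => x _; rewrite scale1r.
Qed.

Definition cut (C : rV * measurableTypeR R -> bool) (f : rV * measurableTypeR R -> R) z : \bar R :=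
  (if C z then f z else 0)%:E.

Lemma measurable_cut (C : rV * measurableTypeR R -> bool) (f : rV * measurableTypeR R -> R) : measurable_fun setT C -> measurable_fun setT f ->
  measurable_fun setT (cut C f).
Proof. by move=> mC mf; apply/measurable_EFinP; exact: measurable_fun_ifT. Qed.

Lemma cut_ge0 (C : rV * measurableTypeR R -> bool) (f : rV * measurableTypeR R -> R) z : (forall z, 0 <= f z) -> (0 <= cut C f z)%E.
Proof. by move=> f0; rewrite /cut; case: ifP => _; rewrite lee_fin. Qed.

Definition side (C : rV * measurableTypeR R -> bool) (f : rV * measurableTypeR R -> R) (x : rV) : \bar R := (\int[leb1]_t cut C f (x, t))%E.

Lemma cut_fubini (C : rV * measurableTypeR R -> bool) (f : rV * measurableTypeR R -> R) (g : rV -> R) : measurable_fun setT C -> measurable_fun setT f ->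
  (forall z, 0 <= f z) -> measurable_fun setT g -> (forall x, 0 <= g x) ->
  (\int[m2]_z cut C (fun z => (g z.1 * f z)%R) z = \int[leb]_x ((g x)%:E * side C f x))%E.
Proof.
move=> mC mf f0 mg g0.
have mg1 : measurable_fun setT (fun z : rV * measurableTypeR R => g z.1).
  exact: (measurableT_comp mg measurable_fst).
rewrite fubini_tonelli1; first last.
- by move=> z; apply: cut_ge0 => z'; rewrite mulr_ge0.
- by apply: measurable_cut => //; exact: measurable_funM.
apply: eq_integral => x _; rewrite /fubini_F /side -ge0_integralZl//.
- by apply: eq_integral => t _; rewrite /cut /=; case: ifP => _; rewrite -EFinM ?mulr0.
- by apply: measurableT_comp; [exact: measurable_cut|exact: pair1_measurable].
- by move=> t _; exact: cut_ge0.
- by rewrite lee_fin.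
Qed.

Lemma measurable_side (C : rV * measurableTypeR R -> bool) (f : rV * measurableTypeR R -> R) : measurable_fun setT C -> measurable_fun setT f ->
  (forall z, 0 <= f z) -> measurable_fun setT (side C f).
Proof.
move=> mC mf f0; apply: (@measurable_fun_fubini_tonelli_F _ _ _ _ _ leb1 (cut C f)).
  exact: measurable_cut.
by move=> z; exact: cut_ge0.
Qed.

Lemma cut_shift (v : rV) (C : rV * measurableTypeR R -> bool) (f : rV * measurableTypeR R -> R) : measurable_fun setT C -> measurable_fun setT f -> (forall z, 0 <= f z) ->
  (\int[m2]_z cut C f z = \int[m2]_z cut C f (z.1 + (- 1 * z.2) *: v, z.2)%R)%E.
Proof.
move=> mC mf f0; apply: ge0_integral_shear; first exact: measurable_cut.
by move=> z; exact: cut_ge0.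
Qed.

Section shear.
Variables (v : rV) (u : rV -> R) (E E' : rV * measurableTypeR R -> bool)
  (k w w' : rV * measurableTypeR R -> R).
Local Notation back z := (z.1 + (- 1 * z.2) *: v, z.2).
Hypotheses (mu : measurable_fun setT u) (mE : measurable_fun setT E)
  (mE' : measurable_fun setT E') (mw : measurable_fun setT w)
  (mw' : measurable_fun setT w') (mk : measurable_fun setT k).
Hypotheses (k0 : forall z, 0 <= k z) (w0 : forall z, 0 <= w z) (w0' : forall z, 0 <= w' z)
  (wE : forall z, E z -> 0 < w z) (kb : forall z, k (back z) = k z)
  (Eb : forall z, E (back z) = E' z) (wb : forall z, E' z -> (w (back z))^-1 = w' z).

Let mu1 : measurable_fun setT (fun z : rV * measurableTypeR R => u z.1).
Proof. exact: (measurableT_comp mu measurable_fst). Qed.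
Let mu2 : measurable_fun setT (fun z : rV * measurableTypeR R => u (z.1 + (1 * z.2) *: v)).
Proof. exact: (measurableT_comp mu (measurable_ray v 1)). Qed.

(** For each pair, (a - b)^2 + w a^2 + b^2 / w - a^2 - b^2 = (w a - b)^2 / w >= 0. The terms in the
    second point are brought back to the first by translating along [v], which turns [E] into [E']
    and 1/w into [w']. *)
Lemma shear_hardy :
  (\int[leb]_x ((u x ^+ 2)%:E * side E k x) +
   \int[leb]_x ((u x ^+ 2)%:E * side E' k x) <=
   \int[m2]_z cut E (fun z => (u z.1 - u (z.1 + (1 * z.2) *: v)) ^+ 2 * k z)%R z +
   (\int[leb]_x ((u x ^+ 2)%:E * side E (fun z => w z * k z)%R x) +
    \int[leb]_x ((u x ^+ 2)%:E * side E' (fun z => w' z * k z)%R x)))%E.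
Proof.
have wk0 (z : rV * measurableTypeR R) : 0 <= w z * k z by rewrite mulr_ge0 ?powR_ge0.
have wk0' (z : rV * measurableTypeR R) : 0 <= w' z * k z by rewrite mulr_ge0 ?powR_ge0.
have msq : measurable_fun setT (fun x => u x ^+ 2) by exact: measurable_funX.
have sq0 x : 0 <= u x ^+ 2 by exact: sqr_ge0.
have mwk := measurable_funM mw mk; have mwk' := measurable_funM mw' mk.
rewrite -(cut_fubini mE mk k0 msq sq0) -(cut_fubini mE' mk k0 msq sq0).
rewrite -(cut_fubini mE mwk wk0 msq sq0) -(cut_fubini mE' mwk' wk0' msq sq0).
have mu22 : measurable_fun setT (fun z : rV * measurableTypeR R => u (z.1 + (1 * z.2) *: v) ^+ 2).
  exact: measurable_funX.
have fb (z : rV * measurableTypeR R) : z.1 + (- 1 * z.2) *: v + (1 * z.2) *: v = z.1.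
  by rewrite -addrA -scalerDl mulN1r mul1r addNr scale0r addr0.
have S1 : (\int[m2]_z cut E' (fun z => (u z.1 ^+ 2 * k z)%R) z =
    \int[m2]_z cut E (fun z => (u (z.1 + (1 * z.2) *: v) ^+ 2 * k z)%R) z)%E.
  rewrite [RHS](cut_shift v)//.
  - by apply: eq_integral => z _; rewrite /cut /= Eb kb fb.
  - exact: measurable_funM.
  - by move=> z; rewrite mulr_ge0.
have mwi : measurable_fun setT (fun z => (w z)^-1).
  by exact: measurable_inv.
have S2 : (\int[m2]_z cut E' (fun z => (u z.1 ^+ 2 * (w' z * k z))%R) z =
    \int[m2]_z cut E (fun z => (u (z.1 + (1 * z.2) *: v) ^+ 2 * ((w z)^-1 * k z))%R) z)%E.
  rewrite [RHS](cut_shift v)//.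
  - apply: eq_integral => z _; rewrite /cut /= Eb kb fb.
    by case: ifPn => // h; rewrite wb.
  - by apply: measurable_funM => //; exact: measurable_funM.
  - by move=> z; rewrite mulr_ge0// mulr_ge0// invr_ge0.
rewrite S1 S2.
have md : measurable_fun setT
    (fun z : rV * measurableTypeR R => (u z.1 - u (z.1 + (1 * z.2) *: v)) ^+ 2 * k z).
  by apply: measurable_funM => //; apply: measurable_funX; exact: measurable_funB.
pose fD (z : rV * measurableTypeR R) := (u z.1 - u (z.1 + (1 * z.2) *: v)) ^+ 2 * k z.
pose f1 (z : rV * measurableTypeR R) := u z.1 ^+ 2 * k z.
pose f2 (z : rV * measurableTypeR R) := u (z.1 + (1 * z.2) *: v) ^+ 2 * k z.
pose g1 (z : rV * measurableTypeR R) := u z.1 ^+ 2 * (w z * k z).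
pose g2 (z : rV * measurableTypeR R) := u (z.1 + (1 * z.2) *: v) ^+ 2 * ((w z)^-1 * k z).
have pD z : 0 <= fD z by rewrite mulr_ge0// sqr_ge0.
have p1 z : 0 <= f1 z by rewrite mulr_ge0// sqr_ge0.
have p2 z : 0 <= f2 z by rewrite mulr_ge0// sqr_ge0.
have r1 z : 0 <= g1 z by rewrite mulr_ge0// sqr_ge0.
have r2 z : 0 <= g2 z by rewrite mulr_ge0 ?sqr_ge0// mulr_ge0// invr_ge0.
have msq1 : measurable_fun setT (fun z : rV * measurableTypeR R => u z.1 ^+ 2) by exact: measurable_funX.
have M1 : measurable_fun setT (cut E f1) by apply: measurable_cut => //; exact: measurable_funM.
have M2 : measurable_fun setT (cut E f2) by apply: measurable_cut => //; exact: measurable_funM.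
have MD : measurable_fun setT (cut E fD) by exact: measurable_cut.
have K1 : measurable_fun setT (cut E g1) by apply: measurable_cut => //; exact: measurable_funM.
have K2 : measurable_fun setT (cut E g2).
  by apply: measurable_cut => //; apply: measurable_funM => //; exact: measurable_funM.
have Q f : (forall z, 0 <= f z) -> (forall z, setT z -> 0 <= cut E f z)%E.
  by move=> f0 z _; exact: cut_ge0.
have QQ f g : (forall z, 0 <= f z) -> (forall z, 0 <= g z) ->
    (forall z, setT z -> 0 <= (cut E f \+ cut E g) z)%E.
  by move=> f0 g0 z _; rewrite adde_ge0// cut_ge0.
rewrite -(ge0_integralD m2 measurableT (Q _ p1) M1 (Q _ p2) M2).
rewrite -(ge0_integralD m2 measurableT (Q _ r1) K1 (Q _ r2) K2).
rewrite -(ge0_integralD m2 measurableT (Q _ pD) MD (QQ _ _ r1 r2) (emeasurable_funD K1 K2)).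
apply: ge0_le_integral; first exact: measurableT.
- exact: QQ.
- exact: emeasurable_funD.
- by apply: emeasurable_funD => //; exact: emeasurable_funD.
move=> z _ /=; rewrite /cut; case: ifPn => [Ez|_]; last by rewrite !adde0.
rewrite -!EFinD lee_fin /f1 /f2 /fD /g1 /g2.
set a := u _; set b := u _; set om := w z.
have om0 : 0 < om by exact: wE.
have -> : a ^+ 2 * k z + b ^+ 2 * k z = (a ^+ 2 + b ^+ 2) * k z by ring.
have -> : (a - b) ^+ 2 * k z + (a ^+ 2 * (om * k z) + b ^+ 2 * (om^-1 * k z)) =
  ((a - b) ^+ 2 + (a ^+ 2 * om + b ^+ 2 / om)) * k z by ring.
rewrite ler_wpM2r// -subr_ge0.
have -> : (a - b) ^+ 2 + (a ^+ 2 * om + b ^+ 2 / om) - (a ^+ 2 + b ^+ 2) = (a * om - b) ^+ 2 / om.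
  by field; rewrite gt_eqF.
by rewrite divr_ge0 ?sqr_ge0// ltW.
Qed.

End shear.

(** Cancels the integral of [W] on both sides, which is legitimate because [W] is dominated by a
    multiple of the integrable [f]. *)
Lemma absorb (W B g : rV -> \bar R) (D : \bar R) (f : rV -> R) (er C : R) :
  measurable_fun setT W -> measurable_fun setT B -> measurable_fun setT g ->
  measurable_fun setT f ->
  (forall x, 0 <= W x)%E -> (forall x, 0 <= B x)%E -> (forall x, 0 <= g x)%E ->
  (forall x, 0 <= f x) -> 0 <= er -> 0 <= C ->
  (forall x, W x + g x <= B x + er%:E * (f x)%:E)%E ->
  (forall x, W x <= C%:E * (f x)%:E)%E ->
  (\int[leb]_x B x <= D + \int[leb]_x W x)%E ->
  (\int[leb]_x (f x)%:E < +oo)%E ->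
  (\int[leb]_x g x <= D + er%:E * \int[leb]_x (f x)%:E)%E.
Proof.
move=> mW mB mg mf W0 B0 g0 f0 er0 C0 pt WC main fL.
have mfE : measurable_fun setT (EFin \o f) by exact/measurable_EFinP.
have f0E x : setT x -> (0 <= (EFin \o f) x)%E by move=> _; rewrite /= lee_fin.
have Zf (r : R) : 0 <= r -> (\int[leb]_x (r%:E * (f x)%:E) = r%:E * \int[leb]_x (f x)%:E)%E.
  by move=> r0; apply: ge0_integralZl => //; rewrite lee_fin.
have Wfin : (\int[leb]_x W x)%E \is a fin_num.
  rewrite ge0_fin_numE; last by apply: integral_ge0 => x _.
  apply: (@le_lt_trans _ _ (C%:E * \int[leb]_x (f x)%:E)%E).
    rewrite -Zf//; apply: ge0_le_integral => //.
    by apply: emeasurable_funM => //; exact: measurable_cst.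
  by apply: lte_mul_pinfty => //; rewrite ?lee_fin.
have h : (\int[leb]_x W x + \int[leb]_x g x <= \int[leb]_x B x + er%:E * \int[leb]_x (f x)%:E)%E.
  have merf : measurable_fun setT (fun x => (er%:E * (f x)%:E)%E).
    by apply: emeasurable_funM => //; exact: measurable_cst.
  have erf0 x : setT x -> (0 <= er%:E * (f x)%:E)%E by move=> _; rewrite mule_ge0 ?lee_fin.
  rewrite -Zf// -(ge0_integralD leb measurableT (fun x _ => W0 x) mW (fun x _ => g0 x) mg).
  rewrite -(ge0_integralD leb measurableT (fun x _ => B0 x) mB erf0 merf).
  apply: ge0_le_integral => //.
  - by move=> x _; rewrite adde_ge0.
  - exact: emeasurable_funD.
  - exact: emeasurable_funD.
have := le_trans h (leeD2r _ main).
rewrite [X in (_ <= X + _)%E]addeC -[leRHS]addeA.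
by rewrite (leeD2lE _ _ Wfin).
Qed.

Lemma scale_ineq (a g e1 e2 : R) (a1 a2 b1 b2 : \bar R) : 0 <= a ->
  (0 <= a1)%E -> (0 <= a2)%E -> (0 <= b1)%E -> (0 <= b2)%E -> 0 <= g -> e1 <= e2 -> 0 <= e2 ->
  (a1 + a2 + g%:E <= b1 + b2 + e1%:E)%E ->
  (a%:E * a1 + a%:E * a2 + (a * g)%:E <= a%:E * b1 + a%:E * b2 + e2%:E * a%:E)%E.
Proof.
move=> a0 a10 a20 b10 b20 g0 e12 e20 h.
have gE : (0 <= g%:E)%E by rewrite lee_fin.
have eE : (0 <= e2%:E)%E by rewrite lee_fin.
rewrite EFinM (muleC e2%:E) -(ge0_muleDr a%:E a10 a20) -(ge0_muleDr a%:E b10 b20).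
rewrite -(ge0_muleDr a%:E (adde_ge0 a10 a20) gE) -(ge0_muleDr a%:E (adde_ge0 b10 b20) eE).
by apply: lee_wpmul2l; rewrite ?lee_fin//; apply: (le_trans h); rewrite leeD2l// lee_fin.
Qed.

Section profile.
Variables (s : R) (v : rV) (u p q : rV -> R).
Hypotheses (s01 : 2^-1 < s < 1) (mu : measurable_fun setT u).
Hypotheses (mq : measurable_fun setT q) (mp : measurable_fun setT p)
  (q0 : forall x, 0 <= q x) (p0 : forall x, 0 <= p x).
Local Notation al := (2 * s).
Local Notation k t := (t `^ (- 1 - al)).
Hypotheses (dom_shift : forall eta y t,
    chord_dom eta (p (y + (- 1 * t) *: v)) (q (y + (- 1 * t) *: v)) t =
    chord_dom eta (q y) (p y) t)
  (weight_shift : forall eta y t, chord_dom eta (q y) (p y) t ->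
    (chord_weight s (p (y + (- 1 * t) *: v)) (q (y + (- 1 * t) *: v)) t)^-1 =
    chord_weight s (q y) (p y) t).

Variable eta : R.
Hypothesis e01 : 0 < eta < 1.
Let E (z : rV * measurableTypeR R) := chord_dom eta (p z.1) (q z.1) z.2.
Let E' (z : rV * measurableTypeR R) := chord_dom eta (q z.1) (p z.1) z.2.
Let w (z : rV * measurableTypeR R) := chord_weight s (p z.1) (q z.1) z.2.
Let w' (z : rV * measurableTypeR R) := chord_weight s (q z.1) (p z.1) z.2.
Let kk (z : rV * measurableTypeR R) := k (z.2 : R).

Let mq1 : measurable_fun setT (fun z : rV * measurableTypeR R => q z.1).
Proof. exact: (measurableT_comp mq measurable_fst). Qed.
Let mp1 : measurable_fun setT (fun z : rV * measurableTypeR R => p z.1).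
Proof. exact: (measurableT_comp mp measurable_fst). Qed.
Let mt1 : measurable_fun setT (fun z : rV * measurableTypeR R => z.2 : R).
Proof. exact: measurable_snd. Qed.
Let mE : measurable_fun setT E. Proof. exact: measurable_chord_dom. Qed.
Let mE' : measurable_fun setT E'. Proof. exact: measurable_chord_dom. Qed.
Let mw : measurable_fun setT w. Proof. exact: measurable_chord_weight. Qed.
Let mw' : measurable_fun setT w'. Proof. exact: measurable_chord_weight. Qed.
Let mk : measurable_fun setT kk.
Proof. exact: (measurableT_comp (measurable_powR _) mt1). Qed.
Lemma side_itv (P Q : R) (f : R -> R) (x : rV) (C : rV * measurableTypeR R -> bool)
    (g : rV * measurableTypeR R -> R) : 0 < P -> 0 < Q ->
  (forall t : R, C (x, t) = chord_dom eta P Q t) -> (forall t : R, g (x, t) = f t) ->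
  (side C g x = \int[leb1]_(t in `[mtau P Q eta, Q[) (f t)%:E)%E.
Proof.
move=> P0 Q0 HC Hg; rewrite [RHS]integral_mkcond; apply: eq_integral => t _.
rewrite /cut patchE mem_setE in_itv/= HC Hg chord_domE//.
by case: ifP.
Qed.

Variable d : R.
Hypotheses (d0 : 0 < d) (ud : forall x, u x != 0 -> d <= p x /\ d <= q x).
Hypothesis uL2 : (\int[leb]_x (u x ^+ 2)%:E < +oo)%E.

Lemma inv_sum_le x : u x != 0 -> ((p x)^-1 + (q x)^-1) `^ al <= (2 / d) `^ al.
Proof.
move=> /ud[h1 h2]; have pp := lt_le_trans d0 h1; have qq := lt_le_trans d0 h2.
have /andP[h3 _] := s01.
apply: ge0_ler_powR; rewrite ?nnegrE ?addr_ge0 ?invr_ge0 ?(ltW pp) ?(ltW qq) ?divr_ge0 ?(ltW d0)//; first lra.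
have : (p x)^-1 <= d^-1 by rewrite lef_pV2.
have : (q x)^-1 <= d^-1 by rewrite lef_pV2.
rewrite (_ : 2 / d = d^-1 + d^-1); last by field; rewrite gt_eqF.
lra.
Qed.

Definition dir_energy : \bar R :=
  (\int[m2]_z cut (fun z => ((0 : R) < z.2)%R && (z.2 < q z.1)%R)
     (fun z => (u z.1 - u (z.1 + (1 * z.2) *: v)) ^+ 2 * k z.2)%R z)%E.

Let mu1 : measurable_fun setT (fun z : rV * measurableTypeR R => u z.1).
Proof. exact: (measurableT_comp mu measurable_fst). Qed.
Let mu2 : measurable_fun setT (fun z : rV * measurableTypeR R => u (z.1 + (1 * z.2) *: v)).
Proof. exact: (measurableT_comp mu (measurable_ray v 1)). Qed.

(** Where [u] does not vanish both exit times are at least [d], so the truncation error of the chord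
    inequality is uniform; elsewhere every term carries the factor u^2 = 0. *)
Lemma direction_hardy_eta :
  (\int[leb]_x (u x ^+ 2 * chord_gain s (p x) (q x))%:E <=
   dir_energy + ((2 / d) `^ al * chord_err s eta)%:E * \int[leb]_x (u x ^+ 2)%:E)%E.
Proof.
have k0 z : 0 <= kk z by exact: powR_ge0.
have w0 z : 0 <= w z by exact: powR_ge0.
have w0' z : 0 <= w' z by exact: powR_ge0.
have wE z : E z -> 0 < w z.
  by move=> /and4P[t0 pz tq _]; apply: chord_weight_gt0 => //; exact: ltW.
have Eb z : E (z.1 + (- 1 * z.2) *: v, z.2) = E' z by exact: dom_shift.
have wb z : E' z -> (w (z.1 + (- 1 * z.2) *: v, z.2))^-1 = w' z by exact: weight_shift.
have main := @shear_hardy v u E E' kk w w' mu mE mE' mw mw' mk k0 w0 w0' wE (fun=> erefl) Eb wb.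
have sg C f x : (forall z, 0 <= f z) -> (0 <= side C f x)%E.
  by move=> f0; apply: integral_ge0 => t _; exact: cut_ge0.
pose wk z := w z * kk z; pose wk' z := w' z * kk z.
have wk0 z : 0 <= wk z := mulr_ge0 (w0 z) (k0 z).
have wk0' z : 0 <= wk' z := mulr_ge0 (w0' z) (k0 z).
have mwk : measurable_fun setT wk := measurable_funM mw mk.
have mwk' : measurable_fun setT wk' := measurable_funM mw' mk.
have mB1 := measurable_side mE mk k0; have mB2 := measurable_side mE' mk k0.
have mW1 := measurable_side mE mwk wk0; have mW2 := measurable_side mE' mwk' wk0'.
have msq : measurable_fun setT (fun x => u x ^+ 2) by exact: measurable_funX.
have msqE : measurable_fun setT (fun x => (u x ^+ 2)%:E) by exact/measurable_EFinP.
have sq0 x : 0 <= u x ^+ 2 by exact: sqr_ge0.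
have sqE0 x : (0 <= (u x ^+ 2)%:E)%E by rewrite lee_fin.
have /andP[h1 h2] := s01.
have er0 : 0 <= (2 / d) `^ al * chord_err s eta.
  by rewrite mulr_ge0 ?powR_ge0// mulr_ge0 ?powR_ge0// addr_ge0// invr_ge0; lra.
pose cw := (2 / d) `^ al * eta `^ (- 1 - al).
have cw0 : 0 <= cw by rewrite mulr_ge0 ?powR_ge0.
pose W x := ((u x ^+ 2)%:E * side E wk x + (u x ^+ 2)%:E * side E' wk' x)%E.
pose B x := ((u x ^+ 2)%:E * side E kk x + (u x ^+ 2)%:E * side E' kk x)%E.
have pE1 (f : rV -> \bar R) : measurable_fun setT f -> measurable_fun setT (fun x => ((u x ^+ 2)%:E * f x)%E).
  by move=> mf; exact: emeasurable_funM.
have pos1 C f : (forall z, 0 <= f z) -> forall x, setT x -> (0 <= (u x ^+ 2)%:E * side C f x)%E.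
  by move=> f0 x _; rewrite mule_ge0// sg.
apply: (@absorb W B _ dir_energy (fun x => u x ^+ 2) _ (cw + cw)).
- by apply: emeasurable_funD; exact: pE1.
- by apply: emeasurable_funD; exact: pE1.
- apply/measurable_EFinP; apply: measurable_funM => //; exact: measurable_chord_gain.
- exact: msq.
- by move=> x; rewrite adde_ge0// pos1.
- by move=> x; rewrite adde_ge0// pos1.
- by move=> x; rewrite lee_fin mulr_ge0// chord_gain_ge0.
- exact: sq0.
- exact: er0.
- by rewrite addr_ge0.
- move=> x; rewrite /W /B.
  have [u0|un0] := eqVneq (u x) 0; first last.
  have [g1 g2] := ud un0; have pp := lt_le_trans d0 g1; have qq := lt_le_trans d0 g2.
  have ci := chord_ineq s01 pp qq e01.
  rewrite (@side_itv (p x) (q x) (fun t => k t) x E kk)//.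
  rewrite (@side_itv (q x) (p x) (fun t => k t) x E' kk)//.
  rewrite (@side_itv (p x) (q x) (fun t => chord_weight s (p x) (q x) t * k t) x E wk)//.
  rewrite (@side_itv (q x) (p x) (fun t => chord_weight s (q x) (p x) t * k t) x E' wk')//.
  move: ci; set a1 := integral _ _ _; set a2 := integral _ _ _; set b1 := integral _ _ _; set b2 := integral _ _ _.
  move=> ci.
  have nn (P Q : R) (f : R -> R) : (forall t, 0 <= f t) -> (0 <= \int[leb1]_(t in `[mtau P Q eta, Q[) (f t)%:E)%E.
    by move=> f0; apply: integral_ge0 => t _; rewrite lee_fin.
  apply: (scale_ineq _ _ _ _ _ _ _ _ ci) => //.
  + by apply: nn => t; rewrite mulr_ge0 ?powR_ge0.
  + by apply: nn => t; rewrite mulr_ge0 ?powR_ge0.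
  + by apply: nn => t; rewrite powR_ge0.
  + by apply: nn => t; rewrite powR_ge0.
  + exact: chord_gain_ge0.
  + by rewrite ler_wpM2r ?inv_sum_le// mulr_ge0 ?powR_ge0// addr_ge0// invr_ge0; lra.
  move: (side E wk x) (side E' wk' x) (side E kk x) (side E' kk x) => A1 A2 A3 A4.
  by rewrite u0 expr0n/= !mul0e mul0r mule0 !adde0.
- move=> x; rewrite /W.
  have [u0|un0] := eqVneq (u x) 0; first last.
  have [g1 g2] := ud un0; have pp := lt_le_trans d0 g1; have qq := lt_le_trans d0 g2.
  have ic := inv_sum_le un0.
  rewrite -ge0_muleDr ?sg// [leRHS]muleC lee_wpmul2l// EFinD leeD//.
    rewrite (@side_itv (p x) (q x) (fun t => chord_weight s (p x) (q x) t * k t) x E wk)//.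
    apply: (le_trans (side_weight_le s01 pp qq e01)).
    by rewrite lee_fin ler_wpM2r ?powR_ge0.
  rewrite (@side_itv (q x) (p x) (fun t => chord_weight s (q x) (p x) t * k t) x E' wk')//.
  apply: (le_trans (side_weight_le s01 qq pp e01)).
  by rewrite lee_fin ler_wpM2r ?powR_ge0// addrC.
  move: (side E wk x) (side E' wk' x) => A1 A2.
  by rewrite u0 expr0n/= !mul0e mule0 adde0.
- rewrite /W /B.
  rewrite (ge0_integralD leb measurableT (pos1 _ _ k0) (pE1 _ mB1) (pos1 _ _ k0) (pE1 _ mB2)).
  rewrite (ge0_integralD leb measurableT (pos1 _ _ wk0) (pE1 _ mW1) (pos1 _ _ wk0') (pE1 _ mW2)).
  apply: (le_trans main); rewrite leeD2r// /dir_energy.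
  have md : measurable_fun setT
      (fun z : rV * measurableTypeR R => (u z.1 - u (z.1 + (1 * z.2) *: v)) ^+ 2 * kk z).
    by apply: measurable_funM => //; apply: measurable_funX; exact: measurable_funB.
  have d0' z : 0 <= (u z.1 - u (z.1 + (1 * z.2) *: v)) ^+ 2 * kk z by rewrite mulr_ge0// sqr_ge0.
  apply: ge0_le_integral => //.
  + by move=> z _; exact: cut_ge0.
  + exact: measurable_cut.
  + apply: measurable_cut => //; apply: measurable_and; exact: measurable_fun_ltr.
  + move=> z _; rewrite /cut lee_fin; case: ifPn => [/and4P[-> _ -> _] //|_].
    by case: ifP.
- exact: uL2.
Qed.

End profile.

Variable Om : set rV.
Hypotheses (oOm : open Om) (bOm : bounded_set Om).
Variables (s : R) (v : rV).
Hypotheses (s01 : 2^-1 < s < 1) (v0 : v != 0).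

Local Notation al := (2 * s).
Local Notation q := (fun x => exit_time Om x v).
Local Notation p := (fun x => exit_time Om x (- v)).
Local Notation k t := (t `^ (- 1 - al)).

Let nv0 : - v != 0. Proof. by rewrite oppr_eq0. Qed.

Let mq : measurable_fun setT q.
Proof. exact: measurable_exit_time. Qed.
Let mp : measurable_fun setT p.
Proof. exact: measurable_exit_time. Qed.
Let q0 x : 0 <= q x. Proof. exact: exit_time_ge0. Qed.
Let p0 x : 0 <= p x. Proof. exact: exit_time_ge0. Qed.

Lemma chord_dom_shift (eta : R) (y : rV) (t : R) :
  chord_dom eta (p (y + (- 1 * t) *: v)) (q (y + (- 1 * t) *: v)) t =
  chord_dom eta (q y) (p y) t.
Proof.
set x := y + _.
have yE : y = x + t *: v by rewrite /x -addrA -scalerDl mulN1r addNr scale0r addr0.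
have xE : x = y + t *: (- v) by rewrite /x mulN1r scaleNr scalerN.
apply/idP/idP => h; have /and4P[t0 _ tq _] := h.
  have := chord_dom_flip tq h; rewrite yE.
  by rewrite exit_time_fwd ?(ltW t0)// exit_time_bwd ?(ltW t0).
have := chord_dom_flip tq h; rewrite xE.
rewrite (@exit_time_fwd _ _ _ oOm bOm y (- v))// ?(ltW t0)//.
have := @exit_time_bwd _ _ _ oOm bOm y (- v) t nv0 (ltW t0) tq.
by rewrite opprK => ->.
Qed.

Lemma chord_weight_shift (eta : R) (y : rV) (t : R) : chord_dom eta (q y) (p y) t ->
  (chord_weight s (p (y + (- 1 * t) *: v)) (q (y + (- 1 * t) *: v)) t)^-1 =
  chord_weight s (q y) (p y) t.
Proof.
move=> /and4P[t0 qy0 tp _].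
have xE : y + (- 1 * t) *: v = y + t *: (- v) by rewrite mulN1r scaleNr scalerN.
rewrite xE (@exit_time_fwd _ _ _ oOm bOm y (- v))// ?(ltW t0)//.
have := @exit_time_bwd _ _ _ oOm bOm y (- v) t nv0 (ltW t0) tp.
rewrite opprK => ->.
by rewrite chord_weight_flip ?invrK// ltW.
Qed.

End direction.

(** * Integration over directions *)

Section ground_state.
Context {R : realType} {n : nat}.
Local Notation rV := 'rV[R]_n.+1.
Local Notation leb1 := (@lebesgue_measure R).
Local Notation leb := (@lebesgue_rV R n.+1).
Local Notation lebn := (@lebesgue_rV R n).
Local Notation m2 := (leb \x leb1)%E.

Lemma enorm_eq0 m (x : 'rV[R]_m) : enorm x = 0 -> x = 0.
Proof.
move=> x0; have := enorm_sqr x; rewrite x0 expr0n/= => /esym/eqP.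
rewrite psumr_eq0; last by move=> i _; exact: sqr_ge0.
move=> /allP h; apply/rowP => i; have := h i (mem_index_enum _).
by rewrite mxE sqrf_eq0 => /eqP.
Qed.

Lemma ge0_integral_reflect (F : rV * measurableTypeR R -> \bar R) :
  measurable_fun setT F -> (forall z, 0 <= F z)%E ->
  (\int[m2]_z F z = \int[m2]_z F (z.1, - z.2)%R)%E.
Proof.
move=> mF F0.
have mG : measurable_fun setT (fun z : rV * measurableTypeR R => F (z.1, - z.2)).
  apply: (measurableT_comp mF); apply: measurable_fun_pair; first exact: measurable_fst.
  by apply: measurableT_comp => //; exact: measurable_snd.
rewrite (fubini_tonelli1 _ mF F0) (fubini_tonelli1 _ mG (fun z => F0 _)); apply: eq_integral => x _.
rewrite /fubini_F /=.
have mFx : measurable_fun setT (fun t : R => F (x, t)).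
  by apply: measurableT_comp => //; exact: pair1_measurable.
have n1 : -1 != 0 :> R by rewrite oppr_eq0 oner_eq0.
have E := ge0_integral_affine 0 n1 mFx (fun x => F0 _).
rewrite normrN1 invr1 mul1e in E; rewrite -[LHS]E.
by apply: eq_integral => t _; rewrite /affine mulN1r addr0.
Qed.

Variables (Om : set rV) (s : R) (u : rV -> R).
Hypotheses (oOm : open Om) (bOm : bounded_set Om) (s01 : 2^-1 < s < 1)
  (mu : measurable_fun setT u).
Local Notation al := (2 * s).
Local Notation N := (n.+1%:R + 2 * s).

Definition pair_kernel (z : rV * rV) : R := (u z.1 - u z.2) ^+ 2 / enorm (z.1 - z.2) `^ N.

Definition pair_cut (z : rV * rV) : \bar R :=
  (if (z.1 \in Om) && (z.2 \in Om) then pair_kernel z else 0)%:E.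

Lemma measurable_mem_open (A : set rV) : open A -> measurable_fun setT (fun x : rV => x \in A).
Proof.
move=> oA; apply: (measurable_fun_bool true); rewrite setTI.
rewrite (_ : _ @^-1` _ = A); first exact: open_measurable_rV.
by apply/seteqP; split=> x /=; [exact: set_mem|exact: mem_set].
Qed.

Lemma measurable_rVB d (T : measurableType d) (f g : T -> rV) :
  measurable_fun setT f -> measurable_fun setT g -> measurable_fun setT (fun x => f x - g x).
Proof.
move=> mf mg; apply: measurable_fun_rVP => i; under eq_fun do rewrite !mxE.
apply: measurable_funB; first exact: (measurableT_comp (measurable_coor i) mf).
exact: (measurableT_comp (measurable_coor i) mg).
Qed.

Lemma pair_kernel_ge0 z : 0 <= pair_kernel z.
Proof. by rewrite divr_ge0 ?sqr_ge0 ?powR_ge0. Qed.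

Lemma measurable_pair_kernel : measurable_fun setT pair_kernel.
Proof.
apply: measurable_funM.
  apply: measurable_funX; apply: measurable_funB.
    exact: (measurableT_comp mu measurable_fst).
  exact: (measurableT_comp mu measurable_snd).
apply: measurable_inv; last by move=> z; exact: powR_ge0.
apply: (measurableT_comp (measurable_powR _)).
apply: (measurableT_comp (@measurable_enorm R n.+1)).
exact: (measurable_rVB measurable_fst measurable_snd).
Qed.

Lemma measurable_pair_cut : measurable_fun setT pair_cut.
Proof.
apply/measurable_EFinP; apply: measurable_fun_ifT => //; last exact: measurable_pair_kernel.
apply: measurable_and.
  exact: (measurableT_comp (measurable_mem_open oOm) measurable_fst).
exact: (measurableT_comp (measurable_mem_open oOm) measurable_snd).
Qed.

Lemma pair_cut_ge0 z : (0 <= pair_cut z)%E.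
Proof. by rewrite /pair_cut; case: ifP; rewrite lee_fin// pair_kernel_ge0. Qed.

Lemma pair_cutC x y : pair_cut (x, y) = pair_cut (y, x).
Proof.
have K : pair_kernel (x, y) = pair_kernel (y, x).
  by rewrite /pair_kernel -(opprB y x) enormN -(opprB (u y)) sqrrN.
change ((if (x \in Om) && (y \in Om) then pair_kernel (x, y) else 0)%:E =
  (if (y \in Om) && (x \in Om) then pair_kernel (y, x) else 0)%:E).
by rewrite K andbC.
Qed.

Section fixed_direction.
Variable v : rV.
Hypothesis v0 : v != 0.
Local Notation q := (fun x => exit_time Om x v).
Local Notation p := (fun x => exit_time Om x (- v)).

Definition ray_cut (z : rV * measurableTypeR R) : \bar R :=
  ((`|z.2 : R| ^+ n)%:E * pair_cut (z.1, z.1 + (1 * z.2) *: v)%R)%E.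

Lemma ray_cut_ge0 z : (0 <= ray_cut z)%E.
Proof. by apply: mule_ge0; [rewrite lee_fin exprn_ge0|exact: pair_cut_ge0]. Qed.

Lemma measurable_ray_cut : measurable_fun setT ray_cut.
Proof.
apply: emeasurable_funM.
  apply/measurable_EFinP; apply: measurable_funX; exact: measurableT_comp.
apply: (measurableT_comp measurable_pair_cut); apply: measurable_fun_pair.
  exact: measurable_fst.
exact: measurable_ray.
Qed.

Local Notation half b := (fun z : rV * measurableTypeR R =>
  if b z.2 then ray_cut z else 0%E).

(** Every pair is met twice, once from each of its points: t -> -t followed by the translation of
    the base point by t v exchanges the two halves. *)
Lemma ray_cut_double : (2%:E * \int[m2]_z half (fun t : R => (0 < t)%R) z = \int[m2]_z ray_cut z)%E.
Proof.
have mP : measurable_fun setT (fun z : rV * measurableTypeR R => (0 < (z.2 : R))%R).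
  by apply: measurable_fun_ltr => //; exact: measurable_snd.
have mN : measurable_fun setT (fun z : rV * measurableTypeR R => ((z.2 : R) < 0)%R).
  by apply: measurable_fun_ltr => //; exact: measurable_snd.
have mHP : measurable_fun setT (half (fun t : R => (0 < t)%R)).
  by apply: measurable_fun_ifT => //; exact: measurable_ray_cut.
have mHN : measurable_fun setT (half (fun t : R => (t < 0)%R)).
  by apply: measurable_fun_ifT => //; exact: measurable_ray_cut.
have pH b z : (0 <= half b z)%E by case: ifP => // _; exact: ray_cut_ge0.
have NP : (\int[m2]_z half (fun t : R => (t < 0)%R) z = \int[m2]_z half (fun t : R => (0 < t)%R) z)%E.
  have E1 := ge0_integral_reflect mHN (pH (fun t : R => (t < 0)%R)).
  have mR : measurable_fun setT (fun z : rV * measurableTypeR R =>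
      half (fun t : R => (t < 0)%R) (z.1, - z.2)).
    apply: (measurableT_comp mHN); apply: measurable_fun_pair; first exact: measurable_fst.
    by apply: measurableT_comp => //; exact: measurable_snd.
  have E2 := @ge0_integral_shear R n.+1 v 1 _ mR (fun z => pH (fun t : R => (t < 0)%R) _).
  have RR (x : rV) (t : measurableTypeR R) : ray_cut (x + (1 * t) *: v, - t) = ray_cut (x, t).
    have xE : x + (1 * t) *: v + (1 * - t) *: v = x.
      by rewrite -addrA -scalerDl mulrN subrr scale0r addr0.
    change ((`|- t : R| ^+ n)%:E * pair_cut (x + (1 * t) *: v, x + (1 * t) *: v + (1 * - t) *: v)%R =
      (`|t : R| ^+ n)%:E * pair_cut (x, x + (1 * t) *: v)%R)%E.
    by rewrite xE normrN pair_cutC.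
  apply: (eq_trans E1); apply: (eq_trans E2); apply: eq_integral => -[x t] _.
  change ((if - t < 0 then ray_cut (x + (1 * t) *: v, - t) else 0%E) =
    (if 0 < t then ray_cut (x, t) else 0%E)).
  by rewrite RR oppr_lt0.
have -> : (2%:E * \int[m2]_z half (fun t : R => (0 < t)%R) z =
   \int[m2]_z half (fun t : R => (0 < t)%R) z + \int[m2]_z half (fun t : R => (t < 0)%R) z)%E.
  by rewrite NP -mule2n mule_natl.
rewrite -(ge0_integralD m2 measurableT (fun z _ => pH (fun t : R => (0 < t)%R) z) mHP
  (fun z _ => pH (fun t : R => (t < 0)%R) z) mHN).
apply: eq_integral => -[x t] _; have [t0|t0|<-] := ltgtP 0 (t : R).
- by rewrite adde0.
- by rewrite add0e.
rewrite adde0 /ray_cut /pair_cut; cbn [fst snd].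
by rewrite mulr0 scale0r addr0 /pair_kernel subrr expr0n mul0r if_same mule0.
Qed.

(** The polar Jacobian t^n against |t v|^(-N) leaves |v|^(-N) t^(-1-2s), the one-dimensional kernel.
    Pairs of [Om] that do not see each other along the line are dropped, which only lowers the
    energy. *)
Lemma dir_energy_le :
  ((enorm v `^ (- N))%:E * dir_energy s v u q <= \int[m2]_z half (fun t : R => (0 < t)%R) z)%E.
Proof.
have md : measurable_fun setT
    (fun z : rV * measurableTypeR R => (u z.1 - u (z.1 + (1 * z.2) *: v)) ^+ 2 * (z.2 : R) `^ (- 1 - al)).
  apply: measurable_funM.
    apply: measurable_funX; apply: measurable_funB; first exact: (measurableT_comp mu measurable_fst).
    exact: (measurableT_comp mu (measurable_ray v 1)).
  exact: (measurableT_comp (measurable_powR _) measurable_snd).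
have mC : measurable_fun setT (fun z : rV * measurableTypeR R => ((0 : R) < z.2)%R && (z.2 < q z.1)%R).
  apply: measurable_and.
    by apply: measurable_fun_ltr => //; exact: measurable_snd.
  apply: measurable_fun_ltr; first exact: measurable_snd.
  exact: measurable_exit_time.
have d0 (z : rV * measurableTypeR R) :
    0 <= (u z.1 - u (z.1 + (1 * z.2) *: v)) ^+ 2 * (z.2 : R) `^ (- 1 - al).
  by rewrite mulr_ge0 ?sqr_ge0 ?powR_ge0.
rewrite /dir_energy -ge0_integralZl//; first last.
- by rewrite lee_fin powR_ge0.
- by move=> z _; apply: cut_ge0; exact: d0.
- exact: measurable_cut.
apply: ge0_le_integral; first exact: measurableT.
- by move=> z _; apply: mule_ge0; [rewrite lee_fin powR_ge0|apply: cut_ge0; exact: d0].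
- by apply: emeasurable_funM; [exact: measurable_cst|exact: measurable_cut].
- apply: measurable_fun_ifT => //; last exact: measurable_ray_cut.
  by apply: measurable_fun_ltr => //; exact: measurable_snd.
move=> z _; rewrite /cut; case: ifPn => [/andP[t0 tq]|_]; last first.
  by rewrite mule0; case: ifP => // _; exact: ray_cut_ge0.
rewrite t0 /ray_cut /pair_cut /=.
have vis := elimT (exit_time_gtP oOm bOm z.1 v0 (ltW t0)) tq.
have O1 : Om z.1 by have := vis 0; rewrite scale0r addr0; apply; rewrite lexx ltW.
have O2 : Om (z.1 + (1 * z.2) *: v) by rewrite mul1r; apply: vis; rewrite lexx ltW.
rewrite !mem_set//= /pair_kernel /= -!EFinM lee_fin.
have -> : z.1 - (z.1 + (1 * z.2) *: v) = - ((z.2 : R) *: v).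
  by rewrite mul1r opprD addrA subrr add0r.
rewrite enormN enormZ !gtr0_norm//.
set D := (_ - _) ^+ 2; have D0 : 0 <= D by exact: sqr_ge0.
have ve : 0 < enorm v by rewrite lt_def enorm_ge0 andbT; apply: contra v0 => /eqP /enorm_eq0 ->.
rewrite powRM ?enorm_ge0 ?(ltW t0)//.
have -> : (z.2 : R) `^ (- 1 - al) = (z.2 : R) ^+ n / (z.2 : R) `^ N.
  rewrite -powR_mulrn ?(ltW t0)// -powRN -powRD ?(gt_eqF t0) ?implybT//; congr (_ `^ _).
  by rewrite -natr1; ring.
rewrite powRN le_eqVlt; apply/orP; left; apply/eqP; field.
by rewrite !gt_eqF// powR_gt0.
Qed.

End fixed_direction.

Lemma chord_err_small (K e : R) : 0 <= K -> 0 < e ->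
  exists2 eta : R, 0 < eta < 1 & chord_err s eta * K <= e.
Proof.
move=> K0 e0; have /andP[h1 h2] := s01.
have c0 : 0 < 2 - al by lra.
pose C := (1 + (2 - al)^-1) * K + 1.
have C0 : 0 < C by rewrite ltr_wpDl// mulr_ge0// addr_ge0// invr_ge0 ltW.
pose eta := Num.min 2^-1 ((e / C) `^ (2 - al)^-1).
have eta0 : 0 < eta by rewrite lt_min invr_gt0 ltr0n/= powR_gt0// divr_gt0.
exists eta.
  by rewrite eta0/= gt_min; apply/orP; left; lra.
have : eta `^ (2 - al) <= e / C.
  have -> : e / C = ((e / C) `^ (2 - al)^-1) `^ (2 - al).
    by rewrite -powRrM mulVf ?gt_eqF// powRr1// divr_ge0 ?ltW.
  apply: ge0_ler_powR; rewrite ?nnegrE ?(ltW eta0) ?powR_ge0 ?(ltW c0)//.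
  by rewrite ge_min lexx orbT.
move=> h; rewrite /chord_err -mulrA; apply: (@le_trans _ _ (e / C * C)); last first.
  by rewrite divfK ?gt_eqF.
apply: ler_pM; rewrite ?powR_ge0//; last by rewrite lerDl.
by rewrite mulr_ge0// addr_ge0// invr_ge0 ltW.
Qed.

(** The cut-off is removed: the error falls below any [e > 0] for small [eta], and no other term
    depends on [eta]. *)
Lemma direction_hardy (v : rV) (d : R) : v != 0 -> 0 < d ->
  (forall x, u x != 0 -> d <= exit_time Om x (- v) /\ d <= exit_time Om x v) ->
  (\int[leb]_x (u x ^+ 2)%:E < +oo)%E ->
  (\int[leb]_x (u x ^+ 2 * chord_gain s (exit_time Om x (- v)) (exit_time Om x v))%:E <=
   dir_energy s v u (fun x => exit_time Om x v))%E.
Proof.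
move=> v0 d0 ud uL2; apply/lee_addgt0Pr => e e0.
have nv0 : - v != 0 by rewrite oppr_eq0.
have I0 : (0 <= \int[leb]_x (u x ^+ 2)%:E)%E by apply: integral_ge0 => x _; rewrite lee_fin sqr_ge0.
have IE : (\int[leb]_x (u x ^+ 2)%:E)%E \is a fin_num by rewrite ge0_fin_numE.
pose K := (2 / d) `^ al * fine (\int[leb]_x (u x ^+ 2)%:E)%E.
have K0 : 0 <= K by rewrite mulr_ge0 ?powR_ge0// fine_ge0.
have [eta e01 he] := chord_err_small K0 e0.
have H := @direction_hardy_eta R n.+1 s v u (fun x => exit_time Om x (- v))
  (fun x => exit_time Om x v) s01 mu _ _ _ _ _ _ eta e01 d d0 ud uL2.
apply: (le_trans (H _ _ _ _ _ _)).
- exact: measurable_exit_time.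
- exact: measurable_exit_time.
- by move=> x; exact: exit_time_ge0.
- by move=> x; exact: exit_time_ge0.
- by move=> eta' y t; exact: chord_dom_shift.
- by move=> eta' y t; exact: chord_weight_shift.
rewrite leeD2l// -(fineK IE) -EFinM lee_fin; apply: le_trans he.
by rewrite /K mulrA (mulrC (chord_err s eta)).
Qed.

Lemma dir_neq0 (z : 'rV[R]_n) : dir z != 0.
Proof. by apply: contraTneq (enorm_dir_gt0 z) => ->; rewrite enorm0 ltxx. Qed.

Let mdz : measurable_fun setT (fun w : rV * 'rV[R]_n => dir w.2).
Proof. exact: (measurableT_comp (@measurable_dir R n) measurable_snd). Qed.

Let mndz : measurable_fun setT (fun w : rV * 'rV[R]_n => - dir w.2).
Proof.
apply: measurable_fun_rVP => i; under eq_fun do rewrite mxE.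
by apply: measurableT_comp => //; exact: (measurableT_comp (measurable_coor i) mdz).
Qed.

Definition gain_at (w : rV * 'rV[R]_n) : R := enorm (dir w.2) `^ (- N) *
     chord_gain s (exit_time Om w.1 (- dir w.2)) (exit_time Om w.1 (dir w.2)).

Lemma gain_at_ge0 w : 0 <= gain_at w.
Proof.
by rewrite mulr_ge0 ?powR_ge0// chord_gain_ge0// exit_time_ge0 ?oppr_eq0 ?dir_neq0.
Qed.

Lemma measurable_gain_at : measurable_fun setT gain_at.
Proof.
apply: measurable_funM.
  apply: (measurableT_comp (measurable_powR _)).
  exact: (measurableT_comp (@measurable_enorm R n.+1) mdz).
apply: measurable_chord_gain.
- apply: measurable_exit_time => //; by move=> w; rewrite oppr_eq0 dir_neq0.
- apply: measurable_exit_time => //; by move=> w; rewrite dir_neq0.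
- by move=> w; rewrite exit_time_ge0 ?oppr_eq0 ?dir_neq0.
- by move=> w; rewrite exit_time_ge0 ?dir_neq0.
Qed.

(** The Hardy weight delivered by all directions together; the lower bound is reduced to estimating
    this function from below. *)
Definition gain_density (x : rV) : \bar R := (\int[lebn]_z (gain_at (x, z))%:E)%E.

Lemma measurable_gain_density : measurable_fun setT gain_density.
Proof.
apply: (@measurable_fun_fubini_tonelli_F _ _ _ _ _ lebn (EFin \o gain_at)) => //=.
  by apply/measurable_EFinP; exact: measurable_gain_at.
by move=> w; rewrite lee_fin gain_at_ge0.
Qed.

Let Q (w : (rV * 'rV[R]_n) * measurableTypeR R) : \bar R :=
  ray_cut (dir w.1.2) (w.1.1, w.2).

Let mQ : measurable_fun setT Q.
Proof.
  apply: emeasurable_funM.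
    change (measurable_fun setT (fun w : (rV * 'rV[R]_n) * measurableTypeR R => (`|w.2 : R| ^+ n)%:E)).
    by apply/measurable_EFinP; apply: measurable_funX; exact: measurableT_comp.
  apply: (measurableT_comp measurable_pair_cut); apply: measurable_fun_pair.
    exact: (measurableT_comp measurable_fst measurable_fst).
  apply: measurable_fun_rVP => i; have -> : (fun w : (rV * 'rV[R]_n) * measurableTypeR R => (w.1.1 + (1 * w.2) *: dir w.1.2) ord0 i) =
    (fun w => w.1.1 ord0 i + (1 * w.2) * dir w.1.2 ord0 i).
    by apply/funext => w; rewrite mxE; congr (_ + _); rewrite mxE.
  apply: measurable_funD.
    exact: (measurableT_comp (measurable_coor i) (measurableT_comp measurable_fst measurable_fst)).
  apply: measurable_funM; first by apply: measurable_funM => //; exact: measurable_snd.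
  exact: (measurableT_comp (measurable_coor i) (measurableT_comp mdz measurable_fst)).
Qed.

Let Q0 w : (0 <= Q w)%E. Proof. exact: ray_cut_ge0. Qed.

Let S (w : rV * 'rV[R]_n) : \bar R := (\int[leb1]_t Q (w, t))%E.

Let mS : measurable_fun setT S.
Proof. exact: (@measurable_fun_fubini_tonelli_F _ _ _ _ _ leb1 Q). Qed.

Let S0 w : (0 <= S w)%E. Proof. by apply: integral_ge0 => t _. Qed.

Let SE z : (\int[leb]_x S (x, z) = \int[m2]_w ray_cut (dir z) w)%E.
Proof.
rewrite (fubini_tonelli1 _ (measurable_ray_cut (dir z)) (ray_cut_ge0 (dir z))).
by apply: eq_integral => x _.
Qed.

Lemma measurable_ray_total :
  measurable_fun setT (fun z => \int[m2]_w ray_cut (dir z) w)%E.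
Proof.
rewrite -(funext SE); exact: (@measurable_fun_fubini_tonelli_G _ _ _ _ _ leb S).
Qed.

Lemma pair_cut_polar :
  (\int[leb \x leb]_z pair_cut z = \int[lebn]_z \int[m2]_w ray_cut (dir z) w)%E.
Proof.
under [RHS]eq_integral do rewrite -SE.
have E := fubini_tonelli (m1 := leb) (m2 := lebn) S mS S0; rewrite -[RHS]E.
rewrite (fubini_tonelli1 _ measurable_pair_cut pair_cut_ge0); apply: eq_integral => x _.
rewrite /fubini_F.
have mx : measurable_fun setT (fun y => pair_cut (x, y)).
  by apply: measurableT_comp; [exact: measurable_pair_cut|exact: pair1_measurable].
have A := @ge0_integral_affine_rV R n.+1 1 x (fun y => pair_cut (x, y)) (oner_neq0 _) mx (fun y => pair_cut_ge0 _).
rewrite normr1 invr1 expr1n mul1e in A; rewrite -[LHS]A.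
have mx2 : measurable_fun setT (fun h : rV => pair_cut (x, 1 *: h + x)).
  exact: (measurableT_comp mx (measurable_affine_rV 1 x)).
rewrite (ge0_integral_polar mx2 (fun h => pair_cut_ge0 _)).
apply: eq_integral => z _; apply: eq_integral => t _.
rewrite /Q /ray_cut; cbn [fst snd]; congr (_ * pair_cut (_, _))%E.
by rewrite scale1r mul1r addrC.
Qed.

(** The one-dimensional inequalities averaged over the directions. The margin [d] keeps the exit
    times away from 0 on the support of [u], direction by direction, and does not enter the
    conclusion. *)
Theorem ground_state (d : R) : 0 < d ->
  (forall x y, u x != 0 -> enorm (y - x) < d -> Om y) ->
  (\int[leb]_x (u x ^+ 2)%:E < +oo)%E ->
  (2%:E * \int[leb]_x ((u x ^+ 2)%:E * gain_density x) <= \int[leb \x leb]_z pair_cut z)%E.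
Proof.
move=> d0 ud uL2.
have msq : measurable_fun setT (fun w : rV * 'rV[R]_n => u w.1 ^+ 2).
  by apply: measurable_funX; exact: (measurableT_comp mu measurable_fst).
pose P (w : rV * 'rV[R]_n) : \bar R := (u w.1 ^+ 2 * gain_at w)%:E.
have mP : measurable_fun setT P.
  by apply/measurable_EFinP; apply: measurable_funM => //; exact: measurable_gain_at.
have P0 w : (0 <= P w)%E by rewrite lee_fin mulr_ge0 ?sqr_ge0// gain_at_ge0.
have E1 : (\int[leb]_x ((u x ^+ 2)%:E * gain_density x) = \int[lebn]_z \int[leb]_x P (x, z))%E.
  have E := fubini_tonelli (m1 := leb) (m2 := lebn) P mP P0; rewrite -[RHS]E.
  apply: eq_integral => x _; rewrite /gain_density -ge0_integralZl//.
  - apply/measurable_EFinP; exact: (measurableT_comp measurable_gain_at (pair1_measurable x)).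
  - by move=> z _; rewrite lee_fin (gain_at_ge0 (x, z)).
  - by rewrite lee_fin sqr_ge0.
have P2 z : (0 <= \int[leb]_x P (x, z))%E by apply: integral_ge0 => x _.
have mP2 : measurable_fun setT (fun z => \int[leb]_x P (x, z))%E.
  exact: (@measurable_fun_fubini_tonelli_G _ _ _ _ _ leb P).
rewrite E1 pair_cut_polar -ge0_integralZl//.
apply: ge0_le_integral; first exact: measurableT.
- by move=> z _; rewrite mule_ge0.
- by apply: emeasurable_funM; first exact: measurable_cst.
- exact: measurable_ray_total.
move=> z _.
have v0 := dir_neq0 z.
rewrite -(ray_cut_double (dir z)).
rewrite lee_wpmul2l//; apply: le_trans (dir_energy_le v0).
have EP : (\int[leb]_x P (x, z) = (enorm (dir z) `^ (- N))%:E *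
   \int[leb]_x (u x ^+ 2 * chord_gain s (exit_time Om x (- dir z)) (exit_time Om x (dir z)))%:E)%E.
  rewrite -ge0_integralZl//.
  - apply: eq_integral => x _; rewrite -EFinM /P /gain_at; cbn [fst snd]; congr (_%:E); ring.
  - apply/measurable_EFinP; apply: measurable_funM; first exact: measurable_funX.
    apply: measurable_chord_gain.
    + by apply: measurable_exit_time => // w; rewrite oppr_eq0.
    + exact: measurable_exit_time.
    + by move=> w; rewrite exit_time_ge0 ?oppr_eq0.
    + by move=> w; rewrite exit_time_ge0.
  - by move=> x _; rewrite lee_fin mulr_ge0 ?sqr_ge0// chord_gain_ge0// exit_time_ge0 ?oppr_eq0.
  - by rewrite lee_fin powR_ge0.
rewrite EP lee_wpmul2l ?lee_fin ?powR_ge0//.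
have ev := enorm_dir_gt0 z.
(* Half of the Euclidean margin, so that the whole closed segment stays strictly within distance [d]
   of [x]. *)
have far (w : rV) (x : rV) : enorm w = enorm (dir z) -> w != 0 -> u x != 0 ->
    d / (2 * enorm (dir z)) <= exit_time Om x w.
  move=> we w0 ux; rewrite ltW//.
  have r0 : 0 <= d / (2 * enorm (dir z)) by rewrite divr_ge0 ?mulr_ge0 ?ltW.
  apply/(exit_time_gtP oOm bOm x w0 r0) => tau /andP[t0 t1]; apply: (ud x) => //.
  rewrite addrC addKr enormZ ger0_norm// we.
  apply: (@le_lt_trans _ _ (d / (2 * enorm (dir z)) * enorm (dir z))); first by rewrite ler_wpM2r// ltW.
  rewrite (_ : _ * _ = d / 2); last by field; rewrite gt_eqF.
  by rewrite gtr_pMr// invf_lt1// ltr1n.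
apply: (@direction_hardy _ (d / (2 * enorm (dir z)))) => //.
  by rewrite divr_gt0// mulr_gt0.
by move=> x ux; split; apply: far; rewrite ?enormN ?oppr_eq0.
Qed.

End ground_state.

(** * Geometry of the boundary *)

Section euclid.
Context {R : realType}.

Lemma coord_le_enorm n (x : 'rV[R]_n) i : `|x ord0 i| <= enorm x.
Proof.
rewrite -sqrtr_sqr /enorm ler_wsqrtr// (bigD1 i)//= lerDl.
by apply: sumr_ge0 => j _; exact: sqr_ge0.
Qed.

Lemma norm_le_enorm n (x : 'rV[R]_n) : `|x| <= enorm x.
Proof.
rewrite leNgt; apply/negP => h.
have x0 : 0 < `|x| by exact: le_lt_trans (enorm_ge0 x) h.
have : ball (0 : 'rV[R]_n) `|x| x.
  split => // i j; rewrite (ord1 i) -ball_normE /= mxE sub0r normrN.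
  exact: le_lt_trans (coord_le_enorm x j) h.
by rewrite -ball_normE /= sub0r normrN ltxx.
Qed.

Lemma dot_le n (x y : 'rV[R]_n) : dot x y <= enorm x * enorm y.
Proof.
have [y0|yn0] := eqVneq (enorm y) 0.
  rewrite y0 mulr0 (enorm_eq0 y0) dotC -(scale0r x) dotZl mul0r.
  by [].
have b0 : 0 < enorm y by rewrite lt_def yn0 enorm_ge0.
set a := enorm x; set b := enorm y; set c := dot x y.
have h : 0 <= b ^+ 2 * (a ^+ 2 * b ^+ 2 - c ^+ 2).
  have := sqr_ge0 (enorm (b ^+ 2 *: x - c *: y)).
  rewrite -dotxx -scaleNr dotDl !dotZl.
  rewrite !(dotC _ (b ^+ 2 *: x + _)) !dotDl !dotZl !dotxx (dotC y x) -/a -/b -/c.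
  by congr (0 <= _); ring.
rewrite pmulr_rge0 ?exprn_gt0// subr_ge0 -exprMn in h.
have ab0 : 0 <= a * b by rewrite mulr_ge0 ?enorm_ge0.
by apply: le_trans (ler_norm c) _; rewrite -ler_sqr ?nnegrE ?normr_ge0// real_normK ?num_real.
Qed.

Lemma norm_dot_le n (x y : 'rV[R]_n) : `|dot x y| <= enorm x * enorm y.
Proof.
rewrite ler_norml dot_le andbT lerNl.
have -> : - dot x y = dot (- x) y by rewrite -(scaleN1r x) dotZl mulN1r.
by rewrite -(enormN x) dot_le.
Qed.

Lemma enormD n (x y : 'rV[R]_n) : enorm (x + y) <= enorm x + enorm y.
Proof.
rewrite -ler_sqr ?nnegrE ?addr_ge0 ?enorm_ge0//.
rewrite -dotxx dotDl !(dotC _ (x + y)) !dotDl !dotxx (dotC y x).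
have := dot_le x y; rewrite sqrrD; lra.
Qed.

Lemma continuous_enorm n : continuous (@enorm R n).
Proof.
have H (s : seq 'I_n) : continuous (fun x : 'rV[R]_n => \sum_(i <- s) x ord0 i ^+ 2).
  elim: s => [|i s IH].
    have -> : (fun x : 'rV[R]_n => \sum_(i <- [::]) x ord0 i ^+ 2) = cst 0.
      by apply/funext => x; rewrite big_nil.
    exact: cst_continuous.
  have -> : (fun x : 'rV[R]_n => \sum_(i <- i :: s) x ord0 i ^+ 2) =
      (fun x => x ord0 i ^+ 2 + \sum_(i <- s) x ord0 i ^+ 2).
    by apply/funext => x; rewrite big_cons.
  move=> x.
  apply: (@cvgD _ _ _ (nbhs x) (nbhs_filter x)); last exact: IH.
  apply: (@continuous_comp _ _ _ (fun x : 'rV[R]_n => x ord0 i) (fun t => t ^+ 2)).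
    exact: coord_continuous.
  exact: exprn_continuous.
move=> x; apply: (@continuous_comp _ _ _ (fun x : 'rV[R]_n => \sum_i x ord0 i ^+ 2) Num.sqrt).
  exact: H.
exact: sqrt_continuous.
Qed.

Lemma nbhs_enorm n (x : 'rV[R]_n) (r : R) : 0 < r -> nbhs x (fun y => enorm (y - x) < r).
Proof.
move=> r0; have c : enorm (y - x) @[y --> x] --> (0 : R).
  rewrite -[X in _ --> X](@enorm0 R n) -(subrr x).
  apply: (@continuous_comp _ _ _ (fun y : 'rV[R]_n => y - x) (@enorm R n)).
    apply: (@cvgD _ _ _ (nbhs x) (nbhs_filter x) id (cst (- x))); first exact: cvg_id.
    exact: cvg_cst.
  exact: continuous_enorm.
exact: (cvgr_lt 0 c).
Qed.

Lemma dot_mulmx n (x y : 'rV[R]_n) : dot x y = (x *m y^T) ord0 ord0.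
Proof. by rewrite mxE; apply: eq_bigr => i _; rewrite mxE. Qed.

Lemma enorm_mulmx n (Q : 'M[R]_n) (x : 'rV[R]_n) : Q *m Q^T = 1%:M -> enorm (x *m Q) = enorm x.
Proof.
move=> QQ; apply/eqP; rewrite -(@eqrXn2 _ 2) ?enorm_ge0//; apply/eqP.
by rewrite -!dotxx !dot_mulmx trmx_mul mulmxA -(mulmxA x) QQ mulmx1.
Qed.

Lemma mvt_line (f df : R -> R) (t : R) : (forall x : R, is_derive x 1 f (df x)) ->
  exists2 xi, `|xi| <= `|t| & f t - f 0 = df xi * t.
Proof.
move=> d; have cf x : {for x, continuous f} := is_derive_continuous (d x).
have cf' (a b : R) : {within `[a, b], continuous f}.
  by apply: continuous_subspaceT => x; exact: cf.
have [t0|t0] := leP 0 t.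
  have [c] := MVT_segment t0 (fun x _ => d x) (cf' 0 t); rewrite in_itv/= subr0 => /andP[c0 ct] e.
  by exists c => //; rewrite !ger0_norm.
have [c] := MVT_segment (ltW t0) (fun x _ => d x) (cf' t 0); rewrite in_itv/= sub0r => /andP[c0 ct] e.
exists c; first by rewrite !ler0_norm ?(ltW t0)// lerN2.
by rewrite -opprB e mulrN opprK.
Qed.

Lemma is_derive_line n (g : 'rV[R]_n -> R) (b v : 'rV[R]_n) (t : R) :
  derivable g (b + t *: v) v -> is_derive t 1 (fun t => g (b + t *: v)) ('D_v g (b + t *: v)).
Proof.
have E : (fun h : R => h^-1 *: (g (b + (h *: (1 : R) + t) *: v) - g (b + t *: v))) =
   (fun h : R => h^-1 *: (g (h *: v + (b + t *: v)) - g (b + t *: v))).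
  apply/funext => h; congr (_ *: (g _ - _)).
  by rewrite scalerDl /GRing.scale/= mulr1 addrCA.
move=> dg; split; first by rewrite /derivable E.
by rewrite /derive E.
Qed.

(** Coordinates are changed one at a time, so only derivatives along the axes occur: the mean value
    theorem on each leg, then the Lipschitz bound for the partial derivative against its value at
    [a]. *)
Lemma C11_taylor n (g : 'rV[R]_n -> R) : class_C11 g ->
  exists2 L : R, 0 <= L & forall a k,
    `|g (a + k) - g a - \sum_j k ord0 j * 'D_('e_j) g a| <= L * enorm k ^+ 2.
Proof.
move=> [[cg dg] lg].
have /boolp.choice[l Hl] : forall j : 'I_n, exists lj : R, 0 <= lj /\ forall x y,
    `|'D_('e_j) g x - 'D_('e_j) g y| <= lj * `|x - y|.
  move=> j.
  have [M [_ HM]] := lg j; exists (`|M| + 1); split; first by rewrite addr_ge0.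
  have := HM (`|M| + 1) _; rewrite (le_lt_trans (ler_norm M)) ?ltrDl// => /(_ isT) H x y.
  by apply: (H (x, y)).
exists (\sum_j l j); first by apply: sumr_ge0 => j _; case: (Hl j).
move=> a k.
pose A (m : nat) : 'rV[R]_n := \row_j (a ord0 j + (if (j < m)%N then k ord0 j else 0)).
have A0 : A 0%N = a by apply/rowP => j; rewrite mxE addr0.
have An : A n = a + k by apply/rowP => j; rewrite !mxE ltn_ord.
have AS (j : 'I_n) : A j.+1 = A j + k ord0 j *: 'e_j.
  apply/rowP => i; rewrite !mxE eqxx/=; have [->|ij] := eqVneq i j.
    by rewrite ltnS leqnn ltnn mulr1 addr0.
  rewrite mulr0 addr0 ltnS leq_eqVlt; congr (_ + _).
  by rewrite (_ : (nat_of_ord i == j) = false)//; apply/negbTE.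
have tel : g (a + k) - g a = \sum_(j < n) (g (A j.+1) - g (A j)).
  by rewrite -An -A0 -(telescope_sumr (g \o A)) ?leq0n// big_mkord.
rewrite tel -sumrB mulr_suml; apply: le_trans (ler_norm_sum _ _ _) _.
apply: ler_sum => j _; have [lj0 Lj] := Hl j.
have [dgj _] := dg j.
have [xi xik E] := @mvt_line (fun t => g (A j + t *: 'e_j)) (fun t => 'D_('e_j) g (A j + t *: 'e_j))
  (k ord0 j) (fun t => is_derive_line (dgj _)).
rewrite AS; move: E; rewrite scale0r addr0 => ->.
rewrite (mulrC (k ord0 j)) -mulrBl normrM.
have h1 : `|A j + xi *: 'e_j - a| <= enorm k.
  apply: le_trans (norm_le_enorm _) _; rewrite /enorm ler_wsqrtr//.
  apply: ler_sum => i _; rewrite !mxE eqxx/=.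
  have [->|ij] := eqVneq i j.
    rewrite ltnn addr0 mulr1 addrAC subrr add0r.
    by rewrite -(real_normK (num_real xi)) -[leRHS](real_normK (num_real _)) ler_sqr ?nnegrE.
  rewrite mulr0 addr0 addrAC subrr add0r; case: ifP => // _.
  by rewrite expr0n sqr_ge0.
apply: (@le_trans _ _ (l j * enorm k * enorm k)); last by rewrite -mulrA expr2.
apply: ler_pM => //; last exact: coord_le_enorm.
by apply: le_trans (Lj _ _) _; rewrite ler_wpM2l.
Qed.

End euclid.

Section boundary_geometry.
Context {R : realType} {n : nat}.
Local Notation rV := 'rV[R]_n.+1.

(** [nu] is the rotated and normalised gradient (1, -Dg) of the function x_i - g, and the Taylor
    remainder gives quadratic contact from both sides. Each conclusion assumes only one-sided
    information on [y]: a point outside [Om] lies on or below the graph, a point of the closure on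
    or above it. *)
Lemma chart_normal (Om : set rV) (y0 : rV) (r : R) (Q : 'M[R]_n.+1) (i : 'I_n.+1)
    (g : 'rV[R]_n.+1.-1 -> R) :
  0 < r -> Q *m Q^T = 1%:M -> class_C11 g ->
  (forall x, eball y0 r x -> (Om x <-> g (col' i (x *m Q)) < (x *m Q) ord0 i)) ->
  exists2 K : R, 0 <= K & forall y, eball y0 (r / 2) y ->
  exists2 nu : rV, enorm nu = 1 & forall h, enorm h < r / 2 ->
    ((y *m Q) ord0 i <= g (col' i (y *m Q)) -> dot h nu < - K * enorm h ^+ 2 -> ~ Om (y + h)) /\
    (g (col' i (y *m Q)) <= (y *m Q) ord0 i -> K * enorm h ^+ 2 < dot h nu -> Om (y + h)).
Proof.
move=> r0 QQ C11g chart; have [L L0 HL] := C11_taylor C11g.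
exists L => // y yr; set a := col' i (y *m Q).
pose D (j : 'I_n) := 'D_('e_j) g a.
pose Nh : rV := \row_l (if unlift i l is Some j then - D j else 1).
have dotN (H : rV) : dot H Nh = H ord0 i - \sum_j (col' i H) ord0 j * D j.
  rewrite /dot (bigD1_ord i)//= mxE unlift_none mulr1; congr (_ + _).
  rewrite -sumrN; apply: eq_bigr => j _; rewrite !mxE liftK mulrN.
  by congr (- (H _ _ * _)).
(* The entry 1 of [Nh] makes its norm at least 1, so the normalisation does not force a larger
   constant than [L]. *)
have N1 : 1 <= enorm Nh.
  by apply: le_trans (coord_le_enorm Nh i); rewrite mxE unlift_none normr1.
have N0 : 0 < enorm Nh by exact: lt_le_trans N1.
have QQ' : Q^T *m Q^T^T = 1%:M by rewrite trmxK; apply: mulmx1C.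
have dotQ h : dot h (Nh *m Q^T) = dot (h *m Q) Nh.
  by rewrite !dot_mulmx trmx_mul trmxK mulmxA.
exists ((enorm Nh)^-1 *: (Nh *m Q^T)).
  by rewrite enormZ enorm_mulmx// gtr0_norm ?invr_gt0// mulVf ?gt_eqF.
move=> h hr; rewrite dotC dotZl dotC dotQ dotN.
have yh : eball y0 r (y + h).
  rewrite /eball /= addrAC; apply: le_lt_trans (enormD _ _) _.
  by rewrite /eball /= in yr; lra.
have [ch1 ch2] := chart _ yh.
set H := h *m Q; set T := H ord0 i - _.
have colD : col' i ((y + h) *m Q) = a + col' i H.
  by apply/rowP => j; rewrite mulmxDl !mxE.
have hD : ((y + h) *m Q) ord0 i = (y *m Q) ord0 i + H ord0 i by rewrite mulmxDl mxE.
have := HL a (col' i H); rewrite ler_norml => /andP[t1 t2].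
have kh : enorm (col' i H) ^+ 2 <= enorm h ^+ 2.
  rewrite -(enorm_mulmx h QQ) -/H !enorm_sqr [leRHS](bigD1_ord i)//=.
  rewrite -[leLHS]add0r lerD ?sqr_ge0//; apply: ler_sum => j _; rewrite mxE.
  by [].
have Lkh : L * enorm (col' i H) ^+ 2 <= L * enorm h ^+ 2 by exact: ler_wpM2l.
have i1 : (enorm Nh)^-1 <= 1 by rewrite invf_le1.
have i0 : 0 < (enorm Nh)^-1 by rewrite invr_gt0.
have q0 : 0 <= L * enorm h ^+ 2 by rewrite mulr_ge0 ?sqr_ge0.
rewrite colD hD in ch1 ch2.
split=> hy hd.
  move=> /ch1 hlt.
  have TL : - (L * enorm h ^+ 2) < T by rewrite /T; lra.
  have [T0|T0] := leP 0 T.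
    have : 0 <= (enorm Nh)^-1 * T by rewrite mulr_ge0// ltW.
    by lra.
  have : 0 <= (1 - (enorm Nh)^-1) * (- T) by rewrite mulr_ge0 ?subr_ge0// oppr_ge0 ltW.
  rewrite mulrBl mul1r mulrN.
  by lra.
apply: ch2.
have TL : L * enorm h ^+ 2 < T.
  have [T0|T0] := leP T 0.
    have : (enorm Nh)^-1 * T <= 0 by rewrite mulr_ge0_le0// ltW.
    by lra.
  by apply: (lt_le_trans hd); rewrite ler_piMl// ltW.
by move: TL; rewrite /T; lra.
Qed.

Variable Om : set rV.
Hypotheses (oOm : open Om) (bOm : bounded_set Om).

(** For K > 0 the condition on [dot h nu] describes the open ball of radius 1/(2K) centred at y -
    nu/(2K), tangent at [y]. A single number stands for curvature and range, which lets compactness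
    choose it. *)
Definition exterior_normal (K : R) (y nu : rV) : Prop := enorm nu = 1 /\
  forall h, enorm h < K^-1 -> dot h nu < - K * enorm h ^+ 2 -> ~ Om (y + h).

Lemma boundary_notin y : boundary Om y -> ~ Om y.
Proof. by move=> [_ ni] Oy; apply: ni; move/interior_id: oOm => ->. Qed.

Lemma closure_bounded : bounded_set (closure Om).
Proof.
have [M [Mr HM]] := bOm; exists (M + 1); split; first by rewrite num_real.
move=> x Mx y cy; have [z [Oz yz]] := cy _ (nbhsx_ballx y 1 ltr01).
have h : `|z| <= x - 1 by apply: (HM (x - 1)) => //; lra.
rewrite -ball_normE /= in yz.
change (`|y| <= x); rewrite -(subrK z y); apply: le_trans (ler_normD _ _) _; lra.
Qed.

Lemma boundary_compact : compact (boundary Om).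
Proof.
apply: bounded_closed_compact.
  have [M [Mr HM]] := closure_bounded; exists M; split => // x Mx y [cy _].
  exact: HM cy.
apply: closedI; first exact: closed_closure.
by apply: open_closedC; exact: open_interior.
Qed.

Lemma exit_point_boundary (x w : rV) : w != 0 -> Om x ->
  boundary Om (x + exit_time Om x w *: w).
Proof.
move=> w0 Ox; set e := exit_time Om x w.
have e0 : 0 < e by apply/exit_time_gt0.
have vis t : 0 <= t -> t < e -> Om (x + t *: w).
  by move=> t0 te; apply: (elimT (exit_time_gtP oOm bOm x w0 t0) te); rewrite t0 lexx.
split.
  move=> B /(@continuous_ray _ _ x w _) /nbhs_ballP[r /= r0 Hr].
  pose t := Num.max 0 (e - r / 2).
  have t0 : 0 <= t by rewrite le_max lexx.
  have te : t < e by rewrite gt_max e0 gtrBl divr_gt0.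
  exists (x + t *: w); split; first exact: vis.
  apply: Hr; rewrite -ball_normE /= gtr0_norm ?subr_gt0//.
  have : e - r / 2 <= t by rewrite le_max lexx orbT.
  lra.
move/interior_id: oOm => -> Oe.
have : e < e.
  apply/(exit_time_gtP oOm bOm x w0 (ltW e0)) => t /andP[t0].
  by rewrite le_eqVlt => /orP[/eqP -> //|te]; exact: vis.
by rewrite ltxx.
Qed.

Lemma boundary_nonempty x : Om x -> boundary Om !=set0.
Proof.
move=> Ox; have w0 : (const_mx 1 : rV) != 0.
  by apply/eqP => /rowP/(_ ord0)/eqP; rewrite !mxE oner_eq0.
by exists (x + exit_time Om x (const_mx 1) *: const_mx 1); exact: exit_point_boundary.
Qed.

Local Notation delta := (dist_boundary Om).

Lemma dist_boundary_le x y : boundary Om y -> delta x <= enorm (x - y).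
Proof.
move=> By; apply: ge_inf; last by exists y.
by exists 0 => _ [z _ <-]; exact: enorm_ge0.
Qed.

Lemma dist_boundary_attained x : Om x -> exists2 y, boundary Om y & enorm (x - y) = delta x.
Proof.
move=> Ox; have cf : {within boundary Om, continuous (fun y => enorm (x - y))}.
  apply: continuous_subspaceT.
  have -> : (fun y => enorm (x - y)) = (fun y => enorm (y - x)).
    by apply/funext => y; rewrite -enormN opprB.
  move=> y; apply: (@continuous_comp _ _ _ (fun y : rV => y - x) (@enorm R n.+1)).
    apply: (@cvgD _ _ _ (nbhs y) (nbhs_filter y) id (cst (- x))); first exact: cvg_id.
    exact: cvg_cst.
  exact: continuous_enorm.
have [y yB Hy] := EVT_min_rV (boundary_nonempty Ox) boundary_compact cf.
exists y; first exact: set_mem.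
apply/eqP; rewrite eq_le (dist_boundary_le _ (set_mem yB)) andbT.
apply: lb_le_inf; first by exists (enorm (x - y)); exists y => //; exact: set_mem.
by move=> _ [z Bz <-]; apply: Hy; exact: mem_set.
Qed.

Lemma dist_boundary_gt0 x : Om x -> 0 < delta x.
Proof.
move=> Ox; have [y By <-] := dist_boundary_attained Ox.
rewrite lt_def enorm_ge0 andbT; apply/eqP => /enorm_eq0 /eqP; rewrite subr_eq0 => /eqP xy.
by apply: (boundary_notin By); rewrite -xy.
Qed.

Lemma dist_boundary_ball x y : Om x -> enorm (y - x) < delta x -> Om y.
Proof.
move=> Ox yx; have [->//|yx0] := eqVneq y x.
have w0 : y - x != 0 by rewrite subr_eq0.
have := dist_boundary_le x (exit_point_boundary w0 Ox).
set e := exit_time _ _ _; have e0 : 0 <= e by exact: exit_time_ge0.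
rewrite opprD addrA subrr add0r enormN enormZ ger0_norm// => h.
have e1 : 1 < e.
  rewrite ltNge; apply/negP => e1; have := lt_le_trans yx h.
  by rewrite ltNge ler_piMl ?enorm_ge0.
have := elimT (exit_time_gtP oOm bOm x w0 ler01) e1 1.
by rewrite scale1r addrC subrK; apply; rewrite ler01 lexx.
Qed.

(** Compactness of the boundary in covering form, with an integer [k] tending to infinity: near each
    boundary point every large [k] is admissible. *)
Lemma uniform_exterior_normal : C11_boundary Om ->
  exists2 K : R, 0 < K & forall y, boundary Om y -> exists nu, exterior_normal K y nu.
Proof.
move=> C11.
have /compact_near_coveringP cB := boundary_compact.
have : \forall k \near \oo, boundary Om `<=`
    (fun y => boundary Om y -> exists nu, exterior_normal k.+1%:R y nu).
  apply: cB => y0 By0; have [r [Q [i [g [r0 QQ C11g ch]]]]] := C11 _ By0.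
  have [K K0 HK] := chart_normal r0 QQ C11g ch.
  have r2 : 0 < r / 2 by rewrite divr_gt0.
  near=> y k => /= By.
  have yr : eball y0 (r / 2) y by near: y; exact: nbhs_enorm.
  have kr : k.+1%:R^-1 < r / 2 by near: k; exact: (near_infty_natSinv_lt (PosNum r2)).
  have kK : K <= k.+1%:R.
    near: k; exists (Num.truncn K) => // m /= Km; apply: ltW.
    by apply: (lt_le_trans (truncnS_gt K)); rewrite ler_nat.
  have [nu nu1 Hnu] := HK _ yr; exists nu; split => // h hk hd.
  have [+ _] := Hnu h (lt_trans hk kr); apply.
    have yr' : eball y0 r y by rewrite /eball /=; rewrite /eball /= in yr; lra.
    rewrite leNgt; apply/negP => /(ch _ yr').2; exact: boundary_notin.
  apply: (lt_le_trans hd); rewrite !mulNr lerN2 ler_wpM2r ?sqr_ge0//.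
move=> [k _ /(_ k (leqnn k)) Hk].
by exists k.+1%:R; [exact: ltr0Sn|move=> y By; exact: Hk].
Unshelve. all: by end_near. Qed.

(** The ball of radius [delta x] around [x] lies in [Om] and touches the exterior ball at [y]. Were
    x - y not along [nu], a small step from [y] in the direction w - d nu would enter both balls at
    once. *)
Lemma nearest_point_normal (K : R) (x y nu : rV) : 0 < K -> Om x -> boundary Om y ->
  enorm (x - y) = delta x -> exterior_normal K y nu -> x = y + delta x *: nu.
Proof.
move=> K0 Ox By xy [nu1 Hnu]; have d0 : 0 < delta x by exact: dist_boundary_gt0.
have Hball z : enorm (z - x) < delta x -> Om z by exact: dist_boundary_ball.
move: d0 xy Hball; move: (delta x) => d d0 xy Hball.
have [w xE] : exists w, x = y + w by exists (x - y); rewrite addrC subrK.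
rewrite xE addrAC subrr add0r in xy; set g := d - dot w nu.
have wnu : enorm (w - d *: nu) ^+ 2 = 2 * d * g.
  rewrite -dotxx -scaleNr dotDl dotZl !(dotC _ (w + _)) !dotDl !dotZl !dotxx (dotC nu w).
  by rewrite xy nu1 /g; ring.
have g0 : 0 <= g.
  by have := sqr_ge0 (enorm (w - d *: nu)); rewrite wnu pmulr_rge0// mulr_gt0.
have [g00|gn0] := eqVneq g 0.
  move: wnu; rewrite g00 mulr0 => /eqP; rewrite sqrf_eq0 => /eqP /enorm_eq0 /eqP.
  by rewrite subr_eq0 => /eqP wE; rewrite -wE.
have gp : 0 < g by rewrite lt_def gn0.
exfalso.
pose c := enorm (w - d *: nu); have c0 : 0 <= c by exact: enorm_ge0.
(* Small enough for three requirements at once: the step is shorter than 1/K, the product t (2 d K)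
   is below 1, and 2 t <= 1. *)
pose t := (1 + 2 * d * K + K * c)^-1 / 2.
have den1 : 0 < 2 * d * K by rewrite !mulr_gt0.
have den2 : 0 <= K * c by rewrite mulr_ge0// ltW.
have den : 0 < 1 + 2 * d * K + K * c by lra.
have t0 : 0 < t by rewrite divr_gt0// invr_gt0.
have tE : t * (1 + 2 * d * K + K * c) = 2^-1.
  by rewrite /t mulrAC mulVf ?mul1r// gt_eqF.
have td : 0 < t * (2 * d * K) by rewrite mulr_gt0.
have tc : 0 <= t * (K * c) by rewrite mulr_ge0// ltW.
have tEE : t + t * (2 * d * K) + t * (K * c) = 2^-1 by rewrite -tE; ring.
have h1 : enorm (t *: (w - d *: nu)) < K^-1.
  rewrite enormZ gtr0_norm// -/c -(ltr_pM2l K0) mulfV ?gt_eqF// mulrCA; lra.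
have hsq : enorm (t *: (w - d *: nu)) ^+ 2 = t ^+ 2 * (2 * d * g).
  by rewrite enormZ exprMn wnu real_normK ?num_real.
have hnu : dot (t *: (w - d *: nu)) nu = - (t * g).
  by rewrite dotZl -scaleNr dotDl dotZl dotxx nu1 /g; ring.
have h2 : dot (t *: (w - d *: nu)) nu < - K * enorm (t *: (w - d *: nu)) ^+ 2.
  rewrite hnu hsq mulNr ltrN2 (_ : K * _ = (t * (2 * d * K)) * (t * g)); last by ring.
  have ht : t * (2 * d * K) < 1.
    have aux (a b e : R) : e + a + b = 2^-1 -> 0 < e -> 0 <= b -> a < 1 by lra.
    exact: aux tEE t0 tc.
  have tg : 0 < t * g by rewrite mulr_gt0.
  by rewrite -[X in _ < X]mul1r (ltr_pM2r tg).
apply: (Hnu _ h1 h2); apply: Hball.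
rewrite -ltr_sqr ?nnegrE ?enorm_ge0 ?(ltW d0)//.
have -> : y + t *: (w - d *: nu) - x = t *: (w - d *: nu) + (- 1) *: w.
  by rewrite xE scaleN1r opprD addrACA subrr add0r.
rewrite -dotxx dotDl [X in _ + X < _]dotZl !(dotC _ (t *: _ + _)) !dotDl.
rewrite !(dotZl (- 1)) !dotxx hsq xy (dotC w).
have -> : dot (t *: (w - d *: nu)) w = t * d * g.
  by rewrite dotZl -scaleNr dotDl dotZl dotxx xy (dotC nu) /g; ring.
have tdg : 0 < t * d * g by apply: mulr_gt0 => //; exact: mulr_gt0.
have -> : t ^+ 2 * (2 * d * g) = (2 * t) * (t * d * g) by ring.
have t12 : 2 * t <= 1.
  have aux (a b e : R) : e + a + b = 2^-1 -> 0 < a -> 0 <= b -> 2 * e <= 1 by lra.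
  exact: aux tEE td tc.
have : (2 * t) * (t * d * g) <= t * d * g by rewrite ler_piMl// ltW.
by move: tdg; move: (t * d * g) (2 * t * _) => P1 P2; lra.
Qed.

(** At time d / (|w| c) the ray crosses the tangent hyperplane; a relative delay of 7 K d / c^2 puts
    it inside the exterior ball. Its displacement from [y] is then at most (5/2) d / c, and 7
    exceeds (5/2)^2. *)
Lemma exit_time_le (K c d : R) (x y nu w : rV) : 0 < K -> 0 < d -> 0 < c <= 1 -> w != 0 ->
  exterior_normal K y nu -> x = y + d *: nu -> dot w nu = - (c * enorm w) ->
  7 * K * d / c ^+ 2 <= 2^-1 ->
  exit_time Om x w <= d / (enorm w * c) * (1 + 7 * K * d / c ^+ 2).
Proof.
move=> K0 d0 /andP[c0 c1] w0 [nu1 Hnu] -> wnu; set eta := 7 * K * d / c ^+ 2 => eta2.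
have W0 : 0 < enorm w.
  by rewrite lt_def enorm_ge0 andbT; apply: contra w0 => /eqP /enorm_eq0 ->.
have c20 : 0 < c ^+ 2 by rewrite exprn_gt0.
have eta0 : 0 < eta by rewrite divr_gt0 ?mulr_gt0.
set tau := d / _ * _; have tau0 : 0 < tau by rewrite mulr_gt0 ?divr_gt0 ?mulr_gt0// ltr_wpDl.
rewrite leNgt; apply/negP => /(exit_time_gtP oOm bOm _ w0 (ltW tau0)) /(_ tau).
rewrite lexx (ltW tau0) => /(_ isT); rewrite -addrA; apply: Hnu.
- apply: le_lt_trans (enormD _ _) _; rewrite !enormZ nu1 mulr1 !gtr0_norm//.
  have -> : tau * enorm w = d / c * (1 + eta) by rewrite /tau; field; rewrite !gt_eqF.
  have : d <= d / c by rewrite ler_pdivlMr// ler_piMr// ltW.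
  have dc : 0 < d / c by rewrite divr_gt0.
  have : 14 * K * (d / c) <= 1.
    apply: (@le_trans _ _ c) => //; have := eta2; rewrite /eta ler_pdivrMr// => h.
    rewrite mulrA ler_pdivrMr//; rewrite expr2 in h; lra.
  rewrite -[X in _ -> _ -> _ < X]mul1r ltr_pdivlMr// => h1 h2.
  have h3 : d / c * (1 + eta) <= d / c * (3 / 2) by rewrite ler_wpM2l ?(ltW dc)//; lra.
  apply: (@le_lt_trans _ _ ((d / c + d / c * (3 / 2)) * K)); first by apply: ler_wpM2r; [exact: ltW|lra].
  have : 0 < K * (d / c) by rewrite mulr_gt0.
  lra.
have hnu : dot (d *: nu + tau *: w) nu = - (d * eta).
  rewrite dotDl !dotZl dotxx nu1 wnu /tau; field; by rewrite !gt_eqF.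
rewrite hnu mulNr ltrN2.
have -> : d * eta = K * (7 * d ^+ 2 / c ^+ 2) by rewrite /eta; field; rewrite gt_eqF.
rewrite ltr_pM2l//.
have : enorm (d *: nu + tau *: w) <= 5 / 2 * (d / c).
  apply: le_trans (enormD _ _) _; rewrite !enormZ nu1 mulr1 !gtr0_norm//.
  have -> : tau * enorm w = d / c * (1 + eta) by rewrite /tau; field; rewrite !gt_eqF.
  have : d <= d / c by rewrite ler_pdivlMr// ler_piMr// ltW.
  have dc : 0 < d / c by rewrite divr_gt0.
  have h3 : d / c * (1 + eta) <= d / c * (3 / 2) by rewrite ler_wpM2l ?(ltW dc)//; lra.
  lra.
rewrite -ler_sqr ?nnegrE ?enorm_ge0 ?mulr_ge0 ?invr_ge0 ?(ltW c0) ?(ltW d0)// => h.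
apply: (le_lt_trans h); have -> : (5 / 2 * (d / c)) ^+ 2 = 25 / 4 * (d ^+ 2 / c ^+ 2).
  by field; rewrite gt_eqF.
have : 0 < d ^+ 2 / c ^+ 2 by rewrite divr_gt0// exprn_gt0.
by rewrite -mulrA; lra.
Qed.

End boundary_geometry.

(** * Lower bound for the gain *)

Opaque Gamma exit_time lebesgue_rV.

Section convexity.
Context {R : realType}.

Lemma powR_tangent (r x y : R) : 1 <= r -> 0 < x -> 0 <= y ->
  x `^ r + r * x `^ (r - 1) * (y - x) <= y `^ r.
Proof.
move=> r1 x0 y0; have yx0 : 0 <= y / x by rewrite divr_ge0// ltW.
have := powR_ge_bernoulli r1 yx0; rewrite -(ler_pM2l (powR_gt0 r x0)).
have -> : x `^ r * (y / x) `^ r = y `^ r.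
  by rewrite -powRM ?(ltW x0)// mulrC divfK ?gt_eqF.
apply: le_trans; rewrite powRB1// le_eqVlt; apply/orP; left; apply/eqP; field.
by rewrite gt_eqF.
Qed.

Lemma powR_spread (r x m1 m2 y : R) : 1 <= r -> 0 <= x -> x <= m1 -> m1 <= m2 -> x + y = m1 + m2 ->
  m1 `^ r + m2 `^ r <= x `^ r + y `^ r.
Proof.
move=> r1 x0 xm m12 e.
have [m10|m1n] := eqVneq m1 0.
  have -> : x = m1 by lra.
  by have -> : y = m2 by lra.
have m1p : 0 < m1 by rewrite lt_def m1n; lra.
have m2p : 0 < m2 by exact: lt_le_trans m12.
have y0 : 0 <= y by lra.
have h1 := powR_tangent r1 m1p x0; have h2 := powR_tangent r1 m2p y0.
have h3 : m1 `^ (r - 1) <= m2 `^ (r - 1).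
  by apply: ge0_ler_powR; rewrite ?nnegrE ?(ltW m1p) ?(ltW m2p)//; lra.
have h4 : 0 <= r * (m2 `^ (r - 1) - m1 `^ (r - 1)) * (m1 - x).
  by rewrite !mulr_ge0 ?subr_ge0//; lra.
have yE : y - m2 = m1 - x by lra.
rewrite yE in h2; lra.
Qed.

(** By convexity, of two pairs with the same sum the more spread one has the larger sum of powers;
    the two cases only order the inner pair. *)
Lemma powR_gap_le (r a b b' : R) : 1 <= r -> 0 <= a -> 0 <= b -> b <= b' ->
  (a + b) `^ r - a `^ r - b `^ r <= (a + b') `^ r - a `^ r - b' `^ r.
Proof.
move=> r1 a0 b0 bb; have [h|h] := leP (a + b) b'.
  have := @powR_spread r b (a + b) b' (a + b') r1 b0 _ h; lra.
have := @powR_spread r b b' (a + b) (a + b') r1 b0 bb (ltW h); lra.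
Qed.

Lemma chord_gainC (s p q : R) : chord_gain s p q = chord_gain s q p.
Proof. by rewrite /chord_gain (addrC p^-1); congr (_ + _ * _); ring. Qed.

Lemma powR_le_add (r a b : R) : 0 <= r -> 0 <= a -> 0 <= b -> a `^ r <= (a + b) `^ r.
Proof.
by move=> r0 a0 b0; apply: ge0_ler_powR; rewrite ?nnegrE ?addr_ge0 ?lerDl.
Qed.

Lemma chord_gain_ge_kap (s p q : R) : 2^-1 < s < 1 -> 0 < p -> 0 < q ->
  kap s * p^-1 `^ (2 * s) <= chord_gain s p q.
Proof.
move=> s01 p0 q0; have /andP[h1 h2] := s01; have k0 := kap_gt0 s01.
have ip : 0 < p^-1 by rewrite invr_gt0.
have iq : 0 < q^-1 by rewrite invr_gt0.
rewrite /chord_gain -[leLHS]addr0 lerD//.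
  by rewrite ler_pM2l// powR_le_add ?(ltW ip) ?(ltW iq)//; lra.
apply: mulr_ge0; first by rewrite invr_ge0; lra.
rewrite -addrA -opprD subr_ge0; apply: superadditive_powR; rewrite ?(ltW ip) ?(ltW iq)//; lra.
Qed.

(** 1/q is lowered to [b] by monotonicity of the gap; then the tangent at 1/p bounds the gap below
    by 2s b p^(1-2s) - b^(2s), where 1/p >= Q b. *)
Lemma chord_gain_ge (s p q b Q : R) : 2^-1 < s < 1 -> 0 < p -> 0 < q -> 0 < b -> 0 < Q ->
  b <= q^-1 -> Q * b <= p^-1 ->
  kap s * p^-1 `^ (2 * s) + (2 * s)^-1 * (b `^ (2 * s) * (2 * s * Q `^ (2 * s - 1) - 1)) <=
  chord_gain s p q.
Proof.
move=> s01 p0 q0 b0 Q0 bq Qb; have /andP[h1 h2] := s01; have k0 := kap_gt0 s01.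
have ip : 0 < p^-1 by rewrite invr_gt0.
have iq : 0 < q^-1 by rewrite invr_gt0.
rewrite /chord_gain lerD//.
  by rewrite ler_pM2l// powR_le_add ?(ltW ip) ?(ltW iq)//; lra.
rewrite ler_pM2l ?invr_gt0; last lra.
have r1 : 1 <= 2 * s by lra.
apply: le_trans (powR_gap_le r1 (ltW ip) (ltW b0) bq).
have pb : 0 <= p^-1 + b by rewrite addr_ge0 ?ltW.
have := powR_tangent r1 ip pb; rewrite addrAC subrr add0r => t.
have t2 : (Q * b) `^ (2 * s - 1) <= p^-1 `^ (2 * s - 1).
  by apply: ge0_ler_powR; rewrite ?nnegrE ?mulr_ge0 ?(ltW Q0) ?(ltW b0) ?(ltW ip)//; lra.
have bE : b `^ (2 * s) = b `^ (2 * s - 1) * b.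
  by rewrite -(powRD1 (2 * s - 1) b0); congr (_ `^ _); ring.
rewrite powRM ?(ltW Q0) ?(ltW b0)// in t2.
have t3 : 2 * s * b * (Q `^ (2 * s - 1) * b `^ (2 * s - 1)) <= 2 * s * b * p^-1 `^ (2 * s - 1).
  by apply: ler_wpM2l => //; rewrite mulr_ge0// ?(ltW b0)//; lra.
have -> : b `^ (2 * s) * (2 * s * Q `^ (2 * s - 1) - 1) =
   2 * s * b * (Q `^ (2 * s - 1) * b `^ (2 * s - 1)) - b `^ (2 * s) by rewrite bE; ring.
lra.
Qed.

Lemma Gamma_ge (x : R) : 2^-1 <= x -> expR (- 2) / 2 <= Gamma x.
Proof.
move=> x2; have x0 : 0 < x by lra.
rewrite -lee_fin -GammaE//.
apply: (@le_trans _ _ (\int[@lebesgue_measure R]_(t in `[1%R, 2%R]) (t `^ (x - 1) * expR (- t))%:E)%E); last first.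
  apply: ge0_subset_integral => //.
  - by apply/measurable_EFinP; exact: measurable_Gamma_integrand.
  - by move=> t _; rewrite lee_fin mulr_ge0 ?powR_ge0 ?expR_ge0.
  - by move=> t /=; rewrite !in_itv/= => /andP[t1 _]; rewrite andbT (lt_le_trans _ t1).
apply: (@le_trans _ _ (\int[@lebesgue_measure R]_(t in `[1%R, 2%R]) (expR (- 2) / 2)%:E)%E).
  rewrite integral_cst//= lebesgue_measure_itv/= lte_fin ltr1n -EFinD -EFinM lee_fin.
  by rewrite (_ : 2 - 1 = 1) ?mulr1//; ring.
apply: ge0_le_integral => //.
  by apply/measurable_EFinP; exact: measurable_Gamma_integrand.
move=> t /=; rewrite in_itv/= => /andP[t1 t2]; rewrite lee_fin mulrC.
have t0 : 0 < t by exact: lt_le_trans t1.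
apply: ler_pM; rewrite ?expR_ge0//; last by rewrite ler_expR lerN2.
apply: (@le_trans _ _ (t `^ (- 1))).
  by rewrite powR_inv1 ?(ltW t0)// lef_pV2 ?posrE.
by rewrite ler_powR//; lra.
Qed.

(** The exponent 2s - 2 is that of c^(2s) after the curvature correction in 1/c^2. It tends to -1,
    with the rate of Gamma(s - 1/2); with [0 < n] the denominator is Gamma at an argument at least
    1/2, where [Gamma_ge] applies. *)
Lemma dirJ_blowup n : (0 < n)%N -> exists2 C : R, 0 < C &
  forall s, 2^-1 < s -> s <= 3 / 4 -> dirJ n (2 * s - 2) <= C / (s - 2^-1).
Proof.
have aux (m t : R) : 1 <= m -> 2^-1 < t -> 2^-1 <= (m + 1 + (2 * t - 2)) / 2 by lra.
have aux1 (t : R) : 2^-1 < t -> 0 < t - 2^-1 by lra.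
have aux2 (t : R) : t <= 3 / 4 -> t - 2^-1 <= 1 by lra.
move=> n0; have sp : 0 < Num.sqrt (pi : R) by rewrite sqrtr_gt0 pi_gt0.
have G12 : 0 < Gamma (1 : R) + Gamma 2 by rewrite addr_gt0// Gamma_gt0.
have e0 : 0 < expR (- 2 : R) / 2 by rewrite divr_gt0// expR_gt0.
exists (Num.sqrt pi ^+ n * ((Gamma 1 + Gamma 2) / (expR (- 2) / 2))).
  by rewrite mulr_gt0 ?exprn_gt0// divr_gt0.
move=> s s1 s2; have b0 := aux1 _ s1.
rewrite /dirJ -mulrA ler_pM2l ?exprn_gt0//.
have -> : (1 + (2 * s - 2)) / 2 = s - 2^-1 by field.
have h1 : Gamma (s - 2^-1) <= (Gamma 1 + Gamma 2) / (s - 2^-1).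
  by apply: Gamma_le; rewrite b0/= aux2.
have h2 : expR (- 2) / 2 <= Gamma ((n.+1%:R + (2 * s - 2)) / 2).
  have : (1 : R) <= n%:R by rewrite ler1n.
  have -> : n.+1%:R = n%:R + 1 :> R by rewrite -natr1.
  by move=> nn; apply: Gamma_ge; exact: aux.
have g1 : 0 <= Gamma (s - 2^-1) := ltW (Gamma_gt0 b0).
have g2 := lt_le_trans e0 h2.
move: (Gamma _) (Gamma (_ / 2)) (Gamma 1 + _) (expR _ / 2) h1 h2 g1 g2 e0 => a b c d h1 h2 g1 g2 e0.
rewrite mulrAC; apply: ler_pM h1 _ => //; first by rewrite invr_ge0 ltW.
by rewrite lef_pV2 ?posrE.
Qed.

(** Source of the logarithm: the gain is linear in [e] with a coefficient [L] that may be any number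
    below ln Q, as long as 2 e L <= 1. With Q of order 1/delta, thinning the boundary layer makes
    [L] as large as wished. *)
Lemma expR_powR_gain (Q e L : R) : 1 <= Q -> 0 < e -> 0 < L -> L <= ln Q -> 2 * e * L <= 1 ->
  Q `^ (2 * e) * (e * L) <= Q `^ (2 * e) - 1.
Proof.
move=> Q1 e0 L0 LQ eL; have Q0 : 0 < Q by exact: lt_le_trans Q1.
set y := 2 * e * ln Q; have yL : 2 * e * L <= y by rewrite ler_pM2l// mulr_gt0.
have -> : Q `^ (2 * e) = expR y by rewrite powR_expR.
have E0 : 0 < expR y by exact: expR_gt0.
have y0 : 0 < y by apply: lt_le_trans yL; rewrite !mulr_gt0.
have h1 : 1 - expR (- y) >= e * L.
  have h2 : expR (- y) <= (1 + y)^-1.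
    rewrite expRN lef_pV2 ?posrE//; last by rewrite addr_gt0.
    exact: expR_ge1Dx.
  apply: (@le_trans _ _ (1 - (1 + y)^-1)); last by lra.
  have -> : 1 - (1 + y)^-1 = y / (1 + y) by field; rewrite gt_eqF// addr_gt0.
  rewrite ler_pdivlMr ?addr_gt0//.
  have : e * L * y <= 2^-1 * y by rewrite ler_pM2r//; lra.
  lra.
have -> : expR y - 1 = expR y * (1 - expR (- y)).
  by rewrite mulrBr mulr1 -expRD subrr expR0.
by rewrite ler_pM2l.
Qed.

Lemma powR_le_sqr (e t : R) : 0 < e -> e <= 4^-1 -> 1 <= t -> t `^ (2 * e + 1) <= t ^+ 2.
Proof.
move=> e0 e4 t1; rewrite -powR_mulrn ?(le_trans ler01 t1)// ler_powR//; lra.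
Qed.

Lemma powRN_sqr_le (e D : R) : 0 < e -> e <= 4^-1 -> 1 <= D ->
  (D ^+ 2)^-1 <= D `^ (- (2 * e + 1)).
Proof.
move=> e0 e4 D1; have D0 : 0 < D by exact: lt_le_trans D1.
by rewrite powRN lef_pV2 ?posrE ?exprn_gt0 ?powR_gt0// powR_le_sqr.
Qed.

Lemma far_loss_le (q e D d J : R) : 0 < q -> 0 < e -> 0 < D -> 0 < d -> 0 <= J ->
  e <= d ^+ 2 / (2 * q * D ^+ 2) -> q * e ^+ 2 * J * (d ^+ 2)^-1 <= e * (D ^+ 2)^-1 * J / 2.
Proof.
move=> q0 e0 D0 d0 J0; have D2 : 0 < D ^+ 2 by exact: exprn_gt0.
have d2 : 0 < d ^+ 2 by exact: exprn_gt0.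
have qD : 0 < 2 * q * D ^+ 2 by apply: mulr_gt0 => //; exact: mulr_gt0.
rewrite ler_pdivlMr// => h.
have -> : q * e ^+ 2 * J * (d ^+ 2)^-1 = e * (D ^+ 2)^-1 * J / 2 * ((e * (2 * q * D ^+ 2)) / d ^+ 2).
  by field; rewrite !gt_eqF.
have z0 : 0 <= e * (D ^+ 2)^-1 * J / 2.
  by rewrite divr_ge0// mulr_ge0// mulr_ge0 ?(ltW e0)// invr_ge0 ltW.
by apply: ler_piMr => //; rewrite ler_pdivrMr// mul1r.
Qed.

(** At distance at least [d0] the Hardy weight costs order e^2, through [kap], while exit distances
    of at most [D] yield a gain of order e. One half of the gain absorbs the weight, the other half
    pays for [c]. *)
Lemma far_arith (e D d0 d J0 J c k : R) : 0 < e -> e <= 4^-1 -> 1 <= D -> 0 < d0 -> d0 <= 1 ->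
  d0 <= d -> e <= d0 ^+ 2 / (256 * D ^+ 2) -> 0 < J -> J <= J0 -> 0 <= k -> k <= 128 * e ^+ 2 ->
  c <= e * (D ^+ 2)^-1 * J0 / 2 ->
  k * J * d `^ (- (2 * e + 1)) + c <=
  D `^ (- (2 * e + 1)) * ((2 * e + 1)^-1 * (2 * e)) * J0.
Proof.
move=> e0 e4 D1 d00 d01 dd eD Jp JJ k0 ke cJ.
have D0 : 0 < D by exact: lt_le_trans D1.
have dp : 0 < d by exact: lt_le_trans dd.
have J00 : 0 < J0 by exact: lt_le_trans JJ.
have DD0 : 0 < D ^+ 2 by rewrite exprn_gt0.
have dd0 : 0 < d0 ^+ 2 by rewrite exprn_gt0.
have t1 : e * (D ^+ 2)^-1 * J0 <= D `^ (- (2 * e + 1)) * ((2 * e + 1)^-1 * (2 * e)) * J0.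
  rewrite ler_pM2r// (mulrC e); apply: ler_pM.
  - by rewrite invr_ge0 ltW.
  - exact: ltW.
  - exact: powRN_sqr_le.
  - clear -e0 e4; rewrite ler_pdivlMl; last lra.
    have : e * e <= e * 4^-1 by rewrite ler_pM2l.
    lra.
have t2 : d `^ (- (2 * e + 1)) <= (d0 ^+ 2)^-1.
  rewrite powRN lef_pV2 ?posrE ?powR_gt0//.
  have e2 : 0 <= 2 * e + 1 by clear -e0; lra.
  have e3 : 2 * e + 1 <= 2 by clear -e4; lra.
  apply: (@le_trans _ _ (d0 `^ (2 * e + 1))).
    by rewrite -powR_mulrn ?(ltW d00)// ger_powR ?d00.
  by apply: ge0_ler_powR; rewrite ?nnegrE ?(ltW d00) ?(ltW dp).
have t3 : k * J * d `^ (- (2 * e + 1)) <= 128 * e ^+ 2 * J0 * (d0 ^+ 2)^-1.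
  apply: ler_pM; [by rewrite mulr_ge0// ltW|exact: powR_ge0| |exact: t2].
  by apply: ler_pM => //; exact: ltW.
have t4 : 128 * e ^+ 2 * J0 * (d0 ^+ 2)^-1 <= e * (D ^+ 2)^-1 * J0 / 2.
  apply: far_loss_le => //; first exact: ltW.
  by move: eD; have -> : 256 = 2 * 128 :> R by rewrite -natrM.
move: t1 t3 t4 cJ; clear.
move: (_ * _ * J0) (k * J * _) (128 * _ * _ * _) (e * _ * J0) => a1 a2 a3 a4; lra.
Qed.

(** Balance in the boundary layer, with P = d^(-2e). The curvature loss is at most C1 e P, by k <=
    128 e^2 and the 1/e blow-up of [Jm]; [L] is fixed so that the gain is at least (C1 + 1) e P. The
    surplus e P >= e pays for [c]. *)
Lemma near_arith (e K CJ D c0 d J0 J2 J Jm c k L X Y : R) :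
  0 < e -> e <= 4^-1 -> 0 < K -> 0 < CJ -> 1 <= D -> 2 <= D * c0 -> 0 < d -> d < 1 ->
  d < expR (- L) -> 0 < J2 -> c0 ^+ 2 * J0 = J2 / 2 ->
  L = (14 * K * 128 * CJ + 1) * (4 * D ^+ 2) / J2 -> e <= (2 * L)^-1 ->
  0 <= k -> k <= 128 * e ^+ 2 -> 0 <= Jm -> Jm <= CJ / e -> c <= e ->
  X = k * d `^ (- (2 * e + 1)) ->
  Y = (2 * e + 1)^-1 * (D `^ (- (2 * e + 1)) * ((2 * e + 1) * (D * c0 / (2 * d)) `^ (2 * e) - 1)) ->
  0 <= Y /\
  k * J * d `^ (- (2 * e + 1)) + c <=
  X * J + Y * J2 - X * (14 * K * d) * Jm - Y * c0 ^+ 2 * J0.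
Proof.
move=> ep e4 K0 CJ0 D1 Dc0 dp d1 dL J20 c0E LE eL k0 kle Jm0 Jme ce XE YE.
have D0 : 0 < D by exact: lt_le_trans D1.
have DD0 : 0 < D ^+ 2 by rewrite exprn_gt0.
pose C1 := 14 * K * 128 * CJ; have C10 : 0 < C1 by rewrite !mulr_gt0.
have L0 : 0 < L by rewrite LE divr_gt0// mulr_gt0 ?mulr_gt0// addr_gt0.
pose Q := D * c0 / (2 * d); rewrite -/Q in YE.
have Qd : d^-1 <= Q.
  rewrite /Q invfM mulrA -[leLHS]mul1r ler_pM2r ?invr_gt0// ler_pdivlMr// mul1r.
  by [].
have Q1 : 1 <= Q by apply: le_trans Qd; rewrite invf_ge1// ltW.
have Q0 : 0 < Q by exact: lt_le_trans Q1.
have LQ : L <= ln Q.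
  apply: (@le_trans _ _ (ln d^-1)).
    rewrite lnV ?posrE// lerNr -[leRHS]expRK ler_ln ?posrE ?expR_gt0//; exact: ltW.
  by rewrite ler_ln ?posrE ?invr_gt0.
have eL' : 2 * e * L <= 1.
  move: eL; rewrite -[_^-1]mul1r ler_pdivlMr ?mulr_gt0//; clear; lra.
have qg := expR_powR_gain Q1 ep L0 LQ eL'.
have e20 : 0 <= 2 * e by rewrite mulr_ge0// ltW.
pose P := d `^ (- (2 * e)); have P0 : 0 < P by exact: powR_gt0.
have P1 : 1 <= P.
  by rewrite /P powRN invf_ge1 ?powR_gt0// -[leRHS](powRr0 d) ger_powR ?dp ?(ltW d1).
have PQ : P <= Q `^ (2 * e).
  have -> : P = d^-1 `^ (2 * e).
    by rewrite /P -(powR_inv1 (ltW dp)) -powRrM mulN1r.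
  by apply: ge0_ler_powR; rewrite ?nnegrE ?invr_ge0 ?(ltW dp) ?(ltW Q0).
have e1p : 0 < 2 * e + 1 by rewrite ltr_wpDl.
have e12 : 1 <= 2 * e + 1 by rewrite lerDr.
have e1le : 2 * e + 1 <= 2 by clear -e4; lra.
have QQ0 : 0 <= Q `^ (2 * e) by exact: powR_ge0.
have low0 : 0 <= P * (e * L) by rewrite mulr_ge0 ?mulr_ge0 ?ltW.
have Ylow : (2 * D ^+ 2)^-1 * (P * (e * L)) <= Y.
  rewrite YE [leRHS]mulrA invfM; apply: ler_pM; [|exact: low0| |].
  - by rewrite mulr_ge0 ?invr_ge0 ?(ltW DD0).
  - apply: ler_pM; rewrite ?invr_ge0 ?(ltW DD0)//; last exact: powRN_sqr_le.
    by rewrite lef_pV2 ?posrE.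
  - apply: (@le_trans _ _ (Q `^ (2 * e) - 1)).
      by apply: le_trans qg; rewrite ler_wpM2r// mulr_ge0 ?ltW.
    by rewrite lerD2r ler_peMl.
split.
  by apply: le_trans Ylow; rewrite mulr_ge0// invr_ge0 mulr_ge0// ltW.
have loss : X * (14 * K * d) * Jm <= C1 * e * P.
  have -> : X * (14 * K * d) * Jm = 14 * K * P * (k * Jm).
    have -> : P = d `^ (- (2 * e + 1)) * d.
      by rewrite -(powRD1 (- (2 * e + 1)) dp) /P; congr (_ `^ _); ring.
    by rewrite XE; ring.
  have -> : C1 * e * P = 14 * K * P * (128 * e ^+ 2 * (CJ / e)).
    by rewrite /C1; field; rewrite gt_eqF.
  apply: ler_wpM2l; first by rewrite !mulr_ge0 ?(ltW K0) ?(ltW P0).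
  exact: ler_pM.
have gain : (C1 + 1) * e * P <= Y * J2 / 2.
  have -> : (C1 + 1) * e * P = (2 * D ^+ 2)^-1 * (P * (e * L)) * (J2 / 2).
    by rewrite LE -/C1; field; rewrite !gt_eqF.
  rewrite -[leRHS]mulrA; apply: ler_wpM2r; last exact: Ylow.
  by rewrite divr_ge0// ltW.
have Yc : Y * c0 ^+ 2 * J0 = Y * J2 / 2 by rewrite -mulrA c0E mulrA.
have eP : e <= e * P by rewrite ler_peMr// ltW.
rewrite Yc; have -> : k * J * d `^ (- (2 * e + 1)) = X * J by rewrite XE; ring.
have gE : (C1 + 1) * e * P = C1 * e * P + e * P by ring.
rewrite gE in gain; move: loss gain ce eP; clear.
move: (X * (14 * K * d) * _) (X * J) (Y * J2) (C1 * e * P) (e * P) => a1 a2 a3 a4 a5; lra.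
Qed.

Lemma gain_coef_ge0 (s D c0 d : R) : 2^-1 < s -> 0 < D -> 0 < d -> 2 * d <= D * c0 ->
  0 <= (2 * s)^-1 * (D `^ (- (2 * s)) * (2 * s * (D * c0 / (2 * d)) `^ (2 * s - 1) - 1)).
Proof.
move=> h1 D0 d0 Qge.
set Q := D * c0 / (2 * d).
have Q1 : 1 <= Q by rewrite ler_pdivlMr ?mul1r// mulr_gt0.
have Q0 : 0 < Q by exact: lt_le_trans Q1.
have QQ : 1 <= Q `^ (2 * s - 1).
  by rewrite -[leLHS](powRr0 Q) ler_powR//; lra.
  apply: mulr_ge0; first by rewrite invr_ge0; lra.
  apply: mulr_ge0; first exact: powR_ge0.
  have : 1 * 1 <= 2 * s * Q `^ (2 * s - 1) by apply: ler_pM => //; lra.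
  lra.
Qed.

(** If the curvature correction exceeds 1/2 then c < c0, and both terms of the lower bound are
    nonpositive: grazing directions are simply given up. *)
Lemma near_gain_grazing (s K c0 d c X Y : R) : 0 < K -> 0 < c0 -> 0 < d -> 0 < c ->
  7 * K * d / c0 ^+ 2 <= 2^-1 -> 0 <= X -> 0 <= Y -> 2^-1 < 7 * K * d / c ^+ 2 ->
  X * c `^ (2 * s) * (1 - 2 * (7 * K * d / c ^+ 2)) + Y * (c ^+ 2 - c0 ^+ 2) <= 0.
Proof.
move=> K0 c00 d0 cp small X0 Y0 eth.
have cc : c < c0.
  rewrite ltNge; apply/negP => cc; move: eth; rewrite ltNge => /negP; apply.
  apply: le_trans small; rewrite ler_pM2l ?mulr_gt0//.
  rewrite lef_pV2 ?posrE ?exprn_gt0//; apply: lerXn2r => //; rewrite nnegrE ltW//.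
have XC : 0 <= X * c `^ (2 * s) by rewrite mulr_ge0 ?powR_ge0.
have t1 : X * c `^ (2 * s) * (1 - 2 * (7 * K * d / c ^+ 2)) <= 0.
  by apply: mulr_ge0_le0 => //; move: (7 * K * d / _) eth => t h; lra.
have t2 : Y * (c ^+ 2 - c0 ^+ 2) <= 0.
  rewrite mulr_ge0_le0// subr_le0; apply: lerXn2r; rewrite ?nnegrE ?ltW//.
by rewrite -[leRHS]addr0; exact: lerD.
Qed.

(** [e] and [f] are the exit times towards the boundary and away from it. The first term is the
    half-line gain, Bernoulli's inequality accounting for the delay; the second is the excess [Y],
    claimed only for cosines above [c0]. The factor c^2 - c0^2, at most 1 and negative below [c0],
    yields one formula for all directions that integrates exactly. *)
Lemma near_gain_arith (s K D c0 d c W e f X Y : R) : 2^-1 < s < 1 -> 0 < D -> 0 < K -> 0 < c0 ->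
  0 < d -> 0 < W -> 0 < c <= 1 -> 7 * K * d / c0 ^+ 2 <= 2^-1 -> 2 * d <= D * c0 ->
  X = kap s * d `^ (- (2 * s)) ->
  Y = (2 * s)^-1 * (D `^ (- (2 * s)) * (2 * s * (D * c0 / (2 * d)) `^ (2 * s - 1) - 1)) ->
  0 < e -> 0 < f -> 7 * K * d / c ^+ 2 <= 2^-1 -> e <= d / (W * c) * (1 + 7 * K * d / c ^+ 2) -> f * W <= D ->
  X * c `^ (2 * s) * (1 - 2 * (7 * K * d / c ^+ 2)) + Y * (c ^+ 2 - c0 ^+ 2) <=
  W `^ (- (2 * s)) * chord_gain s e f.
Proof.
move=> s01 D0 K0 c00 d0 W0 /andP[cp cle1] small Qge XE YE e0 f0; have /andP[h1 h2] := s01.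
have cge0 := ltW cp.
have kp := kap_gt0 s01.
have X0 : 0 < X by rewrite XE mulr_gt0// powR_gt0.
have G0 : 0 <= chord_gain s e f by apply: chord_gain_ge0 => //; exact: ltW.
have wG : 0 <= W `^ (- (2 * s)) * chord_gain s e f by rewrite mulr_ge0// powR_ge0.
set Q := D * c0 / (2 * d) in YE.
have Q1 : 1 <= Q by rewrite ler_pdivlMr ?mul1r// mulr_gt0.
have Q0 : 0 < Q by exact: lt_le_trans Q1.
have Y0 : 0 <= Y by rewrite YE; exact: gain_coef_ge0.
have c2p : 0 < c ^+ 2 by rewrite exprn_gt0.
set C := c `^ (2 * s); have C0 : 0 < C by exact: powR_gt0.
set et := 7 * K * d / c ^+ 2 => eth eW fW.
have et0 : 0 < et by rewrite divr_gt0// !mulr_gt0.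
have XC : 0 < X * C by rewrite mulr_gt0.
have et1 : 0 < 1 + et by lra.
have ie : W * c / d / (1 + et) <= e^-1.
  have dWc : 0 < d / (W * c) * (1 + et) by rewrite mulr_gt0 ?divr_gt0 ?mulr_gt0.
  have -> : W * c / d / (1 + et) = (d / (W * c) * (1 + et))^-1.
    by field; rewrite !gt_eqF.
  by rewrite lef_pV2.
have ie0 : 0 < W * c / d / (1 + et) by rewrite !divr_gt0 ?mulr_gt0.
have kapE : W `^ (- (2 * s)) * (kap s * e^-1 `^ (2 * s)) >= X * C * (1 - 2 * et).
  have t1 : (W * c / d / (1 + et)) `^ (2 * s) <= e^-1 `^ (2 * s).
    by apply: ge0_ler_powR; rewrite ?nnegrE ?invr_ge0 ?(ltW ie0) ?(ltW e0)//; lra.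
  have t2 : 1 - 2 * et <= (1 + et)^-1 `^ (2 * s).
    have i0 : 0 <= (1 + et)^-1 by rewrite invr_ge0; lra.
    apply: le_trans (powR_ge_bernoulli _ i0); last lra.
    have : 2 * s * (1 - (1 + et)^-1) <= 2 * et.
      have -> : 1 - (1 + et)^-1 = et / (1 + et) by field; rewrite gt_eqF.
      rewrite mulrA ler_pdivrMr//.
      have : 0 <= et * et by rewrite mulr_ge0 ?ltW.
      have : s * et <= et by rewrite ler_piMl// ltW.
      lra.
    lra.
  have t3 : (W * c / d / (1 + et)) `^ (2 * s) =
      W `^ (2 * s) * C * d `^ (- (2 * s)) * (1 + et)^-1 `^ (2 * s).
    rewrite powRM ?invr_ge0 ?divr_ge0 ?mulr_ge0 ?(ltW W0) ?(ltW d0)//; last lra.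
    rewrite powRM ?mulr_ge0 ?invr_ge0 ?(ltW W0) ?(ltW d0)// powRM ?(ltW W0)//.
    congr (_ * _ * _); by rewrite -[in LHS](powR_inv1 (ltW d0)) -powRrM mulN1r.
  rewrite t3 in t1.
  have WW : W `^ (- (2 * s)) * W `^ (2 * s) = 1.
    by rewrite -powRD ?(gt_eqF W0) ?implybT// addNr powRr0.
  have := ler_wpM2l (mulr_ge0 (powR_ge0 W (- (2 * s))) (ltW kp)) t1.
  rewrite [X in _ -> _ <= X]mulrA; apply: le_trans.
  have -> : W `^ (- (2 * s)) * kap s * (W `^ (2 * s) * C * d `^ (- (2 * s)) * (1 + et)^-1 `^ (2 * s)) =
    (W `^ (- (2 * s)) * W `^ (2 * s)) * (X * C * (1 + et)^-1 `^ (2 * s)) by rewrite XE; ring.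
  by rewrite WW mul1r ler_pM2l.
have [cc|cc] := ltP c c0.
  have t2 : Y * (c ^+ 2 - c0 ^+ 2) <= 0.
    rewrite mulr_ge0_le0// subr_le0; apply: lerXn2r; rewrite ?nnegrE ?ltW//.
  have := ler_wpM2l (powR_ge0 W (- (2 * s))) (chord_gain_ge_kap s01 e0 f0); lra.
have b0 : 0 < W / D by rewrite divr_gt0.
have bf : W / D <= f^-1 by rewrite ler_pdivrMr// ler_pdivlMl.
have Qe : Q * (W / D) <= e^-1.
  apply: le_trans ie.
  have -> : Q * (W / D) = W * c0 / d * 2^-1 by rewrite /Q; field; rewrite !gt_eqF.
  apply: ler_pM; rewrite ?divr_ge0 ?mulr_ge0 ?(ltW W0) ?(ltW c00) ?(ltW d0)//.
    by rewrite ler_pM2r ?invr_gt0// ler_pM2l.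
  by rewrite lef_pV2 ?posrE//; lra.
have := ler_wpM2l (powR_ge0 W (- (2 * s))) (chord_gain_ge s01 e0 f0 b0 Q0 bf Qe).
apply: le_trans; rewrite [leRHS]mulrDr; apply: lerD => //.
have -> : W `^ (- (2 * s)) * ((2 * s)^-1 * ((W / D) `^ (2 * s) * (2 * s * Q `^ (2 * s - 1) - 1))) = Y.
  have -> : (W / D) `^ (2 * s) = W `^ (2 * s) * D `^ (- (2 * s)).
    rewrite powRM ?invr_ge0 ?(ltW W0) ?(ltW D0)//; congr (_ * _).
    by rewrite -[in LHS](powR_inv1 (ltW D0)) -powRrM mulN1r.
  have WW : W `^ (- (2 * s)) * W `^ (2 * s) = 1.
    by rewrite -powRD ?(gt_eqF W0) ?implybT// addNr powRr0.
  have -> : W `^ (- (2 * s)) * ((2 * s)^-1 * (W `^ (2 * s) * D `^ (- (2 * s)) * (2 * s * Q `^ (2 * s - 1) - 1))) =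
     (W `^ (- (2 * s)) * W `^ (2 * s)) * Y by rewrite YE; ring.
  by rewrite WW mul1r.
rewrite -[leRHS]mulr1 ler_wpM2l//.
have : c ^+ 2 <= 1 by rewrite expr_le1.
have := sqr_ge0 c0; lra.
Qed.

End convexity.

(** * The gain density far from the boundary and near it *)

Section lower_density.
Context {R : realType} {n : nat}.
Local Notation rV := 'rV[R]_n.+1.
Local Notation lebn := (@lebesgue_rV R n).

Lemma enorm_le_norm m (x : 'rV[R]_m) : enorm x <= m%:R * `|x|.
Proof.
have cn i : `|x ord0 i| <= `|x|.
  rewrite leNgt; apply/negP => h.
  have : ball (0 : 'rV[R]_m) `|x ord0 i| x by rewrite -ball_normE /= sub0r normrN.
  by move=> [_ /(_ ord0 i)]; rewrite -ball_normE /= mxE sub0r normrN ltxx.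
rewrite -ler_sqr ?nnegrE ?enorm_ge0 ?mulr_ge0// enorm_sqr exprMn.
apply: (@le_trans _ _ (\sum_(i < m) `|x| ^+ 2)).
  by apply: ler_sum => i _; rewrite -(real_normK (num_real _)) ler_sqr ?nnegrE.
have -> : \sum_(i < m) `|x| ^+ 2 = m%:R * `|x| ^+ 2 by rewrite sumr_const card_ord mulr_natl.
apply: ler_wpM2r; first exact: sqr_ge0.
rewrite -natrX ler_nat.
by case: m {x cn} => // m; rewrite leq_pmulr.
Qed.

Lemma dirwE (g : R) (nu : rV) (z : 'rV[R]_n) :
  dirw g nu z = enorm (dir z) `^ (- n.+1%:R) * (`|dot (dir z) nu| / enorm (dir z)) `^ g.
Proof.
have W0 := enorm_dir_gt0 z.
have E : (`|dot (dir z) nu| / enorm (dir z)) `^ g = `|dot (dir z) nu| `^ g * enorm (dir z) `^ (- g).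
  rewrite powRM ?invr_ge0 ?(ltW W0)//; congr (_ * _).
  by rewrite -[in LHS](powR_inv1 (ltW W0)) -powRrM mulN1r.
rewrite E mulrCA -powRD ?(gt_eqF W0) ?implybT// /dirw mulrC; congr (_ * _ `^ _).
by rewrite opprD.
Qed.

Lemma cos_le1 (nu : rV) (z : 'rV[R]_n) : enorm nu = 1 ->
  0 <= `|dot (dir z) nu| / enorm (dir z) <= 1.
Proof.
move=> nu1; have W0 := enorm_dir_gt0 z.
by rewrite divr_ge0 ?(ltW W0)//= ler_pdivrMr// mul1r (le_trans (norm_dot_le _ _))// nu1 mulr1.
Qed.

Lemma integral_dirwZ (k g : R) (nu : rV) : 0 <= k -> -1 < g -> enorm nu = 1 ->
  (\int[lebn]_z (k * dirw g nu z)%:E = (k * dirJ n g)%:E)%E.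
Proof.
move=> k0 g1 nu1; under eq_integral do rewrite EFinM.
rewrite ge0_integralZl//.
- by rewrite integral_dirw.
- by apply/measurable_EFinP; exact: measurable_dirw.
- by move=> z _; rewrite lee_fin dirw_ge0.
Qed.

Lemma dirJ_le0 (g : R) : 0 <= g -> dirJ n g <= dirJ n 0 :> R.
Proof.
move=> g0; pose nu : rV := delta_mx ord0 ord0.
have nu1 : enorm nu = 1.
  rewrite /enorm (bigD1 ord0)//= big1; last by move=> i i0; rewrite mxE (negbTE i0) andbF expr0n.
  by rewrite mxE !eqxx expr1n addr0 sqrtr1.
have e1 := integral_dirw (n := n) (lt_le_trans (ltrN10 R) g0) nu1.
have e2 := integral_dirw (n := n) (ltrN10 R) nu1.
rewrite -lee_fin -e1 -e2; apply: ge0_le_integral; first exact: measurableT.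
- by move=> z _; rewrite lee_fin dirw_ge0.
- by apply/measurable_EFinP; exact: measurable_dirw.
- by apply/measurable_EFinP; exact: measurable_dirw.
move=> z _; rewrite lee_fin !dirwE ler_wpM2l ?powR_ge0// powRr0.
have /andP[c0 c1] := cos_le1 z nu1.
have [->|cn] := eqVneq (`|dot (dir z) nu| / enorm (dir z)) 0.
  by rewrite /powR eqxx; case: eqVneq.
rewrite -(powRr0 (`|dot (dir z) nu| / enorm (dir z))) ger_powR// lt_def cn c0.
by [].
Qed.

Variable Om : set rV.
Hypotheses (oOm : open Om) (bOm : bounded_set Om).

Lemma exit_time_diam : exists2 D : R, 1 <= D &
  forall x w, w != 0 -> exit_time Om x w * enorm w <= D.
Proof.
have [M [Mr HM]] := bOm; pose M1 := `|M| + 1.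
pose B := n.+1%:R * M1.
have HB x : Om x -> enorm x <= B.
  move=> Ox; apply: le_trans (enorm_le_norm x) _; rewrite ler_wpM2l//.
  by apply: (HM M1) => //; rewrite (le_lt_trans (ler_norm M)) ?ltrDl.
have B0 : 0 <= B by rewrite mulr_ge0// addr_ge0.
exists (B + B + 1); first by lra.
move=> x w w0; rewrite leNgt; apply/negP => h.
have W0 : 0 < enorm w.
  by rewrite lt_def enorm_ge0 andbT; apply: contra w0 => /eqP /enorm_eq0 ->.
have t0 : 0 <= (B + B + 1) / enorm w by rewrite divr_ge0 ?(ltW W0)//; lra.
have : (B + B + 1) / enorm w < exit_time Om x w by rewrite ltr_pdivrMr.
move/(exit_time_gtP oOm bOm x w0 t0) => vis.
have h0 : Om x by have := vis 0; rewrite scale0r addr0; apply; rewrite lexx.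
have h1 : Om (x + ((B + B + 1) / enorm w) *: w) by apply: vis; rewrite t0 lexx.
have : enorm (((B + B + 1) / enorm w) *: w) <= B + B.
  rewrite -[X in enorm X](addKr x).
  by apply: le_trans (enormD _ _) _; rewrite enormN lerD// HB.
rewrite enormZ ger0_norm// divfK ?gt_eqF//; lra.
Qed.

Lemma gain_far (s D r : R) (x : rV) : 2^-1 < s < 1 -> 1 <= D ->
  (forall x w, w != 0 -> exit_time Om x w * enorm w <= D) -> Om x ->
  ((D `^ (- (2 * s)) * ((2 * s)^-1 * (2 * s - 1)) * dirJ n 0)%:E <= gain_density Om s x)%E.
Proof.
move=> s01 D1 HD Ox; have /andP[h1 h2] := s01.
pose nu : rV := delta_mx ord0 ord0.
have nu1 : enorm nu = 1.
  rewrite /enorm (bigD1 ord0)//= big1; last by move=> i i0; rewrite mxE (negbTE i0) andbF expr0n.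
  by rewrite mxE !eqxx expr1n addr0 sqrtr1.
have D0 : 0 < D by exact: lt_le_trans D1.
have k0 : 0 <= D `^ (- (2 * s)) * ((2 * s)^-1 * (2 * s - 1)).
  by rewrite mulr_ge0 ?powR_ge0// mulr_ge0 ?invr_ge0; lra.
rewrite -(integral_dirwZ k0 (ltrN10 R) nu1).
apply: ge0_le_integral => //.
- by move=> z _; rewrite lee_fin mulr_ge0// dirw_ge0.
- by apply/measurable_EFinP; apply: measurable_funM => //; exact: measurable_dirw.
- apply/measurable_EFinP; exact: (measurableT_comp (measurable_gain_at s oOm bOm) (pair1_measurable x)).
move=> z _; rewrite lee_fin dirwE powRr0 mulr1 /gain_at /=.
have W0 := enorm_dir_gt0 z; have v0 := dir_neq0 z; set W := enorm (dir z) in W0 *.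
have nv0 : - dir z != 0 by rewrite oppr_eq0.
have q0 : 0 < exit_time Om x (dir z) by apply/exit_time_gt0.
have p0 : 0 < exit_time Om x (- dir z) by apply/exit_time_gt0.
have b0 : 0 < W / D by rewrite divr_gt0.
have bq : W / D <= (exit_time Om x (dir z))^-1.
  by rewrite ler_pdivrMr// ler_pdivlMl//; exact: HD.
have bp : 1 * (W / D) <= (exit_time Om x (- dir z))^-1.
  by rewrite mul1r ler_pdivrMr// ler_pdivlMl//; have := HD x _ nv0; rewrite enormN.
have := chord_gain_ge s01 p0 q0 b0 ltr01 bq bp; rewrite powR1E mulr1 => H.
have kp : 0 <= kap s * (exit_time Om x (- dir z))^-1 `^ (2 * s).
  by rewrite mulr_ge0 ?powR_ge0// ltW// kap_gt0.
have : (2 * s)^-1 * ((W / D) `^ (2 * s) * (2 * s - 1)) <=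
  chord_gain s (exit_time Om x (- dir z)) (exit_time Om x (dir z)) by lra.
have WN : 0 <= W `^ (- (n.+1%:R + 2 * s)) by exact: powR_ge0.
move=> /(ler_wpM2l WN); apply: le_trans; rewrite le_eqVlt; apply/orP; left; apply/eqP.
have -> : (W / D) `^ (2 * s) = W `^ (2 * s) * D `^ (- (2 * s)).
  rewrite powRM ?invr_ge0 ?(ltW W0) ?(ltW D0)//; congr (_ * _).
  by rewrite -[in LHS](powR_inv1 (ltW D0)) -powRrM mulN1r.
have -> : W `^ (- n.+1%:R) = W `^ (- (n.+1%:R + 2 * s)) * W `^ (2 * s).
  by rewrite -powRD ?(gt_eqF W0) ?implybT//; congr (_ `^ _); ring.
ring.
Qed.

(* [c0] is a cut-off on the cosine of the angle between direction and normal. *)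
Lemma gain_near_pointwise (s D K c0 d X Y : R) (x y nu : rV) (z : 'rV[R]_n) :
  2^-1 < s < 1 -> 1 <= D -> 0 < K -> 0 < c0 -> 0 < d ->
  (forall x w, w != 0 -> exit_time Om x w * enorm w <= D) -> Om x ->
  exterior_normal Om K y nu -> x = y + d *: nu -> 7 * K * d / c0 ^+ 2 <= 2^-1 ->
  2 * d <= D * c0 ->
  X = kap s * d `^ (- (2 * s)) ->
  Y = (2 * s)^-1 * (D `^ (- (2 * s)) * (2 * s * (D * c0 / (2 * d)) `^ (2 * s - 1) - 1)) ->
  X * dirw (2 * s) nu z + Y * dirw 2 nu z <=
  gain_at Om s (x, z) + (X * (14 * K * d)) * dirw (2 * s - 2) nu z + (Y * c0 ^+ 2) * dirw 0 nu z.
Proof.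
move=> s01 D1 K0 c00 d0 HD Ox Hnu xE small Qge XE YE; have /andP[h1 h2] := s01.
have nu1 : enorm nu = 1 by case: Hnu.
have D0 : 0 < D by exact: lt_le_trans D1.
have kp := kap_gt0 s01.
have X0 : 0 < X by rewrite XE mulr_gt0// powR_gt0.
have Y0 : 0 <= Y by rewrite YE; exact: gain_coef_ge0.
rewrite !dirwE powRr0 mulr1 /gain_at /=.
have W0 := enorm_dir_gt0 z; have v0 := dir_neq0 z; set W := enorm (dir z) in W0 *.
have nv0 : - dir z != 0 by rewrite oppr_eq0.
have /andP[cge0 cle1] := cos_le1 z nu1; rewrite -/W in cge0 cle1.
set c := `|dot (dir z) nu| / W in cge0 cle1 *.
have cW : c * W = `|dot (dir z) nu| by rewrite /c divfK ?gt_eqF.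
clearbody c.
have q0 : 0 < exit_time Om x (dir z) by apply/exit_time_gt0.
have p0 : 0 < exit_time Om x (- dir z) by apply/exit_time_gt0.
set G := chord_gain _ _ _.
have G0 : 0 <= G by apply: chord_gain_ge0 => //; exact: ltW.
have WG : W `^ (- (n.+1%:R + 2 * s)) = W `^ (- n.+1%:R) * W `^ (- (2 * s)).
  by rewrite -powRD ?(gt_eqF W0) ?implybT//; congr (_ `^ _); ring.
rewrite WG.
suff H : X * c `^ (2 * s) + Y * c `^ 2 <=
    W `^ (- (2 * s)) * G + X * (14 * K * d) * c `^ (2 * s - 2) + Y * c0 ^+ 2.
  have := ler_wpM2l (powR_ge0 W (- n.+1%:R)) H; congr (_ <= _); ring.
have wG : 0 <= W `^ (- (2 * s)) * G by rewrite mulr_ge0// powR_ge0.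
have [cz|cn0] := eqVneq c 0.
  have -> : c `^ (2 * s) = 0 by rewrite cz powR0// gt_eqF//; lra.
  have -> : c `^ 2 = 0 by rewrite cz powR0// gt_eqF.
  rewrite !mulr0 addr0 addr_ge0 ?mulr_ge0 ?sqr_ge0 ?addr_ge0 ?mulr_ge0 ?powR_ge0//; exact: ltW.
have cp : 0 < c by rewrite lt_def cn0.
have c2p : 0 < c ^+ 2 by rewrite exprn_gt0.
have -> : c `^ 2 = c ^+ 2 by rewrite (powR_mulrn 2 cge0).
have cE : c `^ (2 * s - 2) = c `^ (2 * s) / c ^+ 2.
  by rewrite -powR_mulrn// -powRN -powRD ?(gt_eqF cp) ?implybT.
rewrite cE; set C := c `^ (2 * s); have C0 : 0 < C by exact: powR_gt0.
set et := 7 * K * d / c ^+ 2.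
have -> : X * (14 * K * d) * (C / c ^+ 2) = X * C * (2 * et) by rewrite /et; field; rewrite gt_eqF.
have et0 : 0 < et by rewrite divr_gt0// !mulr_gt0.
have -> : X * C + Y * c ^+ 2 <= W `^ (- (2 * s)) * G + X * C * (2 * et) + Y * c0 ^+ 2 =
    (X * C * (1 - 2 * et) + Y * (c ^+ 2 - c0 ^+ 2) <= W `^ (- (2 * s)) * G).
  rewrite -subr_ge0 -[RHS]subr_ge0; congr (0 <= _); ring.
have [eth|eth] := ltP 2^-1 et.
  apply: le_trans wG; exact: near_gain_grazing (ltW X0) Y0 eth.
(* [e]: exit time on the side of the boundary, [f]: the opposite one *)
have [e [f [e0 f0 eW fW GE]]] : exists e f : R, [/\ 0 < e, 0 < f,
    e <= d / (W * c) * (1 + et), f * W <= D & G = chord_gain s e f].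
  have c01 : 0 < c <= 1 by rewrite cp.
  have [dp|dn] := leP 0 (dot (dir z) nu).
    exists (exit_time Om x (- dir z)), (exit_time Om x (dir z)).
    split; [exact: p0|exact: q0| |exact: HD|by []].
    have := @exit_time_le R n Om oOm bOm K c d x y nu (- dir z) K0 d0 c01 nv0 Hnu xE.
    rewrite enormN -/W; apply => //.
    by rewrite cW ger0_norm// -(scaleN1r (dir z)) dotZl mulN1r.
  exists (exit_time Om x (dir z)), (exit_time Om x (- dir z)).
  split; [exact: q0|exact: p0| | |].
  - have := @exit_time_le R n Om oOm bOm K c d x y nu (dir z) K0 d0 c01 v0 Hnu xE.
    by rewrite -/W; apply => //; rewrite cW ltr0_norm// opprK.
  - by have := HD x _ nv0; rewrite enormN.
  - exact: chord_gainC.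
have c01 : 0 < c <= 1 by rewrite cp.
rewrite GE; exact: (near_gain_arith s01 D0 K0 c00 d0 W0 c01 small Qge XE YE e0 f0 eth eW fW).
Qed.

(** The pointwise bound is integrated with nonnegative terms on each side, and the four directional
    integrals, being finite, are subtracted afterwards. *)
Lemma gain_near (s D K c0 d X Y : R) (x y nu : rV) :
  2^-1 < s < 1 -> 1 <= D -> 0 < K -> 0 < c0 -> 0 < d ->
  (forall x w, w != 0 -> exit_time Om x w * enorm w <= D) -> Om x ->
  exterior_normal Om K y nu -> x = y + d *: nu -> 7 * K * d / c0 ^+ 2 <= 2^-1 ->
  2 * d <= D * c0 ->
  X = kap s * d `^ (- (2 * s)) ->
  Y = (2 * s)^-1 * (D `^ (- (2 * s)) * (2 * s * (D * c0 / (2 * d)) `^ (2 * s - 1) - 1)) ->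
  0 <= Y ->
  ((X * dirJ n (2 * s) + Y * dirJ n 2 - X * (14 * K * d) * dirJ n (2 * s - 2) -
    Y * c0 ^+ 2 * dirJ n 0)%:E <= gain_density Om s x)%E.
Proof.
move=> s01 D1 K0 c00 d0 HD Ox Hnu xE small Qge XE YE Y0; have /andP[h1 h2] := s01.
have nu1 : enorm nu = 1 by case: Hnu.
have kp := kap_gt0 s01.
have X0 : 0 <= X by rewrite XE mulr_ge0 ?powR_ge0// ltW.
pose A1 := X * (14 * K * d); pose A2 := Y * c0 ^+ 2.
have A10 : 0 <= A1 by rewrite mulr_ge0// !mulr_ge0// ltW.
have A20 : 0 <= A2 by rewrite mulr_ge0// sqr_ge0.
have g1 : -1 < 2 * s by lra.
have g2 : -1 < 2 :> R by lra.
have g3 : -1 < 2 * s - 2 by lra.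
have I1 := integral_dirwZ X0 g1 nu1; have I2 := integral_dirwZ Y0 g2 nu1.
have I3 := integral_dirwZ A10 g3 nu1; have I4 := integral_dirwZ A20 (ltrN10 R) nu1.
have mD k g : measurable_fun setT (fun z => (k * dirw g nu z)%:E).
  by apply/measurable_EFinP; apply: measurable_funM => //; exact: measurable_dirw.
have pD k g : 0 <= k -> forall z : 'rV[R]_n, setT z -> (0 <= (k * dirw g nu z)%:E)%E.
  by move=> k0 z _; rewrite lee_fin mulr_ge0// dirw_ge0.
have mG : measurable_fun setT (fun z => (gain_at Om s (x, z))%:E).
  apply/measurable_EFinP; exact: (measurableT_comp (measurable_gain_at s oOm bOm) (pair1_measurable x)).
have pG (z : 'rV[R]_n) : setT z -> (0 <= (gain_at Om s (x, z))%:E)%E.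
  by move=> _; rewrite lee_fin gain_at_ge0.
have fin (M i1 i2 i3 i4 : \bar R) (a b c e : R) : i1 = a%:E -> i2 = b%:E -> i3 = c%:E ->
    i4 = e%:E -> (i1 + i2 <= M + i3 + i4)%E -> ((a + b - c - e)%:E <= M)%E.
  move=> -> -> -> -> h; rewrite EFinB leeBlDr// EFinB leeBlDr// EFinD.
  by rewrite addeAC.
apply: (fin _ _ _ _ _ _ _ _ _ I1 I2 I3 I4).
rewrite -(ge0_integralD lebn measurableT (pD _ _ X0) (mD _ _) (pD _ _ Y0) (mD _ _)).
rewrite /gain_density -(ge0_integralD lebn measurableT pG mG (pD _ _ A10) (mD _ _)).
rewrite -(ge0_integralD lebn measurableT _ _ (pD _ _ A20) (mD _ _)).
- apply: ge0_le_integral; first exact: measurableT.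
  + by move=> z _; rewrite adde_ge0 ?pD.
  + exact: emeasurable_funD.
  + by apply: emeasurable_funD => //; exact: emeasurable_funD.
  + move=> z _; rewrite -!EFinD lee_fin.
    exact: (gain_near_pointwise z s01 D1 K0 c00 d0 HD Ox Hnu xE small Qge XE YE).
- by move=> z _; rewrite adde_ge0 ?pD ?pG.
- exact: emeasurable_funD.
Qed.

Theorem gain_density_ge : (0 < n)%N -> C11_boundary Om -> exists2 e0 : R, 0 < e0 &
  forall s, 2^-1 < s -> s - 2^-1 <= e0 -> s < 1 /\ exists2 c : R, 0 < c &
  forall x, Om x ->
  ((kap s * dirJ n (2 * s) * dist_boundary Om x `^ (- (2 * s)) + c)%:E <= gain_density Om s x)%E.
Proof.
have quarter (e : R) : 0 < e -> e <= 4^-1 ->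
  [/\ 2^-1 < e + 2^-1, e + 2^-1 <= 3 / 4 & e + 2^-1 < 1] by move=> ? ?; split; lra.
have k256 : 0 < 256 :> R by rewrite ltr0n.
have gneg (e : R) : 0 < e -> -1 < 2 * e + 1 - 2 by lra.
have gpos (e : R) : 0 < e -> -1 < 2 * e + 1 by lra.
have n12 : -1 < 2 :> R by lra.
have half_le (K d c2 : R) : 14 * K * d < c2 -> 7 * K * d <= 2^-1 * c2 by lra.
have dbl (d D c : R) : d < 1 -> 2 <= D * c -> 2 * d <= D * c by lra.
move=> n0 C11.
have [K K0 HK] := uniform_exterior_normal oOm bOm C11.
have [D' D'1 HD'] := exit_time_diam.
have [CJ CJ0 HCJ] := @dirJ_blowup R n n0.
have [J0 J0E J00] : exists2 J0 : R, dirJ n 0 = J0 & 0 < J0.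
  by exists (dirJ n 0) => //; apply: dirJ_gt0; exact: ltrN10.
have [J2 J2E J20] : exists2 J2 : R, dirJ n 2 = J2 & 0 < J2.
  by exists (dirJ n 2) => //; exact: dirJ_gt0.
(* Chosen so that the integral of c^2 - c0^2 over the directions is still J2 / 2 > 0. *)
have [c0 c00 c0E] : exists2 c0 : R, 0 < c0 & c0 ^+ 2 * J0 = J2 / 2.
  have q0 : 0 < J2 / (2 * J0) by apply: divr_gt0 => //; exact: mulr_gt0.
  exists (Num.sqrt (J2 / (2 * J0))); first by rewrite sqrtr_gt0.
  by rewrite sqr_sqrtr ?ltW//; field; rewrite gt_eqF.
(* [D] is enlarged until D c0 >= 2, which makes D c0 / (2 delta) at least 1/delta. *)
have [D D1 [HD Dc0]] : exists2 D : R, 1 <= D &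
    (forall x w, w != 0 -> exit_time Om x w * enorm w <= D) /\ 2 <= D * c0.
  have i0 : 0 <= 2 / c0 by rewrite divr_ge0// ltW.
  exists (D' + 2 / c0); first by rewrite ler_wpDr.
  split=> [x w w0|]; first by apply: (le_trans (HD' x w w0)); rewrite lerDl.
  rewrite mulrDl divfK ?gt_eqF// lerDr mulr_ge0 ?(ltW c00)//.
  exact: le_trans D'1.
have D0 : 0 < D by exact: lt_le_trans D1.
have DD0 : 0 < D ^+ 2 by rewrite exprn_gt0.
have [L L0 LE] : exists2 L : R, 0 < L & L = (14 * K * 128 * CJ + 1) * (4 * D ^+ 2) / J2.
  exists ((14 * K * 128 * CJ + 1) * (4 * D ^+ 2) / J2) => //.
  apply: divr_gt0 => //; apply: mulr_gt0; last by apply: mulr_gt0 => //; exact: ltr0n.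
  apply: ltr_wpDl => //; apply: mulr_ge0; last exact: ltW.
  by apply: mulr_ge0; [apply: mulr_ge0; [exact: ler0n|exact: ltW]|exact: ler0n].
have c02 : 0 < c0 ^+ 2 by rewrite exprn_gt0.
(* Width of the boundary layer: [expR (- L)] serves the logarithmic gain, and the last bound makes
   the curvature correction at most 1/2 at the cosine [c0]. *)
have [d0 d00 [d01 d0L d0c]] : exists2 d0 : R, 0 < d0 &
    [/\ d0 <= 1, d0 <= expR (- L) & d0 <= c0 ^+ 2 / (14 * K)].
  have K14 : 0 < c0 ^+ 2 / (14 * K) by apply: divr_gt0 => //; exact: mulr_gt0.
  exists (Num.min 1 (Num.min (expR (- L)) (c0 ^+ 2 / (14 * K)))).
    by rewrite !lt_min ltr01 expR_gt0 K14.
  by split; rewrite !ge_min lexx ?orbT.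
have dd0 : 0 < d0 ^+ 2 by rewrite exprn_gt0.
(* Chosen after the layer: 1/4 keeps s <= 3/4, the second bound gives 2 e L <= 1, the third serves
   the points outside the layer. *)
have [e0 e00 [E4 EL ED]] : exists2 e0 : R, 0 < e0 &
    [/\ e0 <= 4^-1, e0 <= (2 * L)^-1 & e0 <= d0 ^+ 2 / (256 * D ^+ 2)].
  have q1 : 0 < (2 * L)^-1 by rewrite invr_gt0 mulr_gt0.
  have q2 : 0 < d0 ^+ 2 / (256 * D ^+ 2) := divr_gt0 dd0 (mulr_gt0 k256 DD0).
  exists (Num.min 4^-1 (Num.min (2 * L)^-1 (d0 ^+ 2 / (256 * D ^+ 2)))).
    by rewrite !lt_min q1 q2 invr_gt0 ltr0n.
  by split; rewrite !ge_min lexx ?orbT.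
exists e0 => // s s1.
have [e sE] : exists e : R, s = e + 2^-1 by exists (s - 2^-1); rewrite subrK.
have sE' : s - 2^-1 = e by rewrite sE addrK.
rewrite sE' => ee0.
have e4 := le_trans ee0 E4; have eL := le_trans ee0 EL; have eD := le_trans ee0 ED.
have ep : 0 < e by move: s1; rewrite sE ltrDr.
have [_ s2 s3] := quarter e ep e4; rewrite -sE in s2 s3.
have s01 : 2^-1 < s < 1 by rewrite s1 s3.
split=> //.
have kle : kap s <= 128 * e ^+ 2.
  by have := @kap_le R s; rewrite s1 s2 sE'; exact.
have kp := kap_gt0 s01.
have sE2 : 2 * s = 2 * e + 1 by rewrite sE; field.
have es : 2 * s - 1 = 2 * e by rewrite sE2 addrK.
have J2s : dirJ n (2 * s) <= J0.
  by rewrite -J0E; apply: dirJ_le0; rewrite mulr_ge0// (le_trans _ (ltW s1)).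
have J2s0 : 0 < dirJ n (2 * s) :> R by rewrite sE2; apply: dirJ_gt0; exact: gpos.
have [c cp [ce cJ]] : exists2 c : R, 0 < c & c <= e /\ c <= e * (D ^+ 2)^-1 * J0 / 2.
  exists (Num.min e (e * (D ^+ 2)^-1 * J0 / 2)).
    by rewrite lt_min ep/= divr_gt0// mulr_gt0// mulr_gt0// invr_gt0.
  by rewrite !ge_min !lexx orbT.
exists c => // x Ox.
have dp : 0 < dist_boundary Om x by exact: dist_boundary_gt0.
have [far|near] := leP d0 (dist_boundary Om x).
  apply: le_trans (@gain_far s D 0 x s01 D1 HD Ox); rewrite lee_fin.
  have FA := far_arith ep e4 D1 d00 d01 far eD J2s0 J2s (ltW kp) kle cJ.
  by rewrite -sE2 -es in FA; rewrite J0E.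
have [y By xy] := dist_boundary_attained oOm bOm Ox.
have [nu Hnu] := HK y By.
have xE := nearest_point_normal oOm bOm K0 Ox By xy Hnu.
have d1 := lt_le_trans near d01; have dL := lt_le_trans near d0L; have dc := lt_le_trans near d0c.
have small : 7 * K * dist_boundary Om x / c0 ^+ 2 <= 2^-1.
  rewrite ler_pdivrMr//; apply: half_le.
  by move: dc; rewrite ltr_pdivlMr ?mulr_gt0// mulrC.
have Jm0 : 0 <= dirJ n (2 * s - 2) :> R.
  by apply: ltW; apply: dirJ_gt0; rewrite sE2; exact: gneg.
have Jme : dirJ n (2 * s - 2) <= CJ / e by rewrite -sE'; exact: HCJ.
have [Y0 NA] := near_arith (dirJ n (2 * s)) ep e4 K0 CJ0 D1 Dc0 dp d1 dL J20 c0E LE eL (ltW kp) kle Jm0 Jme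
  ce erefl erefl.
rewrite -sE2 -es in Y0 NA.
apply: le_trans (@gain_near s D K c0 _ _ _ x y nu s01 D1 K0 c00 dp HD Ox Hnu xE small
  (dbl _ _ _ d1 Dc0) erefl erefl Y0).
by rewrite lee_fin J0E J2E.
Qed.

End lower_density.

(** * Closure of the test functions and the lower bound *)

Lemma measurable_gauss_rV (R : realType) n :
  measurable_fun setT (fun x : 'rV[R]_n => (expR (- enorm x ^+ 2))%:E).
Proof.
by apply/measurable_EFinP; apply: (measurableT_comp (@measurable_expRNsqr _ setT)); exact: measurable_enorm.
Qed.

Lemma integral_gauss_rV (R : realType) n :
  (\int[lebesgue_rV R n]_x (expR (- enorm x ^+ 2))%:E = (Num.sqrt pi ^+ n)%:E)%E.
Proof.
have G := @integral_gauss_dot R n 0 (cst 1%E) (measurable_cst _) (fun=> lee01).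
have -> : (\int[lebesgue_rV R n]_x (expR (- enorm x ^+ 2))%:E =
    \int[lebesgue_rV R n]_h (cst 1 (dot h 0) * (expR (- enorm h ^+ 2))%:E))%E.
  by apply: eq_integral => x _; rewrite mul1e.
apply: (eq_trans G).
have -> : (\int[lebesgue_measure]_t (cst 1 (enorm (0 : 'rV[R]_n) * t)%R * (expR (- t ^+ 2))%:E) =
   \int[@lebesgue_measure R]_x (gauss_fun x)%:E)%E.
  by apply: eq_integral => x _; rewrite mul1e.
by rewrite integralT_gauss -!EFinM mulVf ?mulr1// gt_eqF// sqrtr_gt0 pi_gt0.
Qed.

(** The Gaussian has a positive lower bound on a bounded set and a finite integral. *)
Lemma bounded_lebesgue_rV (R : realType) n (A : set 'rV[R]_n) :
  measurable A -> bounded_set A -> (lebesgue_rV R n A < +oo)%E.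
Proof.
move=> mA [M [_ HM]].
pose r := `|M| + 1.
have bA x : A x -> enorm x ^+ 2 <= (n%:R * r) ^+ 2.
  move=> Ax; rewrite ler_sqr ?nnegrE ?enorm_ge0 ?mulr_ge0 ?addr_ge0//.
  apply: le_trans (enorm_le_norm _) _; rewrite ler_wpM2l//.
  by apply: (HM r) => //; rewrite (le_lt_trans (ler_norm M))// ltrDl.
have mg := @measurable_gauss_rV R n.
have gfin : (\int[lebesgue_rV R n]_x (expR (- enorm x ^+ 2))%:E < +oo)%E.
  by rewrite integral_gauss_rV ltry.
have : (\int[lebesgue_rV R n]_(x in A) 1%E < +oo)%E.
  apply: le_lt_trans (_ : (expR ((n%:R * r) ^+ 2))%:E * \int[lebesgue_rV R n]_x (expR (- enorm x ^+ 2))%:E < +oo)%E.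
    rewrite -ge0_integralZl//.
    - apply: (@le_trans _ _ (\int[lebesgue_rV R n]_(x in A) ((expR ((n%:R * r) ^+ 2))%:E * (expR (- enorm x ^+ 2))%:E))%E).
        apply: ge0_le_integral => //.
        + apply: measurable_funTS; apply: emeasurable_funM => //.
        + by move=> x Ax; rewrite -EFinM lee_fin -expRD; apply: le_trans (expR_ge1Dx _); rewrite lerDl subr_ge0; exact: bA.
      apply: ge0_subset_integral => //.
      + by apply: emeasurable_funM.
  by rewrite lte_mul_pinfty ?lee_fin ?expR_ge0.
by rewrite integral_cst// mul1e.
Qed.

Lemma measurable_eball (R : realType) m (x : 'rV[R]_m) (r : R) : measurable (eball x r).
Proof.
apply: open_measurable_rV; rewrite openE => z zx.
have d0 : 0 < r - enorm (z - x) by rewrite subr_gt0.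
apply: filterS (nbhs_enorm z d0) => w wz.
rewrite /eball /= -[w - x](_ : (w - z) + (z - x) = _); last by rewrite addrA subrK.
by apply: le_lt_trans (enormD _ _) _; rewrite -ltrBrDr.
Qed.

(** If one ball were null, all balls around 0 would be null by the affine change of variables, hence
    the whole space too, against the value of the Gaussian integral. *)
Lemma eball_lebesgue_gt0 (R : realType) m (x : 'rV[R]_m) (r : R) : 0 < r ->
  (0 < lebesgue_rV R m (eball x r))%E.
Proof.
move=> r0; rewrite lt0e measure_ge0 andbT; apply/eqP => B0.
have null k : lebesgue_rV R m (eball 0 k.+1%:R) = 0%E.
  have c0 : r / k.+1%:R != 0 by rewrite gt_eqF// divr_gt0.
  have mI : measurable_fun setT (cst 1%E \_ (eball x r) : 'rV[R]_m -> \bar R).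
    by apply: (iffLR (measurable_restrictT _ (measurable_eball x r))).
  have I0 w : (0 <= (cst 1%E \_ (eball x r) : 'rV[R]_m -> \bar R) w)%E.
    by rewrite patchE; case: ifP.
  have E := @ge0_integral_affine_rV R m (r / k.+1%:R) x _ c0 mI I0.
  have Er : (\int[lebesgue_rV R m]_w (cst 1%E \_ (eball x r) : 'rV[R]_m -> \bar R) w = 0)%E.
    by rewrite -integral_mkcond (integral_cst _ (measurable_eball x r)) mul1e.
  rewrite Er mule0 in E.
  rewrite -[LHS]mul1e -(integral_cst (lebesgue_rV R m) (measurable_eball 0 k.+1%:R)) integral_mkcond -[RHS]E.
  apply: eq_integral => w _; rewrite !patchE.
  suff -> : (r / k.+1%:R *: w + x \in eball x r) = (w \in eball 0 k.+1%:R) by [].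
  apply/idP/idP => /set_mem h; apply/mem_set; move: h; rewrite /eball /= addrK subr0 enormZ gtr0_norm ?divr_gt0//.
    by rewrite -mulrA gtr_pMr// mulrC ltr_pdivrMr// mul1r.
  by move=> h; rewrite -mulrA gtr_pMr// mulrC ltr_pdivrMr// mul1r.
have : lebesgue_rV R m setT = 0%E.
  have -> : [set: 'rV[R]_m] = \bigcup_k eball 0 k.+1%:R.
    apply/seteqP; split => // w _.
    exists (Num.truncn (enorm w)) => //=; rewrite /eball /= subr0.
    by have /andP[] := truncn_itv (enorm_ge0 w).
  apply/negligibleP; first by apply: bigcup_measurable => k _; exact: measurable_eball.
  by apply: negligible_bigcup => k; apply/negligibleP; [exact: measurable_eball|exact: null].
move=> T0; have := @integral_gauss_rV R m.
rewrite (null_set_integral measurableT (@measurable_gauss_rV R m) T0) => -[] /esym/eqP.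
by rewrite expf_eq0 [X in _ && X]gt_eqF ?andbF// sqrtr_gt0 pi_gt0.
Qed.

Lemma powRNE (R : realType) (x p : R) : 0 < p -> (x `^ (- (p / 2))) ^+ 2 = (x `^ p)^-1.
Proof.
move=> p0; rewrite powRN exprVn; congr (_^-1).
by rewrite -[LHS]powR_mulrn ?powR_ge0// -powRrM mulfVK.
Qed.

Lemma young_sqr (R : realType) (e a b : R) : 0 < e ->
  (a - b) ^+ 2 <= (1 + e) * a ^+ 2 + (1 + e^-1) * b ^+ 2.
Proof.
move=> e0; have : 0 <= (e * a + b) ^+ 2 / e by rewrite divr_ge0 ?sqr_ge0// ltW.
have -> : (e * a + b) ^+ 2 / e = e * a ^+ 2 + e^-1 * b ^+ 2 + 2 * (a * b).
  by field; rewrite gt_eqF.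
nra.
Qed.

(** Strictness comes from c I > 0. When H = 0 the quotient is +oo, the extended inverse of 0 being
    +oo. *)
Lemma le_quotient (R : realType) (h c : R) (G H I : \bar R) : (0 < h)%R -> (0 < c)%R ->
  (0 <= H < +oo)%E -> (0 < I)%E -> (h%:E * H + c%:E * I <= G)%E -> (h%:E < G / H)%E.
Proof.
move=> h0 c0 /andP[H0 Hoo] I0 le.
have G0 : (0 < G)%E.
  apply: lt_le_trans le; rewrite lte_paddl ?mule_ge0 ?lee_fin ?(ltW h0)//.
  by rewrite mule_gt0 ?lte_fin.
have [->|Hn] := eqVneq H 0%E.
  by rewrite inve0 gt0_muley// ltry.
have Hp : (0 < H)%E by rewrite lt0e Hn.
move: H H0 Hoo Hn Hp le => [r| |]// _ _ _ rp le.
rewrite lte_fin in rp.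
rewrite inver gt_eqF//.
have lt : ((h * r)%:E < G)%E.
  apply: lt_le_trans le; rewrite EFinM lteDl ?mule_gt0 ?lte_fin//.
case: G G0 le lt => [g| |]// _ _ => [|_].
  by rewrite lte_fin -EFinM lte_fin ltr_pdivlMr.
by rewrite gt0_mulye ?ltry// lte_fin invr_gt0.
Qed.

Lemma integral_young d (T : measurableType d) (R : realType) (m : {measure set T -> \bar R})
    (D : set T) (e : R) (f g h : T -> \bar R) : measurable D -> (0 < e)%R ->
  measurable_fun D f -> measurable_fun D g -> measurable_fun D h ->
  (forall x, D x -> 0 <= f x)%E -> (forall x, D x -> 0 <= g x)%E -> (forall x, D x -> 0 <= h x)%E ->
  (forall x, D x -> f x <= (1 + e)%:E * g x + (1 + e^-1)%:E * h x)%E ->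
  (\int[m]_(x in D) f x <= (1 + e)%:E * \int[m]_(x in D) g x + (1 + e^-1)%:E * \int[m]_(x in D) h x)%E.
Proof.
move=> mD e0 mf mg mh f0 g0 h0 le.
have e1 : 0 <= 1 + e by rewrite addr_ge0// ltW.
have e2 : 0 <= 1 + e^-1 by rewrite addr_ge0// invr_ge0 ltW.
rewrite -(ge0_integralZl m mD mg g0)// -(ge0_integralZl m mD mh h0)//.
rewrite -ge0_integralD//.
- apply: ge0_le_integral => //.
  by apply: emeasurable_funD; apply: measurable_funeM.
- by move=> x Dx; rewrite mule_ge0 ?lee_fin// g0.
- exact: measurable_funeM.
- by move=> x Dx; rewrite mule_ge0 ?lee_fin// h0.
- exact: measurable_funeM.
Qed.

(** [e] is fixed first, to bring (1 + e)^2 G close to G; then [d] is taken small against constants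
    that involve 1/e. *)
Lemma young_limit (R : realType) (a G k c : R) : 0 <= G -> 0 <= k -> 0 <= c ->
  (forall e d : R, 0 < e -> 0 < d ->
    a <= (1 + e) * ((1 + e) * G + (1 + e^-1) * (c * d)) + (1 + e^-1) * (k * d)) -> a <= G.
Proof.
move=> G0 k0 c0 H; rewrite leNgt; apply/negP => Ga.
pose e := Num.min 1 ((a - G) / (6 * (G + 1))).
have G1 : 0 < G + 1 by rewrite ltr_pwDr.
have e0 : 0 < e by rewrite lt_min ltr01 divr_gt0 ?subr_gt0// mulr_gt0.
have e1 : e <= 1 by rewrite ge_min lexx.
have eG : e * (G + 1) <= (a - G) / 6.
  have : e <= (a - G) / (6 * (G + 1)) by rewrite ge_min lexx orbT.
  by rewrite ler_pdivlMr ?mulr_gt0// mulrCA mulrC -ler_pdivlMr.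
pose C := (1 + e) * ((1 + e^-1) * c) + (1 + e^-1) * k.
have V0 : 0 <= 1 + e^-1 by rewrite addr_ge0// invr_ge0 ltW.
have C0 : 0 <= C by rewrite addr_ge0// ?mulr_ge0// addr_ge0// ltW.
have C1 : 0 < C + 1 by rewrite ltr_pwDr.
pose d := (a - G) / (3 * (C + 1)).
have d0 : 0 < d by rewrite divr_gt0 ?subr_gt0// mulr_gt0.
have dC : d * (C + 1) = (a - G) / 3 by rewrite /d; field; rewrite gt_eqF.
have := H e d e0 d0.
have -> : (1 + e) * ((1 + e) * G + (1 + e^-1) * (c * d)) + (1 + e^-1) * (k * d) =
  (1 + e) ^+ 2 * G + C * d by rewrite /C; ring.
clearbody e C d => {H}.
have : e * (e * G) <= e * G by rewrite ler_piMl// mulr_ge0// ltW.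
rewrite leNgt => h1; apply/negP; rewrite -ltNge.
move: h1; rewrite -leNgt => h1.
rewrite expr2; clear -h1 dC eG e0 d0 C0 G0 Ga; nra.
Qed.

(** * From test functions to their closure *)

Section test_functions.
Context {R : realType} {n : nat}.
Local Notation rV := 'rV[R]_n.+1.
Local Notation leb := (@lebesgue_rV R n.+1).
Variable Om : set rV.
Hypotheses (oOm : open Om) (bOm : bounded_set Om).
Local Notation delta := (dist_boundary Om).

Let mOm : measurable Om. Proof. exact: open_measurable_rV. Qed.

Lemma dist_boundary_lip x y : boundary Om !=set0 -> delta x - delta y <= enorm (x - y).
Proof.
move=> [z0 Bz0]; rewrite lerBlDr -lerBlDl.
apply: lb_le_inf; first by exists (enorm (y - z0)), z0.
move=> _ [z Bz <-]; rewrite lerBlDl; apply: le_trans (dist_boundary_le x Bz) _.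
by rewrite -[x - z](_ : (x - y) + (y - z) = _) ?enormD// addrA subrK.
Qed.

Lemma continuous_dist_boundary : boundary Om !=set0 -> continuous delta.
Proof.
move=> B0 x; apply/(@cvgrPdist_lt _ _ _ (nbhs x) (nbhs_filter x)) => e e0.
apply: filterS (nbhs_enorm x e0) => y xy.
rewrite ltr_norml ltrNl opprB.
rewrite (le_lt_trans (dist_boundary_lip y x B0))//= (le_lt_trans (dist_boundary_lip x y B0))//.
by rewrite -enormN opprB.
Qed.

Lemma measurable_dist_boundary : boundary Om !=set0 -> measurable_fun setT delta.
Proof. by move=> B0; apply: continuous_measurable_rV; exact: continuous_dist_boundary. Qed.

Lemma test_continuous phi : test_function Om phi -> continuous phi.
Proof. by move=> [h _ _]; have [] := h 0%N. Qed.

Lemma test_measurable phi : test_function Om phi -> measurable_fun setT phi.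
Proof. by move=> /test_continuous; exact: continuous_measurable_rV. Qed.

Lemma test_support phi x : test_function Om phi -> phi x != 0 -> Om x.
Proof. by move=> [_ _ h] p0; apply: h; exact: subset_closure. Qed.

Lemma test_margin phi : test_function Om phi -> exists2 d : R, 0 < d &
  forall x, phi x != 0 -> Om x /\ d <= delta x.
Proof.
move=> tphi; have [_ cS SO] := tphi.
have [S0|S0] := pselect (closure [set x | phi x != 0] !=set0); last first.
  by exists 1 => // x px; exfalso; apply: S0; exists x; exact: subset_closure.
have [x0 /SO Ox0] := S0.
have [] := compact_EVT_min S0 cS (continuous_subspaceT (continuous_dist_boundary (boundary_nonempty oOm bOm Ox0))).
move=> c /set_mem /SO Oc H; exists (delta c); first exact: dist_boundary_gt0.
move=> x px; split; first exact: (test_support tphi).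
by apply: H; apply/mem_set; exact: subset_closure.
Qed.

Lemma test_bounded phi : test_function Om phi -> exists2 B : R, 0 < B & forall x, phi x ^+ 2 <= B.
Proof.
move=> tphi; have [_ cS SO] := tphi.
have cp : compact (phi @` closure [set x | phi x != 0]).
  by apply: continuous_compact => //; apply: continuous_subspaceT; exact: (test_continuous tphi).
have [M [_ HM]] := compact_bounded cp.
exists ((`|M| + 1) ^+ 2); first by rewrite exprn_gt0// ltr_wpDl.
move=> x; rewrite -real_normK ?num_real// ler_sqr ?nnegrE ?addr_ge0//.
have [->|px] := eqVneq (phi x) 0; first by rewrite normr0 addr_ge0.
apply: (HM (`|M| + 1)); first by rewrite (le_lt_trans (ler_norm M))// ltrDl.
by exists x => //; exact: subset_closure.
Qed.

Lemma test_integral_fin phi (f : rV -> R) (C : R) : test_function Om phi ->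
  measurable_fun setT f -> (forall x, Om x -> 0 <= f x) -> (forall x, phi x != 0 -> f x <= C) ->
  (\int[leb]_(x in Om) (phi x ^+ 2 * f x)%:E < +oo)%E.
Proof.
move=> tphi mf f0 fC; have [B B0 HB] := test_bounded tphi.
have C0 : 0 <= `|C| by [].
apply: (@le_lt_trans _ _ (\int[leb]_(x in Om) (B * `|C|)%:E)%E).
  apply: ge0_le_integral => //.
  - by move=> x Ox; rewrite lee_fin mulr_ge0 ?sqr_ge0 ?f0.
  - apply: measurable_funTS; apply/measurable_EFinP; apply: measurable_funM => //.
    by apply: measurable_funX; exact: (test_measurable tphi).
  - move=> x Ox; rewrite lee_fin.
    have [->|px] := eqVneq (phi x) 0; first by rewrite expr0n/= mul0r mulr_ge0// ltW.
    by apply: ler_pM => //; rewrite ?sqr_ge0 ?f0// (le_trans (fC x px))// ler_norm.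
rewrite integral_cst// lte_mul_pinfty ?bounded_lebesgue_rV//.
by rewrite lee_fin mulr_ge0// ltW.
Qed.

Lemma test_norm_gt0 phi x0 : test_function Om phi -> phi x0 != 0 ->
  (0 < \int[leb]_(x in Om) (phi x ^+ 2)%:E)%E.
Proof.
move=> tphi p0; have Ox0 := test_support tphi p0.
pose e := phi x0 ^+ 2 / 4.
have e0 : 0 < e by rewrite divr_gt0// exprn_even_gt0.
have : \forall x \near x0, phi x ^+ 2 > e /\ Om x.
  near=> x; split; last by near: x; exact: open_nbhs_nbhs.
  have : `|phi x0 - phi x| < `|phi x0| / 2.
    near: x; apply: (@cvgr_dist_lt _ _ _ (nbhs x0) (nbhs_filter x0)); last by rewrite divr_gt0 ?normr_gt0.
    exact: test_continuous tphi _.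
  move=> h; rewrite /e -[phi x ^+ 2]real_normK ?num_real// -[phi x0 ^+ 2]real_normK ?num_real//.
  have h2 := ler_distD (phi x) (phi x0) 0; rewrite !subr0 in h2.
  have h3 := normr_ge0 (phi x0); have h4 := normr_ge0 (phi x).
  clear -h h2 h3 h4; move: (`|phi x0|) (`|phi x|) (`|phi x0 - phi x|) h h2 h3 h4 => a b c h h2 h3 h4.
  nra.
case/nbhs_ballP => r /= r0 Hr.
have sub : eball x0 r `<=` [set x | phi x ^+ 2 > e /\ Om x].
  move=> y yx; apply: Hr; rewrite -ball_normE /=.
  by apply: le_lt_trans yx; rewrite -normrN opprB norm_le_enorm.
have mB := measurable_eball x0 r.
have mphi : measurable_fun setT (fun x => (phi x ^+ 2)%:E).
  by apply/measurable_EFinP; apply: measurable_funX; exact: (test_measurable tphi).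
apply: (@lt_le_trans _ _ (\int[leb]_(x in eball x0 r) (e%:E))%E).
  by rewrite integral_cst// mule_gt0 ?eball_lebesgue_gt0.
apply: (@le_trans _ _ (\int[leb]_(x in eball x0 r) (phi x ^+ 2)%:E)%E).
  apply: ge0_le_integral => //.
  - by move=> x _; rewrite lee_fin ltW.
  - exact: measurable_funTS.
  - by move=> x /sub[/ltW h _]; rewrite lee_fin.
apply: ge0_subset_integral => //.
- exact: measurable_funTS.
- by move=> x _; rewrite lee_fin sqr_ge0.
- by move=> x /sub[].
Unshelve. all: by end_near. Qed.

Variable s : R.
Hypothesis s01 : 2^-1 < s < 1.

Let s0 : 0 < s. Proof. by case/andP: s01 => h _; apply: lt_trans h; rewrite invr_gt0. Qed.
Let p0 : 0 < n.+1%:R + 2 * s. Proof. by rewrite addr_gt0// mulr_gt0. Qed.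
Let mOm2 : measurable (Om `*` Om). Proof. exact: measurableX. Qed.

Definition pair_energy (u : rV -> R) : \bar R :=
  (\int[leb \x leb]_(z in Om `*` Om) (pair_kernel s u z)%:E)%E.

Lemma pair_energyE (u : rV -> R) :
  (\int[leb \x leb]_z pair_cut Om s u z)%E = pair_energy u.
Proof.
rewrite /pair_energy [RHS]integral_mkcond; apply: eq_integral => -[x y] _.
rewrite patchE /pair_cut; cbn [fst snd].
suff -> : (x \in Om) && (y \in Om) = ((x, y) \in Om `*` Om) by case: ifP.
apply/idP/idP => [/andP[/set_mem xO /set_mem yO]|/set_mem[xO yO]]; first exact/mem_set.
by apply/andP; split; exact/mem_set.
Qed.

Lemma gagliardoE (u : rV -> R) :
  gagliardo s Om u = ((c_Ns n.+1 s / 2)%:E * pair_energy u)%E.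
Proof. by []. Qed.

Lemma c_Ns_gt0 : 0 < c_Ns n.+1 s :> R.
Proof.
have [_ s1] := andP s01.
rewrite /c_Ns divr_gt0 ?Gamma_gt0 ?subr_gt0//.
by rewrite !mulr_gt0 ?powR_gt0 ?pi_gt0 ?Gamma_gt0 ?divr_gt0.
Qed.

Lemma pair_energy_ge0 (u : rV -> R) : (0 <= pair_energy u)%E.
Proof. by apply: integral_ge0 => z _; rewrite lee_fin pair_kernel_ge0. Qed.

Lemma gagliardo_ge0 (u : rV -> R) : (0 <= gagliardo s Om u)%E.
Proof.
by rewrite gagliardoE mule_ge0 ?pair_energy_ge0// lee_fin divr_ge0// ltW// c_Ns_gt0.
Qed.

Lemma test_hardy (w : rV -> R) phi : measurable_fun setT w -> (forall x, 0 <= w x) ->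
  (forall x, Om x -> ((w x)%:E <= gain_density Om s x)%E) -> test_function Om phi ->
  (\int[leb]_(x in Om) (phi x ^+ 2 * w x)%:E <= 2^-1%:E * pair_energy phi)%E.
Proof.
move=> mw w0 Hw tphi; have [d d0 Hd] := test_margin tphi.
have mphi := test_measurable tphi.
have m2 : measurable_fun setT (fun x => phi x ^+ 2) by exact: measurable_funX.
have L2 : (\int[leb]_x (phi x ^+ 2)%:E < +oo)%E.
  have := @test_integral_fin phi (cst 1) 1 tphi (measurable_cst _) (fun _ _ => ler01) (fun _ _ => lexx _).
  apply: le_lt_trans; rewrite [leRHS]integral_mkcond; apply: ge0_le_integral => //.
  - by move=> x _; rewrite lee_fin sqr_ge0.
  - exact/measurable_EFinP.
  - apply: (iffLR (measurable_restrictT _ mOm)); apply/measurable_EFinP; apply: measurable_funTS.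
    exact: measurable_funM.
  - move=> x _; rewrite patchE; case: ifPn => [_|/negP xO]; first by rewrite mulr1.
    have [->|px] := eqVneq (phi x) 0; first by rewrite expr0n.
    by exfalso; apply: xO; apply/mem_set; exact: (test_support tphi).
have G := ground_state oOm bOm s01 mphi d0 _ L2.
rewrite pair_energyE in G.
have {}G := G (fun x y px xy => dist_boundary_ball oOm bOm (Hd x px).1 (lt_le_trans xy (Hd x px).2)).
have : (2%:E * \int[leb]_(x in Om) (phi x ^+ 2 * w x)%:E <= pair_energy phi)%E.
  apply: le_trans G; rewrite lee_wpmul2l// [leLHS]integral_mkcond; apply: ge0_le_integral => //.
  - by move=> x _; rewrite patchE; case: ifP => // _; rewrite lee_fin mulr_ge0 ?sqr_ge0.
  - apply: (iffLR (measurable_restrictT _ mOm)); apply/measurable_EFinP; apply: measurable_funTS.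
    exact: measurable_funM.
  - apply: emeasurable_funM; first exact/measurable_EFinP.
    exact: measurable_gain_density.
  - move=> x _; rewrite patchE; case: ifPn => [/set_mem xO|_].
      by rewrite EFinM lee_wpmul2l ?lee_fin ?sqr_ge0// Hw.
    rewrite mule_ge0 ?lee_fin ?sqr_ge0//.
    by apply: integral_ge0 => z _; rewrite lee_fin; exact: gain_at_ge0.
move=> {}G.
have := lee_wpmul2l (_ : (0 <= 2^-1%:E)%E) G; rewrite muleA -EFinM mulVf// mul1e; apply.
by rewrite lee_fin invr_ge0.
Qed.

Lemma pair_kernel_young (u v : rV -> R) (e : R) z : 0 < e ->
  pair_kernel s v z <= (1 + e) * pair_kernel s u z + (1 + e^-1) * pair_kernel s (u \- v) z.
Proof.
move=> e0; rewrite /pair_kernel !mulrA -mulrDl ler_wpM2r ?invr_ge0 ?powR_ge0//.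
have := young_sqr (u z.1 - u z.2) ((u \- v) z.1 - (u \- v) z.2) e0; rewrite /=.
by congr (_ ^+ 2 <= _); ring.
Qed.

(** Convergence in L^2 controls the weighted integral only for bounded weights, so [w] is truncated
    at [k] and monotone convergence removes the truncation. [u] and its approximations are compared
    by Young's inequality with a factor 1 + e, both in the weighted integral and in the energy. *)
Lemma hardy_closure (w u : rV -> R) (C : R) : measurable_fun setT w -> (forall x, 0 <= w x) ->
  measurable_fun setT u -> (\int[leb]_(x in Om) (u x ^+ 2)%:E < +oo)%E ->
  (pair_energy u < +oo)%E -> 0 <= C ->
  (forall d : R, 0 < d -> exists phi : rV -> R, [/\ measurable_fun setT phi,
    (\int[leb]_(x in Om) (phi x ^+ 2 * w x)%:E <= 2^-1%:E * pair_energy phi)%E,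
    (\int[leb]_(x in Om) ((u x - phi x) ^+ 2)%:E <= d%:E)%E &
    (pair_energy (u \- phi)%R <= (C * d)%:E)%E]) ->
  (\int[leb]_(x in Om) (u x ^+ 2 * w x)%:E <= 2^-1%:E * pair_energy u)%E.
Proof.
move=> mw w0 mu uL2 uE C0 H.
pose wk k x := Num.min (w x) k%:R.
have wk0 k x : 0 <= wk k x by rewrite le_min w0 ler0n.
have wkw k x : wk k x <= w x by rewrite ge_min lexx.
have mwk k : measurable_fun setT (wk k).
  by apply: measurable_minr => //; exact: measurable_cst.
have mm k (f : rV -> R) : measurable_fun setT f -> measurable_fun Om (fun x => (f x ^+ 2 * wk k x)%:E).
  move=> mf; apply: measurable_funTS; apply/measurable_EFinP; apply: measurable_funM => //.
  exact: measurable_funX.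
have mK (f : rV -> R) : measurable_fun setT f -> measurable_fun (Om `*` Om) (fun z => (pair_kernel s f z)%:E).
  by move=> mf; apply: measurable_funTS; apply/measurable_EFinP; exact: measurable_pair_kernel.
have main k : (\int[leb]_(x in Om) (u x ^+ 2 * wk k x)%:E <= 2^-1%:E * pair_energy u)%E.
  have afin : (\int[leb]_(x in Om) (u x ^+ 2 * wk k x)%:E < +oo)%E.
    apply: (@le_lt_trans _ _ (k%:R%:E * \int[leb]_(x in Om) (u x ^+ 2)%:E)%E); last first.
      by rewrite lte_mul_pinfty// lee_fin.
    have mu2 : measurable_fun Om (fun x => (u x ^+ 2)%:E).
      by apply: measurable_funTS; apply/measurable_EFinP; exact: measurable_funX.
    rewrite -(ge0_integralZl leb mOm mu2 (fun x _ => _))//; last first.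
      by move=> x _; rewrite lee_fin sqr_ge0.
    apply: ge0_le_integral => //.
    - by move=> x _; rewrite lee_fin mulr_ge0 ?sqr_ge0.
    - exact: mm.
    - exact: measurable_funeM.
    - by move=> x _; rewrite -EFinM lee_fin mulrC ler_wpM2r ?sqr_ge0// ge_min lexx orbT.
  have a0 : (0 <= \int[leb]_(x in Om) (u x ^+ 2 * wk k x)%:E)%E.
    by apply: integral_ge0 => x _; rewrite lee_fin mulr_ge0 ?sqr_ge0.
  have [a aE] : exists a : R, (\int[leb]_(x in Om) (u x ^+ 2 * wk k x)%:E = a%:E)%E.
    by exists (fine (\int[leb]_(x in Om) (u x ^+ 2 * wk k x)%:E)%E); rewrite fineK// ge0_fin_numE.
  have [G GE] : exists G : R, pair_energy u = G%:E.
    by exists (fine (pair_energy u)); rewrite fineK// ge0_fin_numE ?pair_energy_ge0.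
  have G0 : 0 <= G by rewrite -lee_fin -GE pair_energy_ge0.
  rewrite aE GE -EFinM lee_fin.
  apply: (@young_limit _ a (2^-1 * G) k%:R (2^-1 * C)) => //.
  - by rewrite mulr_ge0// invr_ge0.
  - by rewrite mulr_ge0// invr_ge0.
  move=> e d e0 d0; have [phi [mphi hphi h1 h2]] := H d d0.
  have mup : measurable_fun setT (u \- phi) by exact: measurable_funB.
  have e1 : 0 <= 1 + e by rewrite addr_ge0// ltW.
  have e2 : 0 <= 1 + e^-1 by rewrite addr_ge0// invr_ge0 ltW.
  have Y1 : (\int[leb]_(x in Om) (u x ^+ 2 * wk k x)%:E <=
      (1 + e)%:E * \int[leb]_(x in Om) (phi x ^+ 2 * wk k x)%:E +
      (1 + e^-1)%:E * \int[leb]_(x in Om) ((u x - phi x) ^+ 2 * wk k x)%:E)%E.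
    apply: (integral_young leb mOm e0 (mm k u mu) (mm k phi mphi) (mm k _ mup)) => x _; try by rewrite lee_fin mulr_ge0 ?sqr_ge0.
    rewrite -!EFinM -EFinD lee_fin !mulrA -mulrDl ler_wpM2r//.
    have := young_sqr (phi x) (- (u \- phi) x) e0; rewrite sqrrN opprK /=.
    by congr (_ ^+ 2 <= _); ring.
  have Y2 : (pair_energy phi <= (1 + e)%:E * pair_energy u + (1 + e^-1)%:E * pair_energy (u \- phi)%R)%E.
    apply: (integral_young _ mOm2 e0 (mK phi mphi) (mK u mu) (mK _ mup)) => z _; try by rewrite lee_fin pair_kernel_ge0.
    by rewrite -!EFinM -EFinD lee_fin pair_kernel_young.
  have Z1 : (\int[leb]_(x in Om) (phi x ^+ 2 * wk k x)%:E <= 2^-1%:E * pair_energy phi)%E.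
    apply: le_trans hphi; apply: ge0_le_integral => //.
    - by move=> x _; rewrite lee_fin mulr_ge0 ?sqr_ge0.
    - exact: mm.
    - apply: measurable_funTS; apply/measurable_EFinP; apply: measurable_funM => //.
      exact: measurable_funX.
    - by move=> x _; rewrite lee_fin ler_wpM2l ?sqr_ge0.
  have Z2 : (\int[leb]_(x in Om) ((u x - phi x) ^+ 2 * wk k x)%:E <= (k%:R * d)%:E)%E.
    have mu2 : measurable_fun Om (fun x => ((u x - phi x) ^+ 2)%:E).
      by apply: measurable_funTS; apply/measurable_EFinP; exact: measurable_funX.
    rewrite EFinM; apply: le_trans (lee_wpmul2l _ h1); last by rewrite lee_fin.
    rewrite -(ge0_integralZl leb mOm mu2 (fun x _ => _))//; last first.
      by move=> x _; rewrite lee_fin sqr_ge0.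
    apply: ge0_le_integral => //.
    - by move=> x _; rewrite lee_fin mulr_ge0 ?sqr_ge0.
    - exact: mm.
    - exact: measurable_funeM.
    - by move=> x _; rewrite -EFinM lee_fin mulrC ler_wpM2r ?sqr_ge0// ge_min lexx orbT.
  rewrite aE in Y1; rewrite GE in Y2; rewrite -lee_fin; apply: (le_trans Y1).
  rewrite [leRHS]EFinD; apply: leeD; rewrite [leRHS]EFinM; apply: lee_wpmul2l; rewrite ?lee_fin//.
  apply: (le_trans Z1).
  have -> : (1 + e) * (2^-1 * G) + (1 + e^-1) * (2^-1 * C * d) =
    2^-1 * ((1 + e) * G + (1 + e^-1) * (C * d)) by ring.
  rewrite [leRHS]EFinM; apply: lee_wpmul2l; first by rewrite lee_fin invr_ge0.
  apply: (le_trans Y2); rewrite [leRHS]EFinD [X in (_ <= X + _)%E]EFinM [X in (_ <= _ + X)%E]EFinM.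
  by rewrite leeD2l// lee_wpmul2l// lee_fin.
have E : (\int[leb]_(x in Om) (u x ^+ 2 * w x)%:E =
    \int[leb]_(x in Om) limn (fun k => (u x ^+ 2 * wk k x)%:E))%E.
  apply: eq_integral => x _; apply/esym/cvg_lim => //.
  apply: cvg_near_cst; near=> k; congr (_ * _)%:E.
  apply: min_l; apply: ltW; near: k; exact: nbhs_infty_gtr.
rewrite E (monotone_convergence leb mOm) => [|k|k x _|x _ k l kl].
- apply: lime_le; last by apply: nearW => k; exact: main.
  apply: ereal_nondecreasing_is_cvgn => k l kl; apply: ge0_le_integral => //.
  + by move=> x _; rewrite lee_fin mulr_ge0 ?sqr_ge0.
  + exact: mm.
  + exact: mm.
  + by move=> x _; rewrite lee_fin ler_wpM2l ?sqr_ge0// le_min ge_min lexx/= ge_min ler_nat kl orbT.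
- exact: mm.
- by rewrite lee_fin mulr_ge0 ?sqr_ge0.
- by rewrite lee_fin ler_wpM2l ?sqr_ge0// le_min ge_min lexx/= ge_min ler_nat kl orbT.
Unshelve. all: by end_near. Qed.

Lemma le_poweR_half (X : \bar R) (d : R) : (0 <= X)%E -> 0 <= d -> (X `^ 2^-1 < d%:E)%E -> (X <= (d ^+ 2)%:E)%E.
Proof.
move=> X0 d0 h; rewrite leNgt; apply/negP => lt; move: h; rewrite ltNge => /negP; apply.
have -> : d%:E = ((d ^+ 2)%:E `^ 2^-1)%E.
  by rewrite poweR12_sqrt ?lee_fin ?sqr_ge0//= sqrtr_sqr ger0_norm.
apply: gt0_ler_poweR; rewrite ?invr_ge0//; last exact: ltW.
- by rewrite in_itv/= lee_fin sqr_ge0 leey.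
- by rewrite in_itv/= X0 leey.
Qed.

Lemma Hs0_hardy (w u : rV -> R) : measurable_fun setT w -> (forall x, 0 <= w x) ->
  (forall x, Om x -> ((w x)%:E <= gain_density Om s x)%E) -> in_Hs0 s Om u ->
  (\int[leb]_(x in Om) (u x ^+ 2 * w x)%:E <= 2^-1%:E * pair_energy u)%E /\
  (pair_energy u < +oo)%E.
Proof.
move=> mw w0 Hw [[[mu uL2] [_ uE]] H].
have {}uE : (pair_energy u < +oo)%E.
  apply: le_lt_trans uE; rewrite le_eqVlt; apply/orP; left; apply/eqP.
  by apply: eq_integral => z _; rewrite exprMn powRNE.
split=> //.
(* [u] is only known to be measurable on [Om]; its extension by 0 is measurable everywhere and has
   the same integrals. *)
pose v := u \_ Om.
have mv : measurable_fun setT v by apply: (iffLR (measurable_restrictT _ mOm)).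
have vu x : Om x -> v x = u x by move=> /mem_set xO; rewrite /v patchE xO.
have vE f : pair_energy (u \- f)%R = pair_energy (v \- f)%R.
  by apply: eq_integral => -[x y] /set_mem[xO yO]; rewrite /pair_kernel /= !vu.
have vE0 : pair_energy u = pair_energy v.
  by apply: eq_integral => -[x y] /set_mem[xO yO]; rewrite /pair_kernel /= !vu.
have -> : (\int[leb]_(x in Om) (u x ^+ 2 * w x)%:E = \int[leb]_(x in Om) (v x ^+ 2 * w x)%:E)%E.
  by apply: eq_integral => x /set_mem xO; rewrite vu.
rewrite vE0; rewrite vE0 in uE.
have cpos := c_Ns_gt0.
apply: (@hardy_closure w v (2 / c_Ns n.+1 s)) => //.
- apply: le_lt_trans uL2; rewrite le_eqVlt; apply/orP; left; apply/eqP.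
  by apply: eq_integral => x /set_mem xO; rewrite vu.
- by rewrite divr_ge0// ltW.
move=> d d0; have sd0 : 0 < Num.sqrt d by rewrite sqrtr_gt0.
have [phi [tphi Hphi]] := H _ sd0; exists phi.
have I0 : (0 <= \int[leb]_(x in Om) ((u \- phi)%R x ^+ 2)%:E)%E.
  by apply: integral_ge0 => x _; rewrite lee_fin sqr_ge0.
have G0 := gagliardo_ge0 (u \- phi).
have := le_poweR_half (adde_ge0 I0 G0) (ltW sd0) Hphi; rewrite sqr_sqrtr ?(ltW d0)// => le.
split.
- exact: (test_measurable tphi).
- exact: test_hardy.
- apply: le_trans (le_trans (leeDl _ G0) le).
  rewrite le_eqVlt; apply/orP; left; apply/eqP.
  by apply: eq_integral => x /set_mem xO; rewrite vu.
- have : (gagliardo s Om (u \- phi)%R <= d%:E)%E := le_trans (leeDr _ I0) le.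
  rewrite gagliardoE vE => {}le.
  have := lee_wpmul2l (_ : (0 <= (2 / c_Ns n.+1 s)%:E)%E) le.
  rewrite muleA -!EFinM mulrA divfK ?gt_eqF// divff// mul1e; apply.
  by rewrite lee_fin divr_ge0// ltW.
Qed.

End test_functions.

(** The term c u^2 of the density estimate survives in the closure and makes the inequality strict
    for every nonzero admissible function; hence no function attains the infimum when the latter is
    at most [h_Ns]. *)
Theorem hardy_lower (R : realType) (n : nat) (Om : set 'rV[R]_n.+1) :
  (0 < n)%N -> Om !=set0 -> open Om -> bounded_set Om -> C11_boundary Om -> exists2 e0 : R, 0 < e0 &
  forall s, 2^-1 < s -> s - 2^-1 <= e0 ->
  [/\ s < 1, ((h_Ns n.+1 s)%:E <= mu_Ns s Om)%E &
    (mu_Ns s Om <= (h_Ns n.+1 s)%:E)%E -> ~ mu_achieved s Om].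
Proof.
move=> n0 [y0 Oy0] oOm bOm cOm; have [e0 e00 He] := gain_density_ge oOm bOm n0 cOm.
exists e0 => // s s1 se; have [s2 [c c0 Hc]] := He s s1 se.
have s01 : 2^-1 < s < 1 by rewrite s1.
have Ob : boundary Om !=set0 by exact: (boundary_nonempty oOm bOm Oy0).
have mOm : measurable Om by exact: open_measurable_rV.
have md := measurable_dist_boundary Ob.
have mdp : measurable_fun setT (fun x => dist_boundary Om x `^ (- (2 * s))).
  by apply: (measurableT_comp (measurable_powR _)).
pose k := kap s * dirJ n (2 * s).
have J0 : 0 < dirJ n (2 * s) :> R.
  by apply: dirJ_gt0; rewrite (lt_trans (ltrN10 R))// mulr_gt0// (lt_trans _ s1)// invr_gt0.
have k0 : 0 < k by rewrite mulr_gt0// kap_gt0.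
pose w x := k * dist_boundary Om x `^ (- (2 * s)) + c.
have mw : measurable_fun setT w.
  by apply: measurable_funD => //; apply: measurable_funM.
have w0 x : 0 <= w x by rewrite addr_ge0 ?(ltW c0)// mulr_ge0 ?powR_ge0// ltW.
have cpos : 0 < c_Ns n.+1 s :> R by exact: c_Ns_gt0.
have hE : h_Ns n.+1 s = c_Ns n.+1 s * k :> R by rewrite h_NsE /k [kap s * _]mulrC.
have h0 : 0 < h_Ns n.+1 s :> R by rewrite hE mulr_gt0.
pose H (u : 'rV[R]_n.+1 -> R) := (\int[lebesgue_rV R n.+1]_(x in Om) (u x ^+ 2 * dist_boundary Om x `^ (- (2 * s)))%:E)%E.
have H0 u : (0 <= H u)%E by apply: integral_ge0 => x _; rewrite lee_fin mulr_ge0 ?sqr_ge0 ?powR_ge0.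
pose I (u : 'rV[R]_n.+1 -> R) := (\int[lebesgue_rV R n.+1]_(x in Om) (u x ^+ 2)%:E)%E.
have I0 u : (0 <= I u)%E by apply: integral_ge0 => x _; rewrite lee_fin sqr_ge0.
have split_w (u : 'rV[R]_n.+1 -> R) : measurable_fun Om u ->
  (\int[lebesgue_rV R n.+1]_(x in Om) (u x ^+ 2 * w x)%:E = k%:E * H u + c%:E * I u)%E.
  move=> mu.
  have m1 : measurable_fun Om (fun x => (u x ^+ 2)%:E).
    by apply/measurable_EFinP; apply: measurable_funX.
  have m2 : measurable_fun Om (fun x => (u x ^+ 2 * dist_boundary Om x `^ (- (2 * s)))%:E).
    apply/measurable_EFinP; apply: measurable_funM; first exact: measurable_funX.
    exact: measurable_funTS.
  have p1 x : Om x -> (0 <= (u x ^+ 2)%:E)%E by move=> _; rewrite lee_fin sqr_ge0.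
  have p2 x : Om x -> (0 <= (u x ^+ 2 * dist_boundary Om x `^ (- (2 * s)))%:E)%E.
    by move=> _; rewrite lee_fin mulr_ge0 ?sqr_ge0 ?powR_ge0.
  have c0' : (0 <= c%:E)%E by rewrite lee_fin ltW.
  have k0' : (0 <= k%:E)%E by rewrite lee_fin ltW.
  rewrite -(ge0_integralZl _ mOm m1 p1 c0') -(ge0_integralZl _ mOm m2 p2 k0').
  rewrite -(ge0_integralD _ mOm).
  - by apply: eq_integral => x _; rewrite -!EFinM -EFinD; congr _%:E; rewrite /w; ring.
  - by move=> x _; rewrite -EFinM lee_fin mulr_ge0 ?(ltW k0)// mulr_ge0 ?sqr_ge0 ?powR_ge0.
  - exact: measurable_funeM.
  - by move=> x _; rewrite -EFinM lee_fin mulr_ge0 ?(ltW c0)// sqr_ge0.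
  - exact: measurable_funeM.
have key (u : 'rV[R]_n.+1 -> R) : measurable_fun Om u -> (H u < +oo)%E -> (0 < I u)%E ->
    (\int[lebesgue_rV R n.+1]_(x in Om) (u x ^+ 2 * w x)%:E <= 2^-1%:E * pair_energy Om s u)%E ->
    ((h_Ns n.+1 s)%:E < hardy_quotient s Om u)%E.
  move=> mu Hoo Ip le; apply: (le_quotient h0 (mulr_gt0 cpos c0) _ Ip); first by rewrite H0.
  rewrite split_w// in le.
  have := lee_wpmul2l (_ : (0 <= (c_Ns n.+1 s)%:E)%E) le.
  rewrite ge0_muleDr; last 2 first.
  - by rewrite mule_ge0 ?lee_fin ?(ltW k0).
  - by rewrite mule_ge0 ?lee_fin ?(ltW c0).
  by rewrite !muleA -!EFinM -hE; apply; rewrite lee_fin ltW.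
split=> //.
- apply: le_ereal_inf_tmp => _ [u [tu [x ux]]] <-; apply: ltW; apply: key.
  + by apply: measurable_funTS; exact: test_measurable tu.
  + have [d d0 Hd] := test_margin oOm bOm tu.
    apply: (@test_integral_fin _ _ Om oOm bOm u _ (d `^ (- (2 * s))) tu mdp) => [y _|y uy].
      exact: powR_ge0.
    rewrite !powRN lef_pV2 ?posrE ?powR_gt0// ?ge0_ler_powR ?nnegrE ?(ltW d0)//.
    * by rewrite mulr_ge0// (le_trans _ (ltW s1)).
    * by rewrite (le_trans (ltW d0))//; exact: (Hd y uy).2.
    * exact: (Hd y uy).2.
    * by rewrite (lt_le_trans d0)//; exact: (Hd y uy).2.
  + exact: (test_norm_gt0 oOm tu ux).
  + by apply: test_hardy.
- move=> leh [u [Hu nz E]].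
  have [le fin] := Hs0_hardy oOm bOm s01 mw w0 Hc Hu.
  have mu : measurable_fun Om u by case: Hu => -[[]].
  have Ip : (0 < I u)%E.
    rewrite lt0e I0 andbT; apply/eqP => Iu0; apply: nz.
    have m1 : measurable_fun Om (fun x => (u x ^+ 2)%:E).
      by apply/measurable_EFinP; apply: measurable_funX.
    have := (ae_eq_integral_abs (lebesgue_rV R n.+1) mOm m1).1.
    rewrite (_ : (\int[_]_(x in Om) _)%E = I u); last first.
      by apply: eq_integral => x _; rewrite gee0_abs// lee_fin sqr_ge0.
    move=> /(_ Iu0); apply: filterS => x /[swap] Ox /(_ Ox)[] /eqP.
    by rewrite sqrf_eq0 => /eqP.
  (* The strict bound for the quotient needs a finite denominator, which the inequality itself
     provides since the energy is finite. *)
  have Hoo : (H u < +oo)%E.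
    have : (k%:E * H u <= 2^-1%:E * pair_energy Om s u)%E.
      by apply: le_trans le; rewrite split_w// leeDl// mule_ge0 ?lee_fin ?(ltW c0).
    move=> le'; rewrite ltNge leye_eq; apply/negP => /eqP Hu0.
    move: le'; rewrite Hu0 gt0_muley ?lte_fin// leNgt => /negP; apply.
    by rewrite lte_mul_pinfty// lee_fin invr_ge0.
  have := key u mu Hoo Ip le; rewrite E => lt.
  by have := lt_le_trans lt leh; rewrite ltxx.
Qed.

(** * Smooth functions of one variable *)

Section smooth_line.
Context {R : realType}.
Implicit Types (f g : R -> R) (k : nat).

(** One-variable counterpart of [class_C], with the derivative as an explicit witness, so that
    smoothness is built by closure rules. *)
Fixpoint line_C k f : Prop :=
  if k is k'.+1 then exists2 g, (forall x : R, is_derive x 1 f (g x)) & line_C k' g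
  else continuous f.

Lemma line_C_continuous k f : line_C k f -> continuous f.
Proof.
by case: k => [//|k] [g fg _] x; exact: is_derive_continuous (fg x).
Qed.

Lemma line_C_pred k f : line_C k.+1 f -> line_C k f.
Proof.
elim: k f => [|k IH] f; first exact: line_C_continuous.
by case=> g fg gk; exists g => //; exact: IH.
Qed.

Lemma line_C_cst k (c : R) : line_C k (cst c).
Proof.
by elim: k c => [|k IH] c /=; [exact: cst_continuous|exists (cst 0) => // x; exact: is_derive_cst].
Qed.

Lemma line_CD k f g : line_C k f -> line_C k g -> line_C k (fun x => f x + g x).
Proof.
elim: k f g => [|k IH] f g /=; first by move=> cf cg x; apply: cvgD; [exact: cf|exact: cg].
move=> [f' ff' Cf] [g' gg' Cg]; exists (fun x => f' x + g' x); last exact: IH.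
by move=> x; exact: (@is_deriveD _ _ _ f g).
Qed.

Lemma line_CM k f g : line_C k f -> line_C k g -> line_C k (fun x => f x * g x).
Proof.
elim: k f g => [|k IH] f g; first by move=> cf cg x; apply: cvgM; [exact: cf|exact: cg].
move=> Cf Cg; have [f' ff' Cf'] := Cf; have [g' gg' Cg'] := Cg.
exists (fun x => f x * g' x + g x * f' x).
  by move=> x; exact: (@is_deriveM _ _ f g).
by apply: line_CD; apply: IH => //; exact: line_C_pred.
Qed.

Lemma line_CZ k (c : R) f : line_C k f -> line_C k (fun x => c * f x).
Proof. by move=> Cf; apply: line_CM => //; exact: line_C_cst. Qed.

Lemma line_C_affine k (c b : R) f : line_C k f -> line_C k (fun x => f (c * x + b)).
Proof.
elim: k f => [|k IH] f.
  move=> cf x; apply: (@continuous_comp _ _ _ (fun x => c * x + b) f); last exact: cf.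
  by apply: cvgD; [apply: cvgM; [exact: cvg_cst|exact: cvg_id]|exact: cvg_cst].
case=> g fg Cg; exists (fun x => c * g (c * x + b)); last by apply: line_CZ; exact: IH.
move=> x; rewrite [c * g _]mulrC.
have dx : is_derive x 1 (fun x => c * x + b) c.
  have := @is_deriveD _ _ _ (fun x => c * x) (cst b) x 1 _ _ (@is_deriveZ _ _ _ id c x 1 1 (is_derive_id _ _)) (is_derive_cst _ _ _).
  by rewrite /GRing.scale/= mulr1 addr0.
exact: (@is_derive1_comp _ f (fun x => c * x + b) x _ _ (fg _) dx).
Qed.

Lemma is_derive_square_bound f (C : R) : (forall h, `|f h| <= C * h ^+ 2) ->
  is_derive (0 : R) 1 f 0.
Proof.
move=> H; have f0 : f 0 = 0.
  by apply/eqP; rewrite -normr_le0; have := H 0; rewrite expr0n mulr0.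
have C0 : 0 <= C by have := H 1; rewrite expr1n mulr1; exact: le_trans.
have cv : h^-1 *: ((f \o shift 0) (h *: (1 : R)) - f 0) @[h --> 0^'] --> (0 : R).
  apply/cvgrPdist_lt => e e0; near=> h.
  have hn : h != 0 by near: h; exact: nbhs_dnbhs_neq.
  rewrite sub0r normrN /= f0 subr0 addr0 /GRing.scale/= mulr1 normrM normfV.
  rewrite mulrC ltr_pdivrMr ?normr_gt0//.
  apply: le_lt_trans (H h) _.
  rewrite -real_normK ?num_real// expr2 mulrA ltr_pM2r ?normr_gt0//.
  have : `|h| < e / (C + 1).
    by near: h; apply: dnbhs0_lt; rewrite divr_gt0// ltr_pwDr.
  rewrite ltr_pdivlMr ?ltr_pwDr// => lt; apply: le_lt_trans lt.
  by rewrite mulrC ler_wpM2l// lerDl.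
apply: DeriveDef; first by apply/cvg_ex; exists 0.
exact: cvg_lim cv.
Unshelve. all: by end_near. Qed.

(** Differentiation maps the functions x^(-k) e^(-1/x), extended by 0, to combinations of one
    another, so smoothness follows by induction over the whole family. *)
Definition flat k (x : R) : R := if 0 < x then x^-1 ^+ k * expR (- x^-1) else 0.

Lemma flat_ge0 k x : 0 <= flat k x.
Proof.
by rewrite /flat; case: ifP => // x0; rewrite mulr_ge0 ?expR_ge0// exprn_ge0// invr_ge0 ltW.
Qed.

(** From e^y >= y^(k+2) / (k+2)! at y = 1/x. A quadratic bound is what gives the zero derivative at
    the origin. *)
Lemma flat_le k x : `|flat k x| <= (k.+2)`!%:R * x ^+ 2.
Proof.
rewrite ger0_norm ?flat_ge0// /flat; case: ifPn => [x0|_]; last by rewrite mulr_ge0 ?sqr_ge0.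
have xi : 0 < x^-1 by rewrite invr_gt0.
have fp : 0 < (k.+2)`!%:R :> R by rewrite ltr0n fact_gt0.
have := expR_ge1Dxn k.+1 (ltW xi).
move=> /(le_trans (ler_wpDl ler01 (lexx _))) h.
rewrite expRN ler_pdivrMr ?expR_gt0//.
apply: le_trans (ler_wpM2l _ h); last by rewrite mulr_ge0 ?sqr_ge0// ltW.
rewrite mulrACA [X in _ <= X](_ : _ = x^-1 ^+ k * ((x^-1 * x) ^+ 2 * ((k.+2)`!%:R / (k.+2)`!%:R))); last first.
  have -> : x^-1 ^+ k.+2 = x^-1 ^+ k * x^-1 ^+ 2 by rewrite -exprD addn2.
  by rewrite exprMn; ring.
by rewrite mulVf ?gt_eqF// divff ?gt_eqF// expr1n !mulr1.
Qed.

Lemma is_derive_flat k (x : R) : is_derive x 1 (flat k) (flat k.+2 x - k%:R * flat k.+1 x).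
Proof.
have [x0|x0|->] := ltgtP x 0.
- have -> : flat k.+2 x - k%:R * flat k.+1 x = 0.
    by rewrite /flat ltNge (ltW x0) mulr0 subr0.
  have nb : \near x, cst 0 x = flat k x.
    by near=> y; rewrite /flat ltNge; have -> // : y <= 0 by near: y; exact: (cvgr_le x cvg_id).
  exact: (@near_eq_is_derive _ R^o R^o (cst 0) (flat k) x 1 0 nb (is_derive_cst _ _ _)).
- have -> : flat k.+2 x - k%:R * flat k.+1 x =
      x^-1 ^+ k *: (expR (- x^-1) * (x ^- 2)) + expR (- x^-1) *: (k%:R * x^-1 ^+ k.-1 * (- x ^- 2)).
    rewrite /flat x0 /GRing.scale/=; case: k => [|k]/=.
      by rewrite !mul0r mulr0 addr0 subr0 expr0 exprVn; ring.
    by rewrite -!exprVn !exprS; ring.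
  apply: (@near_eq_is_derive _ _ _ ((fun y => y^-1 ^+ k) * (fun y => expR (- y^-1)))).
    by near=> y; rewrite /flat; have -> : 0 < y by near: y; exact: (cvgr_gt x cvg_id).
  have dV : is_derive x 1 (fun y : R => y^-1) (- x ^- 2).
    have := @is_deriveV _ id x 1 1 (lt0r_neq0 x0) (is_derive_id _ _).
    by rewrite /GRing.scale/= mulr1.
  have d1 : is_derive x 1 (fun y : R => y^-1 ^+ k) (k%:R * x^-1 ^+ k.-1 * (- x ^- 2)).
    have := @is_deriveX _ _ (fun y : R => y^-1) k _ _ _ dV; rewrite /GRing.scale/=.
    by congr is_derive; apply/funext => y; rewrite exprfctE.
  have d2 : is_derive x 1 (fun y : R => expR (- y^-1)) (expR (- x^-1) * (x ^- 2)).
    apply: (@is_derive1_comp _ (fun y => expR y) (fun y => - y^-1) x _ _ (is_derive_expR _)).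
    by have := @is_deriveN _ _ _ (fun y : R => y^-1) _ _ _ dV; rewrite opprK.
  exact: is_deriveM d1 d2.
- have -> : flat k.+2 0 - k%:R * flat k.+1 0 = 0 by rewrite /flat ltxx mulr0 subr0.
  exact: is_derive_square_bound (flat_le k).
Unshelve. all: by end_near. Qed.

Lemma line_C_flat k j : line_C k (flat j).
Proof.
elim: k j => [|k IH] j; first by move=> x; exact: is_derive_continuous (is_derive_flat j x).
exists (fun x => flat j.+2 x + (- j%:R) * flat j.+1 x).
  by move=> x; rewrite mulNr; exact: is_derive_flat.
by apply: line_CD => //; exact: line_CZ.
Qed.

Definition bump (x : R) : R := flat 0 (1 + x) * flat 0 (1 - x).

Lemma line_C_bump k : line_C k bump.
Proof.
apply: line_CM.
  by have := line_C_affine 1 1 (line_C_flat k 0); under eq_fun do rewrite mul1r addrC.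
by have := line_C_affine (-1) 1 (line_C_flat k 0); under eq_fun do rewrite mulN1r addrC.
Qed.

Lemma bump_ge0 x : 0 <= bump x.
Proof. by rewrite mulr_ge0// flat_ge0. Qed.

Lemma bump_support x : bump x != 0 -> `|x| < 1.
Proof.
rewrite /bump mulf_eq0 negb_or /flat; case: ifP => [x1|_]; last by rewrite eqxx.
case: ifP => [x2 _|_]; last by rewrite eqxx andbF.
by rewrite ltr_norml; apply/andP; split; lra.
Qed.

Lemma bump_le1 x : bump x <= 1.
Proof.
have H y : flat 0 y <= 1.
  rewrite /flat; case: ifP => // y0; rewrite expr0 mul1r -expR0 ler_expR.
  by rewrite oppr_le0 invr_ge0 ltW.
by rewrite mulr_ile1 ?flat_ge0.
Qed.

Lemma bump_lip : exists2 L : R, 0 < L & forall x y, `|bump x - bump y| <= L * `|x - y|.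
Proof.
have [g bg Cg] := line_C_bump 1.
have cg : continuous g := Cg.
have g0 (x : R) : 1 < `|x| -> g x = 0.
  move=> x1; have nb : \near x, cst 0 x = bump x.
    near=> y; apply/esym/eqP; apply: contraT => /bump_support; rewrite ltNge; case/negP.
    apply: ltW; near: y; apply: (@cvgr_gt _ _ _ _ (fun y : R => `|y|) `|x|) => //.
    exact: norm_continuous.
  have [_ <-] := bg x; have [_ <-] := @near_eq_is_derive _ R^o R^o _ _ _ 1 _ nb (is_derive_cst _ _ _).
  by [].
have cng : {within `[-2, 2], continuous (fun x => `|g x|)}.
  apply: continuous_subspaceT => x.
  by apply: (@continuous_comp _ _ _ g (fun y : R => `|y|)); [exact: cg|exact: norm_continuous].
have m22 : -2 <= 2 :> R by lra.
have [c _ Hc] := EVT_max m22 cng.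
have gL x : `|g x| <= `|g c| + 1.
  have [x2|x2] := leP `|x| 2.
    by rewrite (le_trans (Hc x _)) ?lerDl// in_itv/= -ler_norml.
  by rewrite g0 ?normr0 ?addr_ge0// (lt_trans _ x2)// ltr1n.
exists (`|g c| + 1); first by rewrite ltr_wpDl.
move=> x y.
have dg (t : R) : is_derive t 1 (fun t => bump (t + y)) (g (t + y)).
  rewrite -[g _]mulr1; apply: (@is_derive1_comp _ bump (fun t => t + y) t _ _ (bg _)).
  by have := @is_deriveD _ _ _ id (cst y) t 1 1 0 (is_derive_id _ _) (is_derive_cst _ _ _); rewrite addr0.
have [xi _] := mvt_line (x - y) dg.
by rewrite subrK add0r => ->; rewrite normrM ler_wpM2r.
Unshelve. all: by end_near. Qed.

End smooth_line.

(** * Powers times a cut-off in the logarithm *)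

Section power_log.
Context {R : realType}.
Implicit Types (f g : R -> R).

(** A family closed under differentiation: (a, f) becomes (a - 1, a f + f'). When [f] vanishes near
    minus infinity the function is zero near 0, hence regular on the whole line. *)
Definition power_log (a : R) f (x : R) : R := if 0 < x then x `^ a * f (ln x) else 0.

Lemma power_log_near0 (a m x : R) f : (forall l, l < m -> f l = 0) -> x <= 0 ->
  \near x, cst 0 x = power_log a f x.
Proof.
move=> fm x0; near=> y; rewrite /power_log; case: ifPn => // y0.
rewrite fm ?mulr0// -[m]expRK ltr_ln ?posrE ?expR_gt0//.
near: y; apply: (cvgr_lt x cvg_id); exact: le_lt_trans x0 (expR_gt0 _).
Unshelve. all: by end_near. Qed.

Lemma is_derive_power_log (a m x : R) f g : (forall l, l < m -> f l = 0) ->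
  (forall x : R, is_derive x 1 f (g x)) ->
  is_derive x 1 (power_log a f) (power_log (a - 1) (fun l => a * f l + g l) x).
Proof.
move=> fm fg; have [x0|x0] := leP x 0.
  have -> : power_log (a - 1) (fun l => a * f l + g l) x = 0 by rewrite /power_log ltNge x0.
  exact: (@near_eq_is_derive _ R^o R^o (cst 0) _ x 1 0 (power_log_near0 a fm x0) (is_derive_cst _ _ _)).
have nb : \near x, x `^ a * f (ln x) = power_log a f x.
  near=> y; rewrite /power_log; have -> // : 0 < y by near: y; exact: (cvgr_gt x cvg_id).
have d1 : is_derive x 1 (fun y => y `^ a) (a * x `^ (a - 1)) by exact: is_derive1_powR.
have d2 : is_derive x 1 (fun y => f (ln y)) (g (ln x) * x^-1).
  exact: (@is_derive1_comp _ f (@ln R) x _ _ (fg _) (is_derive1_ln x0)).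
have := @near_eq_is_derive _ R^o R^o _ _ x 1 _ nb (is_deriveM d1 d2).
congr is_derive; rewrite /power_log x0 /GRing.scale/=.
have -> : x `^ a = x `^ (a - 1) * x.
  by rewrite -{3}[x]powRr1 ?(ltW x0)// -powRD ?subrK// (gt_eqF x0) implybT.
by field; rewrite gt_eqF.
Unshelve. all: by end_near. Qed.

Lemma line_C_power_log k (a m : R) f : (forall l, l < m -> f l = 0) -> line_C k.+1 f ->
  line_C k (power_log a f).
Proof.
elim: k a f => [|k IH] a f fm [g fg Cg].
  by move=> x; exact: is_derive_continuous (is_derive_power_log a x fm fg).
exists (power_log (a - 1) (fun l => a * f l + g l)).
  by move=> x; exact: is_derive_power_log fm fg.
apply: IH => [l lm|]; last first.
  apply: line_CD => //; apply: line_CZ; apply: line_C_pred; exists g => //.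
have nb : \near l, cst 0 l = f l.
  near=> y; rewrite fm//; near: y; exact: (cvgr_lt l cvg_id).
rewrite fm// mulr0 add0r.
have [_ <-] := fg l; have [_ <-] := @near_eq_is_derive _ R^o R^o _ _ _ 1 _ nb (is_derive_cst _ _ _).
by [].
Unshelve. all: by end_near. Qed.

End power_log.

(** * Smooth functions of several variables built from coordinates *)

Section class_C.
Context {R : realType} {n : nat}.
Local Notation rV := 'rV[R]_n.
Implicit Types (f g : rV -> R).

Lemma class_C_continuous k f : class_C k f -> continuous f.
Proof. by case: k => [|k] []. Qed.

Lemma class_C_pred k f : class_C k.+1 f -> class_C k f.
Proof.
elim: k f => [|k IH] f; first by case.
case=> cf H; split=> // i; have [df Cf] := H i; split=> //; exact: IH.
Qed.

Lemma class_C_cst k (c : R) : class_C k (cst c : rV -> R).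
Proof.
elim: k c => [|k IH] c; first by split=> //; exact: cst_continuous.
split; first exact: cst_continuous.
move=> i; split=> [x|]; first exact: derivable_cst.
have -> : 'D_('e_i) (cst c : rV -> R) = cst 0 by apply/funext => x; exact: derive_cst.
exact: IH.
Qed.

Lemma class_CD k f g : class_C k f -> class_C k g -> class_C k (fun x => f x + g x).
Proof.
elim: k f g => [|k IH] f g Cf Cg.
  split=> // x; apply: (@cvgD _ _ _ (nbhs x) (nbhs_filter x)); [exact: (class_C_continuous Cf)|exact: (class_C_continuous Cg)].
split=> [x|i].
  by apply: (@cvgD _ _ _ (nbhs x) (nbhs_filter x)); [exact: (class_C_continuous Cf)|exact: (class_C_continuous Cg)].
have [_ /(_ i)[df Cf']] := Cf; have [_ /(_ i)[dg Cg']] := Cg.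
split=> [x|]; first exact: (@derivableD _ _ _ f g).
have -> : 'D_('e_i) (fun x => f x + g x) = (fun x => 'D_('e_i) f x + 'D_('e_i) g x).
  by apply/funext => x; exact: (@deriveD _ _ _ f g).
exact: IH.
Qed.

Lemma class_CM k f g : class_C k f -> class_C k g -> class_C k (fun x => f x * g x).
Proof.
have cM (a b : rV -> R) : continuous a -> continuous b -> continuous (fun x : rV => a x * b x : R).
  by move=> ca cb x; apply: (@cvgM _ _ (nbhs x) (nbhs_filter x)); [exact: ca|exact: cb].
elim: k f g => [|k IH] f g Cf Cg.
  by split=> //; apply: cM; [exact: (class_C_continuous Cf)|exact: (class_C_continuous Cg)].
split; first by apply: cM; [exact: (class_C_continuous Cf)|exact: (class_C_continuous Cg)].
move=> i; have [_ /(_ i)[df Cf']] := Cf; have [_ /(_ i)[dg Cg']] := Cg.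
split=> [x|]; first exact: (@derivableM _ _ f g).
have -> : 'D_('e_i) (fun x => f x * g x) = (fun x => f x * 'D_('e_i) g x + g x * 'D_('e_i) f x).
  by apply/funext => x; exact: (@deriveM _ _ f g).
by apply: class_CD; apply: IH => //; exact: class_C_pred.
Qed.

Lemma is_derive_coord (h dh : R -> R) (i : 'I_n) (x v : rV) :
  (forall t : R, is_derive t 1 h (dh t)) ->
  is_derive x v (fun y : rV => h (y ord0 i)) (v ord0 i * dh (x ord0 i)).
Proof.
move=> Hh.
pose F (t : R) := h (v ord0 i * t + x ord0 i).
have dF : is_derive (0 : R) 1 F (v ord0 i * dh (x ord0 i)).
  have dx : is_derive (0 : R) 1 (fun t => v ord0 i * t + x ord0 i) (v ord0 i).
    have := @is_deriveD _ R^o R^o (fun t => v ord0 i * t) (cst (x ord0 i)) (0 : R) 1 _ _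
      (@is_deriveZ _ R^o R^o id (v ord0 i) 0 1 1 (is_derive_id _ _)) (is_derive_cst _ _ _).
    by rewrite /GRing.scale/= mulr1 addr0.
  rewrite mulrC; have := @is_derive1_comp _ h (fun t => v ord0 i * t + x ord0 i) 0 _ _ (Hh _) dx.
  by rewrite mulr0 add0r.
have E : (fun t : R => t^-1 *: (((fun y : rV => h (y ord0 i)) \o shift x) (t *: v) - h (x ord0 i))) =
    (fun t : R => t^-1 *: ((F \o shift 0) (t *: 1) - F 0)).
  apply/funext => t; rewrite /F /= !mxE mulr0 add0r addr0 /GRing.scale/= mulr1.
  by rewrite [v ord0 i * t]mulrC.
have [d1 d2] := dF.
apply: DeriveDef; first by rewrite /derivable E.
by rewrite -d2 /derive E.
Qed.

Lemma class_C_coord k (h : R -> R) (i : 'I_n) : line_C k h ->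
  class_C k (fun x : rV => h (x ord0 i)).
Proof.
have cont (a : R -> R) : continuous a -> continuous (fun x : rV => a (x ord0 i)).
  move=> ca x; apply: (@continuous_comp _ _ _ (fun x : rV => x ord0 i) a); last exact: ca.
  exact: coord_continuous.
elim: k h => [|k IH] h Ch; first by split=> //; exact: cont (line_C_continuous Ch).
split; first exact: cont (line_C_continuous Ch).
move=> j; have [dh Hh Cdh] := Ch; split=> [x|].
  by have [] := is_derive_coord i x 'e_j Hh.
have -> : 'D_('e_j) (fun x : rV => h (x ord0 i)) = (fun x : rV => cst (('e_j : rV) ord0 i) x * dh (x ord0 i)).
  by apply/funext => x; have [_ ->] := is_derive_coord i x 'e_j Hh.
by apply: class_CM; [exact: class_C_cst|exact: IH].
Qed.

Lemma class_C_prod k (I : Type) (r : seq I) (F : I -> rV -> R) :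
  (forall i, class_C k (F i)) -> class_C k (fun x => \prod_(i <- r) F i x).
Proof.
move=> CF; elim: r => [|i r IH].
  by under eq_fun do rewrite big_nil; exact: class_C_cst.
by under eq_fun do rewrite big_cons; exact: class_CM.
Qed.

End class_C.

(** * Tensor products on the half-space *)

(** (p g - q h)^2 + p q (g^2 + h^2) = p^2 g^2 + q^2 h^2 + p q (g - h)^2, integrated as a sum before
    the finite masses are subtracted. It isolates the exact effect of the coefficients from a
    remainder that is small when [g] and [h] are close. *)
Lemma integral_sqr_combination d (T : measurableType d) (R : realType)
    (m : {measure set T -> \bar R}) (g h : T -> R) (A p q : R) :
  measurable_fun setT g -> measurable_fun setT h -> 0 <= p -> 0 <= q ->
  (\int[m]_x (g x ^+ 2)%:E = A%:E)%E -> (\int[m]_x (h x ^+ 2)%:E = A%:E)%E ->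
  (\int[m]_x ((p * g x - q * h x) ^+ 2)%:E =
   ((p - q) ^+ 2 * A)%:E + (p * q)%:E * \int[m]_x ((g x - h x) ^+ 2)%:E)%E.
Proof.
move=> mg mh p0 q0 gA hA.
have m2 (f : T -> R) : measurable_fun setT f -> measurable_fun setT (fun x => (f x ^+ 2)%:E).
  by move=> mf; apply/measurable_EFinP; exact: measurable_funX.
have s0 (f : T -> R) x : setT x -> (0 <= (f x ^+ 2)%:E)%E by move=> _; rewrite lee_fin sqr_ge0.
have mpg : measurable_fun setT (fun x => p * g x - q * h x).
  by apply: measurable_funB; exact: measurable_funM.
have mgh : measurable_fun setT (fun x => g x - h x) by exact: measurable_funB.
have L : (\int[m]_x ((p * g x - q * h x) ^+ 2)%:E +
    ((p * q)%:E * \int[m]_x (g x ^+ 2)%:E + (p * q)%:E * \int[m]_x (h x ^+ 2)%:E) =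
    ((p ^+ 2)%:E * \int[m]_x (g x ^+ 2)%:E + (q ^+ 2)%:E * \int[m]_x (h x ^+ 2)%:E) +
    (p * q)%:E * \int[m]_x ((g x - h x) ^+ 2)%:E)%E.
  have pq0 : (0 <= (p * q)%:E)%E by rewrite lee_fin mulr_ge0.
  have pp0 : (0 <= (p ^+ 2)%:E)%E by rewrite lee_fin sqr_ge0.
  have qq0 : (0 <= (q ^+ 2)%:E)%E by rewrite lee_fin sqr_ge0.
  rewrite -(ge0_integralZl m measurableT (m2 _ mg) (s0 g) pq0).
  rewrite -(ge0_integralZl m measurableT (m2 _ mh) (s0 h) pq0).
  rewrite -(ge0_integralZl m measurableT (m2 _ mg) (s0 g) pp0).
  rewrite -(ge0_integralZl m measurableT (m2 _ mh) (s0 h) qq0).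
  rewrite -(ge0_integralZl m measurableT (m2 _ mgh) (s0 _) pq0).
  have mZ c (f : T -> R) : measurable_fun setT f -> measurable_fun setT (fun x => (c%:E * (f x ^+ 2)%:E)%E).
    by move=> mf; apply: measurable_funeM; exact: m2.
  have pZ c (f : T -> R) : (0 <= c%:E)%E -> forall x, setT x -> (0 <= c%:E * (f x ^+ 2)%:E)%E.
    by move=> c0 x _; rewrite mule_ge0// lee_fin sqr_ge0.
  rewrite -(ge0_integralD m measurableT (pZ _ g pq0) (mZ _ g mg) (pZ _ h pq0) (mZ _ h mh)).
  rewrite -(ge0_integralD m measurableT (pZ _ g pp0) (mZ _ g mg) (pZ _ h qq0) (mZ _ h mh)).
  rewrite -(ge0_integralD m measurableT (s0 _) (m2 _ mpg)); last 2 first.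
  - by move=> x _; apply: adde_ge0; exact: pZ.
  - by apply: emeasurable_funD; exact: mZ.
  rewrite -(ge0_integralD m measurableT); last 4 first.
  - by move=> x _; apply: adde_ge0; exact: pZ.
  - by apply: emeasurable_funD; exact: mZ.
  - exact: pZ.
  - exact: mZ.
  by apply: eq_integral => x _; rewrite -!EFinM -!EFinD; congr _%:E; ring.
rewrite gA hA -!EFinM -!EFinD in L.
have {}L := congr1 (fun z => (z - (p * q * A + p * q * A)%:E)%E) L.
rewrite addeK// in L; rewrite L addeAC -EFinB; congr (_%:E + _)%E; ring.
Qed.

Section half_space.
Context {R : realType} {n : nat}.
Local Notation rV := 'rV[R]_n.+1.
Local Notation leb1 := (@lebesgue_measure R).
Local Notation leb := (@lebesgue_rV R n.+1).
Local Notation lebn := (@lebesgue_rV R n).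
Local Notation m2 := (leb \x leb1)%E.

Definition half_space : set rV := [set x | 0 < x ord0 ord0].

Lemma open_half_space : open half_space.
Proof.
have -> : half_space = (fun x : rV => x ord0 ord0) @^-1` [set y : R | 0 < y] by [].
apply: open_comp; last exact: open_gt.
by move=> x _; exact: coord_continuous.
Qed.

Variable s : R.
Hypothesis s01 : 2^-1 < s < 1.
Local Notation N := (n.+1%:R + 2 * s).

Definition line_quotient (f : R -> R) (a t : R) : R :=
  if (0 < t) && (0 < a) then (f a - f (a + t)) ^+ 2 * t `^ (- 1 - 2 * s) else 0.

(** Factor of the tangential error: the increment of the tangential profile over t z contributes
    t^2, which softens the kernel t^(-1-2s) to t^(1-2s). *)
Definition line_product (f : R -> R) (a t : R) : R :=
  if (0 < t) && (0 < a) then f a * f (a + t) * t `^ (1 - 2 * s) else 0.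

Lemma line_quotient_ge0 f a t : 0 <= line_quotient f a t.
Proof. by rewrite /line_quotient; case: ifP => // _; rewrite mulr_ge0 ?sqr_ge0 ?powR_ge0. Qed.

Let m11 : measurable_fun setT (fun w : measurableTypeR R * measurableTypeR R => (0 < (w.2 : R)) && (0 < (w.1 : R))).
Proof.
apply: measurable_and.
  by apply: measurable_fun_ltr => //; exact: measurable_snd.
by apply: measurable_fun_ltr => //; exact: measurable_fst.
Qed.

Let mD : measurable_fun setT (fun w : measurableTypeR R * measurableTypeR R => (w.1 : R) + (w.2 : R)).
Proof. by apply: measurable_funD; [exact: measurable_fst|exact: measurable_snd]. Qed.

Lemma measurable_line_quotient f : measurable_fun setT f ->
  measurable_fun setT (fun w : measurableTypeR R * measurableTypeR R => line_quotient f w.1 w.2).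
Proof.
move=> mf; apply: (measurable_fun_ifT m11); last exact: measurable_cst.
apply: measurable_funM.
  apply: measurable_funX; apply: measurable_funB; first exact: (measurableT_comp mf measurable_fst).
  exact: (measurableT_comp mf mD).
exact: (measurableT_comp (measurable_powR _) measurable_snd).
Qed.

Lemma measurable_line_product f : measurable_fun setT f ->
  measurable_fun setT (fun w : measurableTypeR R * measurableTypeR R => line_product f w.1 w.2).
Proof.
move=> mf; apply: (measurable_fun_ifT m11); last exact: measurable_cst.
apply: measurable_funM.
  apply: measurable_funM; first exact: (measurableT_comp mf measurable_fst).
  exact: (measurableT_comp mf mD).
exact: (measurableT_comp (measurable_powR _) measurable_snd).
Qed.

Section tensor.
Variables (f : R -> R) (chi : 'rV[R]_n -> R) (A K B1 B2 : R).
Hypotheses (mf : measurable_fun setT f) (f0 : forall x, 0 <= f x)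
  (mchi : measurable_fun setT chi)
  (chiA : (\int[lebn]_v (chi v ^+ 2)%:E = A%:E)%E) (K0 : 0 <= K)
  (chiK : forall xi, (\int[lebn]_v ((chi v - chi (v + xi)) ^+ 2)%:E <= (K * enorm xi ^+ 2)%:E)%E)
  (fB1 : (\int[leb1]_t \int[leb1]_a (line_quotient f a t)%:E <= B1%:E)%E)
  (fB2 : (\int[leb1]_t \int[leb1]_a (line_product f a t)%:E <= B2%:E)%E).

Definition tensor (x : rV) : R := f (x ord0 ord0) * chi (rV_uncons x).2.

Lemma line_product_ge0 a t : 0 <= line_product f a t.
Proof. by rewrite /line_product; case: ifP => // _; rewrite !mulr_ge0 ?powR_ge0. Qed.

Lemma tensor_cons a v : tensor (rV_cons (a, v)) = f a * chi v.
Proof. by rewrite /tensor rV_consK rV_cons0. Qed.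

Lemma measurable_tensor : measurable_fun setT tensor.
Proof.
apply: measurable_funM; first exact: (measurableT_comp mf (measurable_coor ord0)).
exact: (measurableT_comp mchi (measurableT_comp measurable_snd (@measurable_rV_uncons R n))).
Qed.

Let chi_shift xi : (\int[lebn]_v (chi (v + xi) ^+ 2)%:E = A%:E)%E.
Proof.
have m2 : measurable_fun setT (fun v => (chi v ^+ 2)%:E).
  by apply/measurable_EFinP; exact: measurable_funX.
have s0 v : (0 <= (chi v ^+ 2)%:E)%E by rewrite lee_fin sqr_ge0.
have := @ge0_integral_affine_rV R n 1 xi (fun v => (chi v ^+ 2)%:E) (oner_neq0 _) m2
  (fun v => s0 v); rewrite normr1 invr1 expr1n mul1e -chiA => <-.
by apply: eq_integral => v _; rewrite scale1r.
Qed.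

Lemma ray_cut_cons (z v : 'rV[R]_n) (a t : R) : 0 < t ->
  ray_cut half_space s tensor (dir z) (rV_cons (a, v), t) =
  (if 0 < a then (f a * chi v - f (a + t) * chi (v + t *: z)) ^+ 2 *
    (t `^ (- 1 - 2 * s) * enorm (dir z) `^ (- N)) else 0)%:E.
Proof.
move=> t0; rewrite /ray_cut /pair_cut; cbn [fst snd].
have E : rV_cons (a, v) + (1 * t) *: dir z = rV_cons (a + t, v + t *: z).
  by rewrite mul1r /dir rV_consZ rV_consD mulr1.
rewrite E.
have M (b : R) (w : 'rV[R]_n) : (rV_cons (b, w) \in half_space) = (0 < b).
  by apply/idP/idP => [/set_mem|h]; rewrite ?inE /half_space /= rV_cons0.
rewrite !M; have [a0|_] := ltP 0 a; last by rewrite /= mule0.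
rewrite (addr_gt0 a0 t0) /= -EFinM; congr _%:E.
rewrite /pair_kernel; cbn [fst snd].
have -> : rV_cons (a, v) - rV_cons (a + t, v + t *: z) = - (t *: dir z).
  by rewrite -E mul1r opprD addrA subrr add0r.
rewrite enormN enormZ !gtr0_norm// !tensor_cons.
have ve := enorm_dir_gt0 z.
rewrite powRM ?enorm_ge0 ?(ltW t0)//.
have -> : t `^ (- 1 - 2 * s) = t ^+ n / t `^ N.
  rewrite -powR_mulrn ?(ltW t0)// -powRN -powRD ?(gt_eqF t0) ?implybT//; congr (_ `^ _).
  have -> : n.+1%:R = n%:R + 1 :> R by rewrite -natr1.
  by ring.
by rewrite powRN; field; rewrite !gt_eqF// powR_gt0.
Qed.

(** The square expansion for [chi] and its translate by t z, with coefficients f(a) and f(a + t).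
    The error carries |z|^2 <= |dir z|^2, which raises the exponent of |dir z| by 2; its integral
    over [z] is then [dirJ n (2 * s - 2)], finite for s > 1/2. *)
Lemma slice_energy_le (z : 'rV[R]_n) (a t : R) : 0 < t ->
  (\int[lebn]_v ray_cut half_space s tensor (dir z) (rV_cons (a, v), t) <=
   (A * enorm (dir z) `^ (- N) * line_quotient f a t +
    K * enorm (dir z) `^ (- (n.+1%:R + (2 * s - 2))) * line_product f a t)%:E)%E.
Proof.
move=> t0; have ve := enorm_dir_gt0 z.
under eq_integral => v _ do rewrite ray_cut_cons//.
rewrite /line_quotient /line_product t0 /=; case: ifPn => [a0|_]; last first.
  by rewrite integral0 !mulr0 addr0.
set c := t `^ _ * _; have c0 : (0 <= c%:E)%E by rewrite lee_fin mulr_ge0 ?powR_ge0.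
have mS : measurable_fun setT (fun v : 'rV[R]_n => chi (v + t *: z)).
  apply: (measurableT_comp mchi); have := measurable_affine_rV 1 (t *: z).
  by under eq_fun do rewrite scale1r.
have mG : measurable_fun setT (fun v : 'rV[R]_n => f a * chi v - f (a + t) * chi (v + t *: z)).
  by apply: measurable_funB; exact: measurable_funM.
under eq_integral => v _ do rewrite EFinM muleC.
rewrite ge0_integralZl//; last 2 first.
- by apply/measurable_EFinP; exact: measurable_funX.
- by move=> v _; rewrite lee_fin sqr_ge0.
have E := @integral_sqr_combination _ _ R lebn chi (fun v => chi (v + t *: z)) A (f a) (f (a + t))
  mchi mS (f0 _) (f0 _) chiA (chi_shift _).
rewrite E ge0_muleDr; last 2 first.
- by rewrite lee_fin mulr_ge0 ?sqr_ge0// -lee_fin -chiA integral_ge0// => v _; rewrite lee_fin sqr_ge0.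
- rewrite mule_ge0 ?lee_fin ?mulr_ge0// integral_ge0// => v _; by rewrite lee_fin sqr_ge0.
rewrite EFinD; apply: leeD.
  by rewrite -EFinM lee_fin le_eqVlt; apply/orP; left; apply/eqP; rewrite /c; ring.
rewrite muleA -EFinM; apply: le_trans (lee_wpmul2l _ (chiK _)) _.
  by rewrite lee_fin !mulr_ge0 ?powR_ge0.
rewrite -EFinM lee_fin enormZ gtr0_norm//.
have zd : enorm z ^+ 2 <= enorm (dir z) ^+ 2 by rewrite /dir enorm_cons lerDr sqr_ge0.
have -> : t `^ (1 - 2 * s) = t `^ (- 1 - 2 * s) * t ^+ 2.
  rewrite -powR_mulrn ?(ltW t0)// -powRD ?(gt_eqF t0) ?implybT//; congr (_ `^ _).
  by rewrite -[2%N]/(1 + 1)%N natrD; ring.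
have -> : enorm (dir z) `^ (- (n.+1%:R + (2 * s - 2))) = enorm (dir z) `^ (- N) * enorm (dir z) ^+ 2.
  rewrite -powR_mulrn ?(ltW ve)// -powRD ?(gt_eqF ve) ?implybT//; congr (_ `^ _).
  by ring.
rewrite /c.
have -> : t `^ (- 1 - 2 * s) * enorm (dir z) `^ (- N) * (f a * f (a + t)) * (K * (t * enorm z) ^+ 2) =
  (K * (f a * f (a + t)) * t `^ (- 1 - 2 * s) * t ^+ 2 * enorm (dir z) `^ (- N)) * enorm z ^+ 2 by ring.
have -> : K * (enorm (dir z) `^ (- N) * enorm (dir z) ^+ 2) * (f a * f (a + t) * (t `^ (- 1 - 2 * s) * t ^+ 2)) =
  (K * (f a * f (a + t)) * t `^ (- 1 - 2 * s) * t ^+ 2 * enorm (dir z) `^ (- N)) * enorm (dir z) ^+ 2 by ring.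
apply: ler_wpM2l zd; by rewrite !mulr_ge0 ?powR_ge0 ?sqr_ge0 ?exprn_ge0// ltW.
Qed.

Lemma ray_energy_le (z : 'rV[R]_n) :
  (\int[m2]_w ray_cut half_space s tensor (dir z) w <=
   (2 * (A * B1) * enorm (dir z) `^ (- N) +
    2 * (K * B2) * enorm (dir z) `^ (- (n.+1%:R + (2 * s - 2))))%:E)%E.
Proof.
have mT := measurable_tensor; have oH := open_half_space.
have A0 : 0 <= A by rewrite -lee_fin -chiA integral_ge0// => v _; rewrite lee_fin sqr_ge0.
have mr := measurable_ray_cut s oH mT (dir z).
have r0 w : (0 <= ray_cut half_space s tensor (dir z) w)%E by exact: ray_cut_ge0.
rewrite -ray_cut_double//.
set c1 := A * enorm (dir z) `^ (- N); set c2 := K * enorm (dir z) `^ (- (n.+1%:R + (2 * s - 2))).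
have -> : 2 * (A * B1) * enorm (dir z) `^ (- N) + 2 * (K * B2) * enorm (dir z) `^ (- (n.+1%:R + (2 * s - 2))) =
  2 * (c1 * B1 + c2 * B2) by rewrite /c1 /c2; ring.
have c10 : 0 <= c1 by rewrite mulr_ge0 ?powR_ge0.
have c20 : 0 <= c2 by rewrite mulr_ge0 ?powR_ge0.
rewrite EFinM lee_wpmul2l//.
pose G (w : rV * measurableTypeR R) := (if (0 < (w.2 : R))%R then ray_cut half_space s tensor (dir z) w else 0)%E.
have mG : measurable_fun setT G.
  apply: measurable_fun_ifT => //.
  by apply: measurable_fun_ltr => //; exact: measurable_snd.
have G0 w : (0 <= G w)%E by rewrite /G; case: ifP.
have E := fubini_tonelli2 (m1 := leb) (m2 := leb1) G mG G0.
apply: (le_trans (eq_ind _ (fun y => (y <= _)%E) (lexx _) _ (esym E))).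
pose q1 (w : measurableTypeR R * measurableTypeR R) : \bar R := (line_quotient f w.1 w.2)%:E.
pose q2 (w : measurableTypeR R * measurableTypeR R) : \bar R := (line_product f w.1 w.2)%:E.
have mq1 : measurable_fun setT q1 by apply/measurable_EFinP; exact: measurable_line_quotient.
have mq2 : measurable_fun setT q2 by apply/measurable_EFinP; exact: measurable_line_product.
have p1 w : (0 <= q1 w)%E by rewrite lee_fin line_quotient_ge0.
have p2 w : (0 <= q2 w)%E by rewrite lee_fin line_product_ge0.
have c10' : (0 <= c1%:E)%E by rewrite lee_fin.
have c20' : (0 <= c2%:E)%E by rewrite lee_fin.
have m1t t : measurable_fun setT (fun a => q1 (a, t)).
  exact: (measurableT_comp mq1 (pair2_measurable t)).
have m2t t : measurable_fun setT (fun a => q2 (a, t)).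
  exact: (measurableT_comp mq2 (pair2_measurable t)).
have M1 : measurable_fun setT (fun t => \int[leb1]_a q1 (a, t))%E.
  exact: (@measurable_fun_fubini_tonelli_G _ _ _ _ _ leb1 q1).
have M2 : measurable_fun setT (fun t => \int[leb1]_a q2 (a, t))%E.
  exact: (@measurable_fun_fubini_tonelli_G _ _ _ _ _ leb1 q2).
have I1 t : (0 <= \int[leb1]_a q1 (a, t))%E by apply: integral_ge0.
have I2 t : (0 <= \int[leb1]_a q2 (a, t))%E by apply: integral_ge0.
apply: (@le_trans _ _ (\int[leb1]_t (c1%:E * \int[leb1]_a q1 (a, t) + c2%:E * \int[leb1]_a q2 (a, t)))%E); last first.
  rewrite (ge0_integralD leb1 measurableT (fun t _ => mule_ge0 c10' (I1 t)) (measurable_funeM _ M1)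
    (fun t _ => mule_ge0 c20' (I2 t)) (measurable_funeM _ M2)).
  rewrite (ge0_integralZl leb1 measurableT M1 (fun t _ => I1 t) c10').
  rewrite (ge0_integralZl leb1 measurableT M2 (fun t _ => I2 t) c20').
  by rewrite EFinD !EFinM; apply: leeD; apply: lee_wpmul2l.
apply: ge0_le_integral => //.
- by move=> t _; apply: integral_ge0.
- exact: (@measurable_fun_fubini_tonelli_G _ _ _ _ _ leb G).
- exact: (emeasurable_funD (measurable_funeM _ M1) (measurable_funeM _ M2)).
move=> t _; rewrite /fubini_G.
have [t0|t0] := ltP 0 (t : R); last first.
  rewrite integral0_eq => [|x _]; last by rewrite /G ltNge t0.
  by apply: adde_ge0; apply: mule_ge0.
have mGt : measurable_fun setT (fun x => G (x, t)).
  exact: (measurableT_comp mG (pair2_measurable t)).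
rewrite (ge0_integral_rVS mGt (fun x => G0 _)).
rewrite -(ge0_integralZl leb1 measurableT (m1t t) (fun a _ => p1 _) c10').
rewrite -(ge0_integralZl leb1 measurableT (m2t t) (fun a _ => p2 _) c20').
rewrite -(ge0_integralD leb1 measurableT (fun a _ => mule_ge0 c10' (p1 _)) (measurable_funeM _ (m1t t))
    (fun a _ => mule_ge0 c20' (p2 _)) (measurable_funeM _ (m2t t))).
apply: ge0_le_integral => //.
- by move=> a _; apply: integral_ge0.
- exact: (measurable_rVS mGt (fun x => G0 _)).
- by apply: emeasurable_funD; apply: measurable_funeM.
move=> a _; under eq_integral => v _ do rewrite /G t0.
by rewrite -!EFinM -EFinD; exact: slice_energy_le.
Qed.

Let nu : rV := rV_cons (1, 0).

Let nu1 : enorm nu = 1.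
Proof.
have := enorm_cons 1 (0 : 'rV[R]_n); rewrite enorm0 expr0n addr0 expr1n => /eqP.
by rewrite sqrf_eq1 => /orP[/eqP //|/eqP h]; have := enorm_ge0 nu; rewrite h oppr_ge0 ler10.
Qed.

Let dirw_nu g z : dirw g nu z = enorm (dir z) `^ (- (n.+1%:R + g)).
Proof.
rewrite /dirw /dir dot_cons mulr1 (_ : dot z 0 = 0); last first.
  by rewrite /dot big1// => i _; rewrite mxE mulr0.
by rewrite addr0 normr1 powR1 mulr1.
Qed.

Lemma tensor_energy_le : 0 <= B1 -> 0 <= B2 ->
  (pair_energy half_space s tensor <=
   (2 * (A * B1) * dirJ n (2 * s) + 2 * (K * B2) * dirJ n (2 * s - 2))%:E)%E.
Proof.
move=> B10 B20; have oH := open_half_space.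
have A0 : 0 <= A by rewrite -lee_fin -chiA integral_ge0// => v _; rewrite lee_fin sqr_ge0.
have [s1 s2] := andP s01.
have g1 : -1 < 2 * s by rewrite (lt_trans (ltrN10 R))// mulr_gt0// (lt_trans _ s1)// invr_gt0.
have g2 : -1 < 2 * s - 2.
  have h2 : (2 : R) * 2^-1 = 1 by rewrite divff.
  have : 2 * 2^-1 < 2 * s by rewrite ltr_pM2l.
  by rewrite h2; lra.
have a1 : 0 <= 2 * (A * B1) by rewrite !mulr_ge0.
have a2 : 0 <= 2 * (K * B2) by rewrite !mulr_ge0.
rewrite -pair_energyE pair_cut_polar//; last exact: measurable_tensor.
rewrite EFinD -(integral_dirwZ a1 g1 nu1) -(integral_dirwZ a2 g2 nu1).
rewrite -ge0_integralD//; last 4 first.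
- by move=> z _; rewrite lee_fin mulr_ge0 ?dirw_ge0.
- by apply/measurable_EFinP; apply: measurable_funM => //; exact: measurable_dirw.
- by move=> z _; rewrite lee_fin mulr_ge0 ?dirw_ge0.
- by apply/measurable_EFinP; apply: measurable_funM => //; exact: measurable_dirw.
apply: ge0_le_integral => //.
- by move=> z _; apply: integral_ge0 => w _; exact: ray_cut_ge0.
- apply: measurable_ray_total => //; exact: measurable_tensor.
- by apply: emeasurable_funD; apply/measurable_EFinP; apply: measurable_funM => //; exact: measurable_dirw.
by move=> z _; rewrite -EFinD !dirw_nu; exact: ray_energy_le.
Qed.

Lemma tensor_weight (C : R) : 0 <= C ->
  (\int[leb1]_a (if 0 < (a : R) then f a ^+ 2 * a `^ (- (2 * s)) else 0)%:E = C%:E)%E ->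
  (\int[leb]_(x in half_space) (tensor x ^+ 2 * x ord0 ord0 `^ (- (2 * s)))%:E = (A * C)%:E)%E.
Proof.
move=> C0 HC; have A0 : 0 <= A by rewrite -lee_fin -chiA integral_ge0// => v _; rewrite lee_fin sqr_ge0.
pose w (a : R) := if 0 < a then f a ^+ 2 * a `^ (- (2 * s)) else 0.
have mw : measurable_fun setT w.
  apply: measurable_fun_ifT => //; first by apply: measurable_fun_ltr.
  by apply: measurable_funM; [exact: measurable_funX|exact: measurable_powR].
have w0 a : 0 <= w a by rewrite /w; case: ifP => // _; rewrite mulr_ge0 ?sqr_ge0 ?powR_ge0.
pose F (x : rV) : \bar R := (w (x ord0 ord0) * chi (rV_uncons x).2 ^+ 2)%:E.
have mF : measurable_fun setT F.
  apply/measurable_EFinP; apply: measurable_funM; first exact: (measurableT_comp mw (measurable_coor ord0)).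
  by apply: measurable_funX; exact: (measurableT_comp mchi (measurableT_comp measurable_snd (@measurable_rV_uncons R n))).
have F0 x : (0 <= F x)%E by rewrite lee_fin mulr_ge0 ?sqr_ge0.
rewrite integral_mkcond; transitivity (\int[leb]_x F x)%E.
  apply: eq_integral => x _; rewrite patchE /F /w.
  have -> : (x \in half_space) = (0 < x ord0 ord0) by apply/idP/idP => [/set_mem//|h]; rewrite inE.
  by case: ifP => _; [congr _%:E; rewrite /tensor; ring|rewrite mul0r].
rewrite (ge0_integral_rVS mF F0).
transitivity (\int[leb1]_a (A%:E * (w a)%:E))%E.
  apply: eq_integral => a _; rewrite -chiA muleC -ge0_integralZl//.
  - by apply: eq_integral => v _; rewrite /F rV_consK rV_cons0 -EFinM.
  - by apply/measurable_EFinP; exact: measurable_funX.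
  - by move=> v _; rewrite lee_fin sqr_ge0.
  - by rewrite lee_fin.
have mwE : measurable_fun setT (fun a => (w a)%:E) by exact/measurable_EFinP.
have w0E a : setT a -> (0 <= (w a)%:E)%E by rewrite lee_fin.
have A0E : (0 <= A%:E)%E by rewrite lee_fin.
by rewrite (ge0_integralZl leb1 measurableT mwE w0E A0E) HC -EFinM.
Qed.

End tensor.
End half_space.

(** * Almost optimal profiles *)

Section log_cutoff.
Context {R : realType}.
Local Notation leb1 := (@lebesgue_measure R).

(** Density of the dilation-invariant measure da/a on the set |ln a| <= r. *)
Definition log_weight (r a : R) : R := if expR (- r) <= a <= expR r then a^-1 else 0.

Lemma log_weight_ge0 r a : 0 <= log_weight r a.
Proof.
rewrite /log_weight; case: ifP => // /andP[h _].
by rewrite invr_ge0 (le_trans _ h)// expR_ge0.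
Qed.

Lemma measurable_log_weight r : measurable_fun setT (log_weight r).
Proof.
have -> : log_weight r = (fun a => if expR (- r) <= a <= expR r then a `^ (- 1) else 0).
  apply/funext => a; rewrite /log_weight; case: ifP => // /andP[h _].
  by rewrite powR_inv1// (le_trans _ h)// expR_ge0.
apply: measurable_fun_ifT => //.
by apply: measurable_and; apply: measurable_fun_ler.
Qed.

Lemma integral_log_weight r : 0 <= r -> (\int[leb1]_a (log_weight r a)%:E = (2 * r)%:E)%E.
Proof.
move=> r0; have er : expR (- r) <= expR r by rewrite ler_expR; lra.
have pos (x : R) : x \in `[expR (- r), expR r] -> 0 < x.
  by rewrite in_itv/= => /andP[h _]; exact: lt_le_trans (expR_gt0 _) h.
have c x : x \in `[expR (- r), expR r] -> {for x, continuous (fun a : R => a^-1)}.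
  by move=> /pos x0; apply: inv_continuous; rewrite gt_eqF.
have E := @integral_itvcc_is_derive R (fun a => a^-1) (@ln R) _ _ er.
have -> : (\int[leb1]_a (log_weight r a)%:E = \int[leb1]_(a in `[expR (- r), expR r]) (a^-1)%:E)%E.
  rewrite [RHS]integral_mkcond; apply: eq_integral => a _; rewrite patchE /log_weight.
  by rewrite mem_setE in_itv/=; case: ifP.
have {}E := E c (fun x xr => is_derive1_ln (pos x xr)).
apply: (eq_trans E); by rewrite !expRK; congr _%:E; ring.
Qed.

Lemma log_weight_dilation r tau : 0 <= r -> 0 < tau ->
  (\int[leb1]_a (tau * log_weight r (tau * a))%:E = (2 * r)%:E)%E.
Proof.
move=> r0 t0; have tn : tau != 0 by rewrite gt_eqF.
have mw : measurable_fun setT (fun a => (tau * log_weight r a)%:E).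
  by apply/measurable_EFinP; apply: measurable_funM => //; exact: measurable_log_weight.
have E := @ge0_integral_affine R tau 0 _ tn mw (fun a => _).
transitivity (\int[leb1]_a (tau * log_weight r (affine tau 0 a))%:E)%E.
  by apply: eq_integral => a _; rewrite /affine addr0.
rewrite E; last by move=> a; rewrite lee_fin mulr_ge0 ?log_weight_ge0// ltW.
have ml : measurable_fun setT (fun a => (log_weight r a)%:E).
  by apply/measurable_EFinP; exact: measurable_log_weight.
have l0 a : setT a -> (0 <= (log_weight r a)%:E)%E by rewrite lee_fin log_weight_ge0.
have t0' : (0 <= tau%:E)%E by rewrite lee_fin ltW.
under eq_integral => a _ do rewrite EFinM.
rewrite (ge0_integralZl leb1 measurableT ml l0 t0') integral_log_weight// muleA -EFinM.
by rewrite gtr0_norm// mulVf// mul1r.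
Qed.

Variable M : R.
Hypothesis M1 : 1 <= M.

Let M0 : 0 < M. Proof. exact: lt_le_trans M1. Qed.

Definition cut_line (l : R) : R := bump (M^-1 * l + 0).

Lemma line_C_cut k : line_C k cut_line.
Proof. exact: line_C_affine (line_C_bump k). Qed.

Lemma cut_line_ge0 l : 0 <= cut_line l. Proof. exact: bump_ge0. Qed.
Lemma cut_line_le1 l : cut_line l <= 1. Proof. exact: bump_le1. Qed.

Lemma cut_line_support l : cut_line l != 0 -> `|l| < M.
Proof.
rewrite /cut_line addr0 => /bump_support; rewrite normrM gtr0_norm ?invr_gt0// mulrC.
by rewrite ltr_pdivrMr// mul1r.
Qed.

Lemma cut_line_lip (L : R) : (forall x y, `|bump x - bump y| <= L * `|x - y|) ->
  forall k l, `|cut_line k - cut_line l| <= L / M * `|k - l|.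
Proof.
move=> H k l; apply: le_trans (H _ _) _; rewrite !addr0 -mulrBr normrM gtr0_norm ?invr_gt0//.
by rewrite mulrA.
Qed.

Variable s : R.
Hypothesis s01 : 2^-1 < s < 1.
Local Notation b := (s - 2^-1).

Let b0 : 0 < b. Proof. by have [h _] := andP s01; rewrite subr_gt0. Qed.
Let s2 : 0 < 2 - 2 * s. Proof. by have [_ h] := andP s01; rewrite subr_gt0 gtr_pMr. Qed.

Definition cut_power (a : R) : R := power_log b cut_line a.

Definition log_cut (a : R) : R := if 0 < a then cut_line (ln a) else 0.

Lemma log_cut_ge0 a : 0 <= log_cut a.
Proof. by rewrite /log_cut; case: ifP => // _; exact: cut_line_ge0. Qed.

Lemma log_cut_le1 a : log_cut a <= 1.
Proof. by rewrite /log_cut; case: ifP => // _; exact: cut_line_le1. Qed.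

Lemma log_cut_support a : log_cut a != 0 -> expR (- M) <= a <= expR M.
Proof.
rewrite /log_cut; case: ifP => [a0|]; last by rewrite eqxx.
move=> /cut_line_support; rewrite ltr_norml => /andP[h1 h2].
by rewrite -[a]lnK ?posrE// !ler_expR !ltW.
Qed.

Lemma cut_powerE a : cut_power a = a `^ b * log_cut a.
Proof. by rewrite /cut_power /power_log /log_cut; case: ifP => // _; rewrite mulr0. Qed.

Lemma line_C_cut_power k : line_C k cut_power.
Proof.
apply: (@line_C_power_log _ k b (- M)); last exact: line_C_cut.
move=> l lM; apply/eqP; apply: contraTT isT => /cut_line_support.
by rewrite ltr_norml => /andP[h _]; have := lt_trans lM h; rewrite ltxx.
Qed.

Lemma cut_power_ge0 a : 0 <= cut_power a.
Proof. by rewrite cut_powerE mulr_ge0 ?powR_ge0 ?log_cut_ge0. Qed.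

Lemma cut_power_support a : cut_power a != 0 -> expR (- M) <= a <= expR M.
Proof. by rewrite cut_powerE mulf_eq0 negb_or => /andP[_ /log_cut_support]. Qed.

Lemma cut_power_le a : cut_power a <= expR M `^ b.
Proof.
have [a0|/cut_power_support /andP[a1 a2]] := eqVneq (cut_power a) 0; first by rewrite a0 powR_ge0.
have ap : 0 <= a by rewrite (le_trans _ a1)// expR_ge0.
rewrite cut_powerE (le_trans (ler_wpM2l (powR_ge0 _ _) (log_cut_le1 _)))// mulr1.
by rewrite ge0_ler_powR// ?nnegrE ?expR_ge0// ltW.
Qed.

Lemma measurable_cut_power : measurable_fun setT cut_power.
Proof. by apply: continuous_measurable_fun; exact: (line_C_continuous (line_C_cut_power 0)). Qed.

Lemma measurable_log_cut : measurable_fun setT log_cut.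
Proof.
apply: measurable_fun_ifT => //; first by apply: measurable_fun_ltr.
apply: (@measurableT_comp _ _ _ _ _ _ cut_line _ (@ln R)); last exact: measurable_ln.
by apply: continuous_measurable_fun; exact: (line_C_continuous (line_C_cut 0)).
Qed.

(** On the half-line, [cut_power] squared times the Hardy weight a^(-2s) is the square of this
    function: the problem moves to L^2, where normalised dilations are isometries and only the
    cut-off changes. *)
Definition log_profile (a : R) : R := a `^ (- (1 / 2)) * log_cut a.

Lemma measurable_log_profile : measurable_fun setT log_profile.
Proof. by apply: measurable_funM; [exact: measurable_powR|exact: measurable_log_cut]. Qed.

Lemma log_profile_sqr a : log_profile a ^+ 2 = if 0 < a then log_cut a ^+ 2 / a else 0.
Proof.
rewrite /log_profile exprMn powRNE ?ltr01//; case: ifPn => [a0|a0].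
  by rewrite powRr1 ?(ltW a0)// mulrC.
by rewrite /log_cut (negbTE a0) expr0n mulr0.
Qed.

Lemma bump_half (x : R) : `|x| <= 1 / 2 -> expR (- 4) <= bump x.
Proof.
rewrite ler_norml => /andP[x1 x2].
have H y : 1 / 2 <= y -> expR (- 2) <= flat 0 y :> R.
  move=> y2; have y0 : 0 < y by lra.
  rewrite /flat y0 expr0 mul1r ler_expR lerN2 -[X in _ <= X]invrK lef_pV2 ?posrE ?invr_gt0//; lra.
rewrite (_ : - 4 = - 2 + - 2 :> R); last by ring.
by rewrite expRD ler_pM ?expR_ge0// H//; lra.
Qed.

(** The mass is of the order of [M]: at most 2M, and at least e^(-8) M because the bump is at least
    e^(-4) on the middle half. Errors of order 1/M are therefore negligible against it. *)
Lemma log_mass : exists2 A : R, (\int[leb1]_a (log_profile a ^+ 2)%:E = A%:E)%E & expR (- 8) * M <= A.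
Proof.
have mp : measurable_fun setT (fun a => (log_profile a ^+ 2)%:E).
  by apply/measurable_EFinP; apply: measurable_funX; exact: measurable_log_profile.
have up : (\int[leb1]_a (log_profile a ^+ 2)%:E <= (2 * M)%:E)%E.
  rewrite -(integral_log_weight (ltW M0)); apply: ge0_le_integral => //.
  - by move=> a _; rewrite lee_fin sqr_ge0.
  - by apply/measurable_EFinP; exact: measurable_log_weight.
  move=> a _; rewrite lee_fin log_profile_sqr; case: ifPn => [a0|_]; last exact: log_weight_ge0.
  have [->|/log_cut_support h] := eqVneq (log_cut a) 0; first by rewrite expr0n mul0r log_weight_ge0.
  rewrite /log_weight h ler_piMl ?invr_ge0 ?(ltW a0)//.
  by rewrite expr_le1 ?log_cut_le1 ?log_cut_ge0.
have lo : ((expR (- 8) * M)%:E <= \int[leb1]_a (log_profile a ^+ 2)%:E)%E.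
  have h2 : 0 <= M / 2 by rewrite divr_ge0// ltW.
  have -> : (expR (- 8) * M)%:E = ((expR (- 8))%:E * \int[leb1]_a (log_weight (M / 2) a)%:E)%E.
    by rewrite integral_log_weight// -EFinM; congr _%:E; field.
  have ml : measurable_fun setT (fun a => (log_weight (M / 2) a)%:E).
    by apply/measurable_EFinP; exact: measurable_log_weight.
  have l0 a : setT a -> (0 <= (log_weight (M / 2) a)%:E)%E by rewrite lee_fin log_weight_ge0.
  have e0 : (0 <= (expR (- 8))%:E :> \bar R)%E by rewrite lee_fin expR_ge0.
  rewrite -(ge0_integralZl leb1 measurableT ml l0 e0).
  apply: ge0_le_integral => //.
  - by move=> a _; rewrite mule_ge0// l0.
  - exact: measurable_funeM.
  move=> a _; rewrite -EFinM lee_fin /log_weight; case: ifPn => [/andP[a1 a2]|_]; last first.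
    by rewrite mulr0 sqr_ge0.
  have a0 : 0 < a by rewrite (lt_le_trans _ a1)// expR_gt0.
  rewrite log_profile_sqr a0 ler_wpM2r ?invr_ge0 ?(ltW a0)// /log_cut a0.
  rewrite (_ : - 8 = - 4 + - 4 :> R); last by ring.
  rewrite expRD expr2 ler_pM ?expR_ge0//; apply: bump_half.
  - rewrite addr0 normrM gtr0_norm ?invr_gt0// mulrC ler_pdivrMr// mulrC mul1r ler_norml.
    by rewrite -(ler_expR (- (M / 2))) -(ler_expR (ln a)) lnK ?posrE// a1 a2.
  - rewrite addr0 normrM gtr0_norm ?invr_gt0// mulrC ler_pdivrMr// mulrC mul1r ler_norml.
    by rewrite -(ler_expR (- (M / 2))) -(ler_expR (ln a)) lnK ?posrE// a1 a2.
have i0 : (0 <= \int[leb1]_a (log_profile a ^+ 2)%:E)%E by apply: integral_ge0 => a _; rewrite lee_fin sqr_ge0.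
have fin : (\int[leb1]_a (log_profile a ^+ 2)%:E)%E \is a fin_num.
  by rewrite ge0_fin_numE// (le_lt_trans up)// ltry.
exists (fine (\int[leb1]_a (log_profile a ^+ 2)%:E)%E); first by rewrite fineK.
by rewrite -lee_fin fineK.
Qed.

Lemma log_mass_weight (A : R) : (\int[leb1]_a (log_profile a ^+ 2)%:E = A%:E)%E ->
  (\int[leb1]_a (if 0 < (a : R) then cut_power a ^+ 2 * a `^ (- (2 * s)) else 0)%:E = A%:E)%E.
Proof.
move=> <-; apply: eq_integral => a _; rewrite log_profile_sqr; case: ifPn => // a0.
rewrite cut_powerE exprMn -[(a `^ b) ^+ 2]powR_mulrn ?powR_ge0// -powRrM.
have -> : a^-1 = a `^ (b * 2) * a `^ (- (2 * s)).
  rewrite -powRD ?(gt_eqF a0) ?implybT// -powR_inv1 ?(ltW a0)//; congr (_ `^ _); by field.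
by congr _%:E; ring.
Qed.

Section dilation.
Variables (L tau : R).
Hypotheses (tau01 : 0 < tau < 1) (L0 : 0 < L)
  (HL : forall k l, `|cut_line k - cut_line l| <= L / M * `|k - l|).

(** The normalised dilate tau^(1/2) log_profile(tau a), in which the powers of [tau] cancel. *)
Definition log_profile_dil (a : R) : R := a `^ (- (1 / 2)) * log_cut (tau * a).

Let t0 : 0 < tau. Proof. by have [] := andP tau01. Qed.

Lemma measurable_log_profile_dil : measurable_fun setT log_profile_dil.
Proof.
apply: measurable_funM; first exact: measurable_powR.
apply: (measurableT_comp measurable_log_cut); exact: measurable_funM.
Qed.

Lemma log_profile_dil_mass (A : R) : (\int[leb1]_a (log_profile a ^+ 2)%:E = A%:E)%E ->
  (\int[leb1]_a (log_profile_dil a ^+ 2)%:E = A%:E)%E.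
Proof.
move=> HA; have tn : tau != 0 by rewrite gt_eqF.
have mp : measurable_fun setT (fun a => (tau * log_profile a ^+ 2)%:E).
  apply/measurable_EFinP; apply: measurable_funM => //.
  by apply: measurable_funX; exact: measurable_log_profile.
have p0 a : (0 <= (tau * log_profile a ^+ 2)%:E)%E by rewrite lee_fin mulr_ge0 ?sqr_ge0// ltW.
have E := @ge0_integral_affine R tau 0 _ tn mp p0.
transitivity (\int[leb1]_a (tau * log_profile (affine tau 0 a) ^+ 2)%:E)%E.
  apply: eq_integral => a _; rewrite /affine addr0 log_profile_sqr /log_profile_dil exprMn powRNE ?ltr01//.
  rewrite pmulr_rgt0//; case: ifPn => [a0|a0].
    rewrite powRr1 ?(ltW a0)//; congr _%:E; field; by rewrite !gt_eqF.
  by rewrite /log_cut pmulr_rgt0// (negbTE a0) expr0n mulr0 mulr0.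
rewrite E; have ml : measurable_fun setT (fun a => (log_profile a ^+ 2)%:E).
  by apply/measurable_EFinP; apply: measurable_funX; exact: measurable_log_profile.
have l0 a : setT a -> (0 <= (log_profile a ^+ 2)%:E)%E by rewrite lee_fin sqr_ge0.
have t0' : (0 <= tau%:E)%E by rewrite lee_fin ltW.
under eq_integral => a _ do rewrite EFinM.
rewrite (ge0_integralZl leb1 measurableT ml l0 t0') HA -!EFinM; congr _%:E.
by rewrite gtr0_norm// mulKf.
Qed.

(** The cut-off is Lipschitz in ln a with constant L/M, and the dilation shifts ln a by ln tau; the
    squared difference is integrated over two supports of logarithmic length 2M. *)
Lemma log_profile_diff :
  (\int[leb1]_a ((log_profile a - log_profile_dil a) ^+ 2)%:E <= (4 * L ^+ 2 / M * ln tau ^+ 2)%:E)%E.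
Proof.
set c := (L / M * ln tau) ^+ 2.
have c0 : 0 <= c by exact: sqr_ge0.
have c0' : (0 <= c%:E)%E by rewrite lee_fin.
have m1 : measurable_fun setT (fun a => (log_weight M a)%:E).
  by apply/measurable_EFinP; exact: measurable_log_weight.
have m2 : measurable_fun setT (fun a => (tau * log_weight M (tau * a))%:E).
  apply/measurable_EFinP; apply: measurable_funM => //.
  apply: (measurableT_comp (measurable_log_weight M)); exact: measurable_funM.
have l1 a : setT a -> (0 <= (log_weight M a)%:E)%E by rewrite lee_fin log_weight_ge0.
have l2 a : setT a -> (0 <= (tau * log_weight M (tau * a))%:E)%E.
  by move=> _; rewrite lee_fin mulr_ge0 ?log_weight_ge0// ltW.
have -> : (4 * L ^+ 2 / M * ln tau ^+ 2)%:E = (c%:E * (\int[leb1]_a (log_weight M a)%:E + \int[leb1]_a (tau * log_weight M (tau * a))%:E))%E.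
  rewrite integral_log_weight ?(ltW M0)// log_weight_dilation ?(ltW M0)// -EFinD -EFinM.
  by congr _%:E; rewrite /c; field; rewrite gt_eqF.
rewrite -(ge0_integralD leb1 measurableT l1 m1 l2 m2).
have l3 a : setT a -> (0 <= (log_weight M a)%:E + (tau * log_weight M (tau * a))%:E)%E.
  by move=> _; apply: adde_ge0; [exact: l1|exact: l2].
have m3 := emeasurable_funD m1 m2.
rewrite -(ge0_integralZl leb1 measurableT m3 l3 c0').
apply: ge0_le_integral => //.
- by move=> a _; rewrite lee_fin sqr_ge0.
- apply/measurable_EFinP; apply: measurable_funX; apply: measurable_funB.
    exact: measurable_log_profile.
  exact: measurable_log_profile_dil.
- exact: measurable_funeM.
move=> a _; rewrite -EFinD -EFinM lee_fin /log_profile /log_profile_dil -mulrBr exprMn powRNE ?ltr01//.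
have [a0|a0] := ltP 0 a; last first.
  rewrite /log_cut pmulr_rgt0// ltNge a0 /= subrr expr0n mulr0.
  by rewrite mulr_ge0// addr_ge0 ?log_weight_ge0// mulr_ge0 ?log_weight_ge0// ltW.
rewrite powRr1 ?(ltW a0)//.
have ta0 : 0 < tau * a by rewrite mulr_gt0.
have ai : 0 <= a^-1 by rewrite invr_ge0 ltW.
have dif : (log_cut a - log_cut (tau * a)) ^+ 2 <= c.
  rewrite /c -real_normK ?num_real// -[X in _ <= X]real_normK ?num_real// ler_sqr ?nnegrE//.
  rewrite /log_cut a0 ta0 (le_trans (HL _ _))// lnM ?posrE// opprD addrCA subrr addr0 normrN normrM.
  by rewrite [X in _ <= X * _]gtr0_norm// divr_gt0.
have lw x : 0 < x -> log_cut x != 0 -> log_weight M x = x^-1.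
  by move=> x0 /log_cut_support h; rewrite /log_weight h.
have [A0|A0] := eqVneq (log_cut a) 0.
  have [B0|B0] := eqVneq (log_cut (tau * a)) 0.
    rewrite A0 B0 subrr expr0n mulr0.
    by rewrite mulr_ge0// addr_ge0 ?log_weight_ge0// mulr_ge0 ?log_weight_ge0// ltW.
  rewrite mulrC; apply: ler_pM; rewrite ?sqr_ge0//.
  rewrite (lw _ ta0 B0) invfM mulrA divff ?gt_eqF// mul1r.
  by rewrite lerDr log_weight_ge0.
rewrite mulrC; apply: ler_pM; rewrite ?sqr_ge0//.
by rewrite (lw _ a0 A0) lerDl mulr_ge0 ?log_weight_ge0// ltW.
Qed.

(** The square expansion with coefficients 1 and tau^b: the mass times (1 - tau^b)^2 is the exact
    half-line integrand, and the remainder is of order 1/M. *)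
Lemma slice_quotient_le (A : R) : (\int[leb1]_a (log_profile a ^+ 2)%:E = A%:E)%E ->
  (\int[leb1]_a (if 0 < (a : R) then a `^ (- (2 * s)) * (cut_power (tau * a) - cut_power a) ^+ 2 else 0)%:E
   <= (A * (1 - tau `^ b) ^+ 2 + 4 * L ^+ 2 / M * (2 / b) ^+ 2 * (1 - tau) ^+ 2)%:E)%E.
Proof.
move=> HA.
have E := @integral_sqr_combination _ _ R leb1 _ _ A 1 (tau `^ b) measurable_log_profile
  measurable_log_profile_dil ler01 (powR_ge0 tau b) HA (log_profile_dil_mass HA).
have -> : (\int[leb1]_a (if 0 < (a : R) then a `^ (- (2 * s)) * (cut_power (tau * a) - cut_power a) ^+ 2 else 0)%:E
   = \int[leb1]_a ((1 * log_profile a - tau `^ b * log_profile_dil a) ^+ 2)%:E)%E.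
  apply: eq_integral => a _; congr _%:E; case: ifPn => [a0|a0]; last first.
    by rewrite /log_profile /log_profile_dil /log_cut pmulr_rgt0// (negbTE a0) !mulr0 subr0 expr0n.
  rewrite /log_profile /log_profile_dil !cut_powerE powRM ?(ltW a0) ?(ltW t0)//.
  have -> : (1 * (a `^ (- (1 / 2)) * log_cut a) - tau `^ b * (a `^ (- (1 / 2)) * log_cut (tau * a))) ^+ 2 =
     (a `^ (- (1 / 2))) ^+ 2 * (tau `^ b * log_cut (tau * a) - log_cut a) ^+ 2 by ring.
  have -> : (a `^ (- (1 / 2))) ^+ 2 = a `^ (- (2 * s)) * (a `^ b) ^+ 2.
    rewrite -![_ ^+ 2]powR_mulrn ?powR_ge0// -!powRrM -powRD ?(gt_eqF a0) ?implybT//.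
    by congr (_ `^ _); field.
  by ring.
rewrite E EFinD; apply: leeD; first by rewrite lee_fin mulrC.
apply: le_trans (lee_wpmul2l _ log_profile_diff) _; first by rewrite lee_fin mulr_ge0 ?powR_ge0.
rewrite -EFinM lee_fin mul1r.
have lt0 : 0 <= - ln tau by rewrite oppr_ge0 ln_le0// ltW//; have [] := andP tau01.
have b2 : 0 < b / 2 by rewrite divr_gt0.
(* The factor tau^b, taken as a square, tames ln tau as tau -> 0; what is left is the factor 1 -
   tau, whose square makes the error integrable against u^(-1-2s) with u = 1 - tau. *)
have key : tau `^ (b / 2) * (- ln tau) <= 2 / b * (1 - tau).
  have h1 : - ln tau * (b / 2) <= tau `^ (- (b / 2)) - 1.
    rewrite /powR gt_eqF// lerBrDl (_ : - ln tau * (b / 2) = - (b / 2) * ln tau); last by ring.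
    exact: expR_ge1Dx.
  have p0 : 0 < tau `^ (b / 2) by rewrite powR_gt0.
  have h2 : tau `^ (b / 2) * (- ln tau * (b / 2)) <= 1 - tau `^ (b / 2).
    apply: le_trans (ler_wpM2l (ltW p0) h1) _.
    by rewrite powRN mulrBr mulr1 divff ?gt_eqF.
  have h3 : tau <= tau `^ (b / 2).
    rewrite -{1}[tau]powRr1 ?(ltW t0)// ger_powR//; first by rewrite t0 ltW//; have [] := andP tau01.
    by have [_ ?] := andP s01; lra.
  rewrite (_ : tau `^ (b / 2) * - ln tau = 2 / b * (tau `^ (b / 2) * (- ln tau * (b / 2)))); last first.
    have bb : 2 / b * (b / 2) = 1 by rewrite mulrA divfK ?divff// gt_eqF.
    by rewrite -[LHS]mulr1 -[X in _ * X = _]bb; clear; move: (2 / b) (b / 2) => x y; ring.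
  rewrite ler_wpM2l ?divr_ge0 ?(ltW b0)//; lra.
have k0 : 0 <= tau `^ (b / 2) * - ln tau by rewrite mulr_ge0 ?powR_ge0.
have := ler_pM k0 k0 key key; rewrite -!expr2 => k2.
have -> : tau `^ b * (4 * L ^+ 2 / M * ln tau ^+ 2) = 4 * L ^+ 2 / M * (tau `^ (b / 2) * - ln tau) ^+ 2.
  rewrite exprMn sqrrN -[_ ^+ 2 in X in _ = X]/(_ * _).
  have -> : tau `^ (b / 2) ^+ 2 = tau `^ b by rewrite -[LHS]powR_mulrn ?powR_ge0// -powRrM divfK.
  by ring.
rewrite -[X in _ <= X]mulrA -exprMn; apply: ler_wpM2l => //.
by rewrite divr_ge0 ?(ltW M0)// mulr_ge0 ?sqr_ge0.
Qed.

End dilation.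

Lemma integral_powR_01 : (\int[leb1]_(u in `]0%R, 1%R[) (u `^ (1 - 2 * s))%:E <= ((2 - 2 * s)^-1)%:E)%E.
Proof.
have E : 1 - 2 * s = (2 - 2 * s) - 1 by ring.
apply: (@FTC_itv01_le _ (fun u => (2 - 2 * s)^-1 * u `^ (2 - 2 * s))).
- by move=> x _; exact: powR_ge0.
- by move=> x /andP[x0 _]; exact: continuous_powRl.
- move=> x /andP[x0 _].
  have := @is_deriveZ _ _ _ (fun u => u `^ (2 - 2 * s)) (2 - 2 * s)^-1 x 1 _ (is_derive1_powR _ x0).
  by rewrite /GRing.scale/= mulrA mulVf ?gt_eqF// mul1r -E.
- move=> x y /andP[x0 _] /andP[y0 y1]; rewrite -mulrBr ler_piMr ?invr_ge0 ?(ltW s2)//.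
  have : y `^ (2 - 2 * s) <= 1 `^ (2 - 2 * s) by rewrite ge0_ler_powR// ?nnegrE ?(ltW s2)// ltW.
  rewrite powR1E.
  by have := powR_ge0 x (2 - 2 * s); lra.
Qed.

Let mfst : measurable_fun setT (fun w : measurableTypeR R * measurableTypeR R => (w.1 : R)).
Proof. exact: measurable_fst. Qed.
Let msnd : measurable_fun setT (fun w : measurableTypeR R * measurableTypeR R => (w.2 : R)).
Proof. exact: measurable_snd. Qed.
Let pos_fst : measurable_fun setT (fun w : measurableTypeR R * measurableTypeR R => 0 < (w.1 : R)).
Proof. exact: measurable_fun_ltr. Qed.

Let K1 (w : measurableTypeR R * measurableTypeR R) : \bar R :=
  (if (0 < (w.2 : R)) && ((w.2 : R) < (w.1 : R)) then
    (cut_power (w.1 - w.2) - cut_power w.1) ^+ 2 * w.2 `^ (- 1 - 2 * s) else 0)%:E.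

Let K2 (w : measurableTypeR R * measurableTypeR R) : \bar R :=
  (if (0 < (w.1 : R)) && ((0 < (w.2 : R)) && ((w.2 : R) < 1)) then
    (w.1 `^ (- (2 * s)) * (cut_power ((1 - w.2) * w.1) - cut_power w.1) ^+ 2) * w.2 `^ (- 1 - 2 * s) else 0)%:E.

Let mK1 : measurable_fun setT K1.
Proof.
apply/measurable_EFinP; apply: measurable_fun_ifT; last exact: measurable_cst.
  by apply: measurable_and; exact: measurable_fun_ltr.
apply: measurable_funM; last exact: (measurableT_comp (measurable_powR _) msnd).
apply: measurable_funX; apply: measurable_funB; last exact: (measurableT_comp measurable_cut_power mfst).
by apply: (measurableT_comp measurable_cut_power); exact: measurable_funB.
Qed.

Let mK2 : measurable_fun setT K2.
Proof.
apply/measurable_EFinP; apply: measurable_fun_ifT; last exact: measurable_cst.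
  by apply: measurable_and => //; apply: measurable_and; exact: measurable_fun_ltr.
apply: measurable_funM; last exact: (measurableT_comp (measurable_powR _) msnd).
apply: measurable_funM; first exact: (measurableT_comp (measurable_powR _) mfst).
apply: measurable_funX; apply: measurable_funB; last exact: (measurableT_comp measurable_cut_power mfst).
apply: (measurableT_comp measurable_cut_power); apply: measurable_funM => //; exact: measurable_funB.
Qed.

Let K10 w : (0 <= K1 w)%E.
Proof. by rewrite /K1 lee_fin; case: ifP => // _; rewrite mulr_ge0 ?sqr_ge0 ?powR_ge0. Qed.

Let K20 w : (0 <= K2 w)%E.
Proof.
rewrite /K2 lee_fin; case: ifP => // _.
by rewrite mulr_ge0 ?powR_ge0// mulr_ge0 ?powR_ge0 ?sqr_ge0.
Qed.

(** The base point becomes the farther of the two, so that in the next step t = a u with 0 < u <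
    1. *)
Let shiftK (t : R) : (\int[leb1]_a (line_quotient s cut_power a t)%:E = \int[leb1]_a K1 (a, t))%E.
Proof.
have ml : measurable_fun setT (fun a : R => (line_quotient s cut_power a t)%:E).
  apply/measurable_EFinP.
  exact: (measurableT_comp (measurable_line_quotient s measurable_cut_power) (pair2_measurable (t : measurableTypeR R))).
have l0 a : (0 <= (line_quotient s cut_power a t)%:E)%E by rewrite lee_fin line_quotient_ge0.
have E := @ge0_integral_affine R 1 (- t) _ (oner_neq0 _) ml l0.
rewrite normr1 invr1 mul1e in E; rewrite -[LHS]E; apply: eq_integral => a _.
rewrite /affine mul1r /line_quotient /K1; cbn [fst snd].
by rewrite subr_gt0 subrK.
Qed.

Let scaleK (a : R) : (\int[leb1]_t K1 (a, t) = \int[leb1]_u K2 (a, u))%E.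
Proof.
have [a0|a0] := ltP 0 a; last first.
  rewrite !integral0_eq// => t _.
    by rewrite /K2; cbn [fst snd]; rewrite ltNge a0.
  rewrite /K1; cbn [fst snd]; case: ifP => // /andP[h1 h2].
  by have := lt_le_trans (lt_trans h1 h2) a0; rewrite ltxx.
have an : a != 0 by rewrite gt_eqF.
have m1 : measurable_fun setT (fun t : R => (a%:E * K1 (a, t))%E).
  apply: measurable_funeM; exact: (measurableT_comp mK1 (pair1_measurable (a : measurableTypeR R))).
have p1 t : (0 <= a%:E * K1 (a, t))%E by rewrite mule_ge0// lee_fin ltW.
have E := @ge0_integral_affine R a 0 _ an m1 p1.
transitivity (\int[leb1]_u (a%:E * K1 (a, affine a 0 u)))%E; last first.
  apply: eq_integral => u _; rewrite /affine addr0 /K1 /K2; cbn [fst snd]; rewrite a0 pmulr_rgt0//.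
  rewrite gtr_pMr// -EFinM; congr _%:E; case: ifPn => [/andP[u0 u1]|_]; last by rewrite mulr0.
  have -> : a - a * u = (1 - u) * a by ring.
  rewrite powRM ?(ltW a0) ?(ltW u0)//.
  have -> : a `^ (- (2 * s)) = a * a `^ (- 1 - 2 * s).
    rewrite -{2}[a]powRr1 ?(ltW a0)// -powRD ?(gt_eqF a0) ?implybT//; congr (_ `^ _); by ring.
  by ring.
rewrite E; have m2 : measurable_fun setT (fun t : R => K1 (a, t)).
  exact: (measurableT_comp mK1 (pair1_measurable (a : measurableTypeR R))).
have a0' : (0 <= a%:E)%E by rewrite lee_fin ltW.
rewrite (ge0_integralZl leb1 measurableT m2 (fun t _ => K10 _) a0').
by rewrite muleA -EFinM gtr0_norm// mulVf// mul1e.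
Qed.

(** With [a] the farther point and u = t / a, Tonelli puts the integral in [u] outside. The slice
    estimate at tau = 1 - u yields [rkint], whose integral is [kap], and an error with the
    integrable kernel u^(1-2s). *)
Lemma cut_quotient_le (A L : R) : (\int[leb1]_a (log_profile a ^+ 2)%:E = A%:E)%E -> 0 <= A -> 0 < L ->
  (forall k l, `|cut_line k - cut_line l| <= L / M * `|k - l|) ->
  (\int[leb1]_t \int[leb1]_a (line_quotient s cut_power a t)%:E <=
   (A * kap s + 4 * L ^+ 2 / M * (2 / b) ^+ 2 / (2 - 2 * s))%:E)%E.
Proof.
move=> HA A0 L0 HL.
under eq_integral => t _ do rewrite shiftK.
have F1 := fubini_tonelli (m1 := leb1) (m2 := leb1) K1 mK1 K10.
apply: (le_trans (eq_ind _ (fun y => (y <= _)%E) (lexx _) _ F1)).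
under eq_integral => a _ do rewrite scaleK.
have F2 := fubini_tonelli (m1 := leb1) (m2 := leb1) K2 mK2 K20.
apply: (le_trans (eq_ind _ (fun y => (_ <= y)%E) (lexx _) _ F2)).
set C := 4 * L ^+ 2 / M * (2 / b) ^+ 2.
have C0 : 0 <= C.
  apply: mulr_ge0; last exact: sqr_ge0.
  by apply: divr_ge0; [apply: mulr_ge0; [exact: ler0n|exact: sqr_ge0]|exact: ltW].
have C0' : (0 <= C%:E)%E by rewrite lee_fin.
have A0' : (0 <= A%:E)%E by rewrite lee_fin.
pose D : set R := `]0%R, 1%R[%classic.
have mitv : measurable D by exact: measurable_itv.
have mr : measurable_fun D (fun u => (rkint s u)%:E).
  by apply: measurable_funTS; apply/measurable_EFinP; exact: measurable_rkint.
have mp : measurable_fun D (fun u : R => (u `^ (1 - 2 * s))%:E).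
  by apply: measurable_funTS; apply/measurable_EFinP; exact: measurable_powR.
have r0 u : D u -> (0 <= (rkint s u)%:E)%E.
  by move=> _; rewrite lee_fin /rkint /kint mulr_ge0 ?sqr_ge0 ?powR_ge0.
have p0 u : D u -> (0 <= (u `^ (1 - 2 * s))%:E)%E by move=> _; rewrite lee_fin powR_ge0.
apply: (@le_trans _ _ (A%:E * \int[leb1]_(u in D) (rkint s u)%:E +
    C%:E * \int[leb1]_(u in D) (u `^ (1 - 2 * s))%:E)%E); last first.
  have E1 := integral_rkint s01; rewrite EFinD; apply: leeD; rewrite [leRHS]EFinM.
    by apply: (lee_wpmul2l A0'); rewrite -E1.
  by apply: (lee_wpmul2l C0'); exact: integral_powR_01.
rewrite -(ge0_integralZl leb1 mitv mr r0 A0') -(ge0_integralZl leb1 mitv mp p0 C0').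
rewrite -(ge0_integralD leb1 mitv (fun u h => mule_ge0 A0' (r0 u h)) (measurable_funeM _ mr)
  (fun u h => mule_ge0 C0' (p0 u h)) (measurable_funeM _ mp)).
clear F1 F2; rewrite [leRHS]integral_mkcond; apply: ge0_le_integral; first exact: measurableT.
- by move=> u _; apply: integral_ge0 => a _; exact: K20.
- exact: (@measurable_fun_fubini_tonelli_G _ _ _ _ _ leb1 K2 mK2 K20).
- apply: (iffLR (measurable_restrictT _ mitv)).
  exact: (emeasurable_funD (measurable_funeM _ mr) (measurable_funeM _ mp)).
move=> u _; rewrite patchE /D mem_setE in_itv/=; case: ifPn => [/andP[u0 u1]|nu]; last first.
  by rewrite integral0_eq// => a _; rewrite /K2; cbn [fst snd]; rewrite (negbTE nu) andbF.
have tau01 : 0 < 1 - u < 1 by rewrite subr_gt0 u1 ltrBlDr ltrDl.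
have S := slice_quotient_le tau01 L0 HL HA.
have up0 : (0 <= (u `^ (- 1 - 2 * s))%:E)%E by rewrite lee_fin powR_ge0.
pose P (a : R) := if 0 < a then a `^ (- (2 * s)) * (cut_power ((1 - u) * a) - cut_power a) ^+ 2 else 0.
have mP : measurable_fun setT (fun a => (P a)%:E).
  apply/measurable_EFinP; apply: measurable_fun_ifT => //; first by apply: measurable_fun_ltr.
  apply: measurable_funM; first exact: measurable_powR.
  apply: measurable_funX; apply: measurable_funB; last exact: measurable_cut_power.
  by apply: (measurableT_comp measurable_cut_power); exact: measurable_funM.
have P0 a : setT a -> (0 <= (P a)%:E)%E.
  by move=> _; rewrite lee_fin /P; case: ifP => // _; rewrite mulr_ge0 ?powR_ge0 ?sqr_ge0.
have -> : (\int[leb1]_a K2 (a, u) = (u `^ (- 1 - 2 * s))%:E * \int[leb1]_a (P a)%:E)%E.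
  rewrite -(ge0_integralZl leb1 measurableT mP P0 up0); apply: eq_integral => a _.
  rewrite -EFinM /K2 /P; cbn [fst snd]; rewrite u0 u1 !andbT; case: ifP => _; congr _%:E.
    by rewrite mulrC.
  by rewrite mulr0.
apply: (le_trans (lee_wpmul2l up0 S)); rewrite -!EFinM -EFinD lee_fin le_eqVlt; apply/orP; left; apply/eqP.
rewrite /rkint /kint !subKr.
have -> : u `^ (1 - 2 * s) = u `^ (- 1 - 2 * s) * u ^+ 2.
  rewrite -powR_mulrn ?(ltW u0)// -powRD ?(gt_eqF u0) ?implybT//; congr (_ `^ _).
  by rewrite -[2%N]/(1 + 1)%N natrD; ring.
by rewrite /C; ring.
Qed.

(** Any finite bound will do, since it ends up divided by the square of the tangential scale. The
    product lives where a + t <= e^M, and t^(1-2s) is integrable at 0. *)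
Lemma cut_product_fin : exists2 B : R, 0 <= B &
  (\int[leb1]_t \int[leb1]_a (line_product s cut_power a t)%:E <= B%:E)%E.
Proof.
pose c := expR M; have c0 : 0 < c by exact: expR_gt0.
pose F := (c `^ b) ^+ 2; have F0 : 0 <= F by exact: sqr_ge0.
have [_ slt1] := andP s01.
pose S (t : R) : R := (if 0 < t < 1 then t `^ (1 - 2 * s) else 0) + (if 0 <= t <= c then 1 else 0).
have S0 t : 0 <= S t by rewrite /S addr_ge0//; case: ifP => // _; exact: powR_ge0.
have mS : measurable_fun setT S.
  apply: measurable_funD; apply: measurable_fun_ifT => //.
  - by apply: measurable_and; exact: measurable_fun_ltr.
  - by apply: measurable_and; exact: measurable_fun_ler.
have mSE : measurable_fun setT (fun t => (S t)%:E) by exact/measurable_EFinP.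
have cI : (\int[leb1]_(t in `[0%R, c]) 1 = c%:E)%E.
  rewrite (integral_cst leb1 (measurable_itv `[0, c])) mul1e.
  by have := @lebesgue_measure_itv R `[0, c]; rewrite /= lte_fin c0 oppr0 adde0.
have SI : (\int[leb1]_t (S t)%:E <= ((2 - 2 * s)^-1 + c)%:E)%E.
  have m1 : measurable_fun setT (fun t : R => (if 0 < t < 1 then t `^ (1 - 2 * s) else 0)%:E).
    apply/measurable_EFinP; apply: measurable_fun_ifT => //.
    by apply: measurable_and; exact: measurable_fun_ltr.
  have m2 : measurable_fun setT (fun t : R => (if 0 <= t <= c then 1 else 0 : R)%:E).
    apply/measurable_EFinP; apply: measurable_fun_ifT => //.
    by apply: measurable_and; exact: measurable_fun_ler.
  under eq_integral => t _ do rewrite /S EFinD.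
  rewrite (ge0_integralD leb1 measurableT _ m1 _ m2) ?EFinD; last 2 first.
  - by move=> t _; rewrite lee_fin; case: ifP => // _; exact: powR_ge0.
  - by move=> t _; rewrite lee_fin; case: ifP.
  apply: leeD.
    apply: le_trans integral_powR_01; rewrite [leRHS]integral_mkcond le_eqVlt; apply/orP; left; apply/eqP.
    by apply: eq_integral => t _; rewrite patchE mem_setE in_itv/=; case: ifP.
  have -> : (\int[leb1]_t (if 0 <= (t : R) <= c then 1 else 0)%:E = \int[leb1]_(t in `[0%R, c]) 1)%E.
    rewrite [RHS]integral_mkcond; apply: eq_integral => t _.
    by rewrite patchE mem_setE in_itv/=; case: ifP.
  by rewrite cI.
pose I (a : R) : R := if 0 <= a <= c then 1 else 0.
have mI : measurable_fun setT I.
  by apply: measurable_fun_ifT => //; apply: measurable_and; exact: measurable_fun_ler.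
have II : (\int[leb1]_a (I a)%:E = c%:E)%E.
  have -> : (\int[leb1]_a (I a)%:E = \int[leb1]_(t in `[0%R, c]) 1)%E.
    rewrite [RHS]integral_mkcond; apply: eq_integral => t _.
    by rewrite patchE mem_setE in_itv/= /I; case: ifP.
  by rewrite cI.
have I0' a : 0 <= I a by rewrite /I; case: ifP.
have FSI (a t : R) : 0 <= F * S t * I a by apply: mulr_ge0 => //; exact: mulr_ge0.
have ptw (a t : R) : line_product s cut_power a t <= F * S t * I a.
  rewrite /line_product; case: ifPn => [/andP[t0 a0]|_]; last first.
    by [].
  have [za|na] := eqVneq (cut_power a) 0.
    by rewrite za !mul0r.
  have [zb|nb] := eqVneq (cut_power (a + t)) 0.
    by rewrite zb mulr0 mul0r.
  have /andP[_ ac] := cut_power_support na; have /andP[_ tc] := cut_power_support nb.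
  rewrite /I (ltW a0) ac mulr1; apply: ler_pM.
  - by rewrite mulr_ge0 ?cut_power_ge0.
  - exact: powR_ge0.
  - by rewrite /F expr2 ler_pM ?cut_power_ge0 ?cut_power_le.
  rewrite /S t0 (ltW t0) (_ : t <= c) /=; last by rewrite (le_trans _ tc)// lerDr ltW.
  have [t1|t1] := ltP t 1; first by rewrite lerDl.
  rewrite add0r (_ : 1 - 2 * s = - (2 * s - 1)); last by ring.
  rewrite powRN invf_le1 ?powR_gt0//.
  have : 1 `^ (2 * s - 1) <= t `^ (2 * s - 1).
    by rewrite ge0_ler_powR// ?nnegrE ?(ltW t0)//; have [h _] := andP s01; lra.
  by rewrite powR1E.
exists (F * c * ((2 - 2 * s)^-1 + c)).
  apply: mulr_ge0; first by apply: mulr_ge0 => //; exact: ltW.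
  by apply: addr_ge0; [rewrite invr_ge0|]; exact: ltW.
apply: (@le_trans _ _ (\int[leb1]_t ((F * c)%:E * (S t)%:E))%E); last first.
  have S0E t : setT t -> (0 <= (S t)%:E)%E by rewrite lee_fin.
  have Fc0 : (0 <= (F * c)%:E)%E by rewrite lee_fin; apply: mulr_ge0 => //; exact: ltW.
  rewrite (ge0_integralZl leb1 measurableT mSE S0E Fc0) [leRHS]EFinM.
  exact: lee_wpmul2l.
apply: ge0_le_integral => //.
- move=> t _; apply: integral_ge0 => a _; rewrite lee_fin; apply: line_product_ge0.
  exact: cut_power_ge0.
- pose q (w : measurableTypeR R * measurableTypeR R) : \bar R := (line_product s cut_power w.1 w.2)%:E.
  apply: (@measurable_fun_fubini_tonelli_G _ _ _ _ _ leb1 q).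
  + by apply/measurable_EFinP; apply: measurable_line_product; exact: measurable_cut_power.
  + by move=> w; rewrite lee_fin; apply: line_product_ge0; exact: cut_power_ge0.
- exact: measurable_funeM.
move=> t _; have FS0 : (0 <= (F * S t)%:E)%E by rewrite lee_fin mulr_ge0.
have -> : ((F * c)%:E * (S t)%:E = (F * S t)%:E * \int[leb1]_a (I a)%:E)%E.
  by rewrite II -!EFinM; congr _%:E; ring.
have mIE : measurable_fun setT (fun a => (I a)%:E) by exact/measurable_EFinP.
have I0 a : setT a -> (0 <= (I a)%:E)%E by rewrite lee_fin /I; case: ifP.
rewrite -(ge0_integralZl leb1 measurableT mIE I0 FS0).
apply: ge0_le_integral => //.
- by move=> a _; rewrite lee_fin; apply: line_product_ge0; exact: cut_power_ge0.
- apply/measurable_EFinP.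
  exact: (measurableT_comp (measurable_line_product s measurable_cut_power) (pair2_measurable (t : measurableTypeR R))).
- exact: measurable_funeM.
by move=> a _; rewrite -EFinM lee_fin; exact: ptw.
Qed.

End log_cutoff.

Lemma prod_lip (R : realDomainType) (I : Type) (r : seq I) (a b : I -> R) :
  (forall i, 0 <= a i <= 1) -> (forall i, 0 <= b i <= 1) ->
  `|\prod_(i <- r) a i - \prod_(i <- r) b i| <= \sum_(i <- r) `|a i - b i|.
Proof.
move=> a01 b01; elim: r => [|i r IH]; first by rewrite !big_nil subrr normr0.
rewrite !big_cons; set A := \prod_(j <- r) a j in IH *; set B := \prod_(j <- r) b j in IH *.
have A1 : `|A| <= 1.
  rewrite /A ger0_norm; last by apply: prodr_ge0 => j _; have /andP[] := a01 j.
  by apply: prodr_ile1 => j _; exact: a01.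
have -> : a i * A - b i * B = (a i - b i) * A + b i * (A - B) by ring.
apply: le_trans (ler_normD _ _) _; rewrite !normrM; apply: lerD.
  by rewrite ler_piMr.
apply: le_trans IH; rewrite ler_piMl//.
by have /andP[b0 b1] := b01 i; rewrite ger0_norm.
Qed.

Lemma norm_le_coord (R : realType) n (x : 'rV[R]_n) (r : R) : 0 <= r ->
  (forall j, `|x ord0 j| <= r) -> `|x| <= r.
Proof.
move=> r0 H; rewrite leNgt; apply/negP => h.
have x0 : 0 < `|x| by exact: le_lt_trans h.
have : ball (0 : 'rV[R]_n) `|x| x.
  by split => // i j; rewrite (ord1 i) -ball_normE /= mxE sub0r normrN; exact: le_lt_trans (H j) h.
by rewrite -ball_normE /= sub0r normrN ltxx.
Qed.

(** * Wide product bumps in the tangential variables *)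

Section product_bump.
Context {R : realType} {n : nat}.
Local Notation lebn := (@lebesgue_rV R n).

Definition product_bump (r : R) (v : 'rV[R]_n) : R := \prod_i bump (r^-1 * v ord0 i + 0).

Lemma product_bump_ge0 r v : 0 <= product_bump r v.
Proof. by apply: prodr_ge0 => i _; exact: bump_ge0. Qed.

Lemma product_bump_le1 r v : product_bump r v <= 1.
Proof. by apply: prodr_ile1 => i _; rewrite bump_ge0 bump_le1. Qed.

Lemma product_bump_support r v : 0 < r -> product_bump r v != 0 -> forall i, `|v ord0 i| < r.
Proof.
move=> r0 /prodf_neq0 H i; have := H i isT => /bump_support.
by rewrite addr0 normrM gtr0_norm ?invr_gt0// mulrC ltr_pdivrMr// mul1r.
Qed.

Lemma measurable_product_bump r : measurable_fun setT (product_bump r).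
Proof.
apply: continuous_measurable_rV.
apply: (@class_C_continuous _ _ 0); apply: class_C_prod => i.
exact: (@class_C_coord R n 0 (fun x => bump (r^-1 * x + 0)) i (line_C_affine _ _ (line_C_bump 0))).
Qed.

Lemma product_bumpE r v : product_bump r v = product_bump 1 (r^-1 *: v).
Proof. by apply: eq_bigr => i _; rewrite mxE invr1 mul1r. Qed.

Lemma product_bump_lip : exists2 L : R, 0 < L &
  forall v w, `|product_bump 1 v - product_bump 1 w| <= L * enorm (v - w).
Proof.
have [L L0 HL] := @bump_lip R.
(* [n.+1] instead of [n], to keep the constant positive in dimension 0 too. *)
exists (n.+1%:R * L); first by rewrite mulr_gt0.
move=> v w; apply: le_trans (prod_lip _ _ _) _ => [i|i|].
- by rewrite bump_ge0 bump_le1.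
- by rewrite bump_ge0 bump_le1.
apply: (@le_trans _ _ (\sum_(i < n) L * enorm (v - w))).
  apply: ler_sum => i _; apply: le_trans (HL _ _) _; rewrite ler_wpM2l ?(ltW L0)//.
  rewrite invr1 !mul1r !addr0; apply: le_trans (coord_le_enorm _ i).
  by rewrite !mxE.
rewrite sumr_const card_ord -[X in X <= _]mulr_natl mulrA ler_wpM2r ?enorm_ge0// ler_wpM2r ?(ltW L0)//.
by rewrite ler_nat.
Qed.

Let box : set 'rV[R]_n := ball (0 : 'rV[R]_n) 1.

Let mbox : measurable box.
Proof. by apply: open_measurable_rV; exact: ball_open. Qed.

Let boxP v : product_bump 1 v != 0 -> box v.
Proof.
move=> /(product_bump_support ltr01) H; split => // i j; rewrite (ord1 i) -ball_normE /= mxE sub0r normrN; exact: H.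
Qed.

Let box_fin : (lebn box < +oo)%E.
Proof.
apply: bounded_lebesgue_rV => //; exists 1; split => // x x1 v.
rewrite /box -ball_normE /= sub0r normrN => h.
exact: ltW (lt_trans h x1).
Qed.

Lemma product_bump_mass : exists2 A : R, 0 < A &
  (\int[lebn]_v (product_bump 1 v ^+ 2)%:E = A%:E)%E.
Proof.
have m2 : measurable_fun setT (fun v : 'rV[R]_n => (product_bump 1 v ^+ 2)%:E).
  by apply/measurable_EFinP; apply: measurable_funX; exact: measurable_product_bump.
have i0 : (0 <= \int[lebn]_v (product_bump 1 v ^+ 2)%:E)%E.
  by apply: integral_ge0 => v _; rewrite lee_fin sqr_ge0.
have up : (\int[lebn]_v (product_bump 1 v ^+ 2)%:E < +oo)%E.
  apply: le_lt_trans box_fin; rewrite -[leRHS]mul1e -(integral_cst lebn mbox) [leRHS]integral_mkcond.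
  apply: ge0_le_integral; first exact: measurableT.
  - by move=> v _; rewrite lee_fin sqr_ge0.
  - exact: m2.
  - by apply: (iffLR (measurable_restrictT _ mbox)); exact: measurable_cst.
  move=> v _; rewrite patchE; case: ifPn => [_|/negP vb].
    by rewrite lee_fin expr_le1 ?product_bump_ge0 ?product_bump_le1.
  have [->|h] := eqVneq (product_bump 1 v) 0; first by rewrite expr0n.
  by exfalso; apply: vb; apply/mem_set; exact: boxP.
have lo : (0 < \int[lebn]_v (product_bump 1 v ^+ 2)%:E)%E.
  pose e : R := (expR (- 4) ^+ n) ^+ 2.
  have e0 : 0 < e by rewrite !exprn_gt0// expR_gt0.
  have r0 : 0 < 2^-1 :> R by rewrite invr_gt0.
  have mE := measurable_eball (0 : 'rV[R]_n) 2^-1.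
  apply: (@lt_le_trans _ _ (\int[lebn]_(v in eball 0 2^-1) (e%:E))%E).
    by rewrite (integral_cst lebn mE) mule_gt0 ?eball_lebesgue_gt0.
  rewrite integral_mkcond; apply: ge0_le_integral; first exact: measurableT.
  - by move=> v _; rewrite patchE; case: ifP => // _; rewrite lee_fin ltW.
  - by apply: (iffLR (measurable_restrictT _ mE)); exact: measurable_cst.
  - exact: m2.
  move=> v _; rewrite patchE; case: ifPn => [/set_mem vE|_]; rewrite lee_fin ?sqr_ge0//.
  rewrite /e ler_sqr ?nnegrE ?product_bump_ge0 ?exprn_ge0 ?expR_ge0//.
  rewrite -[n in X in X <= _]card_ord -prodr_const; apply: ler_prod => i _.
  rewrite expR_ge0 /=; apply: bump_half; rewrite invr1 mul1r addr0 div1r.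
  apply: le_trans (coord_le_enorm v i) _.
  by move: vE; rewrite /eball /= subr0 => /ltW.
exists (fine (\int[lebn]_v (product_bump 1 v ^+ 2)%:E)%E).
  by rewrite fine_gt0// lo up.
by rewrite fineK// ge0_fin_numE.
Qed.

Lemma product_bump_shift : exists2 K : R, 0 <= K & forall xi : 'rV[R]_n,
  (\int[lebn]_v ((product_bump 1 v - product_bump 1 (v + xi)) ^+ 2)%:E <= (K * enorm xi ^+ 2)%:E)%E.
Proof.
have [L L0 HL] := product_bump_lip.
have [B BE] : exists B : R, lebn box = B%:E.
  by exists (fine (lebn box)); rewrite fineK// ge0_fin_numE// measure_ge0.
have B0 : 0 <= B by rewrite -lee_fin -BE measure_ge0.
exists (2 * L ^+ 2 * B).
  by apply: mulr_ge0 => //; apply: mulr_ge0; [exact: ler0n|exact: sqr_ge0].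
move=> xi.
pose I (v : 'rV[R]_n) : \bar R := (cst 1%E \_ box) v.
have mI : measurable_fun setT I by apply: (iffLR (measurable_restrictT _ mbox)).
have I0 v : (0 <= I v)%E by rewrite /I patchE; case: ifP.
have II : (\int[lebn]_v I v = B%:E)%E by rewrite -integral_mkcond (integral_cst lebn mbox) mul1e.
have mS : measurable_fun setT (fun v : 'rV[R]_n => I (v + xi)).
  have := measurable_affine_rV 1 xi; under eq_fun do rewrite scale1r.
  exact: measurableT_comp.
have IS : (\int[lebn]_v I (v + xi)%R = B%:E)%E.
  have := @ge0_integral_affine_rV R n 1 xi I (oner_neq0 _) mI I0; rewrite normr1 invr1 expr1n mul1e II => <-.
  by apply: eq_integral => v _; rewrite scale1r.
pose c := L ^+ 2 * enorm xi ^+ 2.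
have c0 : (0 <= c%:E)%E by rewrite lee_fin mulr_ge0 ?sqr_ge0.
have -> : (2 * L ^+ 2 * B * enorm xi ^+ 2)%:E = (c%:E * (\int[lebn]_v I v + \int[lebn]_v I (v + xi)%R))%E.
  by rewrite II IS -EFinD -EFinM; congr _%:E; rewrite /c; ring.
rewrite -(ge0_integralD lebn measurableT (fun v _ => I0 v) mI (fun v _ => I0 _) mS).
have s0 v : setT v -> (0 <= I v + I (v + xi)%R)%E by move=> _; exact: adde_ge0.
rewrite -(ge0_integralZl lebn measurableT (emeasurable_funD mI mS) s0 c0).
have mb := measurable_product_bump 1.
have mb2 : measurable_fun setT (fun v : 'rV[R]_n => product_bump 1 (v + xi)).
  have := measurable_affine_rV 1 xi; under eq_fun do rewrite scale1r.
  exact: measurableT_comp.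
apply: ge0_le_integral; first exact: measurableT.
- by move=> v _; rewrite lee_fin sqr_ge0.
- by apply/measurable_EFinP; apply: measurable_funX; exact: measurable_funB.
- exact: (measurable_funeM _ (emeasurable_funD mI mS)).
move=> v _; have dif : (product_bump 1 v - product_bump 1 (v + xi)) ^+ 2 <= c.
  have := HL v (v + xi); rewrite opprD addrA subrr add0r enormN => h.
  rewrite /c -exprMn -real_normK ?num_real// ler_sqr ?nnegrE// mulr_ge0 ?enorm_ge0//.
  exact: ltW.
have In w : product_bump 1 w != 0 -> I w = 1%E.
  by move=> /boxP wb; rewrite /I patchE mem_set.
have [A0|A0] := eqVneq (product_bump 1 v) 0; last first.
  rewrite (In _ A0); apply: (@le_trans _ _ (c%:E * 1)%E); first by rewrite mule1 lee_fin.
  by apply: lee_wpmul2l => //; rewrite leeDl.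
have [A1|A1] := eqVneq (product_bump 1 (v + xi)) 0; last first.
  rewrite (In _ A1); apply: (@le_trans _ _ (c%:E * 1)%E); first by rewrite mule1 lee_fin.
  by apply: lee_wpmul2l => //; rewrite leeDr.
by rewrite A0 A1 subrr expr0n; apply: mule_ge0 => //; exact: s0.
Qed.

Lemma product_bump_mass_scale (r A : R) : 0 < r ->
  (\int[lebn]_v (product_bump 1 v ^+ 2)%:E = A%:E)%E ->
  (\int[lebn]_v (product_bump r v ^+ 2)%:E = (r ^+ n * A)%:E)%E.
Proof.
move=> r0 HA; have rn : r^-1 != 0 by rewrite gt_eqF// invr_gt0.
have m2 : measurable_fun setT (fun v : 'rV[R]_n => (product_bump 1 v ^+ 2)%:E).
  by apply/measurable_EFinP; apply: measurable_funX; exact: measurable_product_bump.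
have p0 (v : 'rV[R]_n) : (0 <= (product_bump 1 v ^+ 2)%:E)%E by rewrite lee_fin sqr_ge0.
have E := @ge0_integral_affine_rV R n r^-1 0 _ rn m2 p0.
rewrite HA -EFinM gtr0_norm ?invr_gt0// invrK in E; rewrite -[RHS]E.
by apply: eq_integral => v _; rewrite product_bumpE addr0.
Qed.

(** Widening by [r] multiplies the mass by r^n and the translation error by r^n / r^2: relative to
    the mass, the tangential error is of order 1/r^2. *)
Lemma product_bump_shift_scale (r K : R) : 0 < r -> (forall xi : 'rV[R]_n,
  (\int[lebn]_v ((product_bump 1 v - product_bump 1 (v + xi)) ^+ 2)%:E <= (K * enorm xi ^+ 2)%:E)%E) ->
  forall xi : 'rV[R]_n,
  (\int[lebn]_v ((product_bump r v - product_bump r (v + xi)) ^+ 2)%:E <= (r ^+ n * (K / r ^+ 2) * enorm xi ^+ 2)%:E)%E.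
Proof.
move=> r0 HK xi; have rn : r^-1 != 0 by rewrite gt_eqF// invr_gt0.
pose F (v : 'rV[R]_n) : \bar R := ((product_bump 1 v - product_bump 1 (v + r^-1 *: xi)) ^+ 2)%:E.
have mF : measurable_fun setT F.
  apply/measurable_EFinP; apply: measurable_funX; apply: measurable_funB; first exact: measurable_product_bump.
  have := measurable_affine_rV 1 (r^-1 *: xi); under eq_fun do rewrite scale1r.
  by apply: measurableT_comp; exact: measurable_product_bump.
have F0 v : (0 <= F v)%E by rewrite lee_fin sqr_ge0.
have E := @ge0_integral_affine_rV R n r^-1 0 F rn mF F0.
have -> : (\int[lebn]_v ((product_bump r v - product_bump r (v + xi)) ^+ 2)%:E = \int[lebn]_v F (r^-1 *: v + 0)%R)%E.
  by apply: eq_integral => v _; rewrite /F !(product_bumpE r) addr0 scalerDr.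
rewrite E gtr0_norm ?invr_gt0// invrK; apply: le_trans (lee_wpmul2l _ (HK _)) _.
  by rewrite lee_fin exprn_ge0// ltW.
rewrite -EFinM lee_fin enormZ gtr0_norm ?invr_gt0// exprMn exprVn le_eqVlt; apply/orP; left; apply/eqP.
by ring.
Qed.

End product_bump.

Lemma cut_scale_le (R : realType) (eta J C M A : R) : 0 < eta -> 1 <= M -> 0 <= J -> 0 <= C ->
  2 * (J * C) * expR 8 / eta <= M -> expR (- 8) * M <= A -> J * (C / M) <= eta / 2 * A.
Proof.
move=> eta0 M1 J0 C0; have M0 : 0 < M by exact: lt_le_trans M1.
rewrite ler_pdivrMr// => h HA.
apply: (@le_trans _ _ (J * C)).
  by apply: ler_wpM2l => //; rewrite ler_pdivrMr//; exact: ler_peMr.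
have h3 : expR (- 8) * (2 * (J * C) * expR 8) <= expR (- 8) * (M * eta) by rewrite ler_wpM2l// expR_ge0.
have h4 : expR (- 8) * (2 * (J * C) * expR 8) = 2 * (J * C).
  by rewrite mulrCA -expRD addNr expR0 mulr1.
have h5 : eta * (expR (- 8) * M) <= eta * A by rewrite ler_wpM2l// ltW.
have h6 : expR (- 8) * (M * eta) = eta * (expR (- 8) * M) by ring.
rewrite h4 h6 in h3; have h7 := le_trans h3 h5.
have -> : eta / 2 * A = eta * A / 2 by ring.
by rewrite ler_pdivlMr// [X in X <= _]mulrC.
Qed.

Lemma box_scale_le (R : realType) (eta K B J A r : R) : 0 < A -> 0 < eta -> 1 <= r ->
  2 * (K * B * J) / (eta * A) <= r -> K / r ^+ 2 * B * J <= eta / 2 * A.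
Proof.
move=> A0 eta0 r1; have r0 : 0 < r by exact: lt_le_trans r1.
have AA : 0 < eta * A by rewrite mulr_gt0.
rewrite ler_pdivrMr// => h.
have -> : K / r ^+ 2 * B * J = K * B * J / r ^+ 2 by ring.
rewrite ler_pdivrMr ?exprn_gt0//.
have -> : eta / 2 * A * r ^+ 2 = r * (eta * A) * r / 2 by field.
rewrite ler_pdivlMr// [X in X <= _]mulrC; apply: (le_trans h).
by rewrite ler_peMr// mulr_ge0 ?(ltW r0) ?(ltW AA).
Qed.

(** [M] is chosen first, for the normal error of order 1/M. The bound [B2] depends on [M], so [r] is
    chosen afterwards to make the tangential error small; each error takes one half of [eta]. The
    product form makes the smoothness of the competitor a one-variable matter. *)
Lemma half_space_near_opt (R : realType) (n : nat) (s eta : R) : 2^-1 < s < 1 -> 0 < eta ->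
  exists (g : 'I_n.+1 -> R -> R) (V a r : R),
  [/\ forall i k, line_C k (g i), 0 < a /\ 0 < V,
    forall x : 'rV[R]_n.+1, (\prod_i g i (x ord0 i) != 0)%R -> a <= x ord0 ord0 /\ enorm x <= r,
    (\int[lebesgue_rV R n.+1]_(x in half_space)
      ((\prod_i g i (x ord0 i))%R ^+ 2 * x ord0 ord0 `^ (- (2 * s)))%:E = V%:E)%E &
    (pair_energy half_space s (fun x => \prod_i g i (x ord0 i))%R <=
      (2 * (dirJ n (2 * s) * kap s + eta) * V)%:E)%E].
Proof.
move=> s01 eta0; have [s1 s2] := andP s01.
have [L L0 HL] := @bump_lip R.
have [A1 A10 HA1] := @product_bump_mass R n.
have [K1 K10 HK1] := @product_bump_shift R n.
set J := dirJ n (2 * s); set J' := dirJ n (2 * s - 2).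
have J0 : 0 <= J.
  apply: ltW; apply: dirJ_gt0; rewrite (lt_trans (ltrN10 R))// mulr_gt0// (lt_trans _ s1)// invr_gt0.
have J'0 : 0 <= J'.
  apply: ltW; apply: dirJ_gt0.
  have : 2 * 2^-1 < 2 * s by rewrite ltr_pM2l.
  by rewrite divff//; lra.
pose b := s - 2^-1; pose C1 := 4 * L ^+ 2 * (2 / b) ^+ 2 / (2 - 2 * s).
have C10 : 0 <= C1.
  apply: divr_ge0; last by rewrite subr_ge0 ger_pMr// ltW.
  by apply: mulr_ge0; [apply: mulr_ge0; [exact: ler0n|exact: sqr_ge0]|exact: sqr_ge0].
pose M := Num.max 1 (2 * (J * C1) * expR 8 / eta).
have M1 : 1 <= M by rewrite le_max lexx.
have M0 : 0 < M by exact: lt_le_trans M1.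
have [A HA HAM] := log_mass M1.
have A0 : 0 < A by apply: lt_le_trans HAM; rewrite mulr_gt0// expR_gt0.
have mg := measurable_cut_power M1 s.
have Q1 := cut_quotient_le M1 s01 HA (ltW A0) L0 (cut_line_lip M1 HL).
have [B2 B20 Q2] := cut_product_fin M1 s01.
pose r := Num.max 1 (2 * (K1 * B2 * J') / (eta * (A1 * A))).
have r1 : 1 <= r by rewrite le_max lexx.
have r0 : 0 < r by exact: lt_le_trans r1.
pose B1 := A * kap s + 4 * L ^+ 2 / M * (2 / (s - 2^-1)) ^+ 2 / (2 - 2 * s).
have B1E : B1 = A * kap s + C1 / M by rewrite /B1 /C1 /b; ring.
have kp := kap_gt0 s01.
have B10 : 0 <= B1.
  rewrite B1E; apply: addr_ge0; [apply: mulr_ge0; exact: ltW|apply: divr_ge0 => //; exact: ltW].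
pose chi := @product_bump R n r.
have mchi : measurable_fun setT chi by exact: measurable_product_bump.
have HAr := product_bump_mass_scale r0 HA1.
have HKr := product_bump_shift_scale r0 HK1.
have K0 : 0 <= r ^+ n * (K1 / r ^+ 2).
  by rewrite mulr_ge0 ?exprn_ge0 ?(ltW r0)// divr_ge0// sqr_ge0.
have f0 x := cut_power_ge0 M s x.
have En := tensor_energy_le s01 mg f0 mchi HAr K0 HKr Q1 Q2 B10 B20.
have Wt := tensor_weight mg mchi HAr (ltW A0) (log_mass_weight s HA).
pose g (i : 'I_n.+1) : R -> R := if unlift ord0 i is Some _ then (fun x => bump (r^-1 * x + 0)) else cut_power M s.
have gE (x : 'rV[R]_n.+1) : \prod_i g i (x ord0 i) = tensor (cut_power M s) chi x.
  rewrite big_ord_recl /g unlift_none /tensor; congr (_ * _).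
  rewrite /chi /product_bump; apply: eq_bigr => i _; rewrite liftK.
  by rewrite -[x in LHS]rV_unconsK rV_consS.
exists g, (r ^+ n * A1 * A), (expR (- M)), (n.+1%:R * (expR M + r)); split.
- move=> i k; rewrite /g; case: unliftP => [j|] _; first exact: line_C_affine (line_C_bump k).
  exact: line_C_cut_power M1 s k.
- by rewrite expR_gt0 !mulr_gt0// exprn_gt0.
- move=> x; rewrite gE /tensor mulf_eq0 negb_or => /andP[/(cut_power_support M1) /andP[h1 h2] h3].
  split=> //; apply: le_trans (enorm_le_norm x) _; rewrite ler_wpM2l//.
  have X0 : 0 <= expR M + r by rewrite addr_ge0 ?expR_ge0 ?ltW.
  apply: norm_le_coord => // j.
  case: (unliftP ord0 j) => [k ->|->].
    have xk : x ord0 (lift ord0 k) = (rV_uncons x).2 ord0 k by rewrite -{1}[x]rV_unconsK rV_consS.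
    have := product_bump_support r0 h3 k; rewrite xk => /ltW h.
    by rewrite (le_trans h)// lerDr expR_ge0.
  rewrite ger0_norm; last by rewrite (le_trans _ h1)// expR_ge0.
  by rewrite (le_trans h2)// lerDl ltW.
- by under eq_integral => x _ do rewrite gE; rewrite Wt.
have -> : (fun x : 'rV[R]_n.+1 => \prod_i g i (x ord0 i)) = tensor (cut_power M s) chi by exact/funext.
apply: (le_trans En); rewrite lee_fin -/J -/J' -/B1 B1E.
have rn0 : 0 < r ^+ n by rewrite exprn_gt0.
have e1 : J * (C1 / M) <= eta / 2 * A.
  apply: (cut_scale_le eta0 M1 J0 C10 _ HAM); by rewrite le_max lexx orbT.
have e2 : K1 / r ^+ 2 * B2 * J' <= eta / 2 * (A1 * A).
  apply: (box_scale_le (mulr_gt0 A10 A0) eta0 r1); by rewrite le_max lexx orbT.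
have -> : 2 * (r ^+ n * A1 * (A * kap s + C1 / M)) * J + 2 * (r ^+ n * (K1 / r ^+ 2) * B2) * J' =
  2 * r ^+ n * (A1 * A * (kap s * J) + A1 * (J * (C1 / M)) + K1 / r ^+ 2 * B2 * J') by ring.
have -> : 2 * (J * kap s + eta) * (r ^+ n * A1 * A) =
  2 * r ^+ n * (A1 * A * (kap s * J) + A1 * (eta / 2 * A) + eta / 2 * (A1 * A)) by field.
apply: ler_wpM2l; first by apply: mulr_ge0; [exact: ler0n|exact: ltW].
apply: lerD e2; rewrite lerD2l; apply: ler_wpM2l e1; exact: ltW.
Qed.

(** * The upper bound *)

Section touching_half_space.
Context {R : realType} {n : nat}.
Local Notation rV := 'rV[R]_n.+1.
Local Notation leb := (@lebesgue_rV R n.+1).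

Let coordDZ (x w : rV) (t : R) : (x + t *: w) ord0 ord0 = x ord0 ord0 + t * w ord0 ord0.
Proof. by rewrite !mxE. Qed.

Let coordB (x y : rV) : (x - y) ord0 ord0 = x ord0 ord0 - y ord0 ord0.
Proof. by rewrite !mxE. Qed.

Let coordN (x : rV) : (- x) ord0 ord0 = - x ord0 ord0.
Proof. by rewrite mxE. Qed.

Let e0 : rV := rV_cons (1, 0).

Lemma dot_rV_cons1 (h : rV) : dot h e0 = h ord0 ord0.
Proof.
rewrite -{1}[h]rV_unconsK /e0; case E : (rV_uncons h) => [a v]; rewrite dot_cons mulr1.
rewrite (_ : dot v 0 = 0); last by rewrite /dot big1// => i _; rewrite mxE mulr0.
by rewrite addr0; have := congr1 fst E.
Qed.

Let e00 : e0 ord0 ord0 = 1. Proof. by rewrite /e0 rV_cons0. Qed.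

Lemma enorm_rV_cons1 : enorm e0 = 1.
Proof.
have := enorm_cons 1 (0 : 'rV[R]_n); rewrite enorm0 expr0n addr0 expr1n => /eqP.
by rewrite sqrf_eq1 => /orP[/eqP //|/eqP h]; have := enorm_ge0 e0; rewrite h oppr_ge0 ler10.
Qed.

Lemma enorm_col' (i : 'I_n.+1) (H : rV) : enorm (col' i H) <= enorm H.
Proof.
rewrite -ler_sqr ?nnegrE ?enorm_ge0// !enorm_sqr [leRHS](bigD1_ord i)//=.
rewrite -[leLHS]add0r lerD ?sqr_ge0//; apply: ler_sum => j _; rewrite mxE.
by [].
Qed.

Variable Om : set rV.
Hypotheses (O0 : Om !=set0) (oOm : open Om) (bOm : bounded_set Om) (cOm : C11_boundary Om).

Lemma closure_above_chart (p : rV) (r : R) (Q : 'M[R]_n.+1) (i : 'I_n.+1) (g : 'rV[R]_n.+1.-1 -> R) :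
  0 < r -> Q *m Q^T = 1%:M -> continuous g ->
  (forall x, eball p r x -> (Om x <-> g (col' i (x *m Q)) < (x *m Q) ord0 i)) ->
  closure Om p -> g (col' i (p *m Q)) <= (p *m Q) ord0 i.
Proof.
move=> r0 QQ cg ch clp; rewrite leNgt; apply/negP => lt.
set a := col' i (p *m Q) in lt *; set T := (p *m Q) ord0 i in lt *.
have gap : 0 < (g a - T) / 2 by rewrite divr_gt0// subr_gt0.
have /nbhs_ballP[r1 /= r10 Hr1] : \forall x \near a, `|g a - g x| < (g a - T) / 2.
  by apply: (@cvgr_dist_lt _ _ _ (nbhs a) (nbhs_filter a)) => //; exact: cg.
pose d := Num.min r (Num.min r1 ((g a - T) / 2)).
have d0 : 0 < d by rewrite !lt_min r0 r10.
have [y [Oy yd]] := clp _ (nbhs_enorm p d0).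
have yr : eball p r y by rewrite /eball /=; apply: lt_le_trans yd _; rewrite ge_min lexx.
have := (ch y yr).1 Oy.
pose h := y - p.
have -> : col' i (y *m Q) = a + col' i (h *m Q).
  by apply/rowP => j; rewrite -(subrK p y) -/h mulmxDl !mxE addrC.
have -> : (y *m Q) ord0 i = T + (h *m Q) ord0 i by rewrite -(subrK p y) -/h mulmxDl mxE addrC.
have hq : enorm (h *m Q) = enorm h by exact: enorm_mulmx.
have b1 : `|(h *m Q) ord0 i| < (g a - T) / 2.
  apply: le_lt_trans (coord_le_enorm _ _) _; rewrite hq; apply: lt_le_trans yd _.
  by rewrite !ge_min lexx !orbT.
have b2 : `|g a - g (a + col' i (h *m Q))| < (g a - T) / 2.
  apply: Hr1; rewrite -ball_normE /= opprD addrA subrr add0r normrN.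
  apply: le_lt_trans (norm_le_enorm _) _; apply: le_lt_trans (enorm_col' _ _) _; rewrite hq.
  by apply: lt_le_trans yd _; rewrite !ge_min lexx orbT.
move: b1 b2; rewrite !ltr_norml; move: (g _) ((h *m Q) _ _) => G H /andP[b1 b2] /andP[b3 b4] b5.
lra.
Qed.

(** [p] minimises the first coordinate over the closure. Going down from a point of [Om] one meets
    the boundary no lower than that level, which bounds the distance; the chart at [p] gives
    quadratic contact from inside, whose normal has to be the first basis vector. *)
Lemma touching_point : exists (p : rV) (K rho : R), [/\ 0 <= K, 0 < rho,
  forall x, Om x -> p ord0 ord0 < x ord0 ord0,
  forall x, Om x -> dist_boundary Om x <= x ord0 ord0 - p ord0 ord0 &
  forall h, enorm h < rho -> K * enorm h ^+ 2 < h ord0 ord0 -> Om (p + h)].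
Proof.
have [x0 Ox0] := O0.
have c0 : closure Om !=set0 by exists x0; exact: subset_closure.
have cc : compact (closure Om).
  apply: bounded_closed_compact; last exact: closed_closure.
  exact: closure_bounded bOm.
have cf : {within closure Om, continuous (fun x : rV => x ord0 ord0)}.
  by apply: continuous_subspaceT; exact: coord_continuous.
have [p /set_mem clp Hp] := compact_EVT_min c0 cc cf.
have w0 : - e0 != 0.
  by rewrite oppr_eq0; apply/eqP => E; have := enorm_rV_cons1; rewrite E enorm0 => /eqP; rewrite eq_sym oner_eq0.
have exitP x : Om x -> p ord0 ord0 <= x ord0 ord0 - exit_time Om x (- e0) /\
    dist_boundary Om x <= exit_time Om x (- e0) /\ 0 < exit_time Om x (- e0).
  move=> Ox; have e_gt0 : 0 < exit_time Om x (- e0) by apply/exit_time_gt0.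
  have By := exit_point_boundary oOm bOm w0 Ox.
  move: (exit_time Om x (- e0)) e_gt0 By => e e_gt0 By.
  split; last split => //.
    have := Hp _ (mem_set By.1).
    by rewrite coordDZ coordN e00 mulrN mulr1.
  apply: le_trans (dist_boundary_le x By) _.
  by rewrite opprD addrA subrr add0r scalerN opprK enormZ enorm_rV_cons1 mulr1 gtr0_norm.
have below x : Om x -> p ord0 ord0 < x ord0 ord0.
  by move=> /exitP[h1 [_ h2]]; apply: (le_lt_trans h1); rewrite ltrBlDr ltrDl.
have Bp : boundary Om p.
  split=> //; rewrite (interior_id Om).1//; first by move/below; rewrite ltxx.
have [r [Q [i [g [r0 QQ C11g ch]]]]] := cOm Bp.
have cg : continuous g by case: C11g => -[].
have above := closure_above_chart r0 QQ cg ch clp.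
have [K K0 HK] := chart_normal r0 QQ C11g ch.
have r2 : 0 < r / 2 by rewrite divr_gt0.
have pp : eball p (r / 2) p by rewrite /eball /= subrr enorm0.
have [nu nu1 Hnu] := HK p pp.
have inn h : enorm h < r / 2 -> K * enorm h ^+ 2 < dot h nu -> Om (p + h).
  by move=> h1 h2; have [_ H] := Hnu h h1; exact: H.
(* Otherwise a small step t w from [p], with w = nu - e0, would land in [Om] since w.nu = 1 - a > 0,
   while lowering the first coordinate by t (1 - a), against the minimality of [p]. *)
have nuE : nu = e0.
  pose a := nu ord0 ord0; pose w := nu - e0.
  have wnu : dot w nu = 1 - a.
    rewrite /w dotDl -[- e0]scaleN1r dotZl dotxx nu1 expr1n dotC dot_rV_cons1.
    by rewrite mulN1r.
  have ww : enorm w ^+ 2 = 2 * (1 - a).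
    rewrite -dotxx {2}/w dotC dotDl -[- e0]scaleN1r dotZl dotC wnu [dot e0 w]dotC dot_rV_cons1.
    by rewrite /w coordB e00 -/a; ring.
  have [a1|a1] := leP 1 a.
    have : enorm w = 0.
      apply/eqP; rewrite -sqrf_eq0 eq_le sqr_ge0 andbT ww; lra.
    by move=> /enorm_eq0 /eqP; rewrite subr_eq0 => /eqP.
  exfalso.
  pose t := Num.min (r / 2 / (enorm w + 1)) ((1 - a) / (K * enorm w ^+ 2 + 1)).
  have ew := enorm_ge0 w.
  have D1 : 0 < enorm w + 1 by rewrite ltr_wpDl.
  have D2 : 0 < K * enorm w ^+ 2 + 1 by rewrite ltr_wpDl// mulr_ge0 ?sqr_ge0.
  have a10 : 0 < 1 - a by rewrite subr_gt0.
  have t0 : 0 < t by rewrite lt_min !divr_gt0.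
  have t1 : t * (enorm w + 1) <= r / 2 by rewrite -ler_pdivlMr// ge_min lexx.
  have t2 : t * (K * enorm w ^+ 2 + 1) <= 1 - a by rewrite -ler_pdivlMr// ge_min lexx orbT.
  have : Om (p + t *: w).
    apply: inn.
      by rewrite enormZ gtr0_norm//; apply: lt_le_trans t1; rewrite mulrDr mulr1 ltrDl.
    rewrite enormZ gtr0_norm// dotZl wnu exprMn.
    have -> : K * (t ^+ 2 * enorm w ^+ 2) = t * (t * (K * enorm w ^+ 2)) by ring.
    rewrite ltr_pM2l//; apply: lt_le_trans t2; rewrite mulrDr mulr1 ltrDl//.
  move=> /below; rewrite coordDZ /w coordB e00 -/a.
  rewrite ltrDl pmulr_rgt0//.
  by rewrite subr_gt0 => h; have := lt_trans h a1; rewrite ltxx.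
exists p, K, (r / 2); split=> //.
- by move=> x Ox; have [h1 [h2 _]] := exitP x Ox; rewrite (le_trans h2)// lerBrDr addrC -lerBrDr.
- by move=> h h1 h2; apply: inn => //; rewrite nuE dot_rV_cons1.
Qed.

Lemma quotient_le (x y : R) (G H : \bar R) : 0 <= x -> 0 < y ->
  (0 <= G <= (x * y)%:E)%E -> (y%:E <= H < +oo)%E -> (G / H <= x%:E)%E.
Proof.
move=> x0 y0 /andP[G0 GE] /andP[yH Hoo].
have H0 : (0 < H)%E by apply: lt_le_trans yH; rewrite lte_fin.
move: H H0 Hoo yH => [h| |]// h0 _ yh; rewrite lte_fin in h0; rewrite lee_fin in yh.
move: G G0 GE => [g| |]// _ gxy; rewrite lee_fin in gxy.
rewrite inver gt_eqF// -EFinM lee_fin ler_pdivrMr//.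
by apply: (le_trans gxy); rewrite ler_wpM2l.
Qed.

Variable s : R.
Hypothesis s01 : 2^-1 < s < 1.
Local Notation N := (n.+1%:R + 2 * s).

(** The factor is lam^(2(n+1)) lam^(-N); the inequality comes from enlarging the translated and
    dilated domain to the half-space. *)
Lemma pair_energy_rescale (p : rV) (lam : R) (Phi : rV -> R) : 0 < lam ->
  measurable_fun setT Phi -> (forall x, Om x -> p ord0 ord0 < x ord0 ord0) ->
  (pair_energy Om s (fun x => Phi (lam^-1 *: x + - (lam^-1 *: p))%R) <=
   (lam ^+ n.+1 * lam `^ (- (2 * s)))%:E * pair_energy half_space s Phi)%E.
Proof.
move=> l0 mPhi above.
pose T (x : rV) : rV := lam^-1 *: x + - (lam^-1 *: p).
have li : 0 < lam^-1 by rewrite invr_gt0.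
have ln : lam^-1 != 0 by rewrite gt_eqF.
have mT : measurable_fun setT T by exact: measurable_affine_rV.
pose u x := Phi (T x).
have mu : measurable_fun setT u by exact: measurableT_comp.
have oH := @open_half_space R n.
pose G := pair_cut half_space s Phi.
have mG : measurable_fun setT G by exact: measurable_pair_cut.
have G0 z : (0 <= G z)%E by exact: pair_cut_ge0.
have TT x y : enorm (x - y) = lam * enorm (T x - T y).
  have -> : T x - T y = lam^-1 *: (x - y).
    by rewrite /T opprD opprK addrACA [- _ + _]addrC subrr addr0 -scalerBr.
  by rewrite enormZ gtr0_norm// mulVKf// gt_eqF.
have TH x : Om x -> half_space (T x).
  move=> /above h; rewrite /half_space /T /= !mxE -mulrBr mulr_gt0// subr_gt0.
  exact: h.
have ptw x y : (pair_cut Om s u (x, y) <= (lam `^ (- N))%:E * G (T x, T y))%E.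
  rewrite /pair_cut; cbn [fst snd]; case: ifPn => [/andP[/set_mem Ox /set_mem Oy]|_]; last first.
    by rewrite mule_ge0// lee_fin powR_ge0.
  rewrite /G /pair_cut; cbn [fst snd]; rewrite (mem_set (TH _ Ox)) (mem_set (TH _ Oy)) /=.
  rewrite -EFinM lee_fin /pair_kernel; cbn [fst snd]; rewrite (TT x y) powRM ?enorm_ge0 ?(ltW l0)//.
  rewrite powRN invfM le_eqVlt; apply/orP; left; apply/eqP; rewrite /u; ring.
have c1 : (0 <= (lam `^ (- N))%:E)%E by rewrite lee_fin powR_ge0.
rewrite -pair_energyE -pair_energyE.
rewrite (fubini_tonelli1 _ (measurable_pair_cut s oOm mu) (pair_cut_ge0 Om s u)).
rewrite (fubini_tonelli1 _ mG G0).
pose I (x : rV) : \bar R := (\int[leb]_y G (x, y))%E.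
have I0 x : (0 <= I x)%E by apply: integral_ge0.
have mI : measurable_fun setT I by exact: (@measurable_fun_fubini_tonelli_F _ _ _ _ _ leb G).
have mGx x : measurable_fun setT (fun y => G (x, y)).
  exact: (measurableT_comp mG (pair1_measurable x)).
have E2 := @ge0_integral_affine_rV R n.+1 lam^-1 (- (lam^-1 *: p)) I ln mI I0.
have sc : (`|lam^-1|^-1 ^+ n.+1)%:E = (lam ^+ n.+1)%:E :> \bar R by rewrite gtr0_norm// invrK.
rewrite sc in E2.
have c2 : (0 <= (lam ^+ n.+1)%:E)%E by rewrite lee_fin exprn_ge0// ltW.
have step x : (\int[leb]_y pair_cut Om s u (x, y) <= (lam `^ (- N))%:E * ((lam ^+ n.+1)%:E * I (T x)))%E.
  have E1 := @ge0_integral_affine_rV R n.+1 lam^-1 (- (lam^-1 *: p)) (fun y => G (T x, y)) ln (mGx _) (fun y => G0 _).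
  rewrite sc in E1; rewrite -[X in (_ * X)%E]E1.
  have mGT : measurable_fun setT (fun y => G (T x, T y)) by exact: (measurableT_comp (mGx _) mT).
  rewrite -(ge0_integralZl leb measurableT mGT (fun y _ => G0 _) c1).
  apply: ge0_le_integral; first exact: measurableT.
  - by move=> y _; exact: pair_cut_ge0.
  - exact: (measurableT_comp (measurable_pair_cut s oOm mu) (pair1_measurable x)).
  - exact: measurable_funeM.
  - by move=> y _; exact: ptw.
have mIT : measurable_fun setT (fun x => I (T x)) by exact: (measurableT_comp mI mT).
apply: (@le_trans _ _ (\int[leb]_x ((lam `^ (- N) * lam ^+ n.+1)%:E * I (T x)))%E).
  apply: ge0_le_integral; first exact: measurableT.
  - by move=> x _; apply: integral_ge0 => y _; exact: pair_cut_ge0.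
  - exact: (@measurable_fun_fubini_tonelli_F _ _ _ _ _ leb _ (measurable_pair_cut s oOm mu) (pair_cut_ge0 Om s u)).
  - exact: measurable_funeM.
  - by move=> x _; rewrite EFinM -muleA; exact: step.
have c3 : (0 <= (lam `^ (- N) * lam ^+ n.+1)%:E)%E by rewrite lee_fin mulr_ge0 ?powR_ge0// exprn_ge0// ltW.
have Z := etrans (ge0_integralZl leb measurableT mIT (fun x _ => I0 (T x)) c3)
  (congr1 (fun y => (lam `^ (- N) * lam ^+ n.+1)%:E * y)%E E2).
rewrite le_eqVlt; apply/orP; left; apply/eqP; apply: (etrans Z).
rewrite muleA -EFinM; congr (_%:E * _)%E.
have -> : lam `^ (- (2 * s)) = lam `^ (- N) * lam ^+ n.+1.
  rewrite -powR_mulrn ?(ltW l0)// -powRD ?(gt_eqF l0) ?implybT//; congr (_ `^ _); by ring.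
by ring.
Qed.

(** The scaling factor is the same as for the energy and cancels in the quotient. The inequality is
    the bound of the distance by the height above [p], raised to a negative power. *)
Lemma weight_rescale (p : rV) (lam V : R) (Phi : rV -> R) : 0 < lam ->
  measurable_fun setT Phi ->
  (forall x, Om x -> p ord0 ord0 < x ord0 ord0) ->
  (forall x, Om x -> dist_boundary Om x <= x ord0 ord0 - p ord0 ord0) ->
  (forall x, Phi (lam^-1 *: x + - (lam^-1 *: p)) != 0 -> Om x) ->
  (\int[leb]_(x in half_space) (Phi x ^+ 2 * x ord0 ord0 `^ (- (2 * s)))%:E = V%:E)%E ->
  ((lam ^+ n.+1 * lam `^ (- (2 * s)) * V)%:E <=
   \int[leb]_(x in Om) (Phi (lam^-1 *: x + - (lam^-1 *: p))%R ^+ 2 * dist_boundary Om x `^ (- (2 * s)))%:E)%E.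
Proof.
move=> l0 mPhi above dle supp HV.
pose T (x : rV) : rV := lam^-1 *: x + - (lam^-1 *: p).
have li : 0 < lam^-1 by rewrite invr_gt0.
have ln : lam^-1 != 0 by rewrite gt_eqF.
have mT : measurable_fun setT T by exact: measurable_affine_rV.
have mOm : measurable Om by exact: open_measurable_rV.
have mH : measurable (@half_space R n) by apply: open_measurable_rV; exact: open_half_space.
have mx0 : measurable_fun setT (fun x : rV => x ord0 ord0 `^ (- (2 * s))).
  exact: (measurableT_comp (measurable_powR _) (measurable_coor ord0)).
pose F (x : rV) : \bar R := ((fun x : rV => (Phi x ^+ 2 * x ord0 ord0 `^ (- (2 * s)))%:E) \_ half_space) x.
have mF : measurable_fun setT F.
  apply: (iffLR (measurable_restrictT _ mH)); apply: measurable_funTS; apply/measurable_EFinP.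
  by apply: measurable_funM => //; exact: measurable_funX.
have F0 x : (0 <= F x)%E.
  by rewrite /F patchE; case: ifP => // _; rewrite lee_fin mulr_ge0 ?sqr_ge0 ?powR_ge0.
have E := @ge0_integral_affine_rV R n.+1 lam^-1 (- (lam^-1 *: p)) F ln mF F0.
have HF : (\int[leb]_x F x = V%:E)%E by rewrite -HV [RHS]integral_mkcond.
rewrite gtr0_norm// invrK HF in E.
have c0 : (0 <= (lam `^ (- (2 * s)))%:E)%E by rewrite lee_fin powR_ge0.
have mFT : measurable_fun setT (fun x => F (T x)) by exact: measurableT_comp.
have -> : ((lam ^+ n.+1 * lam `^ (- (2 * s)) * V)%:E = (lam `^ (- (2 * s)))%:E * \int[leb]_x F (T x))%E.
  by rewrite E -!EFinM; congr _%:E; ring.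
rewrite -(ge0_integralZl leb measurableT mFT (fun x _ => F0 _) c0).
have B0 : boundary Om !=set0 by have [x Ox] := O0; exact: (boundary_nonempty oOm bOm Ox).
rewrite [leRHS]integral_mkcond; apply: ge0_le_integral; first exact: measurableT.
- by move=> x _; exact: mule_ge0.
- exact: measurable_funeM.
- apply: (iffLR (measurable_restrictT _ mOm)); apply: measurable_funTS; apply/measurable_EFinP.
  apply: measurable_funM; first by apply: measurable_funX; exact: (measurableT_comp mPhi mT).
  by apply: (measurableT_comp (measurable_powR _)); exact: measurable_dist_boundary.
move=> x _; rewrite patchE /F patchE; case: ifPn => [/set_mem hx|_]; last first.
  by rewrite mule0; case: ifP => // _; rewrite lee_fin mulr_ge0 ?sqr_ge0 ?powR_ge0.
have [P0|P0] := eqVneq (Phi (T x)) 0.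
  rewrite P0 expr0n mul0r mule0; case: ifP => // _.
  by rewrite lee_fin mulr_ge0 ?sqr_ge0 ?powR_ge0.
have Ox := supp x P0; rewrite mem_set// -EFinM lee_fin mulrCA; apply: ler_wpM2l; first exact: sqr_ge0.
have Tx0 : T x ord0 ord0 = lam^-1 * (x ord0 ord0 - p ord0 ord0) by rewrite /T !mxE mulrBr.
have d0 := dist_boundary_gt0 oOm bOm Ox.
have xp : 0 < x ord0 ord0 - p ord0 ord0 by rewrite subr_gt0; exact: above.
rewrite Tx0 -powRM ?(ltW l0) ?mulr_ge0 ?(ltW li) ?(ltW xp)// mulVKf ?gt_eqF//.
rewrite !powRN lef_pV2 ?posrE ?powR_gt0// ge0_ler_powR ?nnegrE ?(ltW d0) ?(ltW xp)//; last exact: dle.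
by rewrite mulr_ge0// ltW//; have [h _] := andP s01; apply: lt_trans h; rewrite invr_gt0.
Qed.

End touching_half_space.

(** The rescaled competitor lives at height at least lam a above [p] and within distance lam r of
    it. The height is linear in lam while the interior contact only requires K (lam r)^2, so for
    small lam the support falls inside [Om]. *)
Theorem hardy_upper (R : realType) (n : nat) (Om : set 'rV[R]_n.+1) (s : R) :
  Om !=set0 -> open Om -> bounded_set Om -> C11_boundary Om -> 2^-1 < s < 1 ->
  (mu_Ns s Om <= (h_Ns n.+1 s)%:E)%E.
Proof.
move=> O0 oOm bOm cOm s01; apply/lee_addgt0Pr => eps eps0.
have cpos : 0 < c_Ns n.+1 s :> R by exact: c_Ns_gt0.
have eta0 : 0 < eps / c_Ns n.+1 s by rewrite divr_gt0.
have [g [V [a [r [Cg [a0 V0] supp HV HE]]]]] := @half_space_near_opt R n s _ s01 eta0.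
have [p [K [rho [K0 rho0 above dle inn]]]] := touching_point O0 oOm bOm cOm.
pose Phi (x : 'rV[R]_n.+1) := \prod_i g i (x ord0 i).
(* The first bound places the support within [rho] of [p], the second gives K (lam r)^2 < lam a. *)
pose lam := Num.min (rho / (`|r| + 1)) (a / (K * r ^+ 2 + 1)).
have D1 : 0 < `|r| + 1 by rewrite ltr_wpDl.
have D2 : 0 < K * r ^+ 2 + 1 by rewrite ltr_wpDl// mulr_ge0 ?sqr_ge0.
have l0 : 0 < lam by rewrite lt_min !divr_gt0.
have l1 : lam * (`|r| + 1) <= rho by rewrite -ler_pdivlMr// ge_min lexx.
have l2 : lam * (K * r ^+ 2 + 1) <= a by rewrite -ler_pdivlMr// ge_min lexx orbT.
pose T (x : 'rV[R]_n.+1) : 'rV[R]_n.+1 := lam^-1 *: x + - (lam^-1 *: p).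
pose u x := Phi (T x).
have TE x : lam *: T x = x - p by rewrite /T scalerDr scalerN !scalerA mulfV ?gt_eqF// !scale1r.
pose S := [set x : 'rV[R]_n.+1 | lam * a <= (x - p) ord0 ord0] `&` [set x | enorm (x - p) <= lam * r].
have SO : S `<=` Om.
  move=> x [/= h1 h2]; rewrite -(subrK p x) addrC; apply: inn.
    apply: (le_lt_trans h2); apply: lt_le_trans l1; rewrite ltr_pM2l//.
    by apply: le_lt_trans (ler_norm r) _; rewrite ltrDl.
  apply: lt_le_trans h1; apply: (@le_lt_trans _ _ (K * (lam * r) ^+ 2)).
    by rewrite ler_wpM2l// ler_sqr ?nnegrE ?enorm_ge0// (le_trans (enorm_ge0 _) h2).
  rewrite exprMn; have -> : K * (lam ^+ 2 * r ^+ 2) = lam * (lam * (K * r ^+ 2)) by ring.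
  by rewrite ltr_pM2l//; apply: lt_le_trans l2; rewrite mulrDr mulr1 ltrDl.
have uS x : u x != 0 -> S x.
  move=> /supp[h1 h2]; split => /=; rewrite -TE.
    by rewrite mxE ler_pM2l.
  by rewrite enormZ gtr0_norm// ler_pM2l.
have cshift : continuous (fun x : 'rV[R]_n.+1 => x - p).
  by move=> x; apply: (@cvgD _ _ _ (nbhs x) (nbhs_filter x) id (cst (- p))); [exact: cvg_id|exact: cvg_cst].
have clS : closed S.
  apply: closedI.
    apply: (@closed_comp _ _ (fun x : 'rV[R]_n.+1 => (x - p) ord0 ord0) [set y | lam * a <= y]); last exact: closed_ge.
    move=> x _; apply: (@continuous_comp _ _ _ (fun x : 'rV[R]_n.+1 => x - p) (fun x => x ord0 ord0)); first exact: cshift.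
    exact: coord_continuous.
  apply: (@closed_comp _ _ (fun x : 'rV[R]_n.+1 => enorm (x - p)) [set y | y <= lam * r]); last exact: closed_le.
  move=> x _; apply: (@continuous_comp _ _ _ (fun x : 'rV[R]_n.+1 => x - p) (@enorm R n.+1)); first exact: cshift.
  exact: continuous_enorm.
have clu : closure [set x | u x != 0] `<=` S.
  by rewrite (closure_id S).1//; apply: closure_subset => x; exact: uS.
have uE : u = (fun x => \prod_i g i (lam^-1 * x ord0 i + - (lam^-1 * p ord0 i))).
  by apply/funext => x; apply: eq_bigr => i _; rewrite !mxE.
have tu : test_function Om u.
  split=> [k||].
  - rewrite uE; apply: class_C_prod => i.
    exact: (@class_C_coord R n.+1 k (fun y => g i (lam^-1 * y + - (lam^-1 * p ord0 i))) i (line_C_affine _ _ (Cg i k))).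
  - apply: bounded_closed_compact; last exact: closed_closure.
    have [M [Mr HM]] := bOm; exists M; split => // x Mx y /clu /SO Oy; exact: HM Oy.
  - by move=> x /clu /SO.
have mPhi : measurable_fun setT Phi.
  apply: continuous_measurable_rV; apply: (@class_C_continuous _ _ 0); apply: class_C_prod => i.
  exact: class_C_coord (Cg i 0%N).
(* Were [u] identically zero, so would be the profile before rescaling, against [V > 0]. *)
have [x0 ux0] : exists x, u x != 0.
  apply: contrapT => nex; have Phi0 y : Phi y = 0.
    apply/eqP; apply: contraT => Py; exfalso; apply: nex; exists (lam *: y + p).
    have -> : u (lam *: y + p) = Phi y; last by [].
    by rewrite /u /T [lam^-1 *: (_ + _)]scalerDr scalerA mulVf ?gt_eqF// scale1r addrK.
  move: HV; rewrite integral0_eq => [[] V00|x _]; first by rewrite -V00 ltxx in V0.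
  by have := Phi0 x; rewrite /Phi => ->; rewrite expr0n mul0r.
have ER := pair_energy_rescale oOm s l0 mPhi above.
have WR := weight_rescale O0 oOm bOm s01 l0 mPhi above dle (fun x h => SO _ (uS x h)) HV.
pose h := dirJ n (2 * s) * kap s.
have -> : ((h_Ns n.+1 s)%:E + eps%:E = (c_Ns n.+1 s * (h + eps / c_Ns n.+1 s))%:E)%E.
  by rewrite -EFinD h_NsE; congr _%:E; rewrite /h; field; rewrite gt_eqF.
have h0 : 0 <= h + eps / c_Ns n.+1 s.
  apply: addr_ge0; last exact: ltW.
  apply: mulr_ge0; last by apply: ltW; exact: kap_gt0.
  have [s1 _] := andP s01; apply: ltW; apply: dirJ_gt0.
  by rewrite (lt_trans (ltrN10 R))// mulr_gt0// (lt_trans _ s1)// invr_gt0.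
pose W := lam ^+ n.+1 * lam `^ (- (2 * s)).
have W0 : 0 < W by rewrite mulr_gt0 ?exprn_gt0 ?powR_gt0.
have Q : (hardy_quotient s Om u <= (c_Ns n.+1 s * (h + eps / c_Ns n.+1 s))%:E)%E.
  apply: (@quotient_le _ _ (W * V)).
  - by apply: mulr_ge0 => //; exact: ltW.
  - exact: mulr_gt0.
  - apply/andP; split; first exact: gagliardo_ge0.
    rewrite gagliardoE.
    have c2 : (0 <= (c_Ns n.+1 s / 2)%:E)%E by rewrite lee_fin divr_ge0// ltW.
    have W0' : (0 <= W%:E)%E by rewrite lee_fin ltW.
    apply: (le_trans (lee_wpmul2l c2 ER)).
    apply: (le_trans (lee_wpmul2l c2 (lee_wpmul2l W0' HE))).
    rewrite -!EFinM lee_fin le_eqVlt; apply/orP; left; apply/eqP; rewrite -/h.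
    by move: (c_Ns _ _) (eps / _) => c e; field.
  - apply/andP; split; first exact: WR.
    have [d d0 Hd] := test_margin oOm bOm tu.
    have Ob : boundary Om !=set0 by have [x Ox] := O0; exact: (boundary_nonempty oOm bOm Ox).
    have mdp : measurable_fun setT (fun x => dist_boundary Om x `^ (- (2 * s))).
      by apply: (measurableT_comp (measurable_powR _)); exact: measurable_dist_boundary.
    apply: (@test_integral_fin _ _ Om oOm bOm u _ (d `^ (- (2 * s))) tu mdp) => [y _|y uy].
      exact: powR_ge0.
    rewrite !powRN lef_pV2 ?posrE ?powR_gt0// ?ge0_ler_powR ?nnegrE ?(ltW d0)//.
    + by have [s1 _] := andP s01; rewrite mulr_ge0// (le_trans _ (ltW s1)).
    + by rewrite (le_trans (ltW d0))//; exact: (Hd y uy).2.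
    + exact: (Hd y uy).2.
    + by rewrite (lt_le_trans d0)//; exact: (Hd y uy).2.
apply: le_trans Q; apply: ereal_inf_lbound; exists u => //; split=> //; by exists x0.
Qed.

Theorem theorem1p10 (R : realType) (N : nat) (N_ge2 : (2 <= N)%N)
    (Omega : set 'rV[R]_N) (Omega_domain : domain Omega)
    (Omega_bounded : bounded_set Omega) (Omega_C11 : C11_boundary Omega) :
  (exists s_star : R, 2^-1 < s_star < 1 /\
     forall s : R, 2^-1 < s <= s_star -> mu_Ns s Omega = (h_Ns N s)%:E) /\
  (\forall s \near (2^-1 : R)^'+, ~ mu_achieved s Omega).
Proof.
(* With N = n + 1 the assumption on the dimension becomes [0 < n], the form in which the lower bound
   takes it. *)
case: N N_ge2 Omega Omega_domain Omega_bounded Omega_C11 => [|n]// N_ge2 Omega [ne oO _] bO cO.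
have [e0 e00 H] := hardy_lower N_ge2 ne oO bO cO.
have main s : 2^-1 < s -> s <= 2^-1 + e0 -> mu_Ns s Omega = (h_Ns n.+1 s)%:E /\ ~ mu_achieved s Omega.
  move=> s1 s2; have [|s3 lo na] := H s s1; first by rewrite lerBlDl.
  have s01 : 2^-1 < s < 1 by rewrite s1.
  have up := hardy_upper ne oO bO cO s01.
  by split; [apply/eqP; rewrite eq_le up lo|exact: na up].
split.
  exists (2^-1 + e0); split.
    have s1 : 2^-1 < 2^-1 + e0 by rewrite ltrDl.
    rewrite s1 /=; have [|//] := H _ s1; by rewrite addrAC subrr add0r.
  by move=> s /andP[s1 s2]; have [] := main s s1 s2.
near=> s.
have s1 : 2^-1 < s by near: s; exact: nbhs_right_gt.
have s2 : s <= 2^-1 + e0 by near: s; apply: nbhs_right_le; rewrite ltrDl.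
by have [] := main s s1 s2.
Unshelve. all: by end_near. Qed.
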